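(* Let $\mathfrak g=\mathfrak q_{-k}\oplus\dots\oplus\mathfrak q_0\oplus\dots\oplus\mathfrak q_k$ be a $|k|$-graded (real) simple Lie algebra corresponding to a subset $\Sigma^Q$ of simple restricted roots, where $(\mathfrak g,\Sigma^Q)$ is $(\mathfrak g_2^*,\{\alpha_1,\alpha_2\})$, $(\mathfrak{so}(3,4),\{\alpha_2,\alpha_3\})$, $(\mathfrak{so}(p+2,q+2),\{\alpha_1,\alpha_2\})$ for $n=p+q+2\ge5$, or $(\mathfrak{so}(p+2,q+2),\{\alpha_1,\alpha_2,\alpha_3\})$ for $n=p+q+2=4$. Then the graded Lie algebra $\mathfrak g$ has the following properties. (1) $\dim\mathfrak q_{-k}=1$, $\dim(\mathfrak q_{-k+1}\oplus\dots\oplus\mathfrak q_{-1})$ is odd, and $$\mathrm{pr}_{-k}\circ[\,,]:\wedge^2(\mathfrak q_{-1}\oplus\dots\oplus\mathfrak q_{-k+1})\to\mathfrak q_{-k},$$ viewed as a 2-form, has one-dimensional kernel $\tilde{\mathfrak e}\subset\mathfrak q_{-1}$. (2) Let $\tilde{\mathfrak v}$ be the $\mathfrak q_0$-invariant complement to $\tilde{\mathfrak e}$ in $\mathfrak q_{-1}$, so that $\mathfrak q_{-1}=\tilde{\mathfrak e}\oplus\tilde{\mathfrak v}$. Then the only other non-trivial components of the Lie bracket on $\mathfrak q_-=\mathfrak q_{-k}\oplus\dots\oplus\mathfrak q_{-1}$ are $[\,,]:\tilde{\mathfrak e}\otimes\tilde{\mathfrak v}\to\mathfrak q_{-2}$ and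 $[\,,]:\tilde{\mathfrak e}\otimes\mathfrak q_i\to\mathfrak q_{i-1}$ for $i=-2,\dots,-k+2$, which are isomorphisms. In particular, $\tilde{\mathfrak v}$ is abelian. Conversely, any $|k|$-graded simple Lie algebra of depth $k\ge3$ satisfying conditions (1) and (2) is of one of the following types $(\mathfrak g,\Sigma^Q)$: $(\mathfrak g_2^*,\{\alpha_1,\alpha_2\})$, $(\mathfrak{so}(3,4),\{\alpha_2,\alpha_3\})$, $(\mathfrak{so}(p+2,q+2),\{\alpha_1,\alpha_2\})$ with $n=p+q+2\ge5$, or $(\mathfrak{so}(p+2,q+2),\{\alpha_1,\alpha_2,\alpha_3\})$ with $n=p+q+2=4$.
   Context: A $|k|$-grading of a real semisimple Lie algebra $\mathfrak g$ is a decomposition $\mathfrak g=\bigoplus_{i=-k}^k\mathfrak q_i$ with $[\mathfrak q_i,\mathfrak q_j]\subset\mathfrak q_{i+j}$, $\mathfrak q_-=\bigoplus_{i<0}\mathfrak q_i$ generated by $\mathfrak q_{-1}$, and no simple ideal contained in $\mathfrak q_0$. Such gradings correspond to subsets $\Sigma$ of simple (restricted) roots: a root space lies in degree equal to the sum of the coefficients of the roots in $\Sigma$. The non-negative part $\mathfrak q=\bigoplus_{i\ge0}\mathfrak q_i$ is parabolic. $\mathfrak g_2^*$ is the split real form of the 14-dimensional exceptional Lie algebra ($\alpha_1$ short, $\alpha_2$ long); for $\mathfrak{so}(3,4)$ (type $B_3$) $\alpha_3$ is short and $\{\alpha_2,\alpha_3\}$ corresponds to the stabilizer of a flag (null 2-plane)$\subset$(null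 3-plane); for $\mathfrak{so}(p+2,q+2)$ the given subsets ($B_n$, $D_n$ labelling, respectively $A_3=D_3$ labelling when $p+q=2$) correspond to the stabilizer of a flag (null line)$\subset$(null 2-plane) in $\mathbb R^{p+2,q+2}$. $\mathrm{pr}_{-k}$ is the projection to $\mathfrak q_{-k}$.
   Formalization: The converse additionally excludes so(2,3) with Σ={α1,α2} (the case n=p+q+2=3): this |3|-graded simple Lie algebra satisfies (1) and (2) but has dimension 10 and is in no item of the list, so the converse as printed is false for it. *)

(* Defs.v *)
From HB Require Import structures.
From mathcomp Require Import all_boot all_order all_algebra.
From mathcomp Require Import reals.

Set Implicit Arguments.
Unset Strict Implicit.
Unset Printing Implicit Defensive.

Import Order.TTheory GRing.Theory Num.Theory.
Local Open Scope ring_scope.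

HB.mixin Record Vector_isLie (R : fieldType) L of Vector R L := {
  lbr : L -> L -> L;
  lbr_linear_l : forall y, linear (fun x => lbr x y);
  lbr_linear_r : forall x, linear (lbr x);
  lbrxx : forall x, lbr x x = 0;
  lbr_jacobi : forall x y z,
    lbr x (lbr y z) + lbr y (lbr z x) + lbr z (lbr x y) = 0
}.

#[short(type="lieAlgType")]
HB.structure Definition LieAlgebra (R : fieldType) :=
  {L of Vector_isLie R L & Vector R L}.

Notation "[lie x , y ]" := (lbr x y)
  (at level 0, x at level 99, y at level 99, format "[lie  x ,  y ]").

Section LieAlgebras.
Variables (R : fieldType) (L : lieAlgType R).
Implicit Types (U V W I J E : {vspace L}) (x y h : L).

Definition ad x : 'Hom(L, L) := linfun (fun y => [lie x, y]).

Definition subalgebra U := forall x y, x \in U -> y \in U -> [lie x, y] \in U.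

Definition ideal I := forall x y, y \in I -> [lie x, y] \in I.

(* U is simple when regarded as a Lie algebra in its own right. *)
Definition simple_subalgebra U : Prop :=
  [/\ subalgebra U,
      exists x y, [/\ x \in U, y \in U & [lie x, y] != 0]
    & forall J, (J <= U)%VS ->
        (forall x y, x \in U -> y \in J -> [lie x, y] \in J) ->
        J = 0%VS \/ J = U].

Definition simple_lie : Prop := simple_subalgebra fullv.

(* |k|-gradings.  The family q is indexed by all integers, with q i = 0 for
   |i| > k, so that q i + q j is literally sent to q (i + j); k is the actual
   depth, i.e. q (-k) is nonzero. *)
Record kgrading (k : nat) (q : int -> {vspace L}) : Prop := KGrading {
  kgrading_supp : forall i : int, (k < `|i|)%N -> q i = 0%VS;
  kgrading_depth : q (- k%:Z) != 0%VS;
  kgrading_sum : (\sum_(j < (k.*2).+1) q (j%:Z - k%:Z))%VS = fullv;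
  kgrading_direct : directv (\sum_(j < (k.*2).+1) q (j%:Z - k%:Z));
  kgrading_br : forall (i j : int) x y,
    x \in q i -> y \in q j -> [lie x, y] \in q (i + j);
  kgrading_gen : forall U, subalgebra U -> (q (-1) <= U)%VS ->
    forall i : int, i < 0 -> (q i <= U)%VS;
  kgrading_no_ideal : forall I, ideal I -> simple_subalgebra I ->
    ~~ (I <= q 0%R)%VS
}.

Section Conditions.
Variables (k : nat) (q : int -> {vspace L}).

(* q_{-1} + ... + q_{-k+1} *)
Definition neg_part : {vspace L} := (\sum_(j < k.-1) q (- (j.+1)%:Z))%VS.

(* pr_{-k}: the projection onto q_{-k} along q_{-k+1} + ... + q_k *)
Definition pr_bottom : 'End(L) :=
  daddv_pi (q (- k%:Z)) (\sum_(j < k.*2) q ((j.+1)%:Z - k%:Z))%VS.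

Definition is_form_kernel E : Prop := forall x,
  x \in E <->
  x \in neg_part /\ (forall y, y \in neg_part -> pr_bottom [lie x, y] = 0).

Definition condition1 E : Prop :=
  [/\ \dim (q (- k%:Z)) = 1%N,
      odd (\dim neg_part),
      is_form_kernel E,
      \dim E = 1%N
    & (E <= q (-1))%VS].

Definition invariant_complement E V : Prop :=
  [/\ (E + V)%VS = q (-1),
      (E :&: V)%VS = 0%VS
    & forall x y, x \in q 0 -> y \in V -> [lie x, y] \in V].

(* For a line E, the linear map from the tensor product of E and V to W given
   by the bracket is an isomorphism. *)
Definition line_bracket_iso E V W : Prop := forall x, x \in E -> x != 0 ->
  (V :&: lker (ad x))%VS = 0%VS /\ (ad x @: V)%VS = W.

(* The components of the bracket on q_- = E + V + q_{-2} + ... + q_{-k} that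
   do not belong to the 2-form pr_{-k} o [,]. *)
Definition condition2 E V : Prop :=
  [/\ line_bracket_iso E V (q (-2)),
      forall i : int, - k%:Z + 2 <= i <= -2 ->
        line_bracket_iso E (q i) (q (i - 1)),
      forall x y, x \in V -> y \in V -> [lie x, y] = 0,
      forall (i : int) x y, i <= -2 -> i - 1 != - k%:Z ->
        x \in V -> y \in q i -> [lie x, y] = 0
    & forall (i j : int) x y, i <= -2 -> j <= -2 -> i + j != - k%:Z ->
        x \in q i -> y \in q j -> [lie x, y] = 0].

End Conditions.

(* Restricted roots.  Functionals on a subspace A are represented by functions
   on L of which only the values on A matter. *)

Definition ad_diagonalizable x : Prop := exists b : seq L,
  basis_of fullv b /\ (forall y, y \in b -> exists c : R, [lie x, y] = c *: y).

Definition split_abelian (A : {vspace L}) : Prop :=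
  (forall x y, x \in A -> y \in A -> [lie x, y] = 0) /\
  (forall x, x \in A -> ad_diagonalizable x).

Definition cartan_subspace (A : {vspace L}) : Prop :=
  split_abelian A /\
  (forall B : {vspace L}, split_abelian B -> (A <= B)%VS -> B = A).

Definition in_root_space (A : {vspace L}) (lam : L -> R) x : Prop :=
  forall h, h \in A -> [lie h, x] = lam h *: x.

Definition restricted_root (A : {vspace L}) (lam : L -> R) : Prop :=
  (exists2 h, h \in A & lam h != 0) /\
  (exists2 x, x != 0 & in_root_space A lam x).

Definition simple_restricted_roots (A : {vspace L}) (r : nat)
    (alpha : 'I_r -> L -> R) : Prop :=
  [/\ cartan_subspace A,
      forall i, restricted_root A (alpha i),
      forall c : 'I_r -> R,
        (forall h, h \in A -> \sum_i c i * alpha i h = 0) -> forall i, c i = 0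
    & forall lam, restricted_root A lam -> exists n : 'I_r -> nat,
        (forall h, h \in A -> lam h = \sum_i (n i)%:R * alpha i h) \/
        (forall h, h \in A -> lam h = - \sum_i (n i)%:R * alpha i h)].

(* The grading attached to a subset S of the simple restricted roots; the zero
   coefficient family gives the centralizer of A, in degree 0.  As L is the
   sum of its root spaces, this determines q among all gradings. *)
Definition corresponds_to (A : {vspace L}) (r : nat) (alpha : 'I_r -> L -> R)
    (S : {set 'I_r}) (q : int -> {vspace L}) : Prop :=
  forall (c : 'I_r -> int) x,
    in_root_space A (fun h => \sum_i (c i)%:~R * alpha i h) x ->
    x \in q (\sum_(i in S) c i).

(* L is identified by f with the Lie algebra of all elements of T satisfying P,
   under the commutator of mul; the Cartan subspace is the image of H, and the
   numbering of the simple restricted roots is fixed by the functionals root. *)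
Definition has_type (T : vectType R) (mul : T -> T -> T) (P : T -> Prop)
    (r : nat) (H : 'rV[R]_r -> T) (root : 'I_r -> 'rV[R]_r -> R)
    (S : {set 'I_r}) (q : int -> {vspace L}) : Prop :=
  exists (f : 'Hom(L, T)) (A : {vspace L}) (alpha : 'I_r -> L -> R),
    [/\ [/\ lker f = 0%VS,
            forall u, P u <-> exists x, f x = u
          & forall x y, f [lie x, y] = mul (f x) (f y) - mul (f y) (f x)],
        forall h, h \in A <-> exists t, f h = H t,
        forall h t, f h = H t -> forall i, alpha i h = root i t,
        simple_restricted_roots A alpha
      & corresponds_to A alpha S q].

End LieAlgebras.

(* so(p, q), as the matrices that are skew for diag(1, ..., 1, -1, ..., -1) *)
Section Orthogonal.
Variable R : fieldType.

Definition sig_form (p q : nat) : 'M[R]_(p + q) :=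
  block_mx 1%:M 0 0 (- 1%:M).

Definition in_so (p q : nat) (u : 'M[R]_(p + q)) : Prop :=
  u^T *m sig_form p q + sig_form p q *m u = 0.

(* The restricted rank of so(p + 2, q + 2). *)
Definition so_rank (p q : nat) : nat := (minn p q).+2.

(* The boost with parameters t_0, t_1, ... in the planes spanned by the i-th
   positive and the i-th negative basis vector. *)
Definition so_boost (p q : nat) (t : 'rV[R]_(so_rank p q)) :
    'M[R]_(p.+2 + q.+2) :=
  let B : 'M[R]_(p.+2, q.+2) := \matrix_(i, j)
    \sum_l (t 0 l *+ ((i == l :> nat) && (j == l :> nat))) in
  block_mx 0 B B^T 0.

(* With eps_i(t) = t_i and r the restricted rank: eps_i - eps_{i+1} for i < r,
   and then eps_r (diagram B_r) if p <> q, eps_{r-1} + eps_r (diagram D_r) if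
   p = q. *)
Definition so_root (p q : nat) (i : 'I_(so_rank p q))
    (t : 'rV[R]_(so_rank p q)) : R :=
  if (i.+1 < so_rank p q)%N then t 0 i - t 0 (inord i.+1)
  else if p == q then t 0 (inord i.-1) + t 0 i else t 0 i.

End Orthogonal.

(* (so(p + 2, q + 2), {alpha_l | l in labels}), the labels starting from 1 *)
Definition so_type (R : fieldType) (L : lieAlgType R) (p q : nat)
    (labels : seq nat) (gr : int -> {vspace L}) : Prop :=
  has_type (fun u v => u *m v) (@in_so R p.+2 q.+2) (@so_boost R p q)
    (@so_root R p q) [set i : 'I_(so_rank p q) | i.+1 \in labels] gr.

(* The split real form of G_2, as the derivations of the split octonions, the
   latter being written as Zorn vector matrices ((a, u), (v, b)). *)
Section SplitG2.
Variable R : fieldType.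

Definition dot3 (u v : 'rV[R]_3) : R := \sum_i u 0 i * v 0 i.

Definition cross3 (u v : 'rV[R]_3) : 'rV[R]_3 :=
  \row_(i < 3) (u 0 (i + 1) * v 0 (i + 2%:R) - u 0 (i + 2%:R) * v 0 (i + 1)).

Definition zorn : vectType R := ((R^o * 'rV[R]_3) * ('rV[R]_3 * R^o))%type.

Definition zorn_mul (x y : zorn) : zorn :=
  let: ((a, u), (v, b)) := x in
  let: ((a', u'), (v', b')) := y in
  ((a * a' + dot3 u v', a *: u' + b' *: u - cross3 v v'),
   (a' *: v + b *: v' + cross3 u u', dot3 v u' + b * b')).

Definition zorn_derivation (D : 'End(zorn)) : Prop := forall x y,
  D (zorn_mul x y) = zorn_mul (D x) y + zorn_mul x (D y).

(* Weights (t_0, t_1, - t_0 - t_1) on u and their opposites on v; the roots are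
   the short +-w_i and the long w_i - w_j. *)
Definition g2_weights (t : 'rV[R]_2) : 'rV[R]_3 :=
  \row_(i < 3) [:: t 0 0; t 0 1; - t 0 0 - t 0 1]`_i.

Definition g2_torus (t : 'rV[R]_2) : 'End(zorn) :=
  linfun (fun x : zorn =>
    let: ((_, u), (v, _)) := x in
    ((0, \row_i (g2_weights t 0 i * u 0 i)),
     (- \row_i (g2_weights t 0 i * v 0 i), 0)) : zorn).

(* alpha_1 = w_1 (short), alpha_2 = w_0 - w_1 (long) *)
Definition g2_root (i : 'I_2) (t : 'rV[R]_2) : R :=
  if i == 0 then t 0 1 else t 0 0 - t 0 1.

End SplitG2.

(* (g_2^*, {alpha_1, alpha_2}) *)
Definition g2_type (R : fieldType) (L : lieAlgType R)
    (gr : int -> {vspace L}) : Prop :=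
  has_type (fun D D' => (D \o D')%VF) (@zorn_derivation R) (@g2_torus R)
    (@g2_root R) [set: 'I_2] gr.

(* For p + q = 2 the labels 1, 2, 3 exhaust the simple restricted roots.  For
   so(3,3) these are the three simple roots of D_3 = A_3; for so(2,4) and
   so(4,2) the restricted rank is 2, two of the three simple roots of A_3 having
   the same restriction. *)
Definition listed_type (R : fieldType) (L : lieAlgType R)
    (gr : int -> {vspace L}) : Prop :=
  [\/ g2_type gr,
      so_type 1 2 [:: 2; 3]%N gr,
      exists p q : nat, (5 <= p + q + 2)%N /\ so_type p q [:: 1; 2]%N gr
    | exists p q : nat, (p + q + 2 = 4)%N /\ so_type p q [:: 1; 2; 3]%N gr].

(* so(2,3) with its Borel grading: the member n = p + q + 2 = 3 of the family
   (so(p + 2, q + 2), {alpha_1, alpha_2}).  With short root alpha_2, highest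
   root alpha_1 + 2 alpha_2, e = g_{-alpha_1} and v = g_{-alpha_2}, it has depth
   3 and satisfies condition1 and condition2, but it is not in listed_type: its
   dimension is 10, and those in the list have dimension at least 14. *)
Definition low_dim_type (R : fieldType) (L : lieAlgType R)
    (gr : int -> {vspace L}) : Prop :=
  exists p q : nat, (p + q + 2 = 3)%N /\ so_type p q [:: 1; 2]%N gr.

(* Main.v *)
Require Import Defs.
From HB Require Import structures.
From mathcomp Require Import all_boot all_order all_algebra.
From mathcomp Require Import boolp reals.
From mathcomp Require Import ring lra zify.

Set Implicit Arguments.
Unset Strict Implicit.
Unset Printing Implicit Defensive.

Import Order.TTheory GRing.Theory Num.Theory.
Local Open Scope ring_scope.

(* Let e span the kernel of the 2-form, V be the complement of e in degree -1, D = ad e and f a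
   vector of degree -k. Condition (2) says that q_{-j-1} = D^j V for 0 < j < k - 1, and the form is
   [v, D^(k-2) w] = b(v, w) f. For x in q_1 the Jacobi identity, applied to [x, [v, D^n w]], expresses
   the action of [x, e] and [x, v] on q_{-1} through the scalars by which [x, e] and [x, v] act
   on e. As q_{1-k} = [q_1, f], this gives k <= 5, dim V = 1 for k = 5, dim V = 2 for k = 4, and, for
   k = 3, a nondegenerate symmetric b with q_0 acting by conformally skew endomorphisms.
   The negative part is then that of the model of the same depth: so(p + 2, q + 2), where (p, q) is
   the signature of b, for k = 3, so(3, 4) for k = 4 and the split form of G_2 for k = 5.
   A graded isomorphism with the model is obtained from the identification of the negative parts,
   degree after degree: x and u correspond when their brackets with corresponding elements of
   degree -1 do, the model is transitive (an element of degree >= 0 commuting with degree -1 vanishes),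
   and q_{n+1} = [q_1, q_n] for n > 0 by a trace argument. The forward direction is a computation
   in the models with weight vectors. *)

(** * Lie algebra preliminaries *)

Section Coordinates.
Import VectorInternalTheory.
Variables (R : fieldType) (V : vectType R).
Implicit Types x y : V.

(** No Killing form, classification of roots or given grading element is available; simplicity of L
    and closure arguments replace them. The subspace obtained from one vector by brackets with half
    of the degrees turns out to be an ideal, hence everything; this gives the transitivity of L and
    q_{1-k} = [q_1, f]. The trace argument needs h in [q_1, q_{-1}] acting by -1 on q_{-1}. It is a
    combination of a multiple of some [x, e], with scalars 1 on e and -(k-2)/2 on V, and of an
    element with scalars 1 and -(k-1)/2, found separately at each depth. By transitivity h acts by n
    on q_n, while its trace on the positive part modulo what q_1 generates is that of a commutator;
    in characteristic 0 this quotient vanishes. That [x, e] is nonzero for some x is a separate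
    point: otherwise e and the degrees below -1 would span an ideal. The map into the model is
    injective by simplicity and onto because its image contains generators. Square roots are used
    only for Sylvester's theorem at depth 3. The algebra so(2, 3) is what appears at depth 3 when V
    is a line. *)

Definition vcoord (i : 'I_(dim V)) (x : V) : R := v2r x 0 i.

Lemma vcoord_ext x y : (forall i, vcoord i x = vcoord i y) -> x = y.
Proof. by move=> h; apply: v2r_inj; apply/rowP. Qed.
Lemma vcoordD i x y : vcoord i (x + y) = vcoord i x + vcoord i y.
Proof. by rewrite /vcoord linearD mxE. Qed.
Lemma vcoordN i x : vcoord i (- x) = - vcoord i x.
Proof. by rewrite /vcoord linearN mxE. Qed.
Lemma vcoordZ i a x : vcoord i (a *: x) = a * vcoord i x.
Proof. by rewrite /vcoord linearZ mxE. Qed.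
Lemma vcoord0 i : vcoord i (0 : V) = 0.
Proof. by rewrite /vcoord linear0 mxE. Qed.
End Coordinates.

(* Reduces an identity between linear combinations to a ring identity between coordinates. *)
Ltac linear_coord :=
  apply: vcoord_ext => ?; rewrite ?(vcoordD, vcoordN, vcoordZ, vcoord0).
Ltac linear_ring := linear_coord; ring.
Ltac linear_field := linear_coord; field.

Section LieBasics.
Variables (R : fieldType) (L : lieAlgType R).
Implicit Types x y z : L.

Lemma lie0r x : [lie x, 0] = 0.
Proof. by have := lbr_linear_r x (-1) 0 0; rewrite scaleN1r oppr0 addr0 scaleN1r addNr. Qed.
Lemma lie0l x : [lie 0, x] = 0.
Proof. by have := lbr_linear_l x (-1) 0 0; rewrite scaleN1r oppr0 addr0 scaleN1r addNr. Qed.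
Lemma lieDr x y z : [lie x, y + z] = [lie x, y] + [lie x, z].
Proof. by have := lbr_linear_r x 1 y z; rewrite !scale1r. Qed.
Lemma lieDl x y z : [lie x + y, z] = [lie x, z] + [lie y, z].
Proof. by have := lbr_linear_l z 1 x y; rewrite !scale1r. Qed.
Lemma lieZr a x y : [lie x, a *: y] = a *: [lie x, y].
Proof. by have := lbr_linear_r x a y 0; rewrite lie0r !addr0. Qed.
Lemma lieZl a x y : [lie a *: x, y] = a *: [lie x, y].
Proof. by have := lbr_linear_l y a x 0; rewrite lie0l !addr0. Qed.
Lemma lieNr x y : [lie x, - y] = - [lie x, y].
Proof. by rewrite -scaleN1r lieZr scaleN1r. Qed.
Lemma lieNl x y : [lie - x, y] = - [lie x, y].
Proof. by rewrite -scaleN1r lieZl scaleN1r. Qed.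
Lemma lieBr x y z : [lie x, y - z] = [lie x, y] - [lie x, z].
Proof. by rewrite lieDr lieNr. Qed.
Lemma lieBl x y z : [lie x - y, z] = [lie x, z] - [lie y, z].
Proof. by rewrite lieDl lieNl. Qed.
Lemma lieC x y : [lie x, y] = - [lie y, x].
Proof.
apply/eqP; rewrite -addr_eq0; apply/eqP.
by have := lbrxx (x + y); rewrite lieDl !lieDr !lbrxx addr0 add0r.
Qed.
Lemma lieJ x y z : [lie x, [lie y, z]] = [lie [lie x, y], z] + [lie y, [lie x, z]].
Proof.
have := lbr_jacobi x y z.
rewrite (lieC z x) lieNr (lieC z [lie x, y]) => /eqP.
by rewrite -addrA addr_eq0 opprD !opprK addrC => /eqP.
Qed.
Lemma lieJl x y z : [lie [lie x, y], z] = [lie x, [lie y, z]] - [lie y, [lie x, z]].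
Proof. by rewrite (lieJ x) addrK. Qed.
Lemma lieJr x y z : [lie [lie x, y], z] = [lie [lie x, z], y] + [lie x, [lie y, z]].
Proof. by rewrite lieJl (lieC [lie x, z]) addrC. Qed.

Let lie_r (x : L) := lbr x.
HB.instance Definition _ x := GRing.isLinear.Build R L L _ (lie_r x) (lbr_linear_r x).

Lemma adE x y : ad x y = [lie x, y].
Proof. exact: (lfunE (lie_r x)). Qed.

(** A sum of images over a basis of [U], hence a subspace by construction; the membership and
    induction lemmas below make it usable as the span of all brackets. *)
Definition bracket_span (U W : {vspace L}) : {vspace L} :=
  (\sum_(i < \dim U) (ad (vbasis U)`_i @: W))%VS.

Lemma mem_bracket_span (U W : {vspace L}) x y :
  x \in U -> y \in W -> [lie x, y] \in bracket_span U W.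
Proof.
move=> xU yW; rewrite (coord_vbasis xU) -adE.
have -> : ad (\sum_i coord (vbasis U) i x *: (vbasis U)`_i) y =
   \sum_i coord (vbasis U) i x *: ad (vbasis U)`_i y.
  rewrite adE; under [RHS]eq_bigr do rewrite adE.
  elim/big_rec2: _ => [|i a b _ <-]; first by rewrite lie0l.
  by rewrite lieDl lieZl.
apply: memv_suml => i _; apply: memvZ.
by rewrite (memvE) (sumv_sup i) // -memvE memv_img.
Qed.

(** A subspace given as a predicate. Most properties proved by linearity below are existential
    statements, for which no [{vspace _}] is at hand; [linear_closed_vspace] supplies one when
    simplicity has to be applied. *)
Definition linear_closed_pred (V : lmodType R) (P : V -> Prop) :=
  P 0 /\ forall a u w, P u -> P w -> P (a *: u + w).

Lemma bracket_span_ind (U W : {vspace L}) (P : L -> Prop) :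
  linear_closed_pred P -> (forall x y, x \in U -> y \in W -> P [lie x, y]) ->
  forall z, z \in bracket_span U W -> P z.
Proof.
move=> [P0 PD] PB z /memv_sumP[zs zsP ->].
have PD' a b : P a -> P b -> P (a + b) by move=> ? ?; rewrite -[a]scale1r; apply: PD.
elim/big_rec: _ => // i a _ Pa; apply: PD' => //.
have /memv_imgP[w wW ->] := zsP i isT.
rewrite adE; apply: PB => //; apply: vbasis_mem; apply: mem_nth.
by rewrite size_tuple.
Qed.
End LieBasics.

Section LinearPred.
Variables (R : fieldType) (V : vectType R).

Lemma linear_closed_sum (P : V -> Prop) I (r : seq I) (Q : pred I) F :
  linear_closed_pred P -> (forall i, Q i -> P (F i)) -> P (\sum_(i <- r | Q i) F i).
Proof.
move=> [P0 PD] PF; elim/big_rec: _ => // i x Qi Px.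
by rewrite -[F i]scale1r; apply: PD => //; apply: PF.
Qed.

Lemma linear_closed_mem (U : {vspace V}) : linear_closed_pred (fun x => x \in U).
Proof. by split=> [|a x y xU yU]; [exact: mem0v|apply: memvD => //; apply: memvZ]. Qed.

(** Among the subspaces contained in [P] one of maximal dimension is taken; adding the line of a
    vector of [P] cannot enlarge it. *)
Lemma linear_closed_vspace (P : V -> Prop) :
  linear_closed_pred P -> exists U : {vspace V}, forall x, x \in U <-> P x.
Proof.
move=> PL; have [P0 PD] := PL.
pose Q n := `[< exists U : {vspace V}, \dim U = n /\ forall x, x \in U -> P x >].
have exQ : exists n, Q n.
  exists 0%N; apply/asboolP; exists 0%VS; split; first exact: dimv0.
  by move=> x; rewrite memv0 => /eqP->.
have bQ n : Q n -> (n <= \dim {:V})%N.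
  by move=> /asboolP[U [<- _]]; rewrite dimvS ?subvf.
case: (ex_maxnP exQ bQ) => n /asboolP[U [dU UP]] maxU.
exists U => x; split=> [|Px]; first exact: UP.
have /maxU : Q (\dim (<[x]> + U)).
  apply/asboolP; exists (<[x]> + U)%VS; split => // y /memv_addP[_ /vlineP[a ->] [u uU ->]].
  by apply: PD => //; apply: UP.
rewrite -dU => le; have : (U == <[x]> + U)%VS by rewrite eqEdim addvSr.
by rewrite memvE => /eqP->; exact: addvSl.
Qed.

End LinearPred.

Lemma linear_closed_conv (R : fieldType) (V : lmodType R) (P : V -> Prop) :
  linear_closed_pred P -> [/\ P 0, forall u w, P u -> P w -> P (u + w),
    forall u w, P u -> P w -> P (u - w) & forall a u, P u -> P (a *: u)].
Proof.
move=> [P0 PD]; split=> // [u w Pu Pw|u w Pu Pw|a u Pu].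
- by rewrite -[u]scale1r; apply: PD.
- by rewrite -scaleN1r addrC; apply: PD.
- by rewrite -[_ *: _]addr0; apply: PD.
Qed.

(** * Gradings *)

Section Grading.
Variables (R : fieldType) (L : lieAlgType R) (k : nat) (q : int -> {vspace L}).
Hypothesis kg : kgrading k q.
Implicit Types (x y z : L) (i j : int).

Let qsum := (\sum_(j < (k.*2).+1) q (j%:Z - k%:Z))%VS.

Lemma graded_ind (P : L -> Prop) : linear_closed_pred P ->
  (forall i x, x \in q i -> P x) -> forall x, P x.
Proof.
move=> PL PQ x; have : x \in fullv by exact: memvf.
rewrite -(kgrading_sum kg) => /memv_sumP[xs xsP ->].
by apply: linear_closed_sum => // i _; apply: PQ (xsP i isT).
Qed.

Definition gr_index i : 'I_(k.*2).+1 := inord `|(i + k%:Z)%R|%N.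

Lemma gr_indexK i : (`|i| <= k)%N -> (gr_index i)%:Z - k%:Z = i.
Proof. by move=> le; rewrite /gr_index inordK; lia. Qed.

Lemma gr_index_ord (j : 'I_(k.*2).+1) : gr_index (j%:Z - k%:Z) = j.
Proof. by apply: val_inj; rewrite /= inordK; have := ltn_ord j; lia. Qed.

(** Outside the range from -k to k the index [gr_index i] is meaningless and [q i] is zero; the
    value 0 there makes the projection usable for every integer without a side condition. *)
Definition gr_proj i : 'End(L) :=
  if (`|i| <= k)%N then sumv_pi_for (erefl qsum) (gr_index i) else 0.

Lemma gr_proj_mem i x : gr_proj i x \in q i.
Proof.
rewrite /gr_proj; case: ifP => le; last by rewrite lfunE mem0v.
by rewrite -{2}(gr_indexK le); apply: memv_sum_pi.
Qed.

Lemma gr_proj_sum x : x = \sum_(j < (k.*2).+1) gr_proj (j%:Z - k%:Z) x.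
Proof.
have xq : x \in qsum by rewrite /qsum (kgrading_sum kg) memvf.
rewrite -{1}(sumv_pi_sum (erefl qsum) xq); apply: eq_bigr => j _.
rewrite /gr_proj gr_index_ord ifT //; have := ltn_ord j; lia.
Qed.

Lemma gr_direct (us : 'I_(k.*2).+1 -> L) :
  (forall j : 'I_(k.*2).+1, us j \in q (j%:Z - k%:Z)) -> \sum_j us j = 0 ->
  forall j : 'I_(k.*2).+1, us j = 0.
Proof.
move=> usq us0 j; have /directv_sum_independent := kgrading_direct kg.
by apply.
Qed.

Lemma gr_proj_eq i j x : x \in q j -> gr_proj i x = if i == j then x else 0.
Proof.
move=> xq; have [jk|jk] := leqP `|j|%N k; last first.
  by move: xq; rewrite (kgrading_supp kg jk) memv0 => /eqP->; rewrite linear0 if_same.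
have [ik|ik] := leqP `|i|%N k; last first.
  by rewrite /gr_proj leqNgt ik lfunE /=; case: eqP => // ij; lia.
pose us (l : 'I_(k.*2).+1) := gr_proj (l%:Z - k%:Z) x - (if l == gr_index j then x else 0).
have us0 : \sum_l us l = 0.
  by rewrite sumrB -gr_proj_sum -big_mkcond big_pred1_eq subrr.
have usq l : us l \in q (l%:Z - k%:Z).
  rewrite memvB ?gr_proj_mem //; case: eqP => [->|_]; last exact: mem0v.
  by rewrite gr_indexK.
have /eqP := gr_direct usq us0 (gr_index i).
rewrite /us gr_indexK // subr_eq0 => /eqP->; congr (if _ then _ else _).
apply/eqP/eqP => [ij|->//]; by rewrite -(gr_indexK ik) ij gr_indexK.
Qed.

Lemma gr_proj_id i x : x \in q i -> gr_proj i x = x.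
Proof. by move=> xq; rewrite (gr_proj_eq _ xq) eqxx. Qed.

Lemma gr_cap i j x : x \in q i -> x \in q j -> i != j -> x = 0.
Proof. by move=> xi xj ij; rewrite -(gr_proj_id xi) (gr_proj_eq _ xj) (negPf ij). Qed.

Lemma gr_ext (f g : 'End(L)) : (forall i x, x \in q i -> f x = g x) -> f = g.
Proof.
move=> fg; apply/lfunP; apply: graded_ind => [|i x]; last exact: fg.
by split=> [|a u w fu fw]; rewrite ?linear0 // !linearP /= fu fw.
Qed.

Lemma gr_br i j x y : x \in q i -> y \in q j -> [lie x, y] \in q (i + j).
Proof. exact: (kgrading_br kg). Qed.

Lemma gr_br_eq i j l x y : x \in q i -> y \in q j -> i + j = l -> [lie x, y] \in q l.
Proof. by move=> xi yj <-; exact: gr_br. Qed.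

Lemma gr_brP i j x y : [lie x, gr_proj i y] = gr_proj (i + j) [lie x, y] \/ x \notin q j.
Proof.
case: (boolP (x \in q j)) => [xj|]; [left|by right].
move: y; apply: graded_ind => [|l y yl].
  by split=> [|a u w hu hw]; rewrite ?lie0r ?linear0 ?lie0r // !(lieDr, lieZr) !linearP /= !(lieDr, lieZr) hu hw.
rewrite (gr_proj_eq _ yl) (gr_proj_eq _ (gr_br xj yl)) addrC (inj_eq (addrI _)).
by case: ifP => // _; rewrite lie0r.
Qed.

Lemma gr_proj_br i j l x y : x \in q j -> l = j + i ->
  gr_proj l [lie x, y] = [lie x, gr_proj i y].
Proof.
move=> xj ->; have [->|] := gr_brP i j x y; last by rewrite xj.
by rewrite addrC.
Qed.

(* The bracket-closure of a vector under a family of operators; its invariance under the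
   remaining homogeneous elements comes from the Jacobi identity. *)
Inductive lie_closure (A : L -> Prop) (x0 : L) : L -> Prop :=
| Closure_base : lie_closure A x0 x0
| Closure_zero : lie_closure A x0 0
| Closure_lin a x y : lie_closure A x0 x -> lie_closure A x0 y ->
    lie_closure A x0 (a *: x + y)
| Closure_br y x : A y -> lie_closure A x0 x -> lie_closure A x0 [lie y, x].

Lemma lie_closure_linear A x0 : linear_closed_pred (lie_closure A x0).
Proof. by split=> *; constructor. Qed.

(** The closure is a subspace stable under homogeneous elements, hence a nonzero ideal of a simple
    algebra. *)
Lemma lie_closure_ideal (A : L -> Prop) x0 : simple_lie L -> x0 != 0 ->
  (forall i y x, y \in q i -> lie_closure A x0 x -> lie_closure A x0 [lie y, x]) ->
  forall x, lie_closure A x0 x.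
Proof.
move=> [_ _ simp] x0n0 HA x.
have [U UP] := linear_closed_vspace (lie_closure_linear A x0).
have UI z y : z \in fullv -> y \in U -> [lie z, y] \in U.
  move=> _ /UP yU; apply/UP; move: z; apply: graded_ind => [|i z zi]; last exact: HA zi yU.
  have [? ?] := lie_closure_linear A x0.
  by split=> [|a u w hu hw]; rewrite ?lie0l ?lieDl ?lieZl; auto.
have [U0|UF] := simp U (subvf _) UI.
- by move: x0n0; rewrite -memv0 -U0; case/negP; apply/UP; constructor.
- by apply/UP; rewrite UF memvf.
Qed.

Lemma gr_neg_gen (P : L -> Prop) : linear_closed_pred P ->
  (forall x y, P x -> P y -> P [lie x, y]) ->
  (forall x, x \in q (-1) -> P x) -> forall i x, i < 0 -> x \in q i -> P x.
Proof.
move=> PL PB P1 i x i0 xi; have [U UP] := linear_closed_vspace PL.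
apply/UP; move: x xi; apply/subvP; apply: (kgrading_gen kg) => //.
- by move=> x y /UP ? /UP ?; apply/UP; apply: PB.
- by apply/subvP => x /P1 /UP.
Qed.

(** The centralizer of [x] is a subalgebra, and [q (-1)] generates the negative part. *)
Lemma gr_centralizer_neg x : (forall u, u \in q (-1) -> [lie x, u] = 0) ->
  forall i u, i < 0 -> u \in q i -> [lie x, u] = 0.
Proof.
move=> x1; apply: gr_neg_gen => //.
- by split=> [|a u w hu hw]; rewrite ?lie0r // lieDr lieZr hu hw scaler0 addr0.
- by move=> u w hu hw; rewrite lieJ hu hw lie0l lie0r addr0.
Qed.

(** A nonzero [x] of this kind commutes with the whole negative part. By the Jacobi identity its
    closure under degrees at least 0 is then stable under negative degrees as well, so it is all of
    L; but it lies in degrees at least 0, whereas degree -k is nonzero. *)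
Lemma gr_transitive i x : simple_lie L -> 0 <= i -> x \in q i ->
  (forall u, u \in q (-1) -> [lie x, u] = 0) -> x = 0.
Proof.
move=> simp i0 xi x1; apply/eqP/negPn/negP => xn0.
pose A y := exists2 j, 0 <= j & y \in q j.
have xN := gr_centralizer_neg x1.
have AN w : lie_closure A x w -> forall j y, j < 0 -> y \in q j -> lie_closure A x [lie y, w].
  elim=> {w} [|||z w [l l0 zl] clw IH] => [j y j0 yj|j y _ _|a u w _ hu _ hw j y j0 yj|j y j0 yj].
  - by rewrite lieC (xN _ _ j0 yj) oppr0; constructor.
  - by rewrite lie0r; constructor.
  - by rewrite lieDr lieZr; constructor; [apply: hu yj|apply: hw yj].
  (* In [y, [z, w]] the factor [y, z] has degree j + l: if that is negative the induction hypothesis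
     applies, otherwise the closure absorbs it. *)
  rewrite lieJ -[X in lie_closure _ _ X]scale1r scalerDr scale1r.
  rewrite -[X in X + _]scale1r; constructor; last first.
    by rewrite scale1r; constructor; [exists l|apply: IH yj].
  have yzl := gr_br yj zl; have [h|h] := ltP (j + l) 0; first exact: IH yzl.
  by constructor => //; exists (j + l).
have full : forall w, lie_closure A x w.
  apply: lie_closure_ideal => // j y w yj clw.
  have [h|h] := ltP j 0; first exact: AN yj.
  by constructor => //; exists j.
pose U := (\sum_(j < k.+1) q j%:Z)%VS.
have memU j y : 0 <= j -> y \in q j -> y \in U.
  move=> j0 yj; have [jk|jk] := leqP `|j|%N k; last first.
    by move: yj; rewrite (kgrading_supp kg jk) memv0 => /eqP->; exact: mem0v.
  have jk' : (`|j| < k.+1)%N by [].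
  by rewrite memvE (sumv_sup (Ordinal jk')) //= -memvE gez0_abs.
have UA y w : A y -> w \in U -> [lie y, w] \in U.
  move=> [j j0 yj] /memv_sumP[ws wsP ->].
  suff : linear_closed_pred (fun w => [lie y, w] \in U).
    by move/linear_closed_sum; apply => l _; apply: memU (gr_br yj (wsP l isT)); lia.
  by split=> [|a u v hu hv]; rewrite ?lie0r ?mem0v // lieDr lieZr memvD ?memvZ.
have fullU w : w \in U.
  elim: (full w) => [||a u v _ hu _ hv|y v Ay _ hv].
  - exact: memU xi.
  - exact: mem0v.
  - by rewrite memvD ?memvZ.
  - exact: UA.
have := kgrading_depth kg; rewrite -vpick0 => /eqP; apply.
have := memv_pick (q (- k%:Z)); set f := vpick _ => fk.
(* Depth 0 would make L itself a simple ideal inside [q 0]. *)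
have k0 : (0 < k)%N.
  rewrite lt0n; apply/eqP => k0.
  have q0 z : z \in q 0.
    move: z; apply: graded_ind; first exact: linear_closed_mem.
    move=> l z zl; have [l0|l0] := eqVneq l 0; first by rewrite -l0.
    by move: zl; rewrite (kgrading_supp kg) ?memv0 => [/eqP->|]; [exact: mem0v|lia].
  have /negP[] := kgrading_no_ideal kg (I := fullv) (fun _ _ _ => memvf _) simp.
  by apply/subvP => z _.
have /memv_sumP[ws wsP e] := fullU f.
rewrite -(gr_proj_id fk) e linear_sum big1 //= => l _.
rewrite (gr_proj_eq _ (wsP l isT)); case: eqP => //; lia.
Qed.

End Grading.

(** * Traces of endomorphisms *)

Lemma mxtrace_idempotent (R : fieldType) n (P : 'M[R]_n) :
  P *m P = P -> \tr P = (\rank P)%:R.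
Proof.
move=> PP; rewrite -{1}(mulmx_base P) mxtrace_mulC.
(* If [P] = C R is the full rank factorization, idempotence forces R C = 1, a unit matrix of size
   the rank. *)
suff -> : row_base P *m col_base P = 1%:M by rewrite mxtrace1.
have /row_free_inj cinj := row_base_free P.
have /row_full_inj rinj := col_base_full P.
apply: cinj; apply: rinj; rewrite mul1mx.
move: (row_base P) (col_base P) (mulmx_base P) => r c rc.
by rewrite !mulmxA rc -mulmxA rc PP.
Qed.

Import passmx.
Section Trace.
Variables (R : fieldType) (V : vectType R).

Definition lfun_trace (g : 'End(V)) : R^o :=
  \tr (mxof (vbasis {:V}) (vbasis {:V}) g).

Lemma lfun_trace_linear : linear lfun_trace.
Proof. by move=> a g h; rewrite /lfun_trace linearP /= linearP. Qed.
HB.instance Definition _ :=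
  GRing.isLinear.Build R 'End(V) R^o _ lfun_trace lfun_trace_linear.

Lemma lfun_traceC (g h : 'End(V)) : lfun_trace (g \o h)%VF = lfun_trace (h \o g)%VF.
Proof. by rewrite /lfun_trace !(mxof_comp _ _ (vbasisP _)) mxtrace_mulC. Qed.

(** The natural number is the rank. In characteristic 0 a vanishing positive combination of such
    traces makes every projection in it vanish. *)
Lemma lfun_trace_idempotent (g : 'End(V)) : (g \o g)%VF = g ->
  exists2 n : nat, lfun_trace g = n%:R :> R & (n == 0%N -> g = 0).
Proof.
move=> gg; exists (\rank (mxof (vbasis {:V}) (vbasis {:V}) g)).
  by rewrite /lfun_trace mxtrace_idempotent // -(mxof_comp _ _ (vbasisP _)) gg.
by rewrite mxrank_eq0 mxof_eq0 ?vbasisP // => /eqP.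
Qed.
End Trace.

(** * Generation of the positive part by degree one *)

Section PositiveGeneration.
Variables (R : numFieldType) (L : lieAlgType R) (k : nat) (q : int -> {vspace L}).
Hypotheses (kg : kgrading k q) (simp : simple_lie L).
Implicit Types x y z u h : L.

(** Elements of degree at most 0 multiply [f] by scalars, so the closure of [f] under positive
    degrees is an ideal and exhausts L. A bracket of this closure that lands in degree 1 - k can
    only come from [q 1] acting on the line of [f]. *)
Lemma bottom_adjacent (f : L) : (0 < k)%N -> q (- k%:Z) = <[f]>%VS ->
  (q (1 - k%:Z) <= ad f @: q 1%R)%VS.
Proof.
move=> k0 qf; pose A y := exists2 j : int, 0 < j & y \in q j.
have fq : f \in q (- k%:Z) by rewrite qf memv_line.
have fn0 : f != 0 by have := kgrading_depth kg; rewrite qf; apply: contra_neq => ->.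
have AN w : lie_closure A f w ->
    forall (j : int) y, j <= 0 -> y \in q j -> lie_closure A f [lie y, w].
  elim=> {w} [|||z w [l l0 zl] clw IH] => [j y j0 yj|j y _ _|a u w _ hu _ hw j y j0 yj|j y j0 yj].
  - have [j1|j1] := eqVneq j 0; last first.
      have := gr_br kg yj fq; rewrite (kgrading_supp kg); last lia.
      by rewrite memv0 => /eqP->; constructor.
    have := gr_br kg yj fq; rewrite j1 add0r qf => /vlineP[c ->].
    by rewrite -[c *: f]addr0; do 2!constructor.
  - by rewrite lie0r; constructor.
  - by rewrite lieDr lieZr; constructor; [apply: hu yj|apply: hw yj].
  rewrite lieJ -[X in X + _]scale1r; constructor; last first.
    by constructor; [exists l|apply: IH yj].
  have yzl := gr_br kg yj zl; have [h|h] := leP (j + l) 0; first exact: IH yzl.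
  by constructor => //; exists (j + l).
have full w : lie_closure A f w.
  move: w; apply: (lie_closure_ideal kg) => // j w y yj clw.
  have [h|h] := leP j 0; first exact: AN yj.
  by constructor => //; exists j.
have G w : gr_proj k q (1 - k%:Z) w \in (ad f @: q 1%R)%VS.
  elim: (full w) => [||a u v _ hu _ hv|y v [j j0 yj] _ _].
  - by rewrite (gr_proj_eq kg _ fq) ifF ?mem0v //; apply/eqP; lia.
  - by rewrite linear0 mem0v.
  - by rewrite linearP /= memvD ?memvZ.
  rewrite (gr_proj_br kg (i := 1 - k%:Z - j) v yj); last by lia.
  have [j1|j1] := eqVneq j 1; last first.
    have := gr_proj_mem k q (1 - k%:Z - j) v; rewrite (kgrading_supp kg); last lia.
    by rewrite memv0 => /eqP->; rewrite lie0r mem0v.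
  have := gr_proj_mem k q (1 - k%:Z - j) v.
  have -> : 1 - k%:Z - j = - k%:Z by lia.
  rewrite qf => /vlineP[c ->]; rewrite lieZr memvZ // lieC memvN -adE memv_img //.
  by rewrite -j1.
by apply/subvP => x xq; rewrite -(gr_proj_id kg xq).
Qed.

(** The index is one less than the degree: [gen_pos n] consists of brackets of n + 1 elements of
    [q 1]. *)
Fixpoint gen_pos n : {vspace L} :=
  if n is n'.+1 then bracket_span (q 1) (gen_pos n') else q 1.

Lemma gen_pos_sub n : (gen_pos n <= q n.+1%:Z)%VS.
Proof.
elim: n => [//|n IH]; apply/subvP; apply: bracket_span_ind.
  exact: linear_closed_mem.
by move=> x y x1 /(subvP IH) yn; apply: (gr_br_eq kg x1 yn); lia.
Qed.

Lemma gen_pos_br0 n z x : z \in q 0 -> x \in gen_pos n -> [lie z, x] \in gen_pos n.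
Proof.
move=> z0; elim: n x => [|n IH] x /=; first by move=> x1; apply: (gr_br_eq kg z0 x1).
move: x; apply: bracket_span_ind.
  by split=> [|a x y hx hy]; rewrite ?lie0r ?mem0v // lieDr lieZr memvD ?memvZ.
move=> x y x1 yn; rewrite lieJ memvD ?mem_bracket_span ?IH //.
exact: (gr_br_eq kg z0 x1).
Qed.

Lemma gen_pos_brN n u x : u \in q (-1) -> x \in gen_pos n.+1 -> [lie u, x] \in gen_pos n.
Proof.
move=> u1; elim: n x => [|n IH] x xn.
  exact: (gr_br_eq kg u1 (subvP (gen_pos_sub 1) _ xn)).
move: x xn; apply: bracket_span_ind.
  by split=> [|a x y hx hy]; rewrite ?lie0r ?mem0v // lieDr lieZr memvD ?memvZ.
move=> x y x1 yn; rewrite lieJ memvD //; last by rewrite mem_bracket_span ?IH.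
by apply: gen_pos_br0 => //; exact: (gr_br_eq kg u1 x1).
Qed.

(** The projection of L onto a complement of [gen_pos n] in degree n + 1; its trace is the
    codimension of the generated part. *)
Definition pos_defect n : 'End(L) :=
  gr_proj k q n.+1%:Z - (projv (gen_pos n) \o gr_proj k q n.+1%:Z)%VF.
Definition pos_defects : 'End(L) := \sum_(n < k) pos_defect n.

Lemma pos_defectE n x :
  pos_defect n x = gr_proj k q n.+1%:Z x - projv (gen_pos n) (gr_proj k q n.+1%:Z x).
Proof. by rewrite /pos_defect add_lfunE opp_lfunE comp_lfunE. Qed.

Lemma pos_defect_mem n x : pos_defect n x \in q n.+1%:Z.
Proof.
rewrite pos_defectE memvB ?gr_proj_mem //.
by apply: (subvP (gen_pos_sub n)); apply: memv_proj.
Qed.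

Lemma pos_defect_eq0 n x : pos_defect n x = 0 <-> gr_proj k q n.+1%:Z x \in gen_pos n.
Proof.
rewrite pos_defectE; split=> [/eqP|h]; last by rewrite projv_id // subrr.
by rewrite subr_eq0 => /eqP->; exact: memv_proj.
Qed.

Lemma pos_defect_comp n m x :
  pos_defect n (pos_defect m x) = if n == m then pos_defect n x else 0.
Proof.
rewrite [LHS]pos_defectE !(gr_proj_eq kg _ (pos_defect_mem m x)) eqz_nat eqSS.
case: eqP => [->|_]; last by rewrite linear0 subr0.
by rewrite pos_defectE linearB /= projv_proj subrr subr0.
Qed.

Lemma pos_defects_comp (n : 'I_k) x : pos_defect n (pos_defects x) = pos_defect n x.
Proof.
rewrite /pos_defects sum_lfunE linear_sum /=.
under eq_bigr do rewrite pos_defect_comp.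
rewrite (bigD1 n) //= eqxx big1 ?addr0 // => m mn.
by rewrite eq_sym (inj_eq val_inj) (negPf mn).
Qed.

Lemma pos_defects_eq0 x :
  pos_defects x = 0 <-> (forall n, gr_proj k q n.+1%:Z x \in gen_pos n).
Proof.
split=> [px n|px]; last first.
  by rewrite /pos_defects sum_lfunE big1 // => n _; apply/pos_defect_eq0.
have [nk|nk] := ltnP n k; last first.
  have := gr_proj_mem k q n.+1%:Z x; rewrite (kgrading_supp kg) ?memv0; last lia.
  by move/eqP->; exact: mem0v.
by apply/pos_defect_eq0; rewrite -(pos_defects_comp (Ordinal nk)) px linear0.
Qed.

Lemma pos_defects_idem : (pos_defects \o pos_defects)%VF = pos_defects.
Proof.
apply/lfunP => x; rewrite comp_lfunE [LHS]sum_lfunE [RHS]sum_lfunE.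
by apply: eq_bigr => n _; rewrite pos_defects_comp.
Qed.

(** [g] preserves the kernel of the projection [pos_defects] and so acts on the quotient by it; the
    equation lets this action be composed like an endomorphism of L. *)
Lemma pos_defects_stable (g : 'End(L)) :
  (forall x, pos_defects x = 0 -> pos_defects (g x) = 0) ->
  (pos_defects \o g \o pos_defects)%VF = (pos_defects \o g)%VF.
Proof.
move=> gS; apply/lfunP => x; rewrite !comp_lfunE; apply/eqP.
rewrite -subr_eq0 -!linearB /=; apply/eqP; apply: gS.
by rewrite linearB /= -comp_lfunE pos_defects_idem subrr.
Qed.

(** The kernel of [pos_defects] consists of the elements whose positive components are generated by
    [q 1]. It is stable under [x] and [u], so [x, u] acts on the quotient as a commutator, which has
    trace 0. *)
Lemma pos_defects_trace x u : x \in q 1 -> u \in q (-1) ->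
  lfun_trace (pos_defects \o ad [lie x, u])%VF = 0.
Proof.
move=> x1 u1; have Sx : (pos_defects \o ad x \o pos_defects)%VF = (pos_defects \o ad x)%VF.
  apply: pos_defects_stable => y /pos_defects_eq0 yp; apply/pos_defects_eq0 => n.
  rewrite adE (gr_proj_br kg (i := n%:Z) y x1); last lia.
  by case: n => [|n] /=; [exact: (gr_br_eq kg x1 (gr_proj_mem k q _ _))|rewrite mem_bracket_span].
have Su : (pos_defects \o ad u \o pos_defects)%VF = (pos_defects \o ad u)%VF.
  apply: pos_defects_stable => y /pos_defects_eq0 yp; apply/pos_defects_eq0 => n.
  by rewrite adE (gr_proj_br kg (i := n.+2%:Z) y u1) ?gen_pos_brN //; lia.
have -> : (pos_defects \o ad [lie x, u] = ((pos_defects \o ad x \o pos_defects) \o ad u)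
     - ((pos_defects \o ad u \o pos_defects) \o ad x))%VF.
  rewrite Sx Su; apply/lfunP => y.
  by rewrite !(comp_lfunE, add_lfunE, opp_lfunE) !adE lieJl linearB.
rewrite linearB /= -(comp_lfunA (pos_defects \o ad x)%VF) lfun_traceC.
by rewrite comp_lfunA subrr.
Qed.

(** Induction on the degree: [h, x] - n x commutes with [q (-1)], and transitivity kills it. *)
Lemma pos_degree_eigen h : h \in q 0 -> (forall u, u \in q (-1) -> [lie h, u] = - u) ->
  forall n x, x \in q n%:Z -> [lie h, x] = n%:R *: x.
Proof.
move=> h0 h1; elim=> [|n IH] x xn; apply/eqP; rewrite -subr_eq0; apply/eqP.
  rewrite scale0r subr0; apply: (gr_transitive kg (i := 0) simp) => // [|u u1].
    exact: (gr_br_eq kg h0 xn).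
  by rewrite lieJl !h1 ?lieNr ?subrr //; apply: (gr_br_eq kg xn u1).
apply: (gr_transitive kg (i := n.+1%:Z) simp) => // [|u u1].
  by rewrite memvB ?memvZ //; apply: (gr_br_eq kg h0 xn).
have xu : [lie x, u] \in q n%:Z by apply: (gr_br_eq kg xn u1); lia.
rewrite lieBl lieJl (IH _ xu) h1 // lieNr lieZl.
by rewrite -natr1 scalerDl scale1r opprK subrr.
Qed.

(** Since [h] acts by n + 1 in degree n + 1, its trace on the part that is not generated is the sum
    of the codimensions weighted by n + 1. This trace is 0, so every codimension vanishes. *)
Lemma positive_generation h : h \in bracket_span (q 1) (q (-1)) ->
  (forall u, u \in q (-1) -> [lie h, u] = - u) ->
  forall n, q n.+2%:Z = bracket_span (q 1) (q n.+1%:Z).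
Proof.
move=> hs h1.
have h0 : h \in q 0.
  apply: (bracket_span_ind (P := fun h => h \in q 0) _ _ hs); first exact: linear_closed_mem.
  by move=> x y x1 y1; apply: (gr_br_eq kg x1 y1).
have tr0 : lfun_trace (pos_defects \o ad h)%VF = 0.
  pose P h := lfun_trace (pos_defects \o ad h)%VF = 0.
  apply: (bracket_span_ind (P := P) _ _ hs); last exact: pos_defects_trace.
  split=> [|a x y hx hy]; rewrite /P.
    have -> : (pos_defects \o ad 0 = 0)%VF; last by rewrite linear0.
    by apply/lfunP => x; rewrite comp_lfunE adE lie0l linear0 lfunE.
  have -> : (pos_defects \o ad (a *: x + y) =
      a *: (pos_defects \o ad x) + (pos_defects \o ad y))%VF.
    apply/lfunP => z; rewrite !(comp_lfunE, add_lfunE, scale_lfunE) !adE.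
    by rewrite lieDl lieZl linearP.
  by rewrite linearP /= hx hy scaler0 addr0.
have gE n : (pos_defect n \o ad h)%VF = n.+1%:R *: pos_defect n.
  apply: (gr_ext kg) => i x xi; rewrite comp_lfunE scale_lfunE adE !pos_defectE.
  rewrite (gr_proj_br kg (i := n.+1%:Z) x h0) ?add0r //.
  by rewrite (pos_degree_eigen h0 h1 (gr_proj_mem k q _ _)) linearZ /= -scalerBr.
have {}tr0 : \sum_(n < k) n.+1%:R * lfun_trace (pos_defect n) = 0.
  rewrite -[RHS]tr0 /pos_defects; have -> : ((\sum_(n < k) pos_defect n) \o ad h =
      \sum_(n < k) n.+1%:R *: pos_defect n)%VF.
    apply/lfunP => x; rewrite comp_lfunE !sum_lfunE; apply: eq_bigr => n _.
    by rewrite -comp_lfunE gE.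
  by rewrite linear_sum; apply: eq_bigr => n _; rewrite linearZ.
have eqp n : q n.+1%:Z = gen_pos n.
  have [nk|nk] := ltnP n k; last first.
    have := gen_pos_sub n; rewrite (kgrading_supp kg); last lia.
    by rewrite subv0 => /eqP.
  apply/eqP; rewrite eqEsubv gen_pos_sub andbT; apply/subvP => x xn.
  rewrite -(gr_proj_id kg xn); apply/pos_defect_eq0.
  have idem (m : 'I_k) : (pos_defect m \o pos_defect m)%VF = pos_defect m.
    by apply/lfunP => y; rewrite comp_lfunE pos_defect_comp eqxx.
  have [r rE r0] := lfun_trace_idempotent (idem (Ordinal nk)).
  rewrite r0 ?lfunE //; rewrite -(eqr_nat R) -rE.
  have pos (m : 'I_k) : true -> 0 <= m.+1%:R * lfun_trace (pos_defect m).
    by move=> _; have [s -> _] := lfun_trace_idempotent (idem m); rewrite mulr_ge0 ?ler0n.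
  have /eqP : (Ordinal nk).+1%:R * lfun_trace (pos_defect (Ordinal nk)) = 0.
    exact: (psumr_eq0P pos tr0).
  by rewrite mulf_eq0 pnatr_eq0.
by move=> n; rewrite !eqp.
Qed.

End PositiveGeneration.

(** * Extending a homomorphism from the negative part *)

Section Extension.
Variables (R : fieldType) (L T : lieAlgType R) (k : nat) (q : int -> {vspace L}).
Variables (MI : int -> T -> Prop) (Nm : int -> L -> T -> Prop).
Hypothesis kg : kgrading k q.
Hypothesis MI_lin : forall i, linear_closed_pred (MI i).
Hypothesis MI_br : forall i j u w, MI i u -> MI j w -> MI (i + j) [lie u, w].
Hypothesis Nm0 : forall i, Nm i 0 0.
Hypothesis Nm_lin : forall i a x y u w, Nm i x u -> Nm i y w -> Nm i (a *: x + y) (a *: u + w).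
Hypothesis Nm_mem : forall i x u, i < 0 -> Nm i x u -> x \in q i /\ MI i u.
Hypothesis Nm_tot : forall i x, i < 0 -> x \in q i -> exists u, Nm i x u.
Hypothesis Nm_fun0 : forall i u, i < 0 -> Nm i 0 u -> u = 0.
Hypothesis Nm_br : forall i x y u w, i < 0 ->
  Nm (-1) x u -> Nm i y w -> Nm (i - 1) [lie x, y] [lie u, w].
Hypothesis neg_gen : forall n,
  (q (- n.+2%:Z) <= bracket_span (q (-1)%R) (q (- n.+1%:Z)))%VS.
Hypothesis MI_trans : forall i u, 0 <= i -> MI i u ->
  (forall x w, Nm (-1) x w -> [lie u, w] = 0) -> u = 0.
Hypothesis pos_gen : forall n, q n.+2%:Z = bracket_span (q 1) (q n.+1%:Z).

(* [prolong n] relates elements of degree n - 1 that act compatibly on degree -1. *)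
Fixpoint prolong (n : nat) (x : L) (u : T) : Prop :=
  if n is n'.+1 then
    [/\ x \in q n'%:Z, MI n'%:Z u &
        forall y w, Nm (-1) y w -> prolong n' [lie x, y] [lie u, w]]
  else Nm (-1) x u.

(** The homomorphism is built as a relation, because the partner of an element of nonnegative degree
    is specified only through its brackets. Uniqueness of partners comes from transitivity of the
    target, existence in degrees above 1 from generation by degree 1. Degree n is [prolong n.+1]. *)
Definition related (i : int) (x : L) (u : T) : Prop :=
  if i is Posz n then prolong n.+1 x u else Nm i x u.

Hypothesis tot0 : forall x, x \in q 0 -> exists u, related 0 x u.
Hypothesis tot1 : forall x, x \in q 1 -> exists u, related 1 x u.

Lemma related_pred n : related (n%:Z - 1) = prolong n.
Proof. by case: n => [//|n]; rewrite -[n.+1]addn1 PoszD addrK addn1. Qed.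

Lemma prolong_lin n : prolong n 0 0 /\
  forall a x y u w, prolong n x u -> prolong n y w -> prolong n (a *: x + y) (a *: u + w).
Proof.
elim: n => [|n [IH0 IH]] /=; first by split=> [|a x y u w]; [exact: Nm0|exact: Nm_lin].
split=> [|a x y u w [xq uM xu] [yq wM yw]].
  by split=> [||y w _]; rewrite ?mem0v ?lie0l //; have [] := MI_lin n.
split=> [||z v zv]; first by rewrite memvD ?memvZ.
  by have [_] := MI_lin n; apply.
by rewrite !lieDl !lieZl; apply: IH; [apply: xu|apply: yw].
Qed.

Lemma related_lin i : related i 0 0 /\
  forall a x y u w, related i x u -> related i y w -> related i (a *: x + y) (a *: u + w).
Proof.
case: i => n; first exact: prolong_lin.
by split=> [|a x y u w]; [exact: Nm0|exact: Nm_lin].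
Qed.

Lemma relatedD i x y u w : related i x u -> related i y w -> related i (x + y) (u + w).
Proof. by move=> ? ?; rewrite -[x]scale1r -[u]scale1r; apply: (proj2 (related_lin i)). Qed.

Lemma relatedN i x u : related i x u -> related i (- x) (- u).
Proof.
move=> ?; rewrite -scaleN1r -[- u]scaleN1r -[X in related _ X]addr0 -[X in related _ _ X]addr0.
by apply: (proj2 (related_lin i)) => //; exact: (proj1 (related_lin i)).
Qed.

Lemma relatedC i x y u w : related i [lie y, x] [lie w, u] -> related i [lie x, y] [lie u, w].
Proof. by rewrite (lieC x) (lieC u); exact: relatedN. Qed.

Lemma related_mem i x u : related i x u -> x \in q i /\ MI i u.
Proof. by case: i => n; [case|exact: Nm_mem]. Qed.

Lemma related_fun0 i u : related i 0 u -> u = 0.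
Proof.
case: i => n; last exact: Nm_fun0.
suff F m : forall v, prolong m 0 v -> v = 0 by exact: F.
elim: m => [v|m IH v [_ vM v0]] /=; first exact: Nm_fun0.
by apply: (MI_trans (i := m) _ vM) => // x w xw; apply: IH; have := v0 _ _ xw; rewrite lie0l.
Qed.

Lemma related_fun i x u w : related i x u -> related i x w -> u = w.
Proof.
move=> xu xw; apply/eqP; rewrite -subr_eq0; apply/eqP; apply: (related_fun0 (i := i)).
by rewrite -(subrr x); apply: relatedD => //; apply: relatedN.
Qed.

Lemma related_br1 i x u y w : related i x u -> Nm (-1) y w ->
  related (i - 1) [lie x, y] [lie u, w].
Proof.
case: i => n xu yw; first by rewrite related_pred; have [_ _] := xu; apply.
apply: relatedC; have := Nm_br (i := Negz n) isT yw xu.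
by have -> : Negz n - 1 = Negz n.+1 by lia.
Qed.

(** Induction on the depth of [y]: degree -(n + 2) is spanned by brackets of degree -1 with degree
    -(n + 1), and the Jacobi identity reduces the claim to these. *)
Lemma related_brN n i x u y w : related i x u -> Nm (- n.+1%:Z) y w ->
  related (i - n.+1%:Z) [lie x, y] [lie u, w].
Proof.
elim: n i x u y w => [|n IH] i x u y w xu yw; first exact: related_br1.
have yq : y \in q (- n.+2%:Z) by have [] := Nm_mem _ yw.
pose P z := exists2 v, Nm (- n.+2%:Z) z v & forall i x u, related i x u ->
   related (i - n.+2%:Z) [lie x, z] [lie u, v].
have PL : linear_closed_pred P.
  split=> [|a z z' [v zv vH] [v' zv' vH']].
    exists 0 => // j x' u' _; rewrite !lie0r; exact: (proj1 (related_lin _)).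
  exists (a *: v + v'); first exact: Nm_lin.
  move=> j x' u' xu'; rewrite !lieDr !lieZr.
  by apply: (proj2 (related_lin _)); [apply: vH|apply: vH'].
have PB a b : a \in q (-1) -> b \in q (- n.+1%:Z) -> P [lie a, b].
  move=> /(Nm_tot (i := -1) isT)[a' aa] /(Nm_tot (i := - n.+1%:Z) isT)[b' bb].
  exists [lie a', b'].
    by have -> : - n.+2%:Z = - n.+1%:Z - 1; [lia|exact: Nm_br].
  move=> j x' u' xu'; rewrite !(lieJ x') !(lieJ u'); apply: relatedD.
    have -> : j - n.+2%:Z = j - 1 - n.+1%:Z by lia.
    by apply: IH => //; apply: related_br1.
  have -> : j - n.+2%:Z = j - n.+1%:Z - 1 by lia.
  by apply: relatedC; apply: related_br1 => //; apply: IH.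
have [v zv vH] := bracket_span_ind PL PB (subvP (neg_gen n) _ yq).
(* Uniqueness of partners identifies the given [w] with the partner [v] built from an expansion of
   [y] into brackets. *)
by have -> := related_fun (i := Negz n.+1) yw zv; apply: vH.
Qed.

(** Strong induction on the total degree: being related is tested on brackets with degree -1, and
    the Jacobi identity turns these into brackets of smaller total degree. *)
Lemma related_brP n m x u y w : related n%:Z x u -> related m%:Z y w ->
  related (n + m)%:Z [lie x, y] [lie u, w].
Proof.
have [s] := ubnP (n + m); elim: s n m x u y w => // s IH n m x u y w; rewrite ltnS => nms xu yw.
have [xq uM] := related_mem xu; have [yq wM] := related_mem yw.
have xyq : [lie x, y] \in q (n + m)%N by rewrite PoszD; exact: (gr_br kg xq yq).
split=> // [|a a' aa]; first by rewrite PoszD; exact: MI_br.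
have xa := related_br1 xu aa; have ya := related_br1 yw aa.
suff : related ((n + m)%N%:Z - 1) [lie [lie x, y], a] [lie [lie u, w], a'].
  by rewrite related_pred.
rewrite (lieJr x) (lieJr u); apply: relatedD.
  case: n xu {xq uM xyq} xa nms => [|n] xu xa nms.
    by apply: relatedC; exact: related_br1 yw xa.
  have -> : (n.+1 + m)%N%:Z - 1 = (n + m)%N%:Z by lia.
  by apply: IH => //; have -> : n%:Z = n.+1%:Z - 1 by lia.
case: m yw {yq wM xyq} ya nms => [|m] yw ya nms.
  by rewrite addn0; exact: related_br1 xu ya.
have -> : (n + m.+1)%N%:Z - 1 = (n + m)%N%:Z by lia.
by apply: IH => //; [lia|have -> : m%:Z = m.+1%:Z - 1 by lia].
Qed.

Lemma related_tot i x : x \in q i -> exists u, related i x u.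
Proof.
case: i => n; last exact: Nm_tot.
elim: n x => [|[|n] IH] x; [exact: tot0|exact: tot1|].
rewrite pos_gen; move: x.
apply: (bracket_span_ind (P := fun x => exists u, related n.+2%:Z x u)).
  split=> [|a x y [u xu] [w yw]]; first by exists 0; exact: (proj1 (related_lin _)).
  by exists (a *: u + w); exact: (proj2 (related_lin _)).
move=> x y /tot1[u xu] /IH[w yw]; exists [lie u, w].
exact: (related_brP (n := 1) xu yw).
Qed.

Lemma related_br i j x u y w : related i x u -> related j y w ->
  related (i + j) [lie x, y] [lie u, w].
Proof.
case: j => m xu yw; last by rewrite NegzE; exact: related_brN.
case: i xu => n xu; first by rewrite -PoszD; exact: related_brP.
by apply: relatedC; rewrite addrC NegzE; exact: related_brN.
Qed.

(** A partner is chosen for every homogeneous element; uniqueness of partners makes the choice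
    linear and compatible with brackets. *)
Lemma graded_extension : exists f : 'Hom(L, T),
  (forall i x, x \in q i -> related i x (f x)) /\
  (forall x y, f [lie x, y] = [lie f x, f y]).
Proof.
pose g i x := if pselect (exists u, related i x u) is left ex then projT1 (cid ex) else 0.
have gP i x : x \in q i -> related i x (g i x).
  move=> /related_tot ex; rewrite /g; case: pselect => // ex'.
  by case: (cid ex').
have gL i a x y : x \in q i -> y \in q i -> g i (a *: x + y) = a *: g i x + g i y.
  move=> xi yi; apply: (related_fun (i := i) (x := a *: x + y)).
    by apply: gP; rewrite memvD ?memvZ.
  by apply: (proj2 (related_lin i)); apply: gP.
have g0 i : g i 0 = 0 by apply: (related_fun0 (i := i)); apply: gP; exact: mem0v.
pose F x := \sum_(j < (k.*2).+1) g (j%:Z - k%:Z) (gr_proj k q (j%:Z - k%:Z) x).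
have FL : linear F.
  move=> a x y; rewrite /F scaler_sumr -big_split /=; apply: eq_bigr => j _.
  by rewrite linearP gL ?gr_proj_mem.
pose FF := HB.pack_for {linear L -> T} F (GRing.isLinear.Build R L T _ F FL).
have fE x : linfun FF x = F x by rewrite lfunE.
have fP i x : x \in q i -> related i x (linfun FF x).
  move=> xi; rewrite fE /F; have [ik|ik] := leqP `|i|%N k; last first.
    move: xi; rewrite (kgrading_supp kg ik) memv0 => /eqP->.
    by rewrite big1 => [|j _]; rewrite ?linear0 ?g0 //; exact: (proj1 (related_lin _)).
  rewrite (bigD1 (gr_index k i)) //= big1 ?addr0 => [|j jn].
    by rewrite gr_indexK // (gr_proj_id kg xi); exact: gP.
  rewrite (gr_proj_eq kg _ xi); case: eqP => [ji|_]; last exact: g0.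
  by case/eqP: jn; rewrite -ji gr_index_ord.
exists (linfun FF); split=> // x y.
move: x; apply: (graded_ind kg) => [|i x xi].
  split=> [|a x x' hx hx']; first by rewrite linear0 !lie0l linear0.
  by rewrite lieDl lieZl !linearP /= hx hx' lieDl lieZl.
move: y; apply: (graded_ind kg) => [|j y yj].
  split=> [|a y y' hy hy']; first by rewrite linear0 !lie0r linear0.
  by rewrite lieDr lieZr !linearP /= hy hy' lieDr lieZr.
apply: (related_fun (fP _ _ (gr_br kg xi yj))).
by apply: related_br; apply: fP.
Qed.

End Extension.

Lemma scale_vector_inj (R : fieldType) (V : lmodType R) (v : V) (a b : R) :
  v != 0 -> a *: v = b *: v -> a = b.
Proof.
move=> v0 /eqP; rewrite -subr_eq0 -scalerBl scaler_eq0 (negPf v0) orbF subr_eq0.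
by move/eqP.
Qed.

(** * Projection onto the lowest degree, and powers of ad e *)

Section BottomProjection.
Variables (R : fieldType) (L : lieAlgType R) (k : nat) (q : int -> {vspace L}).
Hypothesis kg : kgrading k q.
Implicit Types x y z : L.

Let above := (\sum_(j < k.*2) q ((j.+1)%:Z - k%:Z))%VS.

Lemma bottom_cap : (q (- k%:Z) :&: above = 0)%VS.
Proof.
apply/eqP; rewrite -subv0; apply/subvP => x; rewrite memv_cap => /andP[xb /memv_sumP[xs xsP xE]].
rewrite memv0 -(gr_proj_id kg xb) xE linear_sum big1 //= => j _.
by rewrite (gr_proj_eq kg _ (xsP j isT)); case: eqP => //; lia.
Qed.

Lemma pr_bottom_id x : x \in q (- k%:Z) -> pr_bottom k q x = x.
Proof. exact: daddv_pi_id bottom_cap. Qed.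

Lemma pr_bottom_eq0 i x : x \in q i -> i != - k%:Z -> pr_bottom k q x = 0.
Proof.
move=> xi ik; have [ki|ki] := leqP `|i|%N k; last first.
  by move: xi; rewrite (kgrading_supp kg ki) memv0 => /eqP->; rewrite linear0.
have xa : x \in above.
  have ltj : (`|(i + k%:Z)%R|.-1 < k.*2)%N by lia.
  rewrite memvE (sumv_sup (Ordinal ltj)) //= -memvE.
  by have <- : i = `|(i + k%:Z)%R|.-1.+1%:Z - k%:Z by lia.
have xs : x \in (q (- k%:Z) + above)%VS by rewrite memvE (subv_trans _ (addvSr _ _)) -?memvE.
have := daddv_pi_add bottom_cap xs; rewrite (daddv_pi_id _ xa); last by rewrite capvC bottom_cap.
by move=> h; apply: (addIr x); rewrite [LHS]h add0r.
Qed.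

Lemma neg_part_mem j x : (0 < j < k)%N -> x \in q (- j%:Z) -> x \in neg_part k q.
Proof.
move=> jk xj; have ltj : (j.-1 < k.-1)%N by lia.
rewrite memvE (sumv_sup (Ordinal ltj)) //= -memvE.
by have -> : j.-1.+1%:Z = j%:Z by lia.
Qed.

Lemma neg_part_ind (P : L -> Prop) : linear_closed_pred P ->
  (forall j x, (0 < j < k)%N -> x \in q (- j%:Z) -> P x) ->
  forall x, x \in neg_part k q -> P x.
Proof.
move=> PL PQ x /memv_sumP[xs xsP ->]; apply: linear_closed_sum => // j _.
by apply: PQ (xsP j isT); have := ltn_ord j; lia.
Qed.

End BottomProjection.

Definition adn (R : fieldType) (L : lieAlgType R) (e : L) n (w : L) : L :=
  iter n (lbr e) w.

Section Adn.
Variables (R : fieldType) (L : lieAlgType R) (e : L).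
Local Notation D := (adn e).

Lemma adnS n w : D n.+1 w = [lie e, D n w]. Proof. by []. Qed.
Lemma adn1 w : D 1 w = [lie e, w]. Proof. by []. Qed.
Lemma adn_linear n a u w : D n (a *: u + w) = a *: D n u + D n w.
Proof. by elim: n => [//|n IH]; rewrite !adnS IH lieDr lieZr. Qed.
Lemma adn0 n : D n 0 = 0.
Proof. by elim: n => [//|n IH]; rewrite !adnS IH lie0r. Qed.
Lemma adnD n u w : D n (u + w) = D n u + D n w.
Proof. by rewrite -[u]scale1r adn_linear !scale1r. Qed.
Lemma adnZ n a u : D n (a *: u) = a *: D n u.
Proof. by rewrite -[a *: u]addr0 adn_linear adn0 addr0. Qed.
Lemma adnN n u : D n (- u) = - D n u.
Proof. by rewrite -scaleN1r adnZ scaleN1r. Qed.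

Lemma lie_adn z c n w : [lie z, e] = c *: e ->
  [lie z, D n w] = (n%:R * c) *: D n w + D n [lie z, w].
Proof.
move=> ze; elim: n => [|n IH]; first by rewrite mul0r scale0r add0r.
rewrite !adnS lieJ IH ze lieZl lieDr lieZr addrA -scalerDl -adnS.
by rewrite -nat1r mulrDl mul1r.
Qed.

(** Moving [x] past the n + 2 factors [e] produces z = [x, e] once for each factor, and moving z
    past the remaining ones contributes a for each, in total 0 + 1 + ... + (n + 1) times. The term
    with [x, w] left inside vanishes because two factors [e] kill it; hence the index n + 2. *)
Lemma lie_adn_raise x z a n w : [lie x, e] = z -> [lie z, e] = a *: e ->
  (exists c, [lie e, [lie x, w]] = c *: e) ->
  [lie x, D n.+2 w] = (('C(n.+2, 2))%:R * a) *: D n.+1 w + n.+2%:R *: D n.+1 [lie z, w].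
Proof.
move=> xe ze [c ec].
have E m : [lie z, D m.+1 w] = (m.+1%:R * a) *: D m.+1 w + D m.+1 [lie z, w].
  exact: lie_adn.
elim: n => [|n IH].
  rewrite [D 2 w]adnS (lieJ x) xe E adn1 (lieJ x) xe lieDr ec lieZr lbrxx scaler0 addr0.
  by rewrite -addrA -adn1 scaler_nat mulr2n.
rewrite [D n.+3 w]adnS (lieJ x) xe E IH lieDr !lieZr -!adnS addrACA -scalerDl.
congr (_ + _); last by rewrite -[X in X + _]scale1r -scalerDl nat1r.
have -> : 'C(n.+3, 2)%:R = 'C(n.+2, 2)%:R + n.+2%:R :> R by rewrite binS bin1 natrD.
by congr (_ *: _); ring.
Qed.
End Adn.

(** * Structure of a graded Lie algebra satisfying the two conditions *)

Section Analysis.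
Variables (R : realFieldType) (L : lieAlgType R) (k : nat) (q : int -> {vspace L}).
Variables (E V : {vspace L}) (e f : L).
Hypotheses (simp : simple_lie L) (kg : kgrading k q) (k3 : (3 <= k)%N).
Hypotheses (c1 : condition1 k q E) (ic : invariant_complement q E V) (c2 : condition2 k q E V).
Hypotheses (Ee : E = <[e]>%VS) (fq : q (- k%:Z) = <[f]>%VS).
Implicit Types (x y z u w : L).
Local Notation D := (adn e).

Lemma E_gen_neq0 : e != 0.
Proof. by have [_ _ _ dE _] := c1; move: dE; rewrite Ee dim_vline; case: eqP. Qed.

Lemma bottom_gen_neq0 : f != 0.
Proof. by have [df _ _ _ _] := c1; move: df; rewrite fq dim_vline; case: eqP. Qed.

Lemma E_gen_deg : e \in q (-1).
Proof. by have [_ _ _ _ /subvP] := c1; apply; rewrite Ee memv_line. Qed.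

Lemma V_deg w : w \in V -> w \in q (-1).
Proof. by have [<- _ _] := ic; move=> wV; rewrite memvE (subv_trans _ (addvSr _ _)) -?memvE. Qed.

Lemma degN1_decomp x : x \in q (-1) -> exists c w, w \in V /\ x = c *: e + w.
Proof.
have [<- _ _] := ic; rewrite Ee => /memv_addP[_ /vlineP[c ->] [w wV ->]].
by exists c, w.
Qed.

Lemma EV_indep c w : w \in V -> c *: e + w = 0 -> c = 0 /\ w = 0.
Proof.
move=> wV /eqP; rewrite addr_eq0 => /eqP cw.
have w0 : w = 0.
  apply/eqP; rewrite -memv0; have [_ <- _] := ic; rewrite memv_cap wV andbT Ee.
  by rewrite -memvN -cw memvZ ?memv_line.
split=> //; apply/eqP; have /eqP := cw.
by rewrite w0 oppr0 scaler_eq0 (negPf E_gen_neq0) orbF.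
Qed.

Lemma E_kernel y : y \in neg_part k q -> pr_bottom k q [lie e, y] = 0.
Proof.
by have [_ _ /(_ e)[+ _] _ _] := c1; rewrite Ee memv_line => /(_ isT)[_]; apply.
Qed.

Lemma adn_deg n w : w \in V -> D n w \in q (- n.+1%:Z).
Proof.
move=> wV; elim: n => [|n IH]; first exact: V_deg.
by apply: (gr_br_eq kg E_gen_deg IH); lia.
Qed.

Lemma adn_iso n : (n.+3 < k)%N ->
  (ad e @: q (- n.+2%:Z) = q (- n.+3%:Z))%VS /\
  forall x, x \in q (- n.+2%:Z) -> [lie e, x] = 0 -> x = 0.
Proof.
have [_ iso _ _ _] := c2; move=> nk; have r : - k%:Z + 2 <= - n.+2%:Z <= -2 by lia.
have eE : e \in E by rewrite Ee memv_line.
have [] := iso _ r e eE E_gen_neq0.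
have -> : - n.+2%:Z - 1 = - n.+3%:Z by lia.
move=> ker im; split=> // x xq ex; apply/eqP; rewrite -memv0 -ker memv_cap xq memv_ker adE.
exact/eqP.
Qed.

Lemma adn1_iso : (ad e @: V = q (-2))%VS /\ forall w, w \in V -> [lie e, w] = 0 -> w = 0.
Proof.
have [iso _ _ _ _] := c2; have eE : e \in E by rewrite Ee memv_line.
have [ker im] := iso e eE E_gen_neq0.
by split=> // w wV ew; apply/eqP; rewrite -memv0 -ker memv_cap wV memv_ker adE; apply/eqP.
Qed.

Lemma adn_inj n w : (n.+2 <= k)%N -> w \in V -> D n w = 0 -> w = 0.
Proof.
elim: n => [//|[|n] IH] nk wV Dw; first exact: (proj2 adn1_iso).
apply: IH => //; first lia.
by apply: (proj2 (adn_iso (n := n) _)); [lia|exact: adn_deg|].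
Qed.

Lemma adn_onto n x : (n.+3 <= k)%N -> x \in q (- n.+2%:Z) -> exists2 w, w \in V & x = D n.+1 w.
Proof.
elim: n x => [|n IH] x nk.
  by have [<- _] := adn1_iso => /memv_imgP[w wV ->]; exists w; rewrite ?adE.
have nk' : (n.+3 < k)%N by lia.
have [im _] := adn_iso nk'; rewrite -im.
move=> /memv_imgP[y yq ->]; have [w wV ->] := IH y (ltnW nk) yq.
by exists w; rewrite ?adE.
Qed.

(** The value lies in degree -k, where the projection is the identity, and [e] lies in the kernel of
    the form. *)
Lemma adn_top w : w \in V -> D k.-1 w = 0.
Proof.
move=> wV; have -> : k.-1 = k.-2.+1 by lia.
rewrite adnS -[LHS](pr_bottom_id kg).
  apply: E_kernel; apply: (neg_part_mem (j := k.-1)); first lia.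
  by have := adn_deg k.-2 wV; have -> : k.-2.+1 = k.-1 by lia.
by apply: (gr_br_eq kg E_gen_deg (adn_deg _ wV)); lia.
Qed.

Lemma V_adn0 n w u : (n.+2 < k)%N -> w \in V -> u \in V -> [lie w, D n u] = 0.
Proof.
have [_ _ Vab V0 _] := c2; case: n => [|n] nk wV uV; first exact: Vab.
by apply: (V0 (- n.+2%:Z)) (adn_deg _ uV) => //; lia.
Qed.

Lemma below_bottom (i : int) x : x \in q i -> i < - k%:Z -> x = 0.
Proof. by move=> xi ik; move: xi; rewrite (kgrading_supp kg) ?memv0; [move/eqP|lia]. Qed.

Lemma bottom_deg : f \in q (- k%:Z). Proof. by rewrite fq memv_line. Qed.

Lemma V_bottom w : w \in V -> [lie w, f] = 0.
Proof.
by move=> wV; apply: (below_bottom (gr_br kg (V_deg wV) bottom_deg)); lia.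
Qed.

(** Only degree 1 - k, which is D^(k-2) V, can pair with degree -1, so such a [w] lies in the kernel
    E of the form, hence in the intersection of E and V. *)
Lemma form_nondegenerate w : w \in V -> (forall u, u \in V -> [lie w, D k.-2 u] = 0) -> w = 0.
Proof.
move=> wV wu; suff wE : w \in E.
  by apply/eqP; rewrite -memv0; have [_ <- _] := ic; rewrite memv_cap wV wE.
have [_ _ /(_ w)[_ +] _ _] := c1; apply; split.
  by apply: (neg_part_mem (j := 1)); [lia|exact: V_deg].
apply: neg_part_ind => [|j x jk xj].
  by split=> [|a x y hx hy]; rewrite ?(lie0r, linear0) // lieDr lieZr linearP /= hx hy scaler0 addr0.
have [jk1|jk1] := eqVneq j k.-1; last first.
  by apply: (pr_bottom_eq0 kg (gr_br kg (V_deg wV) xj)); lia.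
have k33 : ((k - 3)%N.+3 <= k)%N by lia.
have xj' : x \in q (- (k - 3)%N.+2%:Z) by have -> : (k - 3)%N.+2 = j by lia.
have [u uV ->] := adn_onto k33 xj'.
have -> : (k - 3)%N.+1 = k.-2 by lia.
by rewrite wu // linear0.
Qed.

(** Otherwise [q (-1)] would be the abelian line E, and degree -k, being generated by it, would lie
    in degree -1. *)
Lemma V_neq0 : exists2 w, w \in V & w != 0.
Proof.
exists (vpick V); first exact: memv_pick.
rewrite vpick0; apply/eqP => V0.
have sub : subalgebra E.
  move=> x y; rewrite Ee => /vlineP[a ->] /vlineP[b ->].
  by rewrite lieZl lieZr lbrxx !scaler0 mem0v.
have le : (q (-1) <= E)%VS by have [<- _ _] := ic; rewrite V0 addv0.
have bE : (q (- k%:Z) <= E)%VS by apply: (kgrading_gen kg sub le); lia.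
have /eqP := bottom_gen_neq0; apply; apply: (gr_cap kg bottom_deg (j := -1)); last first.
- by apply/eqP; lia.
- by have [_ _ _ _ /subvP] := c1; apply; apply: (subvP bE); exact: bottom_deg.
Qed.

(** The scalar by which [z] acts on [e]; meaningful when [z, e] is a multiple of [e], as for [z] in
    [q 0]. *)
Definition lam z : R := coord [tuple e] 0 [lie z, e].

Lemma lam_linear a x y : lam (a *: x + y) = a * lam x + lam y.
Proof. by rewrite /lam lieDl lieZl linearP. Qed.

(** [q 0] maps the kernel of the form to itself, because degree -k is stable under [q 0]; and this
    kernel is the line of [e]. *)
Lemma q0_E z : z \in q 0 -> [lie z, e] = lam z *: e.
Proof.
move=> z0; have zE : [lie z, e] \in E.
  have [_ _ /(_ [lie z, e])[_ +] _ _] := c1; apply; split.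
    apply: (neg_part_mem (j := 1)); first lia.
    exact: (gr_br_eq kg z0 E_gen_deg).
  apply: neg_part_ind => [|j x jk xj].
    by split=> [|a x y hx hy]; rewrite ?(lie0r, linear0) // lieDr lieZr linearP /= hx hy scaler0 addr0.
  rewrite lieJl linearB /= [X in _ - X]E_kernel ?subr0; last first.
    by apply: (neg_part_mem (j := j)) => //; apply: (gr_br_eq kg z0 xj); lia.
  have ex := gr_br kg E_gen_deg xj.
  have [jk1|jk1] := eqVneq j k.-1; last first.
    by apply: (pr_bottom_eq0 kg (gr_br kg z0 ex)); lia.
  suff -> : [lie e, x] = 0 by rewrite lie0r linear0.
  rewrite -[LHS](pr_bottom_id kg) ?E_kernel //; first exact: (neg_part_mem (j := j)).
  by move: ex; have -> : -1 - j%:Z = - k%:Z by lia.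
have eb : basis_of <[e]> [tuple e] by exact: seq1_basis E_gen_neq0.
move: zE; rewrite Ee => zE; rewrite {1}(coord_basis eb zE) big_ord1 /=.
by [].
Qed.

Lemma q0_V z w : z \in q 0 -> w \in V -> [lie z, w] \in V.
Proof. by have [_ _ h] := ic => z0 wV; apply: h. Qed.

Lemma lam_unique z c : [lie z, e] = c *: e -> lam z = c.
Proof.
have eb : free [tuple e] by rewrite seq1_free E_gen_neq0.
by rewrite /lam => ->; rewrite linearZ /= (coord_free 0 0 eb) mulr1.
Qed.

Lemma q0_faithful z : z \in q 0 -> lam z = 0 -> (forall w, w \in V -> [lie z, w] = 0) -> z = 0.
Proof.
move=> z0 lz zV; apply: (gr_transitive kg (i := 0) simp) => // u /degN1_decomp[c [w [wV ->]]].
by rewrite lieDr lieZr q0_E // lz zV // scale0r scaler0 addr0.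
Qed.

(** * Brackets with degree one, and the bound on the depth *)

Section DegreeOne.
Variable x : L.
Hypothesis x1 : x \in q 1.

Lemma q1_e : [lie x, e] \in q 0.
Proof. exact: (gr_br_eq kg x1 E_gen_deg). Qed.
Lemma q1_V w : w \in V -> [lie x, w] \in q 0.
Proof. by move=> wV; exact: (gr_br_eq kg x1 (V_deg wV)). Qed.

Let a := lam [lie x, e].

Lemma q1_raise n w : w \in V ->
  [lie x, D n.+2 w] = ('C(n.+2, 2)%:R * a) *: D n.+1 w + n.+2%:R *: D n.+1 [lie [lie x, e], w].
Proof.
move=> wV; apply: lie_adn_raise => //; first exact: (q0_E q1_e).
by exists (- lam [lie x, w]); rewrite lieC (q0_E (q1_V wV)) scaleNr.
Qed.

(** Bracketing D^(k-1) w = 0 with [x] gives (k-1) D^(k-2) ([z, w] + (k-2)/2 a w) = 0 for z = [x, e],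
    and D^(k-2) is injective on V. *)
Lemma q1_e_V w : w \in V -> [lie [lie x, e], w] = (- ((k.-2)%:R / 2) * a) *: w.
Proof.
move=> wV; apply/eqP; rewrite -subr_eq0; apply/eqP.
set z := [lie x, e]; have zw : [lie z, w] \in V by rewrite q0_V ?q1_e.
have := q1_raise (k - 3)%N wV; have -> : (k - 3)%N.+2 = k.-1 by lia.
rewrite adn_top // lie0r -/z => /esym.
have -> : 'C(k.-1, 2)%:R = (k.-1)%:R * ((k.-2)%:R / 2) :> R.
  apply: (mulIf (x := 2)); first by rewrite pnatr_eq0.
  rewrite -mulrA divfK ?pnatr_eq0 // -!natrM; congr _%:R.
  by rewrite mulnC mul_bin_left bin1 subn1 mulnC.
rewrite -mulrA -scalerA -scalerDr => /eqP; rewrite scaler_eq0 pnatr_eq0.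
have -> : (k - 3)%N.+1 = k.-2 by lia.
rewrite (_ : (k.-1 == 0)%N = false) /=; last lia.
move/eqP => H; apply: (adn_inj (n := k.-2)); [lia|by rewrite memvB ?memvZ|].
by rewrite -scaleN1r adnD adnZ adnZ -[RHS]H addrC scalerA; congr (_ + _); congr (_ *: _); ring.
Qed.

Lemma q1_e_eq0 : a = 0 -> [lie x, e] = 0.
Proof.
by move=> a0; apply: (q0_faithful q1_e a0) => w wV; rewrite q1_e_V // a0 mulr0 scale0r.
Qed.

Lemma q1_D1 u : u \in V -> [lie x, D 1 u] = [lie [lie x, e], u] - lam [lie x, u] *: e.
Proof. by move=> uV; rewrite adn1 lieJ [X in _ + X]lieC (q0_E (q1_V uV)). Qed.

(** The case n = k - 2 is included: the inner bracket on the left is then the form times [f], while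
    the brackets of V with D^(n-1) V produced by the Jacobi identity still vanish. *)
Lemma q1_V_D n w u : (2 <= n)%N -> (n.+1 < k)%N -> w \in V -> u \in V ->
  [lie x, [lie w, D n u]] = D n ((n%:R * lam [lie x, w]) *: u + [lie [lie x, w], u]).
Proof.
case: n => [//|[//|n]] _ nk wV uV.
rewrite lieJ (lie_adn _ _ (q0_E (q1_V wV))) q1_raise // lieDr !lieZr.
by rewrite !V_adn0 ?q0_V ?q1_e //; [rewrite !scaler0 !addr0 adnD adnZ|lia..].
Qed.

(** For n = 1 there is one more term than in [q1_V_D], because [x, D u] has a component along
    [e]. *)
Lemma q1_V_D1 w u : w \in V -> u \in V -> [lie x, [lie w, D 1 u]] =
  D 1 (lam [lie x, w] *: u + [lie [lie x, w], u] + lam [lie x, u] *: w).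
Proof.
move=> wV uV; have [_ _ Vab _ _] := c2.
rewrite lieJ (lie_adn _ _ (q0_E (q1_V wV))) q1_D1 // lieBr (Vab w [lie _, u]) ?q0_V ?q1_e // sub0r.
by rewrite lieZr (lieC w e) scalerN opprK mul1r !adnD !adnZ.
Qed.

(** For k >= 4 the bracket [w, D u] vanishes, so the left-hand side of [q1_V_D1] is 0 and D can be
    cancelled. *)
Lemma q1_V_ge4 w u : (4 <= k)%N -> w \in V -> u \in V ->
  [lie [lie x, w], u] = - (lam [lie x, w] *: u + lam [lie x, u] *: w).
Proof.
move=> k4 wV uV; have := q1_V_D1 wV uV; rewrite V_adn0 ?lie0r // => /esym H.
apply/eqP; rewrite -addr_eq0; apply/eqP; rewrite addrA [X in X + _]addrC.
by apply: (adn_inj _ _ H); [lia|rewrite !memvD ?memvZ ?q0_V ?q1_V].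
Qed.
End DegreeOne.

Lemma q1_bottom_onto w : w \in V -> exists2 x, x \in q 1 & [lie x, f] = D k.-2 w.
Proof.
move=> wV; have := bottom_adjacent kg simp (ltac:(lia) : (0 < k)%N) fq.
have Dw : D k.-2 w \in q (1 - k%:Z).
  by have := adn_deg k.-2 wV; have -> : - (k.-2).+1%:Z = 1 - k%:Z by lia.
move=> /subvP/(_ _ Dw)/memv_imgP[x x1 xE]; exists (- x); first by rewrite memvN.
by rewrite xE adE lieNl -lieC.
Qed.

Lemma form_mem w u : w \in V -> u \in V -> exists c, [lie w, D k.-2 u] = c *: f.
Proof.
move=> wV uV; apply/vlineP; rewrite -fq.
by apply: (gr_br_eq kg (V_deg wV) (adn_deg _ uV)); lia.
Qed.

Lemma form_partner w : w \in V -> w != 0 ->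
  exists u c, [/\ u \in V, c != 0 & [lie w, D k.-2 u] = c *: f].
Proof.
move=> wV w0; apply: contrapT => H; case/eqP: w0; apply: form_nondegenerate => // u uV.
have [c wu] := form_mem wV uV; rewrite wu.
have [->|c0] := eqVneq c 0; first by rewrite scale0r.
by case: H; exists u, c.
Qed.

Lemma q1_V_ge n x w u : (2 <= n)%N -> (n.+2 < k)%N -> x \in q 1 -> w \in V -> u \in V ->
  [lie [lie x, w], u] = - (n%:R * lam [lie x, w]) *: u.
Proof.
move=> n2 nk x1 wV uV; have := q1_V_D x1 n2 (ltnW nk) wV uV.
rewrite V_adn0 // lie0r => /esym H; apply/eqP; rewrite -subr_eq0 scaleNr opprK addrC.
by apply/eqP; apply: (adn_inj _ _ H); [lia|rewrite memvD ?memvZ ?q0_V ?q1_V].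
Qed.

(** If all these scalars were 0, each [x, w] would act trivially on V, and applying an [x] with
    [x, f] = D^(k-2) w0 to [w0, D^(k-2) u] = c f would give c D^(k-2) w0 = 0. *)
Lemma lam_nonzero : (4 <= k)%N ->
  exists x w, [/\ x \in q 1, w \in V & lam [lie x, w] != 0].
Proof.
move=> k4; apply: contrapT => H.
have lam0 x w : x \in q 1 -> w \in V -> lam [lie x, w] = 0.
  by move=> x1 wV; apply: contrapT => /eqP l0; apply: H; exists x, w.
have [w0 w0V w0n0] := V_neq0.
have [x x1 xf] := q1_bottom_onto w0V.
have [u [c [uV cn0 wu]]] := form_partner w0V w0n0.
case/eqP: w0n0; apply: (adn_inj (n := k.-2)) => //; first lia.
have := q1_V_D (n := k.-2) x1 (ltac:(lia)) (ltac:(lia)) w0V uV.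
rewrite wu lieZr xf q1_V_ge4 // !lam0 // mulr0 !scale0r !addr0 oppr0 addr0 adn0.
by move/eqP; rewrite scaler_eq0 (negPf cn0) => /eqP.
Qed.

(** For k >= 6 both [w, D^2 u] and [w, D^3 u] vanish, so [x, w] would act on V by -2 and by -3 times
    the same nonzero scalar. *)
Lemma depth_le5 : (k <= 5)%N.
Proof.
rewrite leqNgt; apply/negP => k6.
have [x [w [x1 wV]]] := lam_nonzero (ltac:(lia)).
apply/negP; rewrite negbK; apply/eqP.
have [w0|wn0] := eqVneq w 0.
  by apply: lam_unique; rewrite w0 lie0r lie0l scale0r.
have := q1_V_ge (n := 3) isT k6 x1 wV wV; rewrite (q1_V_ge (n := 2) isT (ltnW k6) x1 wV wV).
move/eqP; rewrite -subr_eq0 -scalerBl scaler_eq0 (negPf wn0) orbF => /eqP h.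
by lra.
Qed.

(** The actions of [x, w] on V obtained from [w, D u] = 0 and from [w, D^2 u] = 0 agree only if
    every [u] is a multiple of [w]. *)
Lemma depth5_line : k = 5 -> exists x w, [/\ x \in q 1, w \in V, lam [lie x, w] = 1
  & V = <[w]>%VS].
Proof.
move=> k5; have [x [w [x1 wV l0]]] := lam_nonzero (ltac:(lia)).
exists ((lam [lie x, w])^-1 *: x), w; split; rewrite ?memvZ //.
  by rewrite lieZl -[X in lam X]addr0 lam_linear /lam lie0l linear0 addr0 mulVf.
apply/vspaceP => u; apply/idP/vlineP => [uV|[c ->]]; last exact: memvZ.
have := q1_V_ge (n := 2) isT (ltac:(lia)) x1 wV uV.
rewrite q1_V_ge4 //; last lia.
move=> h; exists (lam [lie x, u] / lam [lie x, w]).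
apply: (scalerI l0); rewrite scalerA mulrC divfK //.
move/eqP: h; rewrite scaleNr eqr_opp mulr_natl mulr2n scalerDl => /eqP h.
by apply: (addrI (lam [lie x, w] *: u)); rewrite -h.
Qed.

(** With F(w) = [lam [lie x, w]] and [x, f] = D^2 y, applying [x] to [w, D^2 u] = c f gives F(w) u -
    F(u) w = c y. As F(w1) is nonzero, V is spanned by y and w1, and y lies in the span of w1 and a
    partner w2 of w1 for the form. *)
Lemma depth4_plane : k = 4 -> exists w1 w2, [/\ w1 \in V, w2 \in V,
  [lie w1, D 2 w2] != 0 & forall u, u \in V -> exists a b, u = a *: w1 + b *: w2].
Proof.
move=> k4; have [x [w1 [x1 w1V l0]]] := lam_nonzero (ltac:(lia)).
have k2 : k.-2 = 2 by lia.
have w1n0 : w1 != 0.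
  by apply: contra_neq l0 => ->; apply: lam_unique; rewrite lie0r lie0l scale0r.
have [w2 [c [w2V cn0 w12]]] := form_partner w1V w1n0.
rewrite k2 in w12; exists w1, w2; split=> //.
  by rewrite w12 scaler_eq0 negb_or cn0 bottom_gen_neq0.
(* For k = 4 the form is alternating, since ad e is a derivation and [w, D w] = 0. *)
have form0 w : w \in V -> [lie w, D 2 w] = 0.
  move=> wV; have : [lie e, [lie w, D 1 w]] = 0 by rewrite V_adn0 ?lie0r //; lia.
  by rewrite lieJ lbrxx add0r.
pose F w := lam [lie x, w].
have FE w u : w \in V -> u \in V -> [lie x, [lie w, D 2 u]] = D 2 (F w *: u - F u *: w).
  move=> wV uV; rewrite (q1_V_D x1) //; last lia.
  rewrite q1_V_ge4 //; last lia.
  by congr (D 2 _); rewrite opprD addrA -/(F w) -scalerBl; congr (_ *: _ - _); ring.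
have [y yV xf] : exists2 y, y \in V & [lie x, f] = D 2 y.
  have xfq : [lie x, f] \in q (- 3) by apply: (gr_br_eq kg x1 bottom_deg); lia.
  by have [|y yV yE] := @adn_onto 1 _ _ xfq; [lia|exists y].
have inj2 w : w \in V -> D 2 w = 0 -> w = 0 by apply: adn_inj; lia.
have FF w u : w \in V -> u \in V -> exists c, F w *: u - F u *: w = c *: y.
  move=> wV uV; have [b wu] := form_mem wV uV; rewrite k2 in wu; exists b.
  apply/eqP; rewrite -subr_eq0; apply/eqP; apply: inj2; first by rewrite !memvB ?memvZ.
  by rewrite adnD -FE // wu lieZr xf adnN adnZ subrr.
have [b b12] := FF _ _ w1V w2V.
(* If [b] were 0, w2 would be a multiple of w1 and the alternating form would vanish on the pair. *)
have bn0 : b != 0.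
  apply/eqP => b0; move: w12; rewrite -(scalerK l0 w2).
  have -> : lam [lie x, w1] *: w2 = F w2 *: w1.
    by apply/eqP; rewrite -subr_eq0 [_ - _]b12 b0 scale0r.
  rewrite !adnZ !lieZr form0 // !scaler0 => /esym/eqP.
  by rewrite scaler_eq0 (negPf cn0) (negPf bottom_gen_neq0).
have yE : y = b^-1 *: (F w1 *: w2 - F w2 *: w1) by rewrite b12 scalerK.
move=> u uV; have [d ud] := FF _ _ w1V uV.
have : u = (F w1)^-1 *: (d *: y + F u *: w1) by rewrite -ud subrK scalerK.
rewrite yE => ->; exists ((F w1)^-1 * (F u - d * b^-1 * F w2)), ((F w1)^-1 * (d * b^-1 * F w1)).
by move: (F w1) (F w2) (F u) => *; linear_ring.
Qed.

Definition bform w u : R := coord [tuple f] 0 [lie w, D k.-2 u].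

Lemma formE w u : w \in V -> u \in V -> [lie w, D k.-2 u] = bform w u *: f.
Proof.
move=> wV uV; have [c wu] := form_mem wV uV.
have fb : free [tuple f] by rewrite seq1_free bottom_gen_neq0.
by rewrite /bform wu linearZ /= (coord_free 0 0 fb) mulr1.
Qed.

Lemma form_linl a w w' u : bform (a *: w + w') u = a * bform w u + bform w' u.
Proof. by rewrite /bform lieDl lieZl linearP. Qed.

Lemma form_linr a w u u' : bform w (a *: u + u') = a * bform w u + bform w u'.
Proof. by rewrite /bform adn_linear lieDr lieZr linearP. Qed.

Lemma form_eq0 w : w \in V -> (forall u, u \in V -> bform w u = 0) -> w = 0.
Proof.
by move=> wV h; apply: form_nondegenerate => // u uV; rewrite formE // h // scale0r.
Qed.

(** [z] acts as a derivation on [w, D^(k-2) u], where each factor [e] contributes [lam z]; so [q 0]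
    preserves the form on V up to a scalar. *)
Lemma form_q0 z w u c : z \in q 0 -> [lie z, f] = c *: f -> w \in V -> u \in V ->
  bform [lie z, w] u + bform w [lie z, u] = (c - (k.-2)%:R * lam z) * bform w u.
Proof.
move=> z0 zf wV uV; apply: (scale_vector_inj bottom_gen_neq0).
rewrite scalerDl -!formE ?q0_V // -scalerA -formE // scalerBl.
have : [lie z, [lie w, D k.-2 u]] = c *: [lie w, D k.-2 u].
  by rewrite formE // lieZr zf scalerA mulrC -scalerA.
rewrite lieJ (lie_adn _ _ (q0_E z0)) lieDr lieZr => <-.
linear_ring.
Qed.

Lemma q1_eq0 x : x \in q 1 -> [lie x, e] = 0 -> (forall w, w \in V -> lam [lie x, w] = 0) ->
  (forall w u, w \in V -> u \in V -> [lie [lie x, w], u] = 0) -> x = 0.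
Proof.
move=> x1 xe lx xV; apply: (gr_transitive kg (i := 1) simp) => // _ /degN1_decomp[c [w [wV ->]]].
rewrite lieDr lieZr xe scaler0 add0r; apply: q0_faithful; [exact: q1_V|exact: lx|].
by move=> u uV; exact: xV.
Qed.

(** * The form and the action of degree one at depth three *)

Section DepthThree.
Hypothesis k3e : k = 3.

Lemma adn1_inj w : w \in V -> D 1 w = 0 -> w = 0.
Proof. by apply: adn_inj; lia. Qed.

Lemma form3E w u : w \in V -> u \in V -> [lie w, D 1 u] = bform w u *: f.
Proof. by move=> wV uV; rewrite -formE // k3e. Qed.

(** ad e is a derivation and [w, u] = 0. *)
Lemma form_sym w u : w \in V -> u \in V -> bform w u = bform u w.
Proof.
move=> wV uV; apply: (scale_vector_inj bottom_gen_neq0).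
have [_ _ Vab _ _] := c2; have : [lie e, [lie w, u]] = 0 by rewrite (Vab w u) // lie0r.
rewrite -!form3E // !adn1 (lieJ e) (lieC [lie e, w]) => /eqP.
by rewrite addrC subr_eq0 => /eqP.
Qed.

(** The counterpart of [q1_V_ge4] for k = 3, where [w, D u] is the form times [f] instead of 0. *)
Lemma depth3_action0 x y w u : x \in q 1 -> y \in V -> [lie x, f] = D 1 y ->
  w \in V -> u \in V ->
  [lie [lie x, w], u] = bform w u *: y - lam [lie x, w] *: u - lam [lie x, u] *: w.
Proof.
move=> x1 yV xf wV uV; have := q1_V_D1 x1 wV uV.
rewrite form3E // lieZr xf -adnZ => /eqP; rewrite -subr_eq0 -adnN -adnD => /eqP h.
have := adn1_inj _ h; rewrite !(memvD, memvB, memvN, memvZ) ?q0_V ?q1_V // => /(_ isT) h'.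
apply/eqP; rewrite eq_sym -subr_eq0; apply/eqP; rewrite -[RHS]h'; linear_ring.
Qed.

(** The difference th of the two linear forms satisfies b(v, v) th(v) = 0, by comparing
    [depth3_action0] with the scaling of the form under [x, v]. After polarization of this cubic
    identity, th(w) <> 0 gives first b(w, w) = 0 and then b(w, u) = 0 for all u, against
    nondegeneracy. *)
Lemma depth3_lam x y w : x \in q 1 -> y \in V -> [lie x, f] = D 1 y -> w \in V ->
  lam [lie x, w] = bform y w.
Proof.
move=> x1 yV xf; have act := depth3_action0 x1 yV xf.
pose th w := lam [lie x, w] - bform y w.
have thL a v v' : th (a *: v + v') = a * th v + th v'.
  by rewrite /th form_linr lieDr lieZr lam_linear; ring.
have cubic v : v \in V -> bform v v * th v = 0.
  move=> vV; pose z := [lie x, v]; have z0 : z \in q 0 by rewrite q1_V.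
  have zf : [lie z, f] = (- bform v y) *: f.
    by rewrite /z lieJl (V_bottom vV) lie0r sub0r xf form3E // scaleNr.
  have := form_q0 z0 zf vV vV; rewrite k3e mul1r act // -/z.
  have lin a b c : bform (a *: y - b *: v - c *: v) v = a * bform y v - (b + c) * bform v v.
    have -> : a *: y - b *: v - c *: v = a *: y + (- (b + c) *: v + 0) by linear_ring.
    by rewrite !form_linl /bform lie0l linear0; ring.
  have linr a b c : bform v (a *: y - b *: v - c *: v) = a * bform v y - (b + c) * bform v v.
    have -> : a *: y - b *: v - c *: v = a *: y + (- (b + c) *: v + 0) by linear_ring.
    by rewrite !form_linr /bform adn0 lie0r linear0; ring.
  rewrite lin linr (form_sym vV yV) /th -/z => h.
  have : 3 * (bform v v * (lam z - bform y v)) = 0 by move: h; set A := bform v v; set B := bform y v => h; lra.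
  by move/eqP; rewrite mulf_eq0 pnatr_eq0 => /eqP.
have polar v v' : v \in V -> v' \in V -> bform v v * th v' + 2 * bform v v' * th v = 0.
  move=> vV v'V; have p := cubic _ (memvD vV v'V); have m := cubic _ (memvB vV v'V).
  move: p m (cubic _ vV) (cubic _ v'V).
  have -> : v + v' = 1 *: v + v' by rewrite scale1r.
  have -> : v - v' = (-1) *: v' + v by rewrite scaleN1r addrC.
  rewrite !(form_linl, form_linr, thL) (form_sym v'V vV).
  move: (bform v v) (bform v v') (bform v' v') (th v) (th v') => A B C X Y.
  by lra.
move=> wV; apply/eqP; rewrite -subr_eq0 -/(th w); apply/negPn/negP => thn0.
have w0 : w = 0.
  apply: form_eq0 => // u uV; have := polar _ _ wV uV.
  have /eqP := cubic _ wV; rewrite mulf_eq0 (negPf thn0) orbF => /eqP->.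
  by rewrite mul0r add0r => /eqP; rewrite !mulf_eq0 (negPf thn0) orbF pnatr_eq0 => /eqP.
by case/eqP: thn0; rewrite w0 -[0]addr0 -[X in X + _](scale0r w) thL mul0r add0r /th /bform adn0 !lie0r linear0 /lam lie0l linear0 subr0.
Qed.

Lemma depth3_action x y w u : x \in q 1 -> y \in V -> [lie x, f] = D 1 y ->
  w \in V -> u \in V ->
  [lie [lie x, w], u] = bform w u *: y - bform y w *: u - bform y u *: w.
Proof. by move=> x1 yV xf wV uV; rewrite (depth3_action0 x1 yV xf) // !(depth3_lam x1 yV xf). Qed.

Lemma depth3_q1_bottom x : x \in q 1 -> exists2 y, y \in V & [lie x, f] = D 1 y.
Proof.
move=> x1; have xfq : [lie x, f] \in q (- 2) by apply: (gr_br_eq kg x1 bottom_deg); lia.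
by apply: adn_onto => //; lia.
Qed.

Lemma depth3_q1_eq0 x : x \in q 1 -> [lie x, e] = 0 -> [lie x, f] = 0 -> x = 0.
Proof.
move=> x1 xe xf; have xf0 : [lie x, f] = D 1 0 by rewrite adn0.
have form0 w : bform 0 w = 0 by rewrite /bform lie0l linear0.
apply: q1_eq0 => // [w wV|w u wV uV].
  by rewrite (depth3_lam x1 (mem0v V) xf0).
by rewrite (depth3_action x1 (mem0v V) xf0) // !form0 scaler0 !scale0r !subr0.
Qed.
End DepthThree.

(** The hypothesis is the situation to be excluded in [lam_e_nonzero]. For k >= 4 the components of
    [x, [w, D v]] = 0 along E and V give [x, e] = 0 and [x, w] = 0; for k = 3 the relations D^2 V =
    0 and [V, f] = 0 are used instead. *)
Lemma q2_eq0 : (forall x, x \in q 1 -> [lie x, e] = 0) -> forall x, x \in q 2 -> x = 0.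
Proof.
move=> e0 x x2.
have x'1 : [lie x, e] \in q 1 by apply: (gr_br_eq kg x2 E_gen_deg).
have xV1 w : w \in V -> [lie x, w] \in q 1 by move=> wV; apply: (gr_br_eq kg x2 (V_deg wV)).
have q1D y v : y \in q 1 -> v \in V -> [lie y, D 1 v] = - lam [lie y, v] *: e.
  by move=> y1 vV; rewrite q1_D1 // e0 // lie0l sub0r scaleNr.
have xD v : v \in V -> [lie x, D 1 v] = [lie [lie x, e], v].
  by move=> vV; rewrite adn1 lieJ (lieC e) (e0 _ (xV1 v vV)) oppr0 addr0.
suff [x'0 xV0] : [lie x, e] = 0 /\ forall w, w \in V -> [lie x, w] = 0.
  apply: (gr_transitive kg (i := 2) simp) => // _ /degN1_decomp[c [w [wV ->]]].
  by rewrite lieDr lieZr x'0 xV0 // scaler0 addr0.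
have [V0 V0V V0n0] := V_neq0.
have [k4|k4] := leqP 4 k.
  have key w v : w \in V -> v \in V ->
      lam [lie [lie x, w], v] = 0 /\ [lie [lie [lie x, e], v], w] = 0.
    move=> wV vV; have : [lie x, [lie w, D 1 v]] = 0 by rewrite V_adn0 ?lie0r.
    rewrite (lieJ x w) (q1D _ _ (xV1 w wV) vV) (xD v vV) (lieC w) => /EV_indep[].
      by rewrite memvN q0_V // q1_V.
    by move=> /eqP; rewrite oppr_eq0 => /eqP-> /eqP; rewrite oppr_eq0 => /eqP->.
  split=> [|w wV].
    apply: q1_eq0 => // [|w wV|w v wV vV]; first exact: e0.
      have := (key w w wV wV).2; rewrite q1_V_ge4 // -scalerDl => /eqP.
      rewrite oppr_eq0 scaler_eq0 => /orP[/eqP h|/eqP->]; first lra.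
      by rewrite lie0r /lam lie0l linear0.
    by have := (key v w vV wV).2.
  apply: q1_eq0; [exact: xV1|by apply: e0; exact: xV1| |move=> v u vV uV].
    by move=> v vV; have := (key w v wV vV).1.
  rewrite q1_V_ge4 ?xV1 // (key w v wV vV).1 (key w u wV uV).1.
  by rewrite !scale0r addr0 oppr0.
have k3e : k = 3 by lia.
have x'0 : [lie x, e] = 0.
  have [y yV yE] := depth3_q1_bottom k3e x'1.
  apply: depth3_q1_eq0 => //; first exact: e0.
  suff y0 : y = 0 by rewrite yE y0 adn0.
  apply: form_eq0 => // v vV; rewrite -(depth3_lam k3e x'1 yV yE) //.
  have : [lie x, D k.-1 v] = 0 by rewrite adn_top // lie0r.
  rewrite k3e adnS (lieJ x) (q1D _ _ x'1 vV) (xD v vV) (lieC e) (q0_E (q1_V x'1 vV)).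
  rewrite -scaleNr -scalerDl => /eqP.
  rewrite scaler_eq0 (negPf E_gen_neq0) orbF => /eqP h; lra.
split=> // w0 w0V.
have xD0 v : v \in V -> [lie x, D 1 v] = 0 by move=> vV; rewrite xD // x'0 lie0l.
have xform w v : w \in V -> v \in V -> bform w v *: [lie x, f] = - lam [lie [lie x, w], v] *: e.
  by move=> wV vV; rewrite -lieZr -form3E // (lieJ x) (xD0 v vV) lie0r addr0 (q1D _ _ (xV1 w wV) vV).
have [u [c [uV cn0 Vu]]] := form_partner V0V V0n0.
have xf : exists d, [lie x, f] = - d *: e.
  have cE : bform V0 u = c by apply: (scale_vector_inj bottom_gen_neq0); rewrite -formE.
  by exists (c^-1 * lam [lie [lie x, V0], u]); rewrite -mulrN -scalerA -xform // cE scalerK.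
have [d xfE] := xf.
have xw w : w \in V -> [lie [lie x, w], f] = D 1 (d *: w).
  move=> wV; have [y yV yE] := depth3_q1_bottom k3e (xV1 w wV); rewrite yE; congr (D 1 _).
  apply/eqP; rewrite -subr_eq0; apply/eqP; apply: form_eq0; first by rewrite memvB ?memvZ.
  move=> v vV; have -> : y - d *: w = - d *: w + y by rewrite addrC scaleNr.
  rewrite form_linl -(depth3_lam k3e (xV1 w wV) yV yE) //.
  have := xform w v wV vV; rewrite xfE scalerA => /eqP.
  rewrite -subr_eq0 -scalerBl scaler_eq0 (negPf E_gen_neq0) orbF => /eqP h; lra.
(* Both terms of [x] applied to [V0, f] = 0 equal d [e, V0]. *)
have d0 : d = 0.
  have : [lie x, [lie V0, f]] = 0 by rewrite V_bottom // lie0r.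
  rewrite (lieJ x) (xw V0 V0V) xfE lieZr (lieC V0 e) adnZ adn1 scaleNr scalerN opprK -scalerDl => /eqP.
  rewrite scaler_eq0 => /orP[/eqP h|/eqP h]; first lra.
  by case/eqP: V0n0; apply: adn1_inj.
by apply: depth3_q1_eq0 => //; [exact: xV1|apply: e0; exact: xV1|rewrite xw // d0 scale0r adn0].
Qed.

(** Otherwise [q 1] commutes with [e] and all degrees from 2 on vanish. Then the line of [e] and the
    degrees below -1 span an ideal, nonzero because of [e] and proper because of V. *)
Lemma lam_e_nonzero : exists2 x, x \in q 1 & lam [lie x, e] != 0.
Proof.
apply: contrapT => H.
have e0 x : x \in q 1 -> [lie x, e] = 0.
  by move=> x1; apply: q1_e_eq0 => //; apply: contrapT => /eqP l0; apply: H; exists x.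
have qpos n x : x \in q n.+2%:Z -> x = 0.
  elim: n x => [|n IH] x xn; first exact: q2_eq0.
  apply: (gr_transitive kg (i := n.+3%:Z) simp) => // u u1; apply: IH.
  by apply: (gr_br_eq kg xn u1); lia.
pose P w := (exists c, gr_proj k q (-1) w = c *: e) /\ forall n : nat, gr_proj k q n%:Z w = 0.
have PL : linear_closed_pred P.
  split=> [|a w w' [[c hc] h] [[c' hc'] h']].
    by split=> [|n]; rewrite ?linear0 //; exists 0; rewrite scale0r.
  split=> [|n]; last by rewrite linearP /= h h' scaler0 addr0.
  by exists (a * c + c'); rewrite linearP /= hc hc' scalerDl scalerA.
have [I IP] := linear_closed_vspace PL.
have II y w : y \in fullv -> w \in I -> [lie y, w] \in I.
  move=> _ /IP[[c hc] h]; apply/IP; move: y; apply: (graded_ind kg) => [|i y yi].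
    by have [? ?] := PL; split=> [|a u v hu hv]; rewrite ?lie0l // lieDl lieZl; auto.
  have [i2|i2] := leP 2 i.
    have -> : y = 0 by apply: (qpos `|(i - 2)%R|%N); have -> : `|(i - 2)%R|.+2%:Z = i by lia.
    by rewrite lie0l; have [] := PL.
  have pr j l : l = i + j -> gr_proj k q l [lie y, w] = [lie y, gr_proj k q j w].
    exact: (gr_proj_br kg).
  have prn j : 0 <= j -> gr_proj k q j w = 0 by case: j => // n _; exact: h.
  split=> [|n].
    rewrite (pr (-1 - i)); last lia.
    have [i0|i0] := ltP i 0; first by exists 0; rewrite prn ?lie0r ?scale0r //; lia.
    have [iE|iE] := eqVneq i 0.
      by rewrite iE subr0 hc lieZr q0_E -?iE //; exists (c * lam y); rewrite scalerA.
    have i1 : i = 1 by lia.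
    have m2 : gr_proj k q (-1 - i) w \in q (- 2%:Z) by rewrite i1; exact: gr_proj_mem.
    have [v vV ->] := @adn_onto 0 _ k3 m2.
    rewrite i1 in yi; rewrite q1_D1 // e0 // lie0l sub0r.
    by exists (- lam [lie y, v]); rewrite scaleNr.
  rewrite (pr (n%:Z - i)); last lia.
  have [ni|ni] := leP i n%:Z; first by rewrite prn ?lie0r //; lia.
  have -> : n%:Z - i = -1 by lia.
  have i1 : i = 1 by lia.
  by rewrite i1 in yi; rewrite hc lieZr e0 // scaler0.
have [_ _ /(_ I (subvf _) II)] := simp.
case=> IE; last first.
  have [v vV /eqP[]] := V_neq0; have /IP[[c hc] _] : v \in I by rewrite IE memvf.
  move: hc; rewrite (gr_proj_id kg (V_deg vV)) => ve.
  have [|_ //] := EV_indep (c := - c) vV.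
  by rewrite ve scaleNr addNr.
have /eqP := E_gen_neq0; apply; apply/eqP; rewrite -memv0 -IE; apply/IP; split.
  by exists 1; rewrite (gr_proj_id kg E_gen_deg) scale1r.
by move=> n; rewrite (gr_proj_eq kg _ E_gen_deg); case: n.
Qed.

(** A multiple of some [x, e] has the scalars 1 and -(k-2)/2 on [e] and V, which are independent of
    those of [z]; so a combination of the two acts by -1 on all of [q (-1)]. *)
Lemma analysis_positive_generation z : z \in bracket_span (q 1) (q (-1)) ->
  [lie z, e] = e -> (forall w, w \in V -> [lie z, w] = - ((k.-1)%:R / 2) *: w) ->
  forall n, q n.+2%:Z = bracket_span (q 1) (q n.+1%:Z).
Proof.
move=> zs ze zV; have [x x1 l0] := lam_e_nonzero.
have [y [ys ye yV]] : exists y, [/\ y \in bracket_span (q 1) (q (-1)), [lie y, e] = e &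
    forall w, w \in V -> [lie y, w] = - ((k.-2)%:R / 2) *: w].
  exists ((lam [lie x, e])^-1 *: [lie x, e]); split=> [||w wV].
  - by rewrite memvZ // mem_bracket_span //; exact: E_gen_deg.
  - by rewrite lieZl (q0_E (q1_e x1)) scalerK.
  - by rewrite lieZl q1_e_V // scalerA mulrCA mulVf // mulr1.
have k2 : (k.-2)%:R = k%:R - 2 :> R by rewrite -natrB; [congr _%:R; lia|lia].
have k1 : (k.-1)%:R = k%:R - 1 :> R by rewrite -subn1 natrB //; lia.
(* On [e] the scalar is k - (k + 1) = -1, on V it is - k (k - 1) / 2 + (k + 1) (k - 2) / 2 = -1. *)
apply: (@positive_generation R L k q kg simp (k%:R *: z - (k%:R + 1) *: y)).
  by rewrite memvB // memvZ.
move=> u /degN1_decomp[c [w [wV ->]]].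
by rewrite lieBl !lieZl !lieDr !lieZr ze ye zV // yV // k1 k2; linear_field.
Qed.

End Analysis.

(** * Root data of the models *)

Lemma span_basis_sub (R : fieldType) (V : vectType R) (X : seq V) :
  exists b : seq V, [/\ {subset b <= X}, free b & <<b>>%VS = <<X>>%VS].
Proof.
elim: X => [|x X [b [sb fb eb]]]; first by exists [::]; rewrite nil_free.
have [xb|xb] := boolP (x \in <<X>>%VS).
  exists b; split=> // [y /sb|]; first by rewrite inE orbC => ->.
  by rewrite eb span_cons; apply/esym/addv_idPr; rewrite -memvE.
exists (x :: b); split.
- by move=> y; rewrite !inE => /orP[->//|/sb->]; rewrite orbT.
- by rewrite free_cons eb xb fb.
- by rewrite !span_cons eb.
Qed.

Section WeightVectors.
Variables (R : fieldType) (L : lieAlgType R) (I : Type) (h : I -> L) (K : finType).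
Variables (X : K -> L) (wt : K -> I -> R).
Hypothesis hX : forall i a, [lie h i, X a] = wt a i *: X a.

(* A common eigenvector in the span of weight vectors has one of their weights: otherwise
   the operators [ad (h i) - wt a i] would remove the weight vectors one after the other. *)
Lemma weight_of_sum (lm : I -> R) u (c : K -> R) : u = \sum_a c a *: X a -> u != 0 ->
  (forall i, [lie h i, u] = lm i *: u) -> exists2 a, X a != 0 & forall i, wt a i = lm i.
Proof.
move=> uE un0 hu; apply: contrapT => none.
suff F (s : seq K) : uniq s -> forall c, u = \sum_(a <- s) c a *: X a -> False.
  by apply: (F (index_enum K)) uE; exact: index_enum_uniq.
elim: s => [_ {}c {}uE|a s IH /= /andP[_ us] {}c {}uE].
  by case/eqP: un0; rewrite uE big_nil.
have [Xa0|Xa0] := eqVneq (X a) 0.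
  by apply: (IH us c); rewrite uE big_cons Xa0 scaler0 add0r.
have [i wi] : exists i, wt a i != lm i.
  apply: contrapT => H; apply: none; exists a => // i; apply: contrapT => /eqP wi.
  by apply: H; exists i.
apply: (IH us (fun b => (lm i - wt a i)^-1 * (wt b i - wt a i) * c b)).
have d0 : lm i - wt a i != 0 by rewrite subr_eq0 eq_sym.
apply: (scalerI d0); pose s' := \sum_(b <- s) c b *: X b.
have -> : (lm i - wt a i) *: u = [lie h i, s'] - wt a i *: s'.
  rewrite scalerBl -hu uE big_cons -/s' lieDr lieZr hX; linear_ring.
rewrite /s' [in RHS]scaler_sumr.
have -> : [lie h i, \sum_(b <- s) c b *: X b] = \sum_(b <- s) (c b * wt b i) *: X b.
  elim/big_rec2: _ => [|b y z _ <-]; first by rewrite lie0r.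
  by rewrite lieDr lieZr hX scalerA.
rewrite scaler_sumr -sumrB; apply: eq_bigr => b _.
rewrite !scalerA -scalerBl; congr (_ *: _).
by rewrite !mulrA mulfV // mul1r mulrBl (mulrC (c b)).
Qed.
End WeightVectors.

Section RootModel.
Variables (R : realFieldType) (T : lieAlgType R) (P : T -> Prop) (r : nat).
Variables (H : 'rV[R]_r -> T) (root : 'I_r -> 'rV[R]_r -> R).
Variables (K : finType) (X : K -> T) (wt : K -> 'rV[R]_r -> R).
Implicit Types (t : 'rV[R]_r) (u : T).

(** Diagonalizability on the subalgebra [P] of the ambient algebra [T], in terms of a spanning
    family of eigenvectors. *)
Definition ad_diagonalizable_on (v : T) := exists s : seq T,
  (forall y, y \in s -> P y /\ exists c : R, [lie v, y] = c *: y) /\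
  (forall u, P u -> u \in <<s>>%VS).

(** What has to be known about a concrete algebra to read off Cartan subspace, simple roots and
    grading. The weight vectors [X a] span, but may vanish or repeat. [rm_dual] provides the
    fundamental coweights. [rm_max] gives maximality of the torus: an element [u] centralizing it
    belongs to it as soon as u - H t is diagonalizable for a suitable t. *)
Record root_model : Prop := RootModel {
  rm_lin : linear H;
  rm_inj : forall t, H t = 0 -> t = 0;
  rm_comm : forall t s, [lie H t, H s] = 0;
  rm_PH : forall t, P (H t);
  rm_PX : forall a, P (X a);
  rm_wt : forall t a, [lie H t, X a] = wt a t *: X a;
  rm_span : forall u, P u -> exists c : K -> R, u = \sum_a c a *: X a;
  rm_root_lin : forall i, scalar (root i);
  rm_wt_root : forall a, (forall t, wt a t = 0) \/ exists n : 'I_r -> nat,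
     (forall t, wt a t = \sum_i (n i)%:R * root i t) \/
     (forall t, wt a t = - \sum_i (n i)%:R * root i t);
  rm_root : forall i, exists a, X a != 0 /\ forall t, wt a t = root i t;
  rm_dual : forall i, exists t, forall j, root j t = (i == j)%:R;
  rm_max : forall u, P u -> (forall t, [lie H t, u] = 0) ->
     exists t, ad_diagonalizable_on (u - H t) -> u = H t
}.

Hypothesis M : root_model.

Variables (L : lieAlgType R) (f : 'Hom(L, T)).
Hypothesis fker : lker f = 0%VS.
Hypothesis fP : forall u, P u <-> exists x, f x = u.
Hypothesis fbr : forall x y, f [lie x, y] = [lie f x, f y].

Lemma rm_f_inj : injective f.
Proof. by apply/lker0P/eqP. Qed.

Lemma rm_f_eq0 x : f x = 0 -> x = 0.
Proof. by move=> fx; apply: rm_f_inj; rewrite fx linear0. Qed.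

Lemma rm_preim : exists Y : K -> L, forall a, f (Y a) = X a.
Proof.
have H0 a : exists x, f x = X a by apply/fP; exact: rm_PX M a.
by exists (fun a => projT1 (cid (H0 a))) => a; case: (cid (H0 a)).
Qed.

Lemma rm_span_preim (Y : K -> L) : (forall a, f (Y a) = X a) ->
  forall x, exists c : K -> R, x = \sum_a c a *: Y a.
Proof.
move=> fY x; have [|c fx] := rm_span M (u := f x); first by apply/fP; exists x.
exists c; apply: rm_f_inj; rewrite fx linear_sum; apply: eq_bigr => a _.
by rewrite linearZ /= fY.
Qed.

Lemma rm_H_lin : linear_closed_pred (fun x => exists t, f x = H t).
Proof.
split=> [|a x y [t xt] [s ys]].
  exists 0; rewrite linear0; have := rm_lin M (-1) 0 0.
  by rewrite scaler0 add0r scaleN1r addNr.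
by exists (a *: t + s); rewrite linearP /= xt ys (rm_lin M).
Qed.

Lemma rm_H_uniq t s : H t = H s -> t = s.
Proof.
move=> ts; apply/eqP; rewrite -subr_eq0; apply/eqP; apply: (rm_inj M).
by rewrite -scaleN1r addrC (rm_lin M) scaleN1r ts addNr.
Qed.

Variables (k : nat) (q : int -> {vspace L}) (S : {set 'I_r}) (t0 : 'rV[R]_r).
Hypothesis kg : kgrading k q.
Hypothesis rt0 : forall i, root i t0 = (i \in S)%:R.

Lemma int_root_t0 (c : 'I_r -> int) :
  \sum_i (c i)%:~R * root i t0 = (\sum_(i in S) c i)%:~R.
Proof.
rewrite raddf_sum [RHS]big_mkcond; apply: eq_bigr => i _; rewrite rt0.
by case: (i \in S); rewrite ?mulr1 ?mulr0.
Qed.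

Lemma rm_int_wt a : exists c : 'I_r -> int, forall t, wt a t = \sum_i (c i)%:~R * root i t.
Proof.
have [w0|[n [w|w]]] := rm_wt_root M a.
- by exists (fun=> 0) => t; rewrite w0 big1 // => i _; rewrite mul0r.
- by exists (fun i => (n i)%:Z) => t; rewrite w.
- exists (fun i => - (n i)%:Z) => t; rewrite w -sumrN; apply: eq_bigr => i _.
  by rewrite rmorphN mulNr.
Qed.

Section Eigen.
Variable h0 : L.
Hypothesis fh0 : f h0 = H t0.
Hypothesis hq : forall i x, x \in q i -> [lie h0, x] = i%:~R *: x.

(** Distinct integers stay distinct in [R], so the eigenvalue determines the degree. *)
Lemma degree_eigen i x : [lie h0, x] = i%:~R *: x -> x \in q i.
Proof.
move=> hx; have pj j : gr_proj k q j [lie h0, x] = j%:~R *: gr_proj k q j x.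
  move: {hx} x; apply: (graded_ind kg) => [|l y yl].
    split=> [|a u w hu hw]; first by rewrite lie0r linear0 scaler0.
    rewrite lieDr lieZr [LHS]linearP [X in _ = _ *: X]linearP /= hu hw; linear_ring.
  by rewrite (hq yl) linearZ /= (gr_proj_eq kg _ yl); case: eqP => [->|_]; rewrite ?scaler0.
rewrite (gr_proj_sum kg x); apply: memv_suml => j _.
have [<-|ji] := eqVneq (j%:Z - k%:Z) i; first exact: gr_proj_mem.
have := pj (j%:Z - k%:Z); rewrite hx linearZ /= => /eqP.
rewrite -subr_eq0 -scalerBl scaler_eq0 subr_eq0 eqr_int eq_sym (negPf ji) /= => /eqP->.
exact: mem0v.
Qed.
End Eigen.

(** The preimages of the weight vectors span L, and [corresponds_to] puts each of them in the degree
    that is its weight at [t0]. Hence the grading is the eigenspace decomposition of H t0. *)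
Lemma root_grading (A : {vspace L}) alpha : (forall h, h \in A <-> exists t, f h = H t) ->
  (forall h t, f h = H t -> forall i, alpha i h = root i t) ->
  corresponds_to A alpha S q ->
  (forall i x, x \in q i <-> [lie H t0, f x] = i%:~R *: f x) /\
  (forall i x, x \in q i -> exists c : K -> R, f x = \sum_a c a *: X a /\
     forall a, c a != 0 -> wt a t0 = i%:~R).
Proof.
move=> AH al cor; have [Y fY] := rm_preim; have [h0 fh0] := (fP (H t0)).1 (rm_PH M t0).
pose c a := projT1 (cid (rm_int_wt a)).
have cP a t : wt a t = \sum_i (c a i)%:~R * root i t by rewrite /c; case: (cid _).
pose d a := \sum_(i in S) c a i.
have dP a : wt a t0 = (d a)%:~R by rewrite cP int_root_t0.
have Yd a : Y a \in q (d a).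
  apply: cor => h /AH[t ft]; apply: rm_f_inj; rewrite fbr fY linearZ /= fY ft (rm_wt M) cP.
  by congr (_ *: _); apply: eq_bigr => i _; rewrite (al _ _ ft).
have hY a : [lie h0, Y a] = (d a)%:~R *: Y a.
  by apply: rm_f_inj; rewrite fbr fY linearZ /= fY fh0 (rm_wt M) dP.
have qsum i x : x \in q i -> exists c : K -> R,
    x = \sum_a c a *: Y a /\ forall a, c a != 0 -> d a = i.
  move=> xi; have [b xE] := rm_span_preim fY x.
  exists (fun a => if d a == i then b a else 0); split=> [|a]; last by case: ifP => [/eqP|_ /eqP].
  rewrite -{1}(gr_proj_id kg xi) xE linear_sum; apply: eq_bigr => a _.
  rewrite linearZ /= (gr_proj_eq kg _ (Yd a)) eq_sym.
  by case: ifP => _; rewrite ?scaler0 ?scale0r.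
have hq i x : x \in q i -> [lie h0, x] = i%:~R *: x.
  move=> /qsum[b [-> bd]].
  rewrite scaler_sumr; elim/big_rec2: _ => [|a y z _ IH]; first by rewrite lie0r.
  rewrite lieDr IH lieZr hY; congr (_ + _).
  have [->|/bd->] := eqVneq (b a) 0; first by rewrite !scale0r scaler0.
  by rewrite !scalerA mulrC.
split=> i x; last first.
  move=> /qsum[b [xE bd]]; exists b; split=> [|a /bd <-]; last exact: dP.
  by rewrite xE linear_sum; apply: eq_bigr => a _; rewrite linearZ /= fY.
split=> [/hq hx|hx]; first by rewrite -fh0 -fbr hx linearZ.
apply: (degree_eigen hq); apply: rm_f_inj; rewrite fbr fh0 hx linearZ.
by [].
Qed.

Lemma ad_diagonalizable_transfer x : ad_diagonalizable x -> ad_diagonalizable_on (f x).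
Proof.
move=> [b [bb hb]]; exists (map f b); split=> [_ /mapP[y yb ->]|u /fP[y <-]].
  split; first by apply/fP; exists y.
  by have [c xy] := hb y yb; exists c; rewrite -fbr xy linearZ.
rewrite -limg_span (span_basis bb); exact: memv_img (memvf _).
Qed.

Lemma simple_roots_model (A : {vspace L}) alpha : (forall h, h \in A <-> exists t, f h = H t) ->
  (forall h t, f h = H t -> forall i, alpha i h = root i t) ->
  simple_restricted_roots A alpha.
Proof.
move=> AH al; have [Y fY] := rm_preim.
have AHt t : exists2 h, h \in A & f h = H t.
  have [h fh] := (fP (H t)).1 (rm_PH M t).
  by exists h => //; apply/AH; exists t.
have ht x t : f x = H t -> forall a, [lie x, Y a] = wt a t *: Y a.
  by move=> fx a; apply: rm_f_inj; rewrite fbr fY linearZ /= fY fx (rm_wt M).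
have diagA x : x \in A -> ad_diagonalizable x.
  move=> /AH[t fx]; have [b [sb fb eb]] := span_basis_sub (map Y (index_enum K)).
  exists b; split=> [|y /sb/mapP[a _ ->]]; last by exists (wt a t); exact: ht.
  rewrite /basis_of fb eb andbT eqEsubv subvf; apply/subvP => z _.
  have [c ->] := rm_span_preim fY z; apply: memv_suml => a _; apply: memvZ.
  by apply: memv_span; apply: map_f; exact: mem_index_enum.
have split_A : split_abelian A.
  split=> // x y /AH[t fx] /AH[s fy]; apply: rm_f_inj.
  by rewrite fbr fx fy (rm_comm M) linear0.
split.
(* An abelian [B] containing [A] centralizes the torus, and differences b - h stay in [B], hence are
   diagonalizable, as [rm_max] asks. *)
- split=> // B [Bab Bd] AB; apply/eqP; rewrite eqEsubv AB andbT; apply/subvP => b bB.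
  have Pb : P (f b) by apply/fP; exists b.
  have [|t tmax] := rm_max M Pb.
    by move=> t; have [h hA <-] := AHt t; rewrite -fbr (Bab h b) ?linear0 //; apply: (subvP AB).
  have [h hA fh] := AHt t; apply/AH; exists t; apply: tmax.
  rewrite -fh -linearB; apply: ad_diagonalizable_transfer; apply: Bd.
  by rewrite memvB //; apply: (subvP AB).
- move=> i; split.
    have [t td] := rm_dual M i; have [h hA fh] := AHt t; exists h => //.
    by rewrite (al _ _ fh) td eqxx oner_neq0.
  have [a [Xa0 wa]] := rm_root M i; exists (Y a).
    by apply: contra_neq Xa0 => Ya; rewrite -fY Ya linear0.
  by move=> h /AH[t fh]; rewrite (ht _ _ fh) wa (al _ _ fh).
- move=> c c0 i; have [t td] := rm_dual M i; have [h hA fh] := AHt t.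
  have := c0 h hA; rewrite (bigD1 i) //= (al _ _ fh) td eqxx mulr1 big1 ?addr0 // => j ji.
  by rewrite (al _ _ fh) td eq_sym (negPf ji) mulr0.
- move=> lm [[h hA lh] [x xn0 xl]].
  have fxn0 : f x != 0 by apply: contra_neq xn0; exact: rm_f_eq0.
  have [b fxE] := rm_span M ((fP (f x)).2 (ex_intro _ x erefl)).
  pose g t := projT1 (cid2 (AHt t)).
  have gA t : g t \in A by rewrite /g; case: cid2.
  have gf t : f (g t) = H t by rewrite /g; case: cid2.
  have hfx t : [lie H t, f x] = lm (g t) *: f x by rewrite -gf -fbr (xl _ (gA t)) linearZ.
  (* A restricted root vector is a common eigenvector of the torus, so its root is one of the listed
     weights. *)
  have [a Xa0 wa] := weight_of_sum (rm_wt M) fxE fxn0 hfx.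
  have lmE y t : y \in A -> f y = H t -> lm y = wt a t.
    by move=> yA fy; rewrite wa; have -> : g t = y by apply: rm_f_inj; rewrite gf fy.
  have [w0|[n nw]] := rm_wt_root M a.
    have [t fh] := (AH h).1 hA.
    by move: lh; rewrite (lmE h t hA fh) w0 eqxx.
  exists n; case: nw => nw; [left|right] => y yA; have [t fy] := (AH y).1 yA;
    rewrite (lmE y t yA fy) nw.
  + by apply: eq_bigr => i _; rewrite (al _ _ fy).
  + by congr (- _); apply: eq_bigr => i _; rewrite (al _ _ fy).
Qed.

(** The converse of [root_grading]: it is enough that each degree lies in the corresponding
    eigenspace of H t0. *)
Lemma has_type_intro (mul : T -> T -> T) :
  (forall u w, [lie u, w] = mul u w - mul w u) ->
  (forall i x, x \in q i -> [lie H t0, f x] = i%:~R *: f x) ->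
  @has_type R L T mul P r H root S q.
Proof.
move=> mulE qH; have [A AH] := linear_closed_vspace rm_H_lin.
pose alpha i (h : L) := if pselect (exists t, f h = H t) is left ex
   then root i (projT1 (cid ex)) else 0.
have al h t : f h = H t -> forall i, alpha i h = root i t.
  move=> fh i; rewrite /alpha; case: pselect => [ex|[]]; last by exists t.
  by case: (cid ex) => s /= fs; congr root; apply: rm_H_uniq; rewrite -fs -fh.
exists f, A, alpha; split=> //.
- by split=> // x y; rewrite fbr mulE.
- exact: simple_roots_model.
have [h0 fh0] := (fP (H t0)).1 (rm_PH M t0).
have hq i x : x \in q i -> [lie h0, x] = i%:~R *: x.
  by move=> /qH hx; apply: rm_f_inj; rewrite fbr fh0 hx linearZ.
move=> c x xr; apply: (degree_eigen hq); rewrite -int_root_t0 xr; last by apply/AH; exists t0.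
by congr (_ *: _); apply: eq_bigr => i _; rewrite (al _ _ fh0).
Qed.

End RootModel.

(** * Orthogonal Lie algebras *)

(** An alias of the matrix type that carries the commutator as its Lie bracket. *)
Definition gl (R : fieldType) (n : nat) : Type := 'M[R]_n.

Section GeneralLinear.
Variables (R : fieldType) (n : nat).

HB.instance Definition _ := Vector.copy (gl R n) 'M[R]_n.

Definition gl_br (u w : gl R n) : gl R n := (u : 'M_n) *m w - (w : 'M_n) *m u.

Lemma gl_br_linear_l w : linear (gl_br^~ w).
Proof.
move=> a u v; rewrite /gl_br mulmxDl mulmxDr -scalemxAl -scalemxAr scalerBr.
by rewrite opprD addrACA.
Qed.
Lemma gl_br_linear_r u : linear (gl_br u).
Proof.
move=> a w v; rewrite /gl_br mulmxDl mulmxDr -scalemxAl -scalemxAr scalerBr.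
by rewrite opprD addrACA.
Qed.
Lemma gl_brxx u : gl_br u u = 0. Proof. exact: subrr. Qed.
Lemma gl_br_jacobi u v w :
  gl_br u (gl_br v w) + gl_br v (gl_br w u) + gl_br w (gl_br u v) = 0.
Proof.
rewrite /gl_br !mulmxBl !mulmxBr !mulmxA.
move: (u *m v *m w) (u *m w *m v) (v *m u *m w) (v *m w *m u) (w *m u *m v) (w *m v *m u).
by move=> a b c d g h; apply/matrixP => i j; rewrite !mxE; ring.
Qed.

HB.instance Definition _ := Vector_isLie.Build R (gl R n)
  gl_br_linear_l gl_br_linear_r gl_brxx gl_br_jacobi.

Lemma gl_lieE (u w : gl R n) : [lie u, w] = (u : 'M_n) *m w - (w : 'M_n) *m u.
Proof. by []. Qed.
End GeneralLinear.

Lemma sig_form_tr (R : fieldType) p q : (sig_form R p q)^T = sig_form R p q.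
Proof. by rewrite /sig_form tr_block_mx !trmx0 trmx1 linearN /= trmx1. Qed.

Lemma sig_form_sqr (R : fieldType) p q : sig_form R p q *m sig_form R p q = 1%:M.
Proof.
rewrite /sig_form mulmx_block !mulmx0 !mul0mx !addr0 !add0r mulmx1.
by rewrite mulmxN mulmx1 opprK -scalar_mx_block.
Qed.

(** * The invariant form, and wedges of two vectors as skew matrices *)

Section Wedge.
Variables (R : realFieldType) (p q : nat).
Local Notation N := (p.+2 + q.+2)%N.
Local Notation J := (sig_form R p.+2 q.+2).
Local Notation so u := (@in_so R p.+2 q.+2 u).
Implicit Types (x y z : 'cV[R]_N) (u v : gl R N).

Definition ip x y : R := (x^T *m J *m y) 0 0.

Lemma ipE x y : x^T *m J *m y = (ip x y)%:M.
Proof. by rewrite [LHS]mx11_scalar. Qed.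

Lemma ip_sym x y : ip x y = ip y x.
Proof.
rewrite /ip -[x^T *m J *m y]trmxK [in LHS]mxE; congr (_ _ _).
by rewrite !trmx_mul trmxK sig_form_tr mulmxA.
Qed.
Lemma ipDr x y z : ip x (y + z) = ip x y + ip x z.
Proof. by rewrite /ip mulmxDr mxE. Qed.
Lemma ipZr a x y : ip x (a *: y) = a * ip x y.
Proof. by rewrite /ip -scalemxAr mxE. Qed.
Lemma ipNr x y : ip x (- y) = - ip x y.
Proof. by rewrite -scaleN1r ipZr mulN1r. Qed.
Lemma ip0r x : ip x 0 = 0. Proof. by rewrite -(scale0r 0) ipZr mul0r. Qed.
Lemma ipDl x y z : ip (x + y) z = ip x z + ip y z.
Proof. by rewrite !(ip_sym _ z) ipDr. Qed.
Lemma ipZl a x y : ip (a *: x) y = a * ip x y.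
Proof. by rewrite !(ip_sym _ y) ipZr. Qed.
Lemma ipNl x y : ip (- x) y = - ip x y.
Proof. by rewrite !(ip_sym _ y) ipNr. Qed.
Lemma ip0l x : ip 0 x = 0. Proof. by rewrite ip_sym ip0r. Qed.

(* [locked] keeps the difference from being matched by rewriting with [lieBl]. *)
Definition wd x y : gl R N := locked (x *m (y^T *m J) - y *m (x^T *m J)).

Lemma wdE x y z : (wd x y : 'M_N) *m z = ip y z *: x - ip x z *: y.
Proof.
rewrite /wd -!lock mulmxBl -![_ *m (_ *m J) *m z]mulmxA !ipE.
by rewrite !mul_mx_scalar.
Qed.

Lemma wd_sym x y : wd x y = - wd y x.
Proof. by rewrite /wd -!lock opprB. Qed.
Lemma wd_linear y : linear (wd^~ y).
Proof.
move=> a x z; rewrite /wd -!lock linearP /= mulmxDl -scalemxAl mulmxDl mulmxDr -scalemxAl -scalemxAr.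
by rewrite scalerBr opprD addrACA.
Qed.
Lemma wdDl x y z : wd (x + y) z = wd x z + wd y z.
Proof. by have := wd_linear z 1 x y; rewrite !scale1r. Qed.
Lemma wd0l x : wd 0 x = 0.
Proof. by rewrite /wd -!lock mul0mx trmx0 mul0mx mulmx0 subr0. Qed.
Lemma wdZl a x y : wd (a *: x) y = a *: wd x y.
Proof. by have := wd_linear y a x 0; rewrite wd0l !addr0. Qed.
Lemma wdNl x y : wd (- x) y = - wd x y.
Proof. by rewrite -scaleN1r wdZl scaleN1r. Qed.
Lemma wdDr x y z : wd z (x + y) = wd z x + wd z y.
Proof. by rewrite !(wd_sym z) wdDl opprD. Qed.
Lemma wdZr a x y : wd y (a *: x) = a *: wd y x.
Proof. by rewrite !(wd_sym y) wdZl scalerN. Qed.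
Lemma wdNr x y : wd y (- x) = - wd y x.
Proof. by rewrite !(wd_sym y) wdNl. Qed.
Lemma wd0r x : wd x 0 = 0. Proof. by rewrite wd_sym wd0l oppr0. Qed.
Lemma wdxx x : wd x x = 0. Proof. by rewrite /wd -lock subrr. Qed.

Lemma so_linear : linear_closed_pred (fun u : gl R N => so u).
Proof.
split=> [|a u v su sv]; rewrite /in_so.
  by rewrite trmx0 mul0mx mulmx0 addr0.
rewrite linearP /= mulmxDl mulmxDr -scalemxAl -scalemxAr addrACA -scalerDr.
by rewrite su sv scaler0 addr0.
Qed.

Lemma so_skew u : so u -> J *m (u : 'M_N) = - ((u : 'M_N)^T *m J).
Proof. by move=> /eqP; rewrite addrC addr_eq0 => /eqP. Qed.

Lemma so_tr u : so u -> (u : 'M_N)^T *m J = - (J *m (u : 'M_N)).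
Proof. by move=> su; rewrite so_skew // opprK. Qed.

Lemma so_ip u x y : so u -> ip ((u : 'M_N) *m x) y = - ip x ((u : 'M_N) *m y).
Proof.
move=> su; rewrite /ip trmx_mul -[x^T *m _ *m J]mulmxA.
rewrite so_tr // mulmxN mulNmx mxE; congr (- _).
by rewrite !mulmxA.
Qed.

Lemma so_br u v : so u -> so v -> so [lie u, v].
Proof.
move=> su sv; rewrite /in_so gl_lieE linearB /= !trmx_mul mulmxBl mulmxBr -!mulmxA !so_tr //.
rewrite !mulmxN ![_^T *m (J *m _)]mulmxA !so_tr // !mulNmx !opprK -!mulmxA.
by rewrite addrA subrK subrr.
Qed.

Lemma so_wd x y : so (wd x y).
Proof.
rewrite /in_so /wd -!lock linearB /= !trmx_mul !trmxK sig_form_tr mulmxBl mulmxBr !mulmxA.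
by rewrite addrA subrK subrr.
Qed.

(** The wedge is equivariant under so; this lemma and [br_wd] replace matrix computations in the
    orthogonal models. *)
Lemma br_so_wd u x y : so u -> [lie u, wd x y] = wd ((u : 'M_N) *m x) y + wd x ((u : 'M_N) *m y).
Proof.
move=> su; have e z : ((u : 'M_N) *m z)^T *m J = - (z^T *m J *m (u : 'M_N)).
  by rewrite trmx_mul -[LHS]mulmxA so_tr // mulmxN mulmxA.
rewrite gl_lieE /wd -!lock !e mulmxBl mulmxBr !mulmxN !mulmxA.
by apply/matrixP => i j; rewrite !(mxE, opprK); ring.
Qed.

Lemma br_wd x y z w : [lie wd x y, wd z w] =
  ip y z *: wd x w - ip x z *: wd y w + (ip y w *: wd z x - ip x w *: wd z y).
Proof.
rewrite br_so_wd; last exact: so_wd.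
by rewrite !wdE wdDl wdDr !(wdNl, wdNr, wdZl, wdZr).
Qed.

(** An index out of range gives the zero vector, so that positive and negative basis vectors can be
    paired up to the larger of the two dimensions. *)
Definition pos_vec (i : nat) : 'cV[R]_N := col_mx (\col_k (k == i :> nat)%:R) 0.
Definition neg_vec (i : nat) : 'cV[R]_N := col_mx 0 (\col_k (k == i :> nat)%:R).

Lemma ip_col (a c : 'cV[R]_p.+2) (b d : 'cV[R]_q.+2) :
  ip (col_mx a b) (col_mx c d) = (a^T *m c) 0 0 - (b^T *m d) 0 0.
Proof.
rewrite /ip tr_col_mx /sig_form -mulmxA mul_block_col !mul1mx !mul0mx addr0 add0r mulNmx mul1mx.
by rewrite mul_row_col mulmxN !mxE.
Qed.

Lemma unit_col_dot n (i j : nat) :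
  ((\col_(k < n) (k == i :> nat)%:R)^T *m (\col_(k < n) (k == j :> nat)%:R)) 0 0
    = ((i == j) && (i < n)%N)%:R :> R.
Proof.
rewrite mxE; have [ni|ni] := ltnP i n; last first.
  by rewrite andbF big1 // => k _; rewrite !mxE; case: eqP => [ki|]; rewrite ?mul0r //; have := ltn_ord k; lia.
rewrite (bigD1 (Ordinal ni)) //= !mxE eqxx mul1r big1 ?addr0 ?andbT // => k kn.
by rewrite !mxE -[i]/(val (Ordinal ni)) (inj_eq val_inj) (negPf kn) mul0r.
Qed.

Lemma ip_pp i j : ip (pos_vec i) (pos_vec j) = ((i == j) && (i < p.+2)%N)%:R.
Proof. by rewrite ip_col unit_col_dot trmx0 mul0mx mxE subr0. Qed.
Lemma ip_mm i j : ip (neg_vec i) (neg_vec j) = - ((i == j) && (i < q.+2)%N)%:R.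
Proof. by rewrite ip_col unit_col_dot trmx0 mul0mx mxE sub0r. Qed.
Lemma ip_pm i j : ip (pos_vec i) (neg_vec j) = 0.
Proof. by rewrite ip_col trmx0 mul0mx mulmx0 mxE subr0. Qed.
Lemma ip_mp i j : ip (neg_vec i) (pos_vec j) = 0.
Proof. by rewrite ip_sym ip_pm. Qed.

Lemma col_span n (c : 'cV[R]_n) : \sum_(i < n) c i 0 *: \col_(k < n) (k == i :> nat)%:R = c.
Proof.
apply/colP => k; rewrite summxE (bigD1 k) //= !mxE eqxx mulr1 big1 ?addr0 // => i ik.
by rewrite !mxE (inj_eq val_inj) eq_sym (negPf ik) mulr0.
Qed.

Lemma unit_col_coord n (c : 'cV[R]_n) (i : 'I_n) :
  ((\col_(k < n) (k == i :> nat)%:R)^T *m c) 0 0 = c i 0.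
Proof.
rewrite mxE (bigD1 i) //= !mxE eqxx mul1r big1 ?addr0 // => k ki.
by rewrite !mxE (inj_eq val_inj) (negPf ki) mul0r.
Qed.

Lemma ip_ep (i : 'I_p.+2) (a : 'cV_p.+2) (b : 'cV_q.+2) : ip (pos_vec i) (col_mx a b) = a i 0.
Proof. by rewrite ip_col trmx0 mul0mx unit_col_coord mxE subr0. Qed.
Lemma ip_em (i : 'I_q.+2) (a : 'cV_p.+2) (b : 'cV_q.+2) : ip (neg_vec i) (col_mx a b) = - b i 0.
Proof. by rewrite ip_col trmx0 mul0mx unit_col_coord mxE sub0r. Qed.

Lemma std_span x : x = \sum_(i < p.+2) ip (pos_vec i) x *: pos_vec i - \sum_(j < q.+2) ip (neg_vec j) x *: neg_vec j.
Proof.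
rewrite -[x]vsubmxK; set a := usubmx x; set b := dsubmx x.
have E1 : \sum_(i < p.+2) ip (pos_vec i) (col_mx a b) *: pos_vec i = col_mx a 0.
  under eq_bigr do rewrite ip_ep; rewrite -[in RHS](col_span a).
  elim/big_rec2: _ => [|i y _ _ ->]; first by rewrite col_mx0.
  by rewrite scale_col_mx add_col_mx scaler0 addr0.
have E2 : \sum_(j < q.+2) ip (neg_vec j) (col_mx a b) *: neg_vec j = - col_mx 0 b.
  under eq_bigr do rewrite ip_em; rewrite -[in RHS](col_span b).
  elim/big_rec2: _ => [|i y _ _ ->]; first by rewrite col_mx0 oppr0.
  by rewrite scaleNr -opprD scale_col_mx add_col_mx scaler0 addr0.
by rewrite E1 E2 opprK add_col_mx addr0 add0r.
Qed.
End Wedge.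

Section SoModel.
Variables (R : realFieldType) (p q : nat).
Local Notation N := (p.+2 + q.+2)%N.
Local Notation so u := (@in_so R p.+2 q.+2 u).
Local Notation r := (so_rank p q).
Local Notation m := (maxn p q).+2.
Local Notation ep := (@pos_vec R p q).
Local Notation em := (@neg_vec R p q).
Implicit Types (x y z : 'cV[R]_N) (u v : gl R N) (s : bool) (i j : nat) (t : 'rV[R]_r).

Lemma mulmx_ext (A B : 'M[R]_N) : (forall x, A *m x = B *m x) -> A = B.
Proof.
move=> AB; apply/matrixP => i j.
by have := AB (delta_mx j 0); rewrite -!colE => /colP/(_ i); rewrite !mxE.
Qed.

(** The second terms of the wedges sum up to minus the adjoint of [u], which is [u] again by
    skewness; hence the factor 2. *)
Lemma so_wd_sum u : so u -> 2 *: u =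
  \sum_(i < p.+2) wd ((u : 'M_N) *m ep i) (ep i) - \sum_(j < q.+2) wd ((u : 'M_N) *m em j) (em j).
Proof.
move=> su; apply: mulmx_ext => z.
rewrite -scalemxAl scaler_nat mulr2n mulmxBl !mulmx_suml.
under eq_bigr do rewrite wdE so_ip // scaleNr opprK.
under [X in _ - X]eq_bigr do rewrite wdE so_ip // scaleNr opprK.
rewrite !big_split /= opprD addrACA; congr (_ + _); last by rewrite -std_span.
rewrite {1}(std_span z) mulmxBr !mulmx_sumr.
by congr (_ - _); apply: eq_bigr => i _; rewrite -scalemxAr.
Qed.

(** By [so_wd_sum] the wedges of vectors from a spanning family [F] span so; that [F] spans is
    expressed as an induction principle. *)
Lemma so_ind (Q : gl R N -> Prop) (F : 'cV[R]_N -> Prop) : linear_closed_pred Q ->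
  (forall Q' : 'cV[R]_N -> Prop, linear_closed_pred Q' -> (forall x, F x -> Q' x) -> forall x, Q' x) ->
  (forall x y, F x -> F y -> Q (wd x y)) -> forall u, so u -> Q u.
Proof.
move=> QL Fspan QF; have [Q0 QD QB QZ] := linear_closed_conv QL.
have QW x y : Q (wd x y).
  move: x; apply: (Fspan) => [|x Fx].
    by split=> [|a x z hx hz]; [rewrite wd0l|rewrite wdDl wdZl; apply: (proj2 QL)].
  move: y; apply: (Fspan) => [|y Fy]; last exact: QF.
  by split=> [|a y z hx hz]; [rewrite wd0r|rewrite wdDr wdZr; apply: (proj2 QL)].
move=> u su; rewrite -[u](scalerK (a := 2)) ?pnatr_eq0 // so_wd_sum //.
apply: (QZ); apply: (QB); elim/big_rec: _ => // i x _ Qx; apply: (QD) => //; exact: QW.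
Qed.

Definition sgn s : R := if s then 1 else -1.
(** For i below the rank, an isotropic eigenvector of the boosts. For larger i one of the two terms
    is 0 and the vector is, up to sign, a basis vector of the definite part, of weight 0. *)
Definition null_vec s i : 'cV[R]_N := ep i + sgn s *: em i.

Lemma sgn_sqr s : sgn s * sgn s = 1.
Proof. by case: s; rewrite /sgn ?mulr1 ?mulrNN ?mulr1. Qed.

Lemma wv_ind (Q : 'cV[R]_N -> Prop) : linear_closed_pred Q ->
  (forall s i, (i < m)%N -> Q (null_vec s i)) -> forall x, Q x.
Proof.
move=> QL Qw x; have [Q0 QD QB QZ] := linear_closed_conv QL.
have e1 i : ep i = 2^-1 *: (null_vec true i + null_vec false i) by rewrite /null_vec /sgn; linear_field.
have e2 i : em i = 2^-1 *: (null_vec true i - null_vec false i) by rewrite /null_vec /sgn; linear_field.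
rewrite (std_span x); apply: (QB); apply: linear_closed_sum => // i _; apply: (QZ).
  by rewrite e1; apply/QZ/QD; apply: Qw; have := ltn_ord i; lia.
by rewrite e2; apply/QZ/QB; apply: Qw; have := ltn_ord i; lia.
Qed.

Lemma ip_wv s i s' j : ip (null_vec s i) (null_vec s' j) =
  (i == j)%:R * ((i < p.+2)%N%:R - sgn s * sgn s' * (i < q.+2)%N%:R).
Proof.
rewrite /null_vec !(ipDl, ipDr, ipZl, ipZr) ip_pp ip_mm ip_pm ip_mp.
by rewrite -!mulnb !natrM; ring.
Qed.

(** The parameters are extended by 0 beyond the rank, so that one weight formula holds for all
    [null_vec s i]. *)
Definition boost_coef t i : R := if (i < r)%N then t 0 (inord i) else 0.

Let B t : 'M[R]_(p.+2, q.+2) := \matrix_(i, j)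
    \sum_l (t 0 l *+ ((i == l :> nat) && (j == l :> nat))).

Lemma boost_entry t (i : 'I_p.+2) (j : 'I_q.+2) : B t i j = (i == j :> nat)%:R * boost_coef t i.
Proof.
rewrite mxE /boost_coef; case: ltnP => ir; last first.
  rewrite mulr0 big1 // => l _; case: eqP => [il|] //=.
  by have := ltn_ord l; rewrite -il => /(leq_trans ir); rewrite ltnn.
rewrite (bigD1 (inord (val i))) //= inordK // eqxx /= big1 ?addr0 => [|l li].
  by rewrite eq_sym mulrC mulr_natr.
case: eqP => //= il; case/eqP: li; apply: val_inj; rewrite /= inordK //.
Qed.

Lemma boost_ep t i : so_boost t *m ep i = boost_coef t i *: em i.
Proof.
rewrite /so_boost -/(B t) /pos_vec /neg_vec mul_block_col ?(mul0mx, mulmx0, addr0, add0r) scale_col_mx scaler0.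
congr col_mx; apply/colP => j; rewrite !mxE.
have [ip|ip] := ltnP i p.+2; last first.
  rewrite big1 => [|k _]; last by rewrite !mxE; case: eqP => [ki|]; rewrite ?mulr0 //; have := ltn_ord k; lia.
  by rewrite /boost_coef ifF ?mul0r // /so_rank; apply/negbTE; rewrite -leqNgt; lia.
rewrite (bigD1 (Ordinal ip)) //= [X in _ * X]mxE eqxx mulr1 mxE boost_entry /= big1 ?addr0.
  by rewrite mulrC eq_sym.
by move=> k ki; rewrite [X in _ * X]mxE -[i]/(val (Ordinal ip)) (inj_eq val_inj) (negPf ki) mulr0.
Qed.

Lemma boost_em t i : so_boost t *m em i = boost_coef t i *: ep i.
Proof.
rewrite /so_boost -/(B t) /pos_vec /neg_vec mul_block_col ?(mul0mx, mulmx0, addr0, add0r) scale_col_mx scaler0.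
congr col_mx; apply/colP => j; rewrite !mxE.
have [ip|ip] := ltnP i q.+2; last first.
  rewrite big1 => [|k _]; last by rewrite !mxE; case: eqP => [ki|]; rewrite ?mulr0 //; have := ltn_ord k; lia.
  by rewrite /boost_coef ifF ?mul0r // /so_rank; apply/negbTE; rewrite -leqNgt; lia.
rewrite (bigD1 (Ordinal ip)) //= [X in _ * X]mxE eqxx mulr1 boost_entry /= big1 ?addr0.
  by rewrite mulrC; case: eqP => [->|]; rewrite ?mulr0.
by move=> k ki; rewrite [X in _ * X]mxE -[i]/(val (Ordinal ip)) (inj_eq val_inj) (negPf ki) mulr0.
Qed.

Lemma boost_wv t s i : so_boost t *m null_vec s i = (sgn s * boost_coef t i) *: null_vec s i.
Proof.
rewrite /null_vec mulmxDr -scalemxAr boost_ep boost_em scalerDr !scalerA addrC.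
by rewrite mulrAC sgn_sqr mul1r.
Qed.

Lemma so_boostP t : so (so_boost t : gl R N).
Proof.
rewrite /in_so /so_boost /sig_form -/(B t) tr_block_mx !trmx0 trmxK !mulmx_block.
rewrite !mulmx0 !mul0mx !addr0 !add0r !mulmxN !mulNmx !mulmx1 !mul1mx.
by rewrite add_block_mx !addr0 addNr subrr block_mx0.
Qed.

Lemma tt_linear i : scalar (boost_coef^~ i).
Proof. by move=> a t s; rewrite /boost_coef; case: ifP => _; rewrite ?mxE // mulr0 addr0. Qed.

Lemma so_boost_linear : linear (@so_boost R p q : 'rV[R]_r -> gl R N).
Proof.
move=> a t s; apply: mulmx_ext; apply: wv_ind.
  by split=> [|c x y hx hy]; rewrite ?mulmx0 // !mulmxDr -!scalemxAr hx hy.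
move=> b i _; rewrite mulmxDl -scalemxAl !boost_wv tt_linear scalerA -scalerDl.
by congr (_ *: _); ring.
Qed.
End SoModel.

(** * Restricted roots and Cartan subspace of so(p + 2, q + 2) *)

Section SoRoots.
Variables (R : realFieldType) (p q : nat).
Local Notation N := (p.+2 + q.+2)%N.
Local Notation so u := (@in_so R p.+2 q.+2 u).
Local Notation r := (so_rank p q).
Local Notation m := (maxn p q).+2.
Local Notation ep := (@pos_vec R p q).
Local Notation em := (@neg_vec R p q).
Local Notation wv := (@null_vec R p q).
Local Notation tt := (@boost_coef R p q).
Local Notation H := (@so_boost R p q : 'rV[R]_r -> gl R N).
Implicit Types (x y z : 'cV[R]_N) (u v : gl R N) (s : bool) (t : 'rV[R]_r).

Lemma so_rootE (i : 'I_r) t : so_root i t = if (i.+1 < r)%N then tt t i - tt t i.+1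
  else if p == q then tt t i.-1 + tt t i else tt t i.
Proof.
have tE (j : 'I_r) : t 0 j = tt t j by rewrite /boost_coef ltn_ord inord_val.
have tI j : (j < r)%N -> t 0 (inord j) = tt t j by move=> jr; rewrite /boost_coef jr.
rewrite /so_root tE; case: ifP => ir; first by rewrite tI.
by rewrite tI //; have := ltn_ord i; lia.
Qed.

Definition cone (l : 'rV[R]_r -> R) :=
  exists n : 'I_r -> nat, forall t, l t = \sum_i (n i)%:R * so_root i t.

Lemma cone_ext l l' : cone l -> (forall t, l' t = l t) -> cone l'.
Proof. by move=> [n nE] ll'; exists n => t; rewrite ll'. Qed.

Lemma cone_add l l' : cone l -> cone l' -> cone (fun t => l t + l' t).
Proof.
move=> [n nE] [n' n'E]; exists (fun i => (n i + n' i)%N) => t.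
by rewrite nE n'E -big_split; apply: eq_bigr => i _; rewrite natrD mulrDl.
Qed.

Lemma cone_root (i : 'I_r) : cone (so_root i).
Proof.
exists (fun j => (j == i : nat)) => t; rewrite (bigD1 i) //= eqxx mul1r big1 ?addr0 // => j ji.
by rewrite (negPf ji) mul0r.
Qed.

Lemma cone_diff i j : (i < j < r)%N -> cone (fun t => tt t i - tt t j).
Proof.
move=> /andP[]; elim: j => // j IH; rewrite ltnS => ij jr.
have last : cone (fun t => tt t j - tt t j.+1).
  by apply: cone_ext (cone_root (Ordinal (ltnW jr))) _ => t; rewrite so_rootE /= jr.
move: ij; rewrite leq_eqVlt => /orP[/eqP-> //|ij].
by apply: cone_ext (cone_add (IH ij (ltnW jr)) last) _ => t; rewrite subrKA.
Qed.

Lemma rank_last : (r.-1 < r)%N. Proof. by []. Qed.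

Lemma cone_last : cone (fun t => if p == q then tt t r.-2 + tt t r.-1 else tt t r.-1).
Proof. by apply: cone_ext (cone_root (Ordinal rank_last)) _ => t; rewrite so_rootE /= ltnn. Qed.

Lemma cone_one i : (i < r)%N -> p != q -> cone (fun t => tt t i).
Proof.
move=> ir pq; have := cone_last; rewrite (negPf pq) => cl.
have [->|il] := eqVneq i r.-1; first exact: cl.
have ilr : (i < r.-1 < r)%N by lia.
by apply: cone_ext (cone_add (cone_diff ilr) cl) _ => t; rewrite subrK.
Qed.

(** For p = q the last simple root is itself the sum eps_{r-1} + eps_r, from which the other sums
    arise by adding differences; for p <> q every eps_i is already in the cone. *)
Lemma cone_sum i j : (i < j < r)%N -> cone (fun t => tt t i + tt t j).
Proof.
move=> /andP[ij jr]; have [pq|pq] := boolP (p == q); last first.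
  by apply: cone_add; apply: cone_one; rewrite ?(ltn_trans ij).
have := cone_last; rewrite pq => cl.
have cj : cone (fun t => tt t r.-2 + tt t j).
  have [-> //|jl] := eqVneq j r.-1.
  have jlr : (j < r.-1 < r)%N by lia.
  by apply: cone_ext (cone_add (cone_diff jlr) cl) _ => t; ring.
have [-> //|il] := eqVneq i r.-2.
have ilr : (i < r.-2 < r)%N by lia.
by apply: cone_ext (cone_add (cone_diff ilr) cj) _ => t; ring.
Qed.

Definition so_index : finType := ((bool * 'I_m) * (bool * 'I_m))%type.
Definition so_vec (a : so_index) : gl R N := wd (wv a.1.1 a.1.2) (wv a.2.1 a.2.2).
(** The wedge of two equal vectors is 0 and may be given any weight; the weight 0 falls under the
    first case of [so_wt_root]. *)
Definition so_wt (a : so_index) t : R :=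
  if a.1 == a.2 then 0 else sgn R a.1.1 * tt t a.1.2 + sgn R a.2.1 * tt t a.2.2.

Lemma so_wt_root (a : so_index) : (forall t, so_wt a t = 0) \/
  exists n : 'I_r -> nat, (forall t, so_wt a t = \sum_i (n i)%:R * so_root i t) \/
                          (forall t, so_wt a t = - \sum_i (n i)%:R * so_root i t).
Proof.
case: a => [[s i] [s' j]]; rewrite /so_wt /=; case: eqP => [_|ne]; first by left.
pose good (l : 'rV[R]_r -> R) := (forall t, l t = 0) \/
  exists n : 'I_r -> nat, (forall t, l t = \sum_i (n i)%:R * so_root i t) \/
                          (forall t, l t = - \sum_i (n i)%:R * so_root i t).
have good_ext l l' : good l -> (forall t, l' t = l t) -> good l'.
  move=> [l0|[n nE]] ll'; first by left=> t; rewrite ll'.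
  by right; exists n; case: nE => nE; [left|right] => t; rewrite ll'.
have goodp l : cone l -> good l by move=> [n nE]; right; exists n; left.
have goodn l : cone l -> good (fun t => - l t).
  by move=> [n nE]; right; exists n; right=> t; rewrite nE.
have tt0 i' t : (r <= i')%N -> tt t i' = 0 by rewrite /boost_coef ltnNge => ->.
suff lt b b' (a a' : 'I_m) : (a < a')%N -> good (fun t => sgn R b * tt t a + sgn R b' * tt t a').
  have [ij|ji|ij] := ltngtP i j; first exact: lt.
    by apply: good_ext (lt s' s _ _ ji) _ => t; rewrite addrC.
  left=> t; have -> : i = j by apply: val_inj.
  by move: ne; rewrite (val_inj ij); case: s s' => [] [] //= _; rewrite /sgn; ring.
move=> aa'; have [ar|ar] := ltnP a' r.
  have ar' : (a < a' < r)%N by rewrite aa'.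
  case: b b' => [] []; rewrite /sgn.
  - by apply: good_ext (goodp _ (cone_sum ar')) _ => t; ring.
  - by apply: good_ext (goodp _ (cone_diff ar')) _ => t; ring.
  - by apply: good_ext (goodn _ (cone_diff ar')) _ => t; ring.
  - by apply: good_ext (goodn _ (cone_sum ar')) _ => t; ring.
have [ar'|ar'] := ltnP a r; last by left=> t; rewrite !tt0 // !mulr0 addr0.
have pq : p != q by apply/eqP => pq; have := ltn_ord a'; move: ar; rewrite /so_rank; lia.
case: b; rewrite /sgn.
- by apply: good_ext (goodp _ (cone_one ar' pq)) _ => t; rewrite (tt0 a') //; ring.
- by apply: good_ext (goodn _ (cone_one ar' pq)) _ => t; rewrite (tt0 a') //; ring.
Qed.

(** Applied to the null vector opposite to the first factor, the wedge gives a nonzero multiple of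
    the second factor, whose product with its own opposite is nonzero. *)
Lemma so_vec_neq0 s i s' j : (i < r)%N -> (j < m)%N -> i != j -> wd (wv s i) (wv s' j) != 0.
Proof.
move=> ir jm ij; apply/eqP => /(congr1 (fun u : gl R N => (u : 'M_N) *m wv (~~ s) i)).
rewrite mul0mx wdE !ip_wv (eq_sym j) (negPf ij) eqxx mul0r scale0r mul1r sub0r.
move/(congr1 (fun y => ip y (wv (~~ s') j))); rewrite ip0l ipNl ipZl ip_wv eqxx mul1r.
have sg b : sgn R b * sgn R (~~ b) = -1 by case: b; rewrite /sgn ?mulr1 ?mul1r.
rewrite !sg !mulN1r !opprK; have -> : (i < p.+2)%N by move: ir; rewrite /so_rank; lia.
have -> : (i < q.+2)%N by move: ir; rewrite /so_rank; lia.
have : (j < p.+2)%N || (j < q.+2)%N by move: jm; lia.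
by case: (j < p.+2)%N; case: (j < q.+2)%N => //= _ /eqP;
   rewrite oppr_eq0 mulf_eq0 -!natrD !pnatr_eq0.
Qed.

Lemma tt_row i (g : nat -> R) : (i < r)%N -> tt (\row_k g k) i = g i.
Proof. by move=> ir; rewrite /boost_coef ir mxE inordK. Qed.

Lemma so_root_dual (i : 'I_r) : exists t, forall j, so_root j t = (i == j)%:R.
Proof.
(* Fundamental coweights: i + 1 ones followed by zeros, except that in type D the last two have all
   entries 1/2 up to the sign of the last entry. *)
pose g := if (p == q) && (r.-2 <= i)%N then
    fun l : nat => if l == r.-1 then (if i == r.-1 :> nat then 2^-1 else - 2^-1) else 2^-1
  else fun l : nat => ((l <= i)%N%:R : R).
exists (\row_k g k) => j; rewrite so_rootE.
have r2 : (1 < r)%N by [].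
have ir := ltn_ord i; have jr := ltn_ord j.
have -> : (i == j) = (i == j :> nat) by [].
rewrite (tt_row g jr).
case: ifP => j1; first rewrite (tt_row g j1).
  rewrite /g; case: ifP => [/andP[pq ri]|].
    have -> : (j == r.-1 :> nat) = false by apply/eqP; lia.
    case: (eqVneq j.+1 r.-1) => jr1; case: (eqVneq (i : nat) r.-1) => ir1;
      case: (eqVneq (i : nat) j) => ij; try lia; by rewrite /=; field.
  move=> /negbT; rewrite negb_and => h.
  case: (leqP j i) => ji; case: (leqP j.+1 i) => ji1; case: (eqVneq (i : nat) j) => ij;
    try lia; by rewrite ?subrr ?subr0.
have jl : (j : nat) = r.-1 by lia.
case: ifP => pq; last first.
  by rewrite /g pq /=; case: (leqP j i) => ri; case: (eqVneq (i : nat) j) => ij //; lia.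
have j2 : (j.-1 < r)%N by lia.
rewrite (tt_row g j2) /g pq /=; case: ifP => ri.
  have -> : (j.-1 == r.-1) = false by apply/eqP; lia.
  have -> : (j == r.-1 :> nat) by apply/eqP; lia.
  have -> : (i == r.-1 :> nat) = (i == j :> nat) by rewrite jl.
  by case: (eqVneq (i : nat) j) => _ /=; field.
move/negbT: ri; rewrite -ltnNge => ri.
have ij : (i < j.-1)%N by move: jl ri; rewrite /so_rank /=; lia.
have -> : (j.-1 <= i)%N = false by apply/negbTE; rewrite -ltnNge.
have -> : (j <= i)%N = false by apply/negbTE; rewrite -ltnNge; lia.
have -> : (i == j :> nat) = false by apply/eqP; lia.
by rewrite addr0.
Qed.

Lemma ip_expand x : ip x x = \sum_(i < p.+2) ip (ep i) x ^+ 2 - \sum_(j < q.+2) ip (em j) x ^+ 2.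
Proof.
rewrite {2}(std_span x) ipDr ipNr.
have lin n (F : 'I_n -> 'cV[R]_N) (c : 'I_n -> R) :
    ip x (\sum_i c i *: F i) = \sum_i c i * ip (F i) x.
  elim/big_rec2: _ => [|i a b _ <-]; first by rewrite ip0r.
  by rewrite ipDr ipZr ip_sym.
by rewrite !lin.
Qed.

(** Outside the boost planes only basis vectors of one sign remain, so the form is definite
    there. *)
Lemma ip_definite x : (forall i, (i < r)%N -> ip (ep i) x = 0 /\ ip (em i) x = 0) ->
  ip x x = 0 -> x = 0.
Proof.
move=> x0; rewrite ip_expand => xx.
have sq n (F : 'I_n -> R) : \sum_i F i ^+ 2 = 0 -> forall i, F i = 0.
  move=> s0 i; apply/eqP; rewrite -sqrf_eq0; apply/eqP.
  by apply: (psumr_eq0P _ s0) => // k _; exact: sqr_ge0.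
have [pq|pq] := leqP p q.
  have a0 (i : 'I_p.+2) : ip (ep i) x = 0.
    by have [] := x0 i => //; rewrite /so_rank; have := ltn_ord i; lia.
  move: xx; rewrite big1 => [|i _]; last by rewrite a0 expr0n.
  rewrite sub0r => /eqP; rewrite oppr_eq0 => /eqP /sq b0.
  by rewrite (std_span x) !big1 ?subr0 // => i _; rewrite ?a0 ?b0 scale0r.
have b0 (i : 'I_q.+2) : ip (em i) x = 0.
  by have [] := x0 i => //; rewrite /so_rank; have := ltn_ord i; lia.
move: xx; rewrite [X in _ - X]big1 => [|i _]; last by rewrite b0 expr0n.
rewrite subr0 => /sq a0.
by rewrite (std_span x) !big1 ?subr0 // => i _; rewrite ?a0 ?b0 scale0r.
Qed.

End SoRoots.

Section SoMax.
Variables (R : realFieldType) (p q : nat).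
Local Notation N := (p.+2 + q.+2)%N.
Local Notation so u := (@in_so R p.+2 q.+2 u).
Local Notation r := (so_rank p q).
Local Notation m := (maxn p q).+2.
Local Notation ep := (@pos_vec R p q).
Local Notation em := (@neg_vec R p q).
Local Notation wv := (@null_vec R p q).
Local Notation tt := (@boost_coef R p q).
Local Notation H := (@so_boost R p q : 'rV[R]_r -> gl R N).
Implicit Types (x y z : 'cV[R]_N) (u v : gl R N) (s : bool) (t : 'rV[R]_r).

Lemma rank_lt_p i : (i < r)%N -> (i < p.+2)%N.
Proof. by rewrite /so_rank; lia. Qed.
Lemma rank_lt_q i : (i < r)%N -> (i < q.+2)%N.
Proof. by rewrite /so_rank; lia. Qed.

Lemma boost_delta i x : (i < r)%N ->
  H (\row_k (k == i :> nat)%:R) *m x = ip (ep i) x *: em i - ip (em i) x *: ep i.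
Proof.
move=> ir; move: x; apply: wv_ind => [|s j _].
  split=> [|a x y hx hy]; first by rewrite mulmx0 !ip0r !scale0r subrr.
  by rewrite mulmxDr -scalemxAr hx hy !(ipDr, ipZr); linear_ring.
rewrite boost_wv /wv !(ipDr, ipZr) ip_pp ip_pm ip_mp ip_mm rank_lt_p // rank_lt_q // !andbT.
have [<-|ij] := eqVneq i j; last first.
  rewrite (_ : tt _ j = 0); first by rewrite !(mulr0, scale0r, oppr0, addr0).
  rewrite /boost_coef; case: ifP => // jr; rewrite mxE inordK // eq_sym.
  by rewrite (negPf ij).
rewrite (tt_row (fun k => (k == i)%:R) ir) eqxx; have := sgn_sqr R s; move: (sgn R s) => c cc.
have -> : (c * 1) *: (ep i + c *: em i) = (c * 1) *: ep i + (c * c) *: em i by linear_ring.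
by rewrite cc /=; linear_ring.
Qed.

(** The boost in the i-th plane commutes with [u] and has [null_vec s i] as eigenvector; the
    eigenspace is a line, so [u] preserves it. *)
Lemma so_centralizer_weight u s i : so u -> (forall t, [lie H t, u] = 0) -> (i < r)%N ->
  (u : 'M_N) *m wv s i = ip (ep i) ((u : 'M_N) *m wv s i) *: wv s i.
Proof.
move=> su hu ir; set v := (u : 'M_N) *m wv s i.
have : H (\row_k (k == i :> nat)%:R) *m v = sgn R s *: v.
  have /eqP := hu (\row_k (k == i :> nat)%:R); rewrite gl_lieE subr_eq0 => /eqP hu'.
  rewrite /v mulmxA hu' -mulmxA boost_wv (tt_row (fun k => (k == i)%:R) ir) eqxx mulr1 -scalemxAr.
  by [].
rewrite boost_delta // => hv.
have vE : v = sgn R s *: (ip (ep i) v *: em i - ip (em i) v *: ep i).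
  by rewrite hv scalerA sgn_sqr scale1r.
have aE : ip (ep i) v = - (sgn R s * ip (em i) v).
  rewrite {1}vE !(ipZr, ipDr, ipNr) ip_pm ip_pp rank_lt_p // eqxx /=; ring.
rewrite {1}vE /null_vec scalerBr !scalerA.
have -> : - (sgn R s * ip (em i) v *: ep i) = ip (ep i) v *: ep i by rewrite aE scaleNr.
rewrite addrC scalerDr scalerA; congr (_ + _ *: _); exact: mulrC.
Qed.

(** For a suitable boost H t the difference k = u - H t kills the null vectors of all boost planes.
    If ad k is diagonalizable, an eigenvector w of it maps the null vector n to an eigenvector g = w
    n of k; for a nonzero eigenvalue g is isotropic and orthogonal to the boost planes, hence 0. So
    k kills everything that so makes out of n, and this is enough for k = 0. *)
Lemma so_max u : so u -> (forall t, [lie H t, u] = 0) ->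
  exists t, ad_diagonalizable_on (fun v : gl R N => so v) (u - H t) -> u = H t.
Proof.
move=> su hu; pose a i := ip (ep i) ((u : 'M_N) *m wv true i).
pose t := \row_(k < r) a k; exists t => -[S [Sev Sspan]].
set k := u - H t; have sk : so k.
  have [_ _ B _] := linear_closed_conv (@so_linear R p q).
  by apply: B => //; exact: so_boostP.
have kw s i : (i < r)%N -> (k : 'M_N) *m wv s i = 0.
  move=> ir; rewrite mulmxBl boost_wv (tt_row a ir).
  have ut : (u : 'M_N) *m wv true i = a i *: wv true i by exact: so_centralizer_weight.
  case: s; first by rewrite ut mul1r subrr.
  have uf := so_centralizer_weight false su hu ir; move: uf; set c := ip _ _ => uf.
  have := so_ip (wv true i) (wv false i) su; rewrite ut uf ipZl ipZr ip_wv eqxx.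
  rewrite rank_lt_p // rank_lt_q // /sgn /= => h.
  by rewrite (_ : c = - a i) ?mulN1r ?subrr //; lra.
have r0 : (0 < r)%N by [].
have kker v : so v -> (k : 'M_N) *m ((v : 'M_N) *m wv true 0) = 0.
  suff : forall v, v \in <<S>>%VS -> (k : 'M_N) *m ((v : 'M_N) *m wv true 0) = 0.
    by move=> h sv; apply: h; apply: Sspan.
  move=> {}v vS; have := coord_span (X := in_tuple S) vS => ->.
  rewrite mulmx_suml mulmx_sumr big1 // => l _; rewrite -scalemxAl -scalemxAr.
  have lS : (in_tuple S)`_l \in S by apply: mem_nth.
  move: (in_tuple S)`_l lS => w /Sev[sw [c kz]].
  suff -> : (k : 'M_N) *m ((w : 'M_N) *m wv true 0) = 0 by rewrite scaler0.
  set g := (w : 'M_N) *m wv true 0.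
  have kg : (k : 'M_N) *m g = c *: g.
    have /(congr1 (fun w : gl R N => (w : 'M_N) *m wv true 0)) := kz.
    rewrite gl_lieE mulmxBl -!mulmxA kw // mulmx0 subr0 -/g -scalemxAl.
    by [].
  have [c0|cn0] := eqVneq c 0; first by rewrite kg c0 scale0r.
  suff -> : g = 0 by rewrite mulmx0.
  apply: ip_definite => [i ir|].
    have w0 s : ip (wv s i) g = 0.
      apply: (mulfI cn0); rewrite mulr0 -ipZr -kg.
      by apply: oppr_inj; rewrite -so_ip // kw // ip0l oppr0.
    have := w0 true; have := w0 false; rewrite /null_vec !(ipDl, ipZl) /sgn => h1 h2.
    by split; lra.
  apply: (mulfI cn0); rewrite mulr0 -ipZr -kg.
  have := so_ip g g sk; rewrite [LHS]ip_sym; lra.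
apply/eqP; rewrite -subr_eq0 -/k; apply/eqP; apply: mulmx_ext => x; rewrite mul0mx.
(* This wedge maps the null vector to 2 x minus a multiple of [wv false 0], which [k] kills. *)
have := kker (wd x (wv false 0)) (so_wd _ _).
rewrite wdE mulmxBr -!scalemxAr kw // scaler0 subr0 ip_wv eqxx /sgn => /eqP.
rewrite scaler_eq0 => /orP[/eqP|/eqP //]; rewrite /= => h; exfalso; lra.
Qed.

Lemma so_root_model :
  root_model (fun u : gl R N => so u) H (@so_root R p q) (@so_vec R p q) (@so_wt R p q).
Proof.
have Hw t s i : H t *m wv s i = (sgn R s * tt t i) *: wv s i by exact: boost_wv.
have sqr := @sgn_sqr R.
split.
- exact: so_boost_linear.
- move=> t Ht; apply/rowP => i; rewrite mxE.
  have ir := ltn_ord i; have := boost_ep t i; rewrite (_ : so_boost t = 0) // mul0mx.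
  move/(congr1 (ip (em i))); rewrite ip0r ipZr ip_mm eqxx rank_lt_q //= /boost_coef ir inord_val.
  by move/esym => h; lra.
- move=> t s; apply: mulmx_ext; apply: wv_ind => [|b i _].
    by split=> [|a x y hx hy]; rewrite ?mulmx0 // !mulmxDr -!scalemxAr hx hy.
  rewrite gl_lieE mulmxBl -!mulmxA !Hw -!scalemxAr !Hw mul0mx !scalerA mulrC subrr.
  by [].
- by move=> t; exact: so_boostP.
- by move=> a; exact: so_wd.
- move=> t [[s i] [s' j]]; rewrite /so_vec br_so_wd; last exact: so_boostP.
  rewrite !Hw wdZl wdZr -scalerDl /so_wt /=; case: eqP => [[-> ->]|//].
  by rewrite wdxx !scaler0.
- pose F x := exists s (i : 'I_m), x = wv s i.
  apply: (so_ind (F := F)) => [||_ _ [s [i ->]] [s' [j ->]]].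
  + split=> [|a u w [c ->] [d ->]].
      by exists (fun=> 0); rewrite big1 // => b _; rewrite scale0r.
    exists (fun b => a * c b + d b); rewrite scaler_sumr -big_split; apply: eq_bigr => b _.
    by rewrite scalerDl scalerA.
  + move=> Q QL QF; apply: wv_ind => // s i im; apply: QF.
    by exists s, (Ordinal im).
  + exists (fun b => (b == ((s, i), (s', j)))%:R).
    rewrite (bigD1 ((s, i), (s', j))) //= eqxx scale1r big1 ?addr0 // => b bn.
    by rewrite (negPf bn) scale0r.
- move=> i a t s; rewrite !so_rootE.
  by case: ifP => _; [|case: ifP => _]; rewrite ?tt_linear //; ring.
- exact: so_wt_root.
- move=> i; have ir := ltn_ord i.
  have mr : (r <= m)%N by rewrite /so_rank; lia.
  have im : (i < m)%N by apply: leq_trans mr.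
  have [i1|i1] := boolP (i.+1 < r)%N.
    have im1 : (i.+1 < m)%N by apply: leq_trans mr.
    exists ((true, Ordinal im), (false, Ordinal im1)); split.
      by apply: so_vec_neq0 => //=; lia.
    by move=> t; rewrite /so_wt so_rootE i1 /= /sgn mul1r mulN1r.
  have [pq|pq] := boolP (p == q).
    have im1 : (i.-1 < m)%N by lia.
    have r2 : (1 < r)%N by [].
    exists ((true, Ordinal im1), (true, Ordinal im)); split.
      by apply: so_vec_neq0 => //=; lia.
    move=> t; rewrite /so_wt so_rootE (negPf i1) pq /= /sgn !mul1r ifF //.
    by apply/eqP => -[]; lia.
  (* For p <> q the root eps_r comes from the wedge of a null vector of the last boost plane with an
     unpaired basis vector, of weight 0. *)
  have rm : (r < m)%N by rewrite /so_rank; lia.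
  exists ((true, Ordinal im), (true, Ordinal rm)); split.
    by apply: so_vec_neq0 => //=; apply/eqP; lia.
  move=> t; rewrite /so_wt so_rootE (negPf i1) (negPf pq) /= /sgn !mul1r ifF.
    by rewrite [X in _ + X](_ : _ = 0) ?addr0 // /boost_coef ltnn.
  by apply/eqP => -[]; lia.
- exact: so_root_dual.
- exact: so_max.
Qed.
End SoMax.

(** * From brackets in negative degree to the two conditions *)

Section ForwardConditions.
Variables (R : realFieldType) (L : lieAlgType R) (k : nat) (q : int -> {vspace L}).
Variables (m : nat) (e f : L) (v : 'Hom('rV[R]_m, L)) (b : 'rV[R]_m -> 'rV[R]_m -> R).
Local Notation D := (adn e).
Implicit Types (x y z : L) (u w : 'rV[R]_m).
Hypotheses (kg : kgrading k q) (k3 : (3 <= k)%N).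
Hypotheses (e1 : e \in q (-1)) (v1 : forall w, v w \in q (-1)).
Hypothesis degN1 : forall x, x \in q (-1) -> exists c w, x = c *: e + v w.
Hypothesis degN : forall j x, (j.+3 <= k)%N -> x \in q (- j.+2%:Z) -> exists w, x = D j.+1 (v w).
Hypothesis fk : f \in q (- k%:Z).
Hypothesis degNk : forall x, x \in q (- k%:Z) -> exists c, x = c *: f.
Hypothesis br0 : forall j w u, (j.+2 < k)%N -> [lie v w, D j (v u)] = 0.
Hypothesis br1 : forall w u, [lie v w, D k.-2 (v u)] = b w u *: f.
Hypothesis top : forall w, D k.-1 (v w) = 0.
Hypothesis b_left : forall w, (forall u, b w u = 0) -> w = 0.
Hypothesis b_right : forall u, (forall w, b w u = 0) -> u = 0.
Hypothesis indep : forall c w, c *: e + v w = 0 -> c = 0.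
Hypothesis f0 : f != 0.
Hypothesis q0e : forall z, z \in q 0 -> exists c, [lie z, e] = c *: e.
Hypothesis q0v : forall z w, z \in q 0 -> exists u, [lie z, v w] = v u.
Variables (z0 : L) (la mu : R).
Hypotheses (z00 : z0 \in q 0) (z0e : [lie z0, e] = la *: e).
Hypotheses (z0v : forall w, [lie z0, v w] = mu *: v w) (lamu : la != mu).
Hypothesis parity : ~~ odd (m * k.-1).

Let E := <[e]>%VS.
Let V := limg v.

Lemma fwd_e0 : e != 0.
Proof.
apply/eqP => e0; have := @indep 1 0.
by rewrite e0 scaler0 linear0 addr0 => /(_ erefl)/eqP; rewrite oner_eq0.
Qed.

Lemma fwd_adn_deg j w : D j (v w) \in q (- j.+1%:Z).
Proof. by elim: j => [|j IH]; [exact: v1|apply: (gr_br_eq kg e1 IH); lia]. Qed.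

Lemma fwd_adn_inj j w : (j.+2 <= k)%N -> D j (v w) = 0 -> w = 0.
Proof.
move=> jk Dw; have Dk : D k.-2 (v w) = 0.
  have -> : k.-2 = ((k.-2 - j) + j)%N by lia.
  rewrite /adn iterD -/(adn e j (v w)) Dw; exact: adn0.
apply: b_right => u; have /eqP := br1 u w.
by rewrite Dk lie0r eq_sym scaler_eq0 (negPf f0) orbF => /eqP.
Qed.

Lemma fwd_v_inj w : v w = 0 -> w = 0.
Proof. by apply: (fwd_adn_inj (j := 0)); lia. Qed.

Lemma fwd_indep c w : c *: e + v w = 0 -> c = 0 /\ w = 0.
Proof.
move=> cw; have c0 := indep cw; split=> //; apply: fwd_v_inj.
by rewrite -cw c0 scale0r add0r.
Qed.

(** As ad e is a derivation, the factors [e] on the left can be moved to the right one at a time;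
    each move changes the sign, and the remaining term is e bracketed with 0. The same argument
    explains the sign in [fwd_br1]. *)
Lemma fwd_br0 a j w u : ((a + j).+2 < k)%N -> [lie D a (v w), D j (v u)] = 0.
Proof.
elim: a j => [|a IH] j ajk; first exact: br0.
rewrite adnS lieJl IH; last lia.
by rewrite lie0r sub0r -adnS IH ?oppr0 //; lia.
Qed.

Lemma fwd_br1 a j w u : (a + j).+2 = k ->
  [lie D a (v w), D j (v u)] = ((-1) ^+ a * b w u) *: f.
Proof.
elim: a j => [|a IH] j ajk.
  by rewrite expr0 mul1r -br1; congr [lie _, D _ _]; lia.
rewrite adnS lieJl fwd_br0; last lia.
by rewrite lie0r sub0r -adnS IH ?exprS ?mulN1r ?mulNr ?scaleNr //; lia.
Qed.

Lemma fwd_e_kernel y : y \in neg_part k q -> pr_bottom k q [lie e, y] = 0.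
Proof.
move: y; apply: neg_part_ind => [|j y jk yj].
  by split=> [|a x y hx hy]; rewrite ?(lie0r, linear0) // lieDr lieZr linearP /= hx hy scaler0 addr0.
have [jk1|jk1] := eqVneq j k.-1; last by apply: (pr_bottom_eq0 kg (gr_br kg e1 yj)); lia.
have k3' : ((k - 3).+3 <= k)%N by lia.
have yj' : y \in q (- (k - 3).+2%:Z) by have -> : (k - 3).+2 = j by lia.
have [w ->] := degN k3' yj'; rewrite -adnS.
by have -> : (k - 3).+2 = k.-1 by [lia]; rewrite top linear0.
Qed.

(** The form pairs degree -j only with degree -(k - j). Testing x against each degree, nondegeneracy
    of b removes every component but the one along [e]. *)
Lemma fwd_kernel : is_form_kernel k q E.
Proof.
move=> x; split=> [/vlineP[c ->]|[xn xk]].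
  split; first by apply: memvZ; apply: (neg_part_mem (j := 1)) => //; lia.
  by move=> y yn; rewrite lieZl linearZ /= fwd_e_kernel // scaler0.
have proj j y : (0 < j < k)%N -> y \in q (- (k - j)%N%:Z) -> [lie gr_proj k q (- j%:Z) x, y] = 0.
  move=> jk yj; have yn : y \in neg_part k q by apply: (neg_part_mem (j := (k - j)%N)) => //; lia.
  have := xk y yn; rewrite lieC linearN /= => /eqP; rewrite oppr_eq0 => /eqP pr0.
  rewrite lieC -(gr_proj_br kg (l := - k%:Z) x yj); last lia.
  suff -> : gr_proj k q (- k%:Z) [lie y, x] = pr_bottom k q [lie y, x] by rewrite pr0 oppr0.
  move: [lie y, x]; apply: (graded_ind kg) => [|i z zi].
    by split=> [|a s t hs ht]; rewrite ?linear0 // [LHS]linearP [RHS]linearP /= hs ht.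
  rewrite (gr_proj_eq kg _ zi); case: eqP => [<-|/eqP ik] in zi *.
    by rewrite (pr_bottom_id kg).
  by rewrite (pr_bottom_eq0 kg zi) // eq_sym.
have [c [w xE]] := degN1 (gr_proj_mem k q (-1) x).
have w0 : w = 0.
  apply: b_left => u; have k1 : (0 < 1 < k)%N by lia.
  have Du : D k.-2 (v u) \in q (- (k - 1)%N%:Z).
    by have := fwd_adn_deg k.-2 u; have -> : k.-2.+1 = (k - 1)%N by lia.
  have := proj 1 _ k1 Du; rewrite xE lieDl lieZl -adnS.
  have -> : k.-2.+1 = k.-1 by lia.
  by rewrite top scaler0 add0r br1 => /eqP; rewrite scaler_eq0 (negPf f0) orbF => /eqP.
have x2 j : (j.+2 < k)%N -> gr_proj k q (- j.+2%:Z) x = 0.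
  move=> jk; have [u uE] := degN jk (gr_proj_mem k q _ x); rewrite uE.
  suff -> : u = 0 by rewrite linear0 adn0.
  apply: b_left => u'.
  have jk' : (0 < j.+2 < k)%N by lia.
  have Du : D (k - j.+3)%N (v u') \in q (- (k - j.+2)%N%:Z).
    by have := fwd_adn_deg (k - j.+3)%N u'; have -> : (k - j.+3)%N.+1 = (k - j.+2)%N by lia.
  have := proj _ _ jk' Du; rewrite uE fwd_br1; last lia.
  by move/eqP; rewrite scaler_eq0 (negPf f0) orbF mulf_eq0 signr_eq0 => /eqP.
suff -> : x = gr_proj k q (-1) x by rewrite xE w0 linear0 addr0 memvZ // memv_line.
suff proj0 (i : int) : i != -1 -> gr_proj k q i x = 0.
  rewrite {1}(gr_proj_sum kg x); have k1 : (`|(-1 : int)| <= k)%N by lia.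
  rewrite (bigD1 (gr_index k (-1))) //= gr_indexK // big1 ?addr0 // => j jn.
  by apply: proj0; apply: contra jn => /eqP ji; rewrite -ji gr_index_ord.
move=> i1; have [ik|ik] := boolP ((- k%:Z < i) && (i < 0)).
  have -> : i = - (`|i| - 2)%N.+2%:Z by lia.
  by apply: x2; lia.
move: x xn {xk proj xE x2}; apply: neg_part_ind => [|j y jk yj].
  by split=> [|a s t hs ht]; rewrite ?linear0 // linearP /= hs ht scaler0 addr0.
by rewrite (gr_proj_eq kg _ yj) ifF //; apply/eqP; lia.
Qed.

Lemma fwd_dimV : \dim V = m.
Proof.
have c : (fullv :&: lker v = 0)%VS.
  apply/eqP; rewrite -subv0; apply/subvP => w.
  by rewrite memv_cap memv_ker memv0 => /andP[_ /eqP/fwd_v_inj->].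
by rewrite limg_dim_eq // dimvf dim_matrix; exact: mul1n.
Qed.

Lemma fwd_EV : q (-1) = (E + V)%VS.
Proof.
apply/vspaceP => x; apply/idP/memv_addP => [/degN1[c [w ->]]|].
  exists (c *: e); first by rewrite memvZ ?memv_line.
  by exists (v w) => //; rewrite memv_img ?memvf.
by move=> [_ /vlineP[c ->] [_ /memv_imgP[w _ ->] ->]]; rewrite memvD ?memvZ.
Qed.

Lemma fwd_cap : (E :&: V)%VS = 0%VS.
Proof.
apply/eqP; rewrite -subv0; apply/subvP => x; rewrite memv_cap memv0.
move=> /andP[/vlineP[c ->] /memv_imgP[w _ cw]].
have [|-> _] := @fwd_indep c (- w); last by rewrite scale0r.
by rewrite linearN /= cw subrr.
Qed.

Lemma fwd_dim j : (j.+2 < k)%N -> q (- j.+2%:Z) = (linfun (D j.+1) @: V)%VS /\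
  \dim (q (- j.+2%:Z)) = m.
Proof.
pose Dl := HB.pack_for {linear L -> L} (D j.+1)
  (GRing.isLinear.Build R L L _ (D j.+1) (adn_linear e j.+1)).
have DE x : linfun (D j.+1) x = D j.+1 x by exact: (lfunE Dl).
move=> jk; have qE : q (- j.+2%:Z) = (linfun (D j.+1) @: V)%VS.
  apply/vspaceP => x; apply/idP/memv_imgP => [/(degN jk)[w ->]|[_ /memv_imgP[w _ ->] ->]].
    by exists (v w); rewrite ?DE // memv_img ?memvf.
  by rewrite DE fwd_adn_deg.
split=> //; rewrite qE limg_dim_eq ?fwd_dimV //.
apply/eqP; rewrite -subv0; apply/subvP => x; rewrite memv_cap memv_ker memv0.
move=> /andP[/memv_imgP[w _ ->]]; rewrite DE => /eqP/fwd_adn_inj->; last lia.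
by rewrite linear0.
Qed.

(** The dimension is 1 + m (k - 1): degree -1 contributes 1 + m, and each of the k - 2 degrees
    between -1 and -k contributes m. *)
Lemma fwd_odd : odd (\dim (neg_part k q)).
Proof.
have dir : directv (\sum_(j < k.-1) q (- (j.+1)%:Z)).
  apply/directv_sum_independent => us usq us0 i _.
  have := congr1 (gr_proj k q (- (i.+1)%:Z)) us0; rewrite linear0 linear_sum /=.
  rewrite (bigD1 i) //= (gr_proj_id kg (usq i isT)) big1 ?addr0 // => j ji.
  rewrite (gr_proj_eq kg _ (usq j isT)) ifF //; apply: contraNF ji.
  by rewrite eqr_opp eqz_nat eqSS => /eqP ij; apply/eqP/val_inj.
rewrite /neg_part; move/directvP: dir => /= ->.
have -> : k.-1 = k.-2.+1 by lia.
rewrite big_ord_recl /= fwd_EV dimv_disjoint_sum ?fwd_cap // dim_vline fwd_e0 fwd_dimV.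
rewrite (eq_bigr (fun=> m)) => [|j _]; last first.
  have jk : (j.+2 < k)%N by have := ltn_ord j; lia.
  exact: (proj2 (fwd_dim jk)).
rewrite sum_nat_const card_ord add1n addSn /=; move: parity.
by have -> : (m * k.-1 = m + k.-2 * m)%N by [rewrite mulnC; have -> : k.-1 = k.-2.+1 by [lia]; rewrite mulSn].
Qed.

Lemma fwd_condition1 : condition1 k q E.
Proof.
split.
- have -> : q (- k%:Z) = <[f]>%VS.
    apply/vspaceP => x; apply/idP/vlineP => [/degNk //|[c ->]]; exact: memvZ.
  by rewrite dim_vline f0.
- exact: fwd_odd.
- exact: fwd_kernel.
- by rewrite dim_vline fwd_e0.
- by rewrite -memvE.
Qed.

(** [z0] acts on [e] and on V by different scalars. For y in another invariant complement, [z0, y] -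
    mu y lies both in that complement and on the line E, so it is 0 and y has no component along
    [e]. *)
Lemma fwd_complement : unique (invariant_complement q E) V.
Proof.
split.
  split; [by rewrite fwd_EV|exact: fwd_cap|].
  by move=> x _ x0 /memv_imgP[w _ ->]; have [u ->] := q0v w x0; rewrite memv_img ?memvf.
move=> V' [EV' cap' inv'].
have sub : (V' <= V)%VS.
  apply/subvP => y yV'; have y1 : y \in q (-1).
    by rewrite -EV' memvE (subv_trans _ (addvSr _ _)) -?memvE.
  have [c [w yE]] := degN1 y1.
  have : [lie z0, y] - mu *: y \in (E :&: V')%VS.
    rewrite memv_cap; apply/andP; split; last by rewrite memvB ?memvZ ?inv'.
    rewrite yE lieDr lieZr z0e z0v.
    have -> : c *: (la *: e) + mu *: v w - mu *: (c *: e + v w) = (c * (la - mu)) *: e.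
      by linear_ring.
    by rewrite memvZ ?memv_line.
  rewrite cap' memv0 yE lieDr lieZr z0e z0v.
  have -> : c *: (la *: e) + mu *: v w - mu *: (c *: e + v w) = (c * (la - mu)) *: e.
    by linear_ring.
  rewrite scaler_eq0 (negPf fwd_e0) orbF mulf_eq0 subr_eq0 (negPf lamu) orbF => /eqP->.
  by rewrite scale0r add0r memv_img ?memvf.
apply/esym/eqP; rewrite eqEdim sub /=.
have d1 := dimv_disjoint_sum fwd_cap; have d2 := dimv_disjoint_sum cap'.
by move: d1 d2; rewrite -fwd_EV EV' => -> /addnI ->.
Qed.

Lemma fwd_condition2 : condition2 k q E V.
Proof.
have scaled x : x \in E -> x != 0 -> exists2 c, c != 0 & x = c *: e.
  by move=> /vlineP[c ->] cn0; exists c => //; apply: contra_neq cn0 => ->; rewrite scale0r.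
have iso (W W' : {vspace L}) : (forall y, y \in W -> [lie e, y] \in W') ->
    (forall y, y \in W -> [lie e, y] = 0 -> y = 0) ->
    (forall y, y \in W' -> exists2 x, x \in W & y = [lie e, x]) -> line_bracket_iso E W W'.
  move=> sub inj onto x xE xn0; have [c cn0 ->] := scaled x xE xn0; split.
    apply/eqP; rewrite -subv0; apply/subvP => y; rewrite memv_cap memv_ker memv0 adE lieZl.
    by rewrite scaler_eq0 (negPf cn0) => /andP[yW /eqP/(inj _ yW)->].
  apply/vspaceP => y; apply/memv_imgP/idP => [[w wW ->]|yW'].
    by rewrite adE lieZl memvZ ?sub.
  have [w wW ->] := onto y yW'; exists (c^-1 *: w); first exact: memvZ.
  by rewrite adE lieZl lieZr scalerA mulfV // scale1r.
have pos2 (i : int) : - k%:Z + 1 <= i <= -2 -> exists2 j, (j.+2 < k)%N & i = - j.+2%:Z.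
  by move=> h; exists (`|i| - 2)%N; lia.
have low (i : int) x : x \in q i -> i < - k%:Z -> x = 0.
  by move=> xi ik; move: xi; rewrite (kgrading_supp kg) ?memv0; [move/eqP|lia].
have bot (i : int) x : i <= -2 -> x \in q i -> i != - k%:Z ->
    exists j w, [/\ (j.+2 < k)%N, i = - j.+2%:Z & x = D j.+1 (v w)] \/ x = 0.
  move=> i2 xi ik; have [h|h] := ltP i (- k%:Z).
    by exists 0%N, 0; right; exact: low xi h.
  have [|j jk iE] := pos2 i; first lia.
  by rewrite iE in xi *; have [w ->] := degN jk xi; exists j, w; left.
split.
- apply: iso => [_ /memv_imgP[w _ ->]|_ /memv_imgP[w _ ->] ew|y].
  + exact: (fwd_adn_deg 1).
  + by rewrite (@fwd_adn_inj 1 w) ?linear0.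
  + move=> y2; have [w ->] := @degN 0 y k3 y2.
    by exists (v w) => //; rewrite memv_img ?memvf.
- move=> i hi; have ipos : - k%:Z + 1 <= i <= -2 by lia.
  have [j jk iE] := pos2 i ipos; have jk' : (j.+3 < k)%N by lia.
  have -> : i - 1 = - j.+3%:Z by lia.
  rewrite iE; apply: iso => [y /(degN jk)[w ->]|y /(degN jk)[w ->] ew|y /(degN jk')[w ->]].
  + exact: (fwd_adn_deg j.+2).
  + by rewrite (@fwd_adn_inj j.+2 w) ?linear0 ?adn0.
  + by exists (D j.+1 (v w)) => //; exact: fwd_adn_deg.
- move=> _ _ /memv_imgP[w _ ->] /memv_imgP[u _ ->]; exact: (br0 (j := 0)).
- move=> i _ y i2 ik /memv_imgP[w _ ->] yi.
  have [ik'|ik'] := eqVneq i (- k%:Z).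
    by apply: (low _ _ (gr_br kg (v1 w) yi)); lia.
  have [j [u [[jk iE ->]|->]]] := bot i y i2 yi ik'; last by rewrite lie0r.
  by apply: br0; lia.
move=> i j x y i2 j2 ijk xi yj.
have [ijl|ijl] := ltP (i + j) (- k%:Z); first exact: (low _ _ (gr_br kg xi yj)).
have [|a [w [[ak iE ->]|->]]] := bot i x i2 xi; [lia| |by rewrite lie0l].
have [|c [u [[ck jE ->]|->]]] := bot j y j2 yj; [lia| |by rewrite lie0r].
by apply: fwd_br0; lia.
Qed.

End ForwardConditions.

(** * Recognizing a model *)

Section NegativePart.
Variables (R : fieldType) (T : lieAlgType R) (k m : nat) (e f : T) (v : 'Hom('rV[R]_m, T)).
Variable b : 'rV[R]_m -> 'rV[R]_m -> R.
Local Notation D := (adn e).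

(** The brackets of degree -1 with the negative part in terms of e, V and f alone; the same record
    is used for L and for the model. *)
Record negative_relations : Prop := NegativeRelations {
  nr_br0 : forall j w u, (j.+2 < k)%N -> [lie v w, D j (v u)] = 0;
  nr_br1 : forall w u, [lie v w, D k.-2 (v u)] = b w u *: f;
  nr_top : forall w, D k.-1 (v w) = 0;
  nr_ef : [lie e, f] = 0;
  nr_vf : forall w, [lie v w, f] = 0
}.

(** The normal form of an element of degree -(j + 1). The multiple of [e] counts only for j = 0 and
    that of [f] only for j = k - 1, so one formula covers all negative degrees. *)
Definition nform j c w d : T :=
  (if j == 0%N then c *: e else 0) + D j (v w) + (if j == k.-1 then d *: f else 0).

Lemma nform_linear j a c w d c' w' d' :
  nform j (a * c + c') (a *: w + w') (a * d + d') = a *: nform j c w d + nform j c' w' d'.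
Proof.
rewrite /nform linearP /= adn_linear.
by case: eqP => _; case: eqP => _; linear_ring.
Qed.

Lemma nform0 j : nform j 0 0 0 = 0.
Proof. by rewrite /nform linear0 adn0 !scale0r !if_same !addr0. Qed.

Hypotheses (k3 : (3 <= k)%N) (nr : negative_relations).

Lemma nr_top_ge j w : (k.-1 <= j)%N -> D j (v w) = 0.
Proof.
move=> kj; have -> : j = ((j - k.-1) + k.-1)%N by lia.
by rewrite /adn iterD -/(adn e k.-1 (v w)) (nr_top nr); exact: adn0.
Qed.

(** The coordinates on the right depend only on those on the left, on j, k and b; so elements of L
    and of the model with equal coordinates have brackets with equal coordinates. *)
Lemma nform_br j c w c' w' d :
  [lie nform 0 c w 0, nform j c' w' d] =
  nform j.+1 0 (c *: w' - (if j == 0%N then c' else 0) *: w) (if j == k.-2 then b w w' else 0).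
Proof.
have k10 : (0 == k.-1)%N = false by apply/eqP; lia.
have jk : (j.+1 == k.-1)%N = (j == k.-2) by apply/eqP/eqP; lia.
have bvD : [lie v w, D j (v w')] = if j == k.-2 then b w w' *: f else 0.
  case: eqP => [->|jk']; first exact: nr_br1.
  have [h|h] := ltnP j.+2 k; first exact: nr_br0.
  by rewrite nr_top_ge ?lie0r //; lia.
rewrite /nform /= k10 addr0 add0r jk !(lieDl, lieDr, lieZl).
have eE : [lie e, if j == 0%N then c' *: e else 0] = 0.
  by case: eqP => _; rewrite ?lie0r // lieZr lbrxx scaler0.
have eF : [lie e, if j == k.-1 then d *: f else 0] = 0.
  by case: eqP => _; rewrite ?lie0r // lieZr (nr_ef nr) scaler0.
have vF : [lie v w, if j == k.-1 then d *: f else 0] = 0.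
  by case: eqP => _; rewrite ?lie0r // lieZr (nr_vf nr) scaler0.
set x := if j == 0%N then c' else 0.
have -> : v (c *: w' - x *: w) = c *: v w' + (- x) *: v w.
  rewrite -scaleNr [LHS]linearP. by rewrite linearZ.
rewrite eE eF vF bvD -!adnS adnD !adnZ.
have -> : [lie v w, if j == 0%N then c' *: e else 0] =
    - (x *: D j.+1 (v w)).
  rewrite /x; case: eqP => [->|_]; rewrite ?lie0r ?scale0r ?oppr0 //.
  by rewrite lieZr (lieC (v w)) scalerN.
by case: (j == k.-2); linear_ring.
Qed.
End NegativePart.

Section Recognition.
Variables (R : realFieldType) (L T : lieAlgType R) (k m : nat) (q : int -> {vspace L}).
Variables (e f : L) (v : 'Hom('rV[R]_m, L)) (e' f' : T) (v' : 'Hom('rV[R]_m, T)).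
Variables (b : 'rV[R]_m -> 'rV[R]_m -> R) (MI : int -> T -> Prop).
Hypotheses (kg : kgrading k q) (k3 : (3 <= k)%N).
Hypotheses (nr : negative_relations k e f v b) (nr' : negative_relations k e' f' v' b).
Hypotheses (e1 : e \in q (-1)) (v1 : forall w, v w \in q (-1)) (fk : f \in q (- k%:Z)).
Hypothesis degN1 : forall x, x \in q (-1) -> exists c w, x = c *: e + v w.
Hypothesis degN : forall j x, (j.+3 <= k)%N -> x \in q (- j.+2%:Z) ->
  exists w, x = adn e j.+1 (v w).
Hypothesis degNk : forall x, x \in q (- k%:Z) -> exists c, x = c *: f.
Hypothesis b_left : forall w, (forall u, b w u = 0) -> w = 0.
Hypothesis b_right : forall u, (forall w, b w u = 0) -> u = 0.
Hypothesis indep : forall c w, c *: e + v w = 0 -> c = 0 /\ w = 0.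
Hypothesis f0 : f != 0.
Hypothesis MI_lin : forall i, linear_closed_pred (MI i).
Hypothesis MI_br : forall i j u w, MI i u -> MI j w -> MI (i + j) [lie u, w].
Hypotheses (e'1 : MI (-1) e') (v'1 : forall w, MI (-1) (v' w)) (f'k : MI (- k%:Z) f').
Hypothesis MI_trans : forall i u, 0 <= i -> MI i u -> [lie u, e'] = 0 ->
  (forall w, [lie u, v' w] = 0) -> u = 0.
Hypothesis pos_gen : forall n, q n.+2%:Z = bracket_span (q 1) (q n.+1%:Z).

Definition match0 z u := [/\ z \in q 0, MI 0 u & exists c g,
  [/\ [lie z, e] = c *: e, [lie u, e'] = c *: e',
      forall w, [lie z, v w] = v (g w) & forall w, [lie u, v' w] = v' (g w)]].
Definition match1 x u := [/\ x \in q 1, MI 1 u, match0 [lie x, e] [lie u, e']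
  & forall w, match0 [lie x, v w] [lie u, v' w]].

Hypothesis tot0 : forall z, z \in q 0 -> exists u, match0 z u.
Hypothesis tot1 : forall x, x \in q 1 -> exists u, match1 x u.

(** Equal coordinates in the normal form, whose index is one less than the depth; only negative [i]
    are used. *)
Let Nm i x u := exists c w d,
  x = nform k e f v (absz i).-1 c w d /\ u = nform k e' f' v' (absz i).-1 c w d.

Lemma recog_MI_adn j w : MI (- j.+1%:Z) (adn e' j (v' w)).
Proof.
elim: j => [|j IH]; first exact: v'1.
by have -> : - j.+2%:Z = -1 - j.+1%:Z; [lia|apply: MI_br].
Qed.

Lemma recog_adn_deg j w : adn e j (v w) \in q (- j.+1%:Z).
Proof. by elim: j => [|j IH]; [exact: v1|apply: (gr_br_eq kg e1 IH); lia]. Qed.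

Lemma recog_adn_inj j w : (j.+2 <= k)%N -> adn e j (v w) = 0 -> w = 0.
Proof.
move=> jk Dw; have Dk : adn e k.-2 (v w) = 0.
  have -> : k.-2 = ((k.-2 - j) + j)%N by lia.
  rewrite /adn iterD -/(adn e j (v w)) Dw; exact: adn0.
apply: b_right => u; have /eqP := nr_br1 nr u w.
by rewrite Dk lie0r eq_sym scaler_eq0 (negPf f0) orbF => /eqP.
Qed.

Lemma recog_fun0 i u : i < 0 -> Nm i 0 u -> u = 0.
Proof.
move=> i0 [c [w [d [/esym x0 ->]]]]; move: x0; set j := (absz i).-1; rewrite /nform.
have [->|j0] := eqVneq j 0%N.
  have -> : (0 == k.-1)%N = false by apply/eqP; lia.
  by rewrite addr0 => /indep[-> ->]; rewrite linear0 scale0r !addr0.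
have [->|jk] := eqVneq j k.-1.
  rewrite (nr_top nr) (nr_top nr') addr0 !add0r => /eqP; rewrite scaler_eq0 (negPf f0) orbF.
  by move=> /eqP->; rewrite scale0r.
rewrite !addr0 !add0r => Dw; have [jk'|jk'] := leqP j.+2 k.
  by rewrite (recog_adn_inj jk' Dw) linear0 adn0.
by rewrite (nr_top_ge k3 nr') //; lia.
Qed.

Lemma recognition : exists h : 'Hom(L, T),
  [/\ forall x y, h [lie x, y] = [lie h x, h y], h e = e', forall w, h (v w) = v' w,
      forall i x, x \in q i -> MI i (h x) & forall x u, match1 x u -> h x = u].
Proof.
have Nm1 x u : Nm (-1) x u <-> exists c w, x = c *: e + v w /\ u = c *: e' + v' w.
  have k10 : (0 == k.-1)%N = false by apply/eqP; lia.
  split=> [[c [w [d []]]]|[c [w [-> ->]]]]; last exists c, w, 0; rewrite /nform /= k10 !addr0 //.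
  by exists c, w.
have Nm_lin i a x y u w : Nm i x u -> Nm i y w -> Nm i (a *: x + y) (a *: u + w).
  move=> [c [s [d [-> ->]]]] [c' [s' [d' [-> ->]]]].
  by exists (a * c + c'), (a *: s + s'), (a * d + d'); rewrite !nform_linear.
have Nm00 i : Nm i 0 0 by exists 0, 0, 0; rewrite !nform0.
have Nm_mem i x u : i < 0 -> Nm i x u -> x \in q i /\ MI i u.
  move=> i0 [c [w [d [-> ->]]]]; rewrite /nform.
  have iE : i = - ((absz i).-1).+1%:Z by lia.
  set j := (absz i).-1 in iE *; rewrite iE.
  have [M0 MD _ MZ] := linear_closed_conv (MI_lin (- j.+1%:Z)).
  split.
    apply: memvD; first apply: memvD; last 1 first.
    - by case: eqP => [jk|_]; [apply: memvZ; have -> : j.+1 = k by [lia]|exact: mem0v].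
    - by case: eqP => [->|_]; [apply: memvZ|exact: mem0v].
    - exact: recog_adn_deg.
  apply: (MD); first apply: (MD); last 1 first.
  - by case: eqP => [jk|_] //; apply: MZ; have -> : j.+1 = k by [lia].
  - by case: eqP => [jk|_] //; apply: MZ; rewrite jk.
  - exact: recog_MI_adn.
have Nm_tot i x : i < 0 -> x \in q i -> exists u, Nm i x u.
  move=> i0 xi; have [ik|ik] := ltP i (- k%:Z).
    by move: xi; rewrite (kgrading_supp kg) ?memv0; [move/eqP->; exists 0|lia].
  suff [c [w [d xE]]] : exists c w d, x = nform k e f v (absz i).-1 c w d.
    by exists (nform k e' f' v' (absz i).-1 c w d), c, w, d.
  have k10 : (0 == k.-1)%N = false by apply/eqP; lia.
  have [iE|iN1] := eqVneq i (-1).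
    by move: xi; rewrite iE => /degN1[c [w ->]]; exists c, w, 0; rewrite /nform /= k10 addr0.
  have [iE|iNk] := eqVneq i (- k%:Z).
    move: xi; rewrite iE => /degNk[d ->]; exists 0, 0, d; rewrite /nform linear0 adn0.
    by have -> : `|- k%:Z|.-1 = k.-1 by [lia]; rewrite eqxx scale0r if_same !add0r.
  have iE : i = - (`|i| - 2)%N.+2%:Z by lia.
  rewrite iE in xi; have [|w ->] := degN _ xi; first lia.
  exists 0, w, 0; rewrite /nform !scale0r !if_same addr0 add0r.
  by congr (adn _ _ _); lia.
have Nm_br i x y u w : i < 0 -> Nm (-1) x u -> Nm i y w -> Nm (i - 1) [lie x, y] [lie u, w].
  move=> i0 /Nm1[c [s [-> ->]]] [c' [s' [d' [-> ->]]]].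
  have nf (U : lieAlgType R) (e0 g0 : U) (v0 : 'Hom('rV[R]_m, U)) :
      c *: e0 + v0 s = nform k e0 g0 v0 0 c s 0.
    by rewrite /nform scale0r if_same addr0.
  rewrite (nf _ e f) (nf _ e' f') (nform_br k3 nr) (nform_br k3 nr').
  eexists; eexists; eexists; have -> : `|i - 1|.-1 = (`|i|.-1).+1 by lia.
  by split.
have neg_gen n : (q (- n.+2%:Z) <= bracket_span (q (-1)%R) (q (- n.+1%:Z)))%VS.
  apply/subvP => x xn; have [nk|nk] := ltnP k n.+2.
    by move: xn; rewrite (kgrading_supp kg) ?memv0; [move/eqP->; exact: mem0v|lia].
  have [nE|nk'] := eqVneq n.+2 k; last first.
    have [|w ->] := degN _ xn; first lia.
    by rewrite adnS; apply: mem_bracket_span => //; exact: recog_adn_deg.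
  rewrite nE in xn; have [c ->] := degNk xn; apply: memvZ.
  (* If b were 0, V would be 0 and [q (-1)] an abelian line, which cannot generate degree -k. *)
  have [w [u bn0]] : exists w u, b w u != 0.
    apply: contrapT => H; have w0 (w : 'rV[R]_m) : w = 0.
      by apply: b_left => u; apply: contrapT => /eqP bn0; apply: H; exists w, u.
    have fq1 : (q (-1) <= <[e]>)%VS.
      by apply/subvP => y /degN1[c' [w ->]]; rewrite (w0 w) linear0 addr0 memvZ ?memv_line.
    have sub : subalgebra <[e]>%VS.
      by move=> _ _ /vlineP[a ->] /vlineP[a' ->]; rewrite lieZl lieZr lbrxx !scaler0 mem0v.
    have /subvP/(_ _ fk)/vlineP[a fE] := kgrading_gen kg sub fq1 (ltac:(lia) : - k%:Z < 0).
    case/eqP: f0; apply: (gr_cap kg fk (j := -1)); first by rewrite fE memvZ.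
    by apply/eqP; lia.
  have -> : f = (b w u)^-1 *: [lie v w, adn e n (v u)].
    by rewrite (_ : n = k.-2) ?(nr_br1 nr) ?scalerK //; lia.
  by apply: memvZ; apply: mem_bracket_span => //; exact: recog_adn_deg.
have MI_trans' i u : 0 <= i -> MI i u -> (forall x w, Nm (-1) x w -> [lie u, w] = 0) -> u = 0.
  move=> i0 ui h; apply: (MI_trans i0 ui) => [|w].
    by apply: (h e); apply/Nm1; exists 1, 0; rewrite !linear0 !addr0 !scale1r.
  by apply: (h (v w)); apply/Nm1; exists 0, w; rewrite !scale0r !add0r.
have rel0 z u : match0 z u -> related q MI Nm 0 z u.
  move=> [zq uM [c [g [ze ue zv uv]]]]; split=> // y w /Nm1[c' [s [-> ->]]].
  apply/Nm1; exists (c' * c), (g s).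
  by rewrite !lieDr !lieZr ze ue zv uv !scalerA.
have rel1 x u : match1 x u -> related q MI Nm 1 x u.
  move=> [xq uM xe xv]; split=> // y w /Nm1[c' [s [-> ->]]].
  rewrite !lieDr !lieZr; have [_ rl] := related_lin q MI_lin Nm00 Nm_lin 0.
  by apply: rl; apply: rel0.
have [||h [hrel hbr]] := graded_extension kg MI_lin MI_br Nm00 Nm_lin Nm_mem Nm_tot recog_fun0
  Nm_br neg_gen MI_trans' pos_gen.
- by move=> x /tot0[u xu]; exists u; exact: rel0.
- by move=> x /tot1[u xu]; exists u; exact: rel1.
have uniq := @related_fun _ _ _ q _ _ MI_lin Nm00 Nm_lin recog_fun0 MI_trans'.
exists h; split=> //.
- apply: (uniq _ e); first exact: (hrel (-1)).
  by apply/Nm1; exists 1, 0; rewrite !linear0 !addr0 !scale1r.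
- move=> w; apply: (uniq _ (v w)); first exact: (hrel (-1)).
  by apply/Nm1; exists 0, w; rewrite !scale0r !add0r.
- by move=> i x /hrel /(related_mem Nm_mem)[].
- by move=> x u xu; apply: (uniq _ x); [apply: (hrel 1); case: xu|exact: rel1].
Qed.
End Recognition.

(** * Depth three *)

Section SigForm.
Variables (R : realFieldType) (p q : nat).
Implicit Types u w : 'rV[R]_(p + q).

Definition sform u w : R := (u *m sig_form R p q *m w^T) 0 0.

Lemma sform_linear u : scalar (sform u).
Proof. by move=> a w w'; rewrite /sform linearP /= mulmxDr -scalemxAr !mxE. Qed.

Lemma sform_sym u w : sform u w = sform w u.
Proof.
rewrite /sform -[u *m _ *m _]trmxK [in LHS]mxE; congr (_ _ _).
by rewrite !trmx_mul trmxK sig_form_tr mulmxA.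
Qed.
Lemma sformZr a u w : sform u (a *: w) = a * sform u w.
Proof. by rewrite /sform linearZ /= -scalemxAr mxE. Qed.
Lemma sformDr u w w' : sform u (w + w') = sform u w + sform u w'.
Proof. by rewrite -[w]scale1r sform_linear mul1r scale1r. Qed.
Lemma sformZl a u w : sform (a *: u) w = a * sform u w.
Proof. by rewrite !(sform_sym _ w) sformZr. Qed.
Lemma sformDl u w w' : sform (w + w') u = sform w u + sform w' u.
Proof. by rewrite !(sform_sym _ u) sformDr. Qed.

Lemma sform_nondeg w : (forall u, sform w u = 0) -> w = 0.
Proof.
move=> h; rewrite -[w]mulmx1 -(sig_form_sqr R p q) mulmxA.
suff -> : w *m sig_form R p q = 0 by rewrite mul0mx.
apply/rowP => i; have := h (delta_mx 0 i).
by rewrite /sform trmx_delta -colE !mxE.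
Qed.

Lemma sform_anisotropic (i : 'I_(p + q)) :
  sform (delta_mx 0 i) (delta_mx 0 i) * sform (delta_mx 0 i) (delta_mx 0 i) = 1.
Proof.
rewrite /sform -rowE trmx_delta -colE !mxE.
by case: splitP => j ij; rewrite !mxE; case: splitP => l il; rewrite !mxE;
   try (by have := ltn_ord j; have := ltn_ord l; lia);
   rewrite (_ : j = l) ?eqxx ?mulr1 ?mulrNN ?mulr1 //; apply: val_inj => /=; lia.
Qed.
End SigForm.

Section SoThree.
Variables (R : realFieldType) (p q : nat).
Local Notation N := (p.+2 + q.+2)%N.
Local Notation so u := (@in_so R p.+2 q.+2 u).
Local Notation r := (so_rank p q).
Local Notation m := (p + q)%N.
Local Notation ep := (@pos_vec R p q).
Local Notation em := (@neg_vec R p q).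
Local Notation wv := (@null_vec R p q).
Local Notation tt := (@boost_coef R p q).
Implicit Types (x y z : 'cV[R]_N) (u w : 'rV[R]_m).

Lemma boost_kill (t : 'rV[R]_r) d x : (forall i, (d <= i)%N -> tt t i = 0) ->
  (forall i, (i < d)%N -> ip (ep i) x = 0 /\ ip (em i) x = 0) -> so_boost t *m x = 0.
Proof.
move=> t0 x0; rewrite {1}(std_span x) mulmxBr !mulmx_sumr !big1 ?subr0 // => i _;
  rewrite -scalemxAr ?boost_ep ?boost_em; have [id|di] := ltnP i d.
- by rewrite (proj2 (x0 _ id)) scale0r.
- by rewrite t0 // scale0r scaler0.
- by rewrite (proj1 (x0 _ id)) scale0r.
- by rewrite t0 // scale0r scaler0.
Qed.

(* [a2], [b2] and [a1], [b1] are dual pairs of isotropic vectors, of degrees 2, -2 and 1, -1, and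
   [iota3] embeds their orthogonal complement, of degree 0. The vectors are opaque because
   unification would otherwise compare their entries. *)
Fact a2_subproof : {x | x = wv true 0}. Proof. by exists (wv true 0). Qed.
Fact b2_subproof : {x | x = 2^-1 *: wv false 0}. Proof. by exists (2^-1 *: wv false 0). Qed.
Fact a1_subproof : {x | x = wv true 1}. Proof. by exists (wv true 1). Qed.
Fact b1_subproof : {x | x = 2^-1 *: wv false 1}. Proof. by exists (2^-1 *: wv false 1). Qed.
Definition a2 := sval a2_subproof.
Definition b2 := sval b2_subproof.
Definition a1 := sval a1_subproof.
Definition b1 := sval b1_subproof.
Lemma a2E : a2 = wv true 0. Proof. exact: svalP a2_subproof. Qed.
Lemma b2E : b2 = 2^-1 *: wv false 0. Proof. exact: svalP b2_subproof. Qed.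
Lemma a1E : a1 = wv true 1. Proof. exact: svalP a1_subproof. Qed.
Lemma b1E : b1 = 2^-1 *: wv false 1. Proof. exact: svalP b1_subproof. Qed.
Definition iota3 u : 'cV[R]_N :=
  col_mx (col_mx (0 : 'cV_2) (lsubmx u)^T : 'cV_p.+2) (col_mx (0 : 'cV_2) (rsubmx u)^T : 'cV_q.+2).

Lemma iota3_low u i : (i < 2)%N -> ip (ep i) (iota3 u) = 0 /\ ip (em i) (iota3 u) = 0.
Proof.
move=> i2; have ip2 : (i < p.+2)%N by apply: leq_trans i2 _.
have iq2 : (i < q.+2)%N by apply: leq_trans i2 _.
have low n (c : 'cV[R]_n) (j : 'I_(2 + n)) : (j < 2)%N -> (col_mx (0 : 'cV_2) c) j 0 = 0.
  by move=> j2; rewrite mxE; case: splitP => l jl; rewrite ?mxE //; lia.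
split.
  by have := @ip_ep R p q (Ordinal ip2); rewrite /= => ->; apply: low.
by have := @ip_em R p q (Ordinal iq2); rewrite /= => ->; rewrite low ?oppr0.
Qed.

Lemma iota3_onto x : (forall i, (i < 2)%N -> ip (ep i) x = 0 /\ ip (em i) x = 0) ->
  exists u, x = iota3 u.
Proof.
rewrite -[x]vsubmxK; move: (usubmx x) (dsubmx x) => a b h.
have top n (c : 'cV[R]_(2 + n)) : (forall j : 'I_(2 + n), (j < 2)%N -> c j 0 = 0) ->
    c = col_mx 0 (dsubmx c).
  move=> c0; rewrite -{1}[c]vsubmxK; congr col_mx; apply/colP => j; rewrite !mxE.
  by apply: c0; rewrite /= ltn_ord.
have a0 : a = col_mx (0 : 'cV_2) (dsubmx (a : 'cV_(2 + p))) :> 'cV_(2 + p).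
  apply: top => j j2; have [+ _] := h _ j2.
  by have := @ip_ep R p q j => /= ->.
have b0 : b = col_mx (0 : 'cV_2) (dsubmx (b : 'cV_(2 + q))) :> 'cV_(2 + q).
  apply: top => j j2; have [_ +] := h _ j2.
  by have := @ip_em R p q j => /= -> /eqP; rewrite oppr_eq0 => /eqP.
exists (row_mx (dsubmx (a : 'cV_(2 + p)))^T (dsubmx (b : 'cV_(2 + q)))^T).
by rewrite /iota3 row_mxKl row_mxKr !trmxK -a0 -b0.
Qed.

Lemma iota3_linear : linear iota3.
Proof.
have lin n (c d : 'cV[R]_n) (a : R) : col_mx (0 : 'cV_2) (a *: c + d) = a *: col_mx 0 c + col_mx 0 d.
  by rewrite scale_col_mx add_col_mx scaler0 addr0.
move=> a u w; rewrite /iota3 !linearP /= scale_col_mx add_col_mx.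
by congr col_mx; exact: lin.
Qed.

Lemma ip_iota3 u w : ip (iota3 u) (iota3 w) = sform u w.
Proof.
have e n (c d : 'rV[R]_n) : (col_mx (0 : 'cV_2) c^T : 'cV_n.+2)^T *m
    (col_mx (0 : 'cV_2) d^T : 'cV_n.+2) = c *m d^T.
  have := mul_row_col (0 : 'rV[R]_2) c (0 : 'cV_2) d^T; rewrite mul0mx add0r => <-.
  by congr (_ *m _); rewrite -[RHS]trmxK tr_row_mx trmx0.
rewrite /iota3 ip_col !e /sform -{3}[u]hsubmxK -{3}[w]hsubmxK tr_row_mx /sig_form.
by rewrite mul_row_block mul_row_col !mulmx0 addr0 add0r mulmx1 mulmxN mulmx1 mulNmx !mxE.
Qed.

Lemma ip_low_iota3 s i u : (i < 2)%N -> ip (wv s i) (iota3 u) = 0.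
Proof. by move=> i2; have [h1 h2] := iota3_low u i2; rewrite /null_vec ipDl ipZl h1 h2 mulr0 addr0. Qed.

Lemma gram_a2i u : ip a2 (iota3 u) = 0. Proof. by rewrite a2E; exact: ip_low_iota3. Qed.
Lemma gram_a1i u : ip a1 (iota3 u) = 0. Proof. by rewrite a1E; exact: ip_low_iota3. Qed.
Lemma gram_b2i u : ip b2 (iota3 u) = 0. Proof. by rewrite b2E ipZl ip_low_iota3 // mulr0. Qed.
Lemma gram_b1i u : ip b1 (iota3 u) = 0. Proof. by rewrite b1E ipZl ip_low_iota3 // mulr0. Qed.
Lemma gram_ia2 u : ip (iota3 u) a2 = 0. Proof. by rewrite ip_sym gram_a2i. Qed.
Lemma gram_ia1 u : ip (iota3 u) a1 = 0. Proof. by rewrite ip_sym gram_a1i. Qed.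
Lemma gram_ib2 u : ip (iota3 u) b2 = 0. Proof. by rewrite ip_sym gram_b2i. Qed.
Lemma gram_ib1 u : ip (iota3 u) b1 = 0. Proof. by rewrite ip_sym gram_b1i. Qed.

Ltac gram_calc :=
  rewrite ?(ipZl, ipZr) !ip_wv /sgn /= ?(mul0r, mulr0, mul1r, mulr1, mulrN, mulNr, opprK, subrr) //;
  try by field.

Lemma gram_low :
  ((ip a2 a2 = 0) * (ip a2 b2 = 1) * (ip a2 a1 = 0) * (ip a2 b1 = 0)) *
  ((ip b2 a2 = 1) * (ip b2 b2 = 0) * (ip b2 a1 = 0) * (ip b2 b1 = 0)) *
  ((ip a1 a2 = 0) * (ip a1 b2 = 0) * (ip a1 a1 = 0) * (ip a1 b1 = 1)) *
  ((ip b1 a2 = 0) * (ip b1 b2 = 0) * (ip b1 a1 = 1) * (ip b1 b1 = 0)).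
Proof. by rewrite a2E b2E a1E b1E; do ![split]; gram_calc. Qed.

Definition gram3 := (gram_low, (gram_a2i, gram_a1i, gram_b2i, gram_b1i),
  (gram_ia2, gram_ia1, gram_ib2, gram_ib1), ip_iota3).

Definition zsimp := (@scale0r, @scale1r, @subr0, @sub0r, @addr0, @add0r, @oppr0, @scaler0).

Lemma span3 (Q : 'cV[R]_N -> Prop) : linear_closed_pred Q -> Q a2 -> Q a1 -> Q b1 -> Q b2 ->
  (forall u, Q (iota3 u)) -> forall x, Q x.
Proof.
rewrite a2E a1E b1E b2E => QL Qa2 Qa1 Qb1 Qb2 Qi; have [_ _ _ QZ] := linear_closed_conv QL.
apply: wv_ind => // s i im.
have half j : wv false j = 2 *: (2^-1 *: wv false j).
  by rewrite scalerA mulfV ?pnatr_eq0 // scale1r.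
case: i im => [|[|i]] im.
- by case: s => //; rewrite half; apply: QZ.
- by case: s => //; rewrite half; apply: QZ.
have [|u ->] := iota3_onto (x := wv s i.+2); last exact: Qi.
by move=> j j2; rewrite /null_vec !(ipDr, ipZr) ip_pp ip_pm ip_mp ip_mm;
  have -> : (j == i.+2) = false by [apply/eqP; lia]; rewrite /= !(oppr0, mulr0, addr0).
Qed.

(** The grading element: eps_1 = 2, eps_2 = 1 and the other eps_i = 0, so that the standard
    representation has degrees from 2 to -2. *)
Definition t3 : 'rV[R]_r := \row_k (if k == 0 :> nat then 2 else if k == 1 :> nat then 1 else 0).
Definition H3 : gl R N := so_boost t3.

Lemma tt_t3 i : tt t3 i = if i == 0%N then 2 else if i == 1%N then 1 else 0.
Proof.
rewrite /boost_coef; case: ltnP => ir; first by rewrite mxE inordK.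
by case: i ir => [|[|i]].
Qed.

Lemma H3_a2 : (H3 : 'M_N) *m a2 = 2 *: a2.
Proof. by rewrite /H3 ?a2E ?a1E boost_wv tt_t3 mul1r. Qed.
Lemma H3_a1 : (H3 : 'M_N) *m a1 = 1 *: a1.
Proof. by rewrite /H3 ?a2E ?a1E boost_wv tt_t3 mul1r. Qed.
Lemma H3_b2 : (H3 : 'M_N) *m b2 = (-2) *: b2.
Proof. by rewrite /H3 ?b2E ?b1E -scalemxAr boost_wv tt_t3 mulN1r !scalerA mulrC. Qed.
Lemma H3_b1 : (H3 : 'M_N) *m b1 = (-1) *: b1.
Proof. by rewrite /H3 ?b2E ?b1E -scalemxAr boost_wv tt_t3 mulN1r !scalerA mulrC. Qed.
Lemma H3_i u : (H3 : 'M_N) *m iota3 u = 0 *: iota3 u.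
Proof.
rewrite scale0r; apply: (boost_kill (d := 2)) => i; last exact: iota3_low.
by rewrite tt_t3; case: i => [|[|i]].
Qed.

Inductive gv3 : int -> 'cV[R]_N -> Prop :=
| Gv3_2 c : gv3 2 (c *: a2)
| Gv3_1 c : gv3 1 (c *: a1)
| Gv3_0 u : gv3 0 (iota3 u)
| Gv3_N1 c : gv3 (-1) (c *: b1)
| Gv3_N2 c : gv3 (-2) (c *: b2).

Lemma gv3_wv s i : exists2 d, gv3 d (wv s i) & sgn R s * tt t3 i = d%:~R.
Proof.
rewrite tt_t3; case: i => [|[|i]] /=.
- case: s; rewrite /sgn; first by exists 2; [rewrite -a2E -[a2]scale1r; constructor|rewrite mul1r].
  exists (-2); last by rewrite mulN1r rmorphN.
  by rewrite -[wv _ _]scale1r -(mulfV (x := 2)) ?pnatr_eq0 // -scalerA -b2E; constructor.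
- case: s; rewrite /sgn; first by exists 1; [rewrite -a1E -[a1]scale1r; constructor|rewrite mul1r].
  exists (-1); last by rewrite mulN1r rmorphN.
  by rewrite -[wv _ _]scale1r -(mulfV (x := 2)) ?pnatr_eq0 // -scalerA -b1E; constructor.
exists 0; last by rewrite mulr0.
have [|u ->] := iota3_onto (x := wv s i.+2); last exact: Gv3_0.
by move=> j j2; rewrite /null_vec !(ipDr, ipZr) ip_pp ip_pm ip_mp ip_mm;
  have -> : (j == i.+2) = false by [apply/eqP; lia]; rewrite /= !(oppr0, mulr0, addr0).
Qed.

(** The weight vectors of so are wedges of homogeneous vectors, and degrees add up under the
    wedge. *)
Lemma so3_graded_ind (i : int) (Q : gl R N -> Prop) (c : so_index p q -> R) :
  linear_closed_pred Q ->
  (forall d d' x y, gv3 d x -> gv3 d' y -> d + d' = i -> Q (wd x y)) ->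
  (forall a, c a != 0 -> so_wt a t3 = i%:~R) -> Q (\sum_a c a *: so_vec R a).
Proof.
move=> QL QG cw; have [Q0 _ _ QZ] := linear_closed_conv QL.
apply: linear_closed_sum => // a _.
have [->|/cw] := eqVneq (c a) 0; first by rewrite scale0r.
case: a => [[s j] [s' j']]; rewrite /so_wt /so_vec /=; case: eqP => [[-> ->] _|_].
  by rewrite wdxx scaler0.
have [d dx ->] := gv3_wv s j; have [d' dy ->] := gv3_wv s' j'.
rewrite -rmorphD /= => /intr_inj dd; apply: QZ; exact: QG dx dy dd.
Qed.

(** The degrees are -2 + 1 for [E3], -2 - 1 for [F3] and -1 + 0 for [V3f u]. *)
Definition E3 : gl R N := wd b2 a1.
Definition F3 : gl R N := wd b2 b1.
Definition V3f u : gl R N := wd b1 (iota3 u).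
Lemma V3_linear : linear V3f.
Proof. by move=> a u w; rewrite /V3f iota3_linear wdDr wdZr. Qed.
HB.instance Definition _ := GRing.isLinear.Build R 'rV[R]_m (gl R N) _ V3f V3_linear.
Definition V3 : 'Hom('rV[R]_m, gl R N) := linfun V3f.
Lemma V3E u : V3 u = wd b1 (iota3 u). Proof. exact: lfunE. Qed.

Lemma E3_V3 u : [lie E3, V3 u] = wd b2 (iota3 u).
Proof. by rewrite V3E br_wd !gram3 !zsimp. Qed.

Lemma so3_negative : negative_relations 3 E3 F3 V3 (@sform R p q).
Proof.
split=> [[|j] w u _|w u|w||w] //.
- by rewrite /= !V3E br_wd !gram3 !zsimp ?wdxx ?scaler0.
- by rewrite /= E3_V3 V3E br_wd !gram3 !zsimp.
- by rewrite /= E3_V3 br_wd !gram3 !zsimp ?wdxx.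
- by rewrite br_wd !gram3 !zsimp ?wdxx.
- by rewrite V3E br_wd !gram3 !zsimp.
Qed.

Definition so_MI (t : 'rV[R]_r) (i : int) (u : gl R N) :=
  so u /\ [lie so_boost t : gl R N, u] = i%:~R *: u.

Lemma so_MI_linear t i : linear_closed_pred (so_MI t i).
Proof.
have [s0 sD] := @so_linear R p q.
split=> [|a u v [su hu] [sv hv]]; first by split=> //; rewrite lie0r scaler0.
by split; [exact: sD|rewrite lieDr lieZr hu hv; linear_ring].
Qed.

Lemma so_MI_br t i j (u v : gl R N) : so_MI t i u -> so_MI t j v -> so_MI t (i + j) [lie u, v].
Proof.
move=> [su hu] [sv hv]; split; first exact: so_br.
by rewrite lieJ hu hv lieZl lieZr -scalerDl rmorphD.
Qed.

Lemma so_MI_wd t (d d' : int) (x y : 'cV[R]_N) : so_boost t *m x = d%:~R *: x ->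
  so_boost t *m y = d'%:~R *: y -> so_MI t (d + d') (wd x y).
Proof.
move=> hx hy; split; first exact: so_wd.
by rewrite br_so_wd ?hx ?hy ?wdZl ?wdZr -?scalerDl ?rmorphD //; exact: so_boostP.
Qed.

Lemma so3_MI d d' x y (i : int) : so_boost t3 *m x = d%:~R *: x -> so_boost t3 *m y = d'%:~R *: y ->
  d + d' = i -> so_MI t3 i (wd x y).
Proof. by move=> hx hy <-; exact: so_MI_wd. Qed.

Lemma ip_nondeg x : (forall y, ip y x = 0) -> x = 0.
Proof. by move=> h; rewrite (std_span x) !big1 ?subrr // => i _; rewrite h scale0r. Qed.

(** [u] maps a2, of the top degree 2, to a vector of degree at least 2, hence to c a2. The elements
    of degree -1 lead from a2 to a1, then to the middle vectors, to b1 and to b2; as [u] commutes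
    with them, it is the scalar c on all these vectors. A scalar in so is 0. *)
Lemma so3_transitive (i : int) (u : gl R N) : (0 < m)%N -> 0 <= i -> so_MI t3 i u -> [lie u, E3] = 0 ->
  (forall w, [lie u, V3 w] = 0) -> u = 0.
Proof.
move=> m0 i0 [su hu] uE uV.
have comm (y : gl R N) : [lie u, y] = 0 -> forall x, (u : 'M_N) *m ((y : 'M_N) *m x) = (y : 'M_N) *m ((u : 'M_N) *m x).
  by rewrite gl_lieE => /eqP; rewrite subr_eq0 => /eqP h x; rewrite !mulmxA h.
have hx x (c : R) : (H3 : 'M_N) *m x = c *: x -> (H3 : 'M_N) *m ((u : 'M_N) *m x) = (i%:~R + c) *: ((u : 'M_N) *m x).
  move=> hx; have /(congr1 (fun M : gl R N => (M : 'M_N) *m x)) := hu.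
  rewrite gl_lieE mulmxBl -!mulmxA hx -scalemxAr -scalemxAl => /eqP.
  by rewrite subr_eq -scalerDl => /eqP.
set g := (u : 'M_N) *m a2; have hg := hx _ _ H3_a2; rewrite -/g in hg.
have sH := so_boostP t3.
have pair y (c : R) : (H3 : 'M_N) *m y = c *: y -> (i%:~R + 2 + c) * ip y g = 0.
  move=> hy; have := so_ip y g sH; rewrite -/H3 hy hg ipZl ipZr => h.
  by rewrite mulrDl h addrN.
have i0R : 0 <= i%:~R :> R by rewrite ler0z.
have gE : g = ip b2 g *: a2.
  apply/eqP; rewrite -subr_eq0; apply/eqP; apply: ip_nondeg; apply: span3.
  - by split=> [|a y z hy hz]; rewrite ?ip0l // ipDl ipZl hy hz mulr0 addr0.
  - have /eqP := pair _ _ H3_a2; rewrite mulf_eq0 => /orP[/eqP|/eqP h]; first lra.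
    by rewrite ipDr ipNr ipZr h !gram3 mulr0 subr0.
  - have /eqP := pair _ _ H3_a1; rewrite mulf_eq0 => /orP[/eqP|/eqP h]; first lra.
    by rewrite ipDr ipNr ipZr h !gram3 mulr0 subr0.
  - have /eqP := pair _ _ H3_b1; rewrite mulf_eq0 => /orP[/eqP|/eqP h]; first lra.
    by rewrite ipDr ipNr ipZr h !gram3 mulr0 subr0.
  - by rewrite ipDr ipNr ipZr !gram3 mulr1 subrr.
  - move=> w; have /eqP := pair _ _ (H3_i w); rewrite mulf_eq0 => /orP[/eqP|/eqP h]; first lra.
    by rewrite ipDr ipNr ipZr h !gram3 mulr0 subr0.
set c := ip b2 g in gE.
have cE x x' (y : gl R N) (a : R) : a != 0 -> (u : 'M_N) *m x = c *: x -> [lie u, y] = 0 ->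
    (y : 'M_N) *m x = a *: x' -> (u : 'M_N) *m x' = c *: x'.
  move=> an0 ux uy yx; have := comm y uy x; rewrite yx ux -!scalemxAr yx.
  by rewrite scalerA mulrC -scalerA => /(scalerI an0).
have ua1 : (u : 'M_N) *m a1 = c *: a1.
  apply: (cE a2 _ E3 (-1)) => //; first by rewrite oppr_eq0 oner_eq0.
  by rewrite /E3 wdE !gram3 !zsimp scaleN1r.
have ui w : (u : 'M_N) *m iota3 w = c *: iota3 w.
  apply: (cE a1 _ (V3 w) (-1)) => //; first by rewrite oppr_eq0 oner_eq0.
  by rewrite V3E wdE !gram3 !zsimp scaleN1r.
have ub1 : (u : 'M_N) *m b1 = c *: b1.
  (* Passing from the middle space to b1 takes a vector with nonzero square, which exists since p +
     q > 0. *)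
  pose w : 'rV[R]_m := delta_mx 0 (Ordinal m0).
  apply: (cE (iota3 w) _ (V3 w) (sform w w)) => //.
    have := sform_anisotropic R (Ordinal m0); rewrite -/w => h.
    by apply/eqP => h0; move: h; rewrite h0 mulr0 => /esym/eqP; rewrite oner_eq0.
  by rewrite V3E wdE !gram3 !zsimp.
have ub2 : (u : 'M_N) *m b2 = c *: b2.
  apply: (cE b1 _ E3 1) => //; first by rewrite oner_eq0.
  by rewrite /E3 wdE !gram3 !zsimp.
have c0 : c = 0.
  have := so_ip a2 b2 su; rewrite -/g gE ub2 (ipZl c) (ipZr c) !gram3; lra.
apply: mulmx_ext; apply: span3.
- by split=> [|a y z hy hz]; rewrite ?mulmx0 // !mulmxDr -!scalemxAr hy hz.
- by rewrite -/g gE c0 scale0r mul0mx.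
- by rewrite ua1 c0 scale0r mul0mx.
- by rewrite ub1 c0 scale0r mul0mx.
- by rewrite ub2 c0 scale0r mul0mx.
- by move=> w; rewrite ui c0 scale0r mul0mx.
Qed.

End SoThree.

(** * Sylvester's law of inertia *)

Section Sylvester.
Variables (R : realType) (L : vectType R) (b : L -> L -> R).
Hypothesis b_linl : forall a x y z, b (a *: x + y) z = a * b x z + b y z.
Hypothesis b_linr : forall a x y z, b z (a *: x + y) = a * b z x + b z y.

Let bl (x : L) (y : L) : R^o := b x y.
Let bl_lin x : linear (bl x).
Proof. by move=> a y z; rewrite /bl b_linr. Qed.
HB.instance Definition _ x := GRing.isLinear.Build R L R^o _ (bl x) (bl_lin x).

Lemma bil0r x : b x 0 = 0.
Proof. by have := b_linr (-1) 0 0 x; rewrite scaler0 addr0 mulN1r addNr. Qed.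
Lemma bil0l x : b 0 x = 0.
Proof. by have := b_linl (-1) 0 0 x; rewrite scaler0 addr0 mulN1r addNr. Qed.
Lemma bilZl a x y : b (a *: x) y = a * b x y.
Proof. by rewrite -[a *: x]addr0 b_linl bil0l addr0. Qed.
Lemma bilZr a x y : b y (a *: x) = a * b y x.
Proof. by rewrite -[a *: x]addr0 b_linr bil0r addr0. Qed.
Lemma bilDl x y z : b (x + y) z = b x z + b y z.
Proof. by rewrite -[x]scale1r b_linl mul1r scale1r. Qed.
Lemma bilDr x y z : b z (x + y) = b z x + b z y.
Proof. by rewrite -[x]scale1r b_linr mul1r scale1r. Qed.

Lemma bil_suml n (c : 'I_n -> R) (F : 'I_n -> L) y :
  b (\sum_i c i *: F i) y = \sum_i c i * b (F i) y.
Proof.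
by elim/big_rec2: _ => [|i s t _ <-]; rewrite ?bil0l // bilDl bilZl.
Qed.
Lemma bil_sumr n (c : 'I_n -> R) (F : 'I_n -> L) y :
  b y (\sum_i c i *: F i) = \sum_i c i * b y (F i).
Proof.
by elim/big_rec2: _ => [|i s t _ <-]; rewrite ?bil0r // bilDr bilZr.
Qed.

(** The last clause is the expansion in the frame; the coefficients along [Q] change sign because
    these vectors have square -1. *)
Definition sylvester_frame (U : {vspace L}) p q (P : 'I_p -> L) (Q : 'I_q -> L) :=
  [/\ forall i, P i \in U, forall i, Q i \in U,
      (forall i j, b (P i) (P j) = (i == j)%:R) /\ (forall i j, b (Q i) (Q j) = - (i == j)%:R),
      forall i j, b (P i) (Q j) = 0 /\ b (Q j) (P i) = 0
    & forall y, y \in U -> y = \sum_i b (P i) y *: P i - \sum_j b (Q j) y *: Q j].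

Definition extend n (x : L) (P : 'I_n -> L) (i : 'I_n.+1) : L :=
  if unlift ord0 i is Some j then P j else x.

Lemma extend0 n x (P : 'I_n -> L) : extend x P ord0 = x.
Proof. by rewrite /extend unlift_none. Qed.
Lemma extend_lift n x (P : 'I_n -> L) i : extend x P (lift ord0 i) = P i.
Proof. by rewrite /extend liftK. Qed.

(** Induction on the dimension: a nondegenerate symmetric form has a vector of nonzero square; it is
    scaled to square 1 or -1 by a square root and split off, leaving its orthogonal complement. *)
Lemma sylvester (U : {vspace L}) :
  (forall x y, x \in U -> y \in U -> b x y = b y x) ->
  (forall x, x \in U -> (forall y, y \in U -> b x y = 0) -> x = 0) ->
  exists p q (P : 'I_p -> L) (Q : 'I_q -> L), sylvester_frame U P Q.
Proof.
have [n] := ubnP (\dim U); elim: n U => // n IH U; rewrite ltnS => dU symU ndU.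
have [U0|Un0] := eqVneq U 0%VS.
  exists 0%N, 0%N, (fun=> 0), (fun=> 0); split=> [[]|[]||[]|y] //; first by split=> [[]|[]].
  by rewrite U0 memv0 => /eqP->; rewrite !big_ord0 subr0.
have [x xU bx] : exists2 x, x \in U & b x x != 0.
  apply: contrapT => H.
  have iso x : x \in U -> b x x = 0.
    by move=> xU; apply: contrapT => /eqP bx; apply: H; exists x.
  case/eqP: Un0; apply/eqP; rewrite -subv0; apply/subvP => x xU; rewrite memv0.
  apply/eqP/ndU => // y yU; have := iso _ (memvD xU yU).
  rewrite !(bilDl, bilDr) !iso // (symU y x) // => h; lra.
pose s : R := if 0 < b x x then 1 else -1.
have [e [eU be]] : exists e, e \in U /\ b e e = s.
  exists ((Num.sqrt `|b x x|)^-1 *: x); split; first exact: memvZ.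
  rewrite bilZl bilZr mulrA -invfM -expr2 sqr_sqrtr ?normr_ge0 // /s.
  case: ltP => h; first by rewrite gtr0_norm // mulVf.
  by rewrite ler0_norm // invrN mulNr mulVf.
have ss : s * s = 1 by rewrite /s; case: ifP; rewrite ?mulr1 ?mulrNN ?mulr1.
pose W := (U :&: lker (linfun (bl e)))%VS.
have WP y : (y \in W) = (y \in U) && (b e y == 0).
  by rewrite memv_cap memv_ker lfunE.
have dec y : y \in U -> y - (s * b e y) *: e \in W.
  move=> yU; rewrite WP memvB ?memvZ //=.
  have -> : y - (s * b e y) *: e = (- (s * b e y)) *: e + y by rewrite scaleNr addrC.
  rewrite b_linr be mulNr mulrAC ss mul1r addNr; exact: eqxx.
have eW : e \notin W.
  by rewrite WP eU be /=; apply/eqP => s0; move: ss; rewrite s0 mulr0 => /esym/eqP; rewrite oner_eq0.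
have dW : (\dim W < n)%N.
  apply: leq_trans dU; rewrite ltn_neqAle dimvS ?capvSl // andbT.
  apply: contra eW => dWU; have /eqP-> // : W == U by rewrite eqEdim capvSl (eqP dWU) leqnn.
have symW y z : y \in W -> z \in W -> b y z = b z y.
  by rewrite !WP => /andP[yU _] /andP[zU _]; exact: symU.
have ndW y : y \in W -> (forall z, z \in W -> b y z = 0) -> y = 0.
  move=> yW yW0; have yU : y \in U by move: yW; rewrite WP => /andP[].
  have ey : b e y = 0 by move: yW; rewrite WP => /andP[_ /eqP].
  apply: ndU => // z zU; have -> : z = (s * b e z) *: e + (z - (s * b e z) *: e).
    by rewrite addrC subrK.
  by rewrite b_linr (symU y e yU eU) ey mulr0 add0r yW0 // dec.
have [p [q [P [Q [PW QW [PP QQ] PQ spanW]]]]] := IH W dW symW ndW.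
have WU y : y \in W -> y \in U /\ b e y = 0 by rewrite WP => /andP[-> /eqP].
have eP i : b e (P i) = 0 /\ b (P i) e = 0.
  by have [PU eP] := WU _ (PW i); rewrite (symU _ e PU eU) eP.
have eQ i : b e (Q i) = 0 /\ b (Q i) e = 0.
  by have [QU eQ] := WU _ (QW i); rewrite (symU _ e QU eU) eQ.
have spanU y : y \in U -> y = (s * b e y) *: e +
    (\sum_i b (P i) y *: P i - \sum_j b (Q j) y *: Q j).
  move=> yU; rewrite -{1}[y](subrK ((s * b e y) *: e)) addrC; congr (_ + _).
  rewrite {1}(spanW _ (dec y yU)); congr (_ - _); apply: eq_bigr => i _; congr (_ *: _);
    have -> : y - (s * b e y) *: e = (- (s * b e y)) *: e + y by rewrite scaleNr addrC.
  - by rewrite b_linr (proj2 (eP i)) mulr0 add0r.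
  - by rewrite b_linr (proj2 (eQ i)) mulr0 add0r.
have [s1|s1] : s = 1 \/ s = -1 by rewrite /s; case: ifP; [left|right].
- exists p.+1, q, (extend e P), Q; split.
  + by move=> i; case: (unliftP ord0 i) => [j|] ->; rewrite ?extend0 ?extend_lift //; case: (WU _ (PW j)).
  + by move=> i; case: (WU _ (QW i)).
  + split=> // i j; case: (unliftP ord0 i) => [i'|] ->; case: (unliftP ord0 j) => [j'|] ->;
      rewrite ?extend0 ?extend_lift ?(inj_eq lift_inj) ?be ?eqxx ?PP ?(proj1 (eP _)) ?(proj2 (eP _)) //.
  + move=> i j; case: (unliftP ord0 i) => [i'|] ->; rewrite ?extend0 ?extend_lift; first exact: PQ.
    exact: eQ.
  + move=> y yU; rewrite {1}(spanU y yU) big_ord_recl extend0 s1 mul1r -addrA.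
    by congr (_ + (_ - _)); apply: eq_bigr => i _; rewrite extend_lift.
exists p, q.+1, P, (extend e Q); split.
+ by move=> i; case: (WU _ (PW i)).
+ by move=> i; case: (unliftP ord0 i) => [j|] ->; rewrite ?extend0 ?extend_lift //; case: (WU _ (QW j)).
+ split=> // i j; case: (unliftP ord0 i) => [i'|] ->; case: (unliftP ord0 j) => [j'|] ->;
    rewrite ?extend0 ?extend_lift ?(inj_eq lift_inj) ?be ?eqxx ?QQ ?(proj1 (eQ _)) ?(proj2 (eQ _)) ?oppr0 //.
+ move=> i j; case: (unliftP ord0 j) => [j'|] ->; rewrite ?extend0 ?extend_lift; first exact: PQ.
  by have [? ?] := eP i.
+ move=> y yU; rewrite {1}(spanU y yU) big_ord_recl extend0 s1 mulN1r scaleNr opprD addrCA.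
  by congr (_ + (_ - _)); apply: eq_bigr => i _; rewrite extend_lift.
Qed.

Lemma sylvester_basis (U : {vspace L}) :
  (forall x y, x \in U -> y \in U -> b x y = b y x) ->
  (forall x, x \in U -> (forall y, y \in U -> b x y = 0) -> x = 0) ->
  exists p q (v : 'Hom('rV[R]_(p + q), L)), limg v = U /\
    forall u w, b (v u) (v w) = sform u w.
Proof.
move=> symU ndU; have [p [q [P [Q [PU QU [PP QQ] PQ span]]]]] := sylvester symU ndU.
pose F (u : 'rV[R]_(p + q)) := \sum_i u 0 (lshift q i) *: P i + \sum_j u 0 (rshift p j) *: Q j.
have FL : linear F.
  move=> a u w; rewrite /F scalerDr !scaler_sumr addrACA -!big_split /=.
  by congr (_ + _); apply: eq_bigr => i _; rewrite !mxE scalerDl scalerA.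
pose FF := HB.pack_for {linear 'rV[R]_(p + q) -> L} F
  (GRing.isLinear.Build R 'rV[R]_(p + q) L _ F FL).
have vE u : linfun FF u = F u by rewrite lfunE.
exists p, q, (linfun FF); split.
  apply/vspaceP => y; apply/memv_imgP/idP => [[u _ ->]|yU].
    by rewrite vE memvD ?memv_suml // => i _; rewrite memvZ.
  exists (row_mx (\row_i b (P i) y) (\row_j - b (Q j) y)); first exact: memvf.
  rewrite vE /F {1}(span y yU) -sumrN; congr (_ + _); apply: eq_bigr => i _.
    by rewrite row_mxEl mxE.
  by rewrite row_mxEr mxE scaleNr.
move=> u w; rewrite !vE /F bilDl !bilDr !bil_suml.
have dP n (G : 'I_n -> L) (c : R) (a d : 'I_n -> R) (h : forall i j, b (G i) (G j) = c * (i == j)%:R) :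
    \sum_i a i * b (G i) (\sum_j d j *: G j) = c * \sum_i a i * d i.
  rewrite mulr_sumr; apply: eq_bigr => i _; rewrite bil_sumr (bigD1 i) //= h eqxx mulr1.
  by rewrite big1 ?addr0 => [|j ji]; [ring|rewrite h eq_sym (negPf ji) !mulr0].
have d0 n n' (G : 'I_n -> L) (G' : 'I_n' -> L) (a : 'I_n -> R) (d : 'I_n' -> R)
    (h : forall i j, b (G i) (G' j) = 0) : \sum_i a i * b (G i) (\sum_j d j *: G' j) = 0.
  by rewrite big1 // => i _; rewrite bil_sumr big1 ?mulr0 // => j _; rewrite h mulr0.
rewrite (dP _ P 1) => [|i j]; last by rewrite PP mul1r.
rewrite (dP _ Q (-1)) => [|i j]; last by rewrite QQ mulN1r.
rewrite !d0; [|by move=> i j; case: (PQ j i)|by move=> i j; case: (PQ i j)].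
rewrite addr0 add0r mul1r mulN1r /sform -[u in RHS]hsubmxK -[w in RHS]hsubmxK tr_row_mx /sig_form.
rewrite mul_row_block mul_row_col !mulmx0 addr0 add0r mulmx1 mulmxN mulmx1 mulNmx !mxE.
by congr (_ - _); apply: eq_bigr => i _; rewrite !mxE.
Qed.
End Sylvester.

(** * Transfer of the two conditions from a model *)

Section ForwardTransfer.
Variables (R : realFieldType) (T : lieAlgType R) (k m : nat) (e f : T) (v : 'Hom('rV[R]_m, T)).
Variable b : 'rV[R]_m -> 'rV[R]_m -> R.
(* [M0 i] recognizes the elements of degree [i], [M1 i] gives their expansion. *)
Variables (M0 M1 : int -> T -> Prop).
Variables (z0 : T) (la mu : R).
Hypotheses (k3 : (3 <= k)%N) (nr : negative_relations k e f v b).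
Hypotheses (e1 : M0 (-1) e) (v1 : forall w, M0 (-1) (v w)) (fk : M0 (- k%:Z) f).
Hypothesis degN1 : forall u, M1 (-1) u -> exists c w, u = c *: e + v w.
Hypothesis degN : forall j u, (j.+3 <= k)%N -> M1 (- j.+2%:Z) u -> exists w, u = adn e j.+1 (v w).
Hypothesis degNk : forall u, M1 (- k%:Z) u -> exists c, u = c *: f.
Hypothesis degNlow : forall i u, i < - k%:Z -> M1 i u -> u = 0.
Hypothesis deg0 : forall u, M1 0 u -> (exists c, [lie u, e] = c *: e) /\
  forall w, exists w', [lie u, v w] = v w'.
Hypothesis b_left : forall w, (forall u, b w u = 0) -> w = 0.
Hypothesis b_right : forall u, (forall w, b w u = 0) -> u = 0.
Hypothesis indep : forall c w, c *: e + v w = 0 -> c = 0.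
Hypothesis f0 : f != 0.
Hypotheses (z00 : M0 0 z0) (z0e : [lie z0, e] = la *: e).
Hypotheses (z0v : forall w, [lie z0, v w] = mu *: v w) (lamu : la != mu).
Hypothesis parity : ~~ odd (m * k.-1).

(** All data are pulled back along the injection [g]. That the depth K of the given grading is k
    follows from [f], which has degree -k, and from the vanishing of lower degrees in the model. *)
Lemma forward_transfer (L : lieAlgType R) (K : nat) (q : int -> {vspace L}) (g : 'Hom(L, T)) :
  kgrading K q -> lker g = 0%VS -> (forall x y, g [lie x, y] = [lie g x, g y]) ->
  (forall i x, x \in q i -> M1 i (g x)) ->
  (forall i u, M0 i u -> exists2 x, x \in q i & g x = u) ->
  exists E : {vspace L}, condition1 K q E /\
     exists V : {vspace L}, unique (invariant_complement q E) V /\ condition2 K q E V.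
Proof.
move=> kg /eqP gker gbr gM1 gM0.
have gi : injective g by apply/lker0P.
have gK : cancel g (g^-1)%VF by exact: lker0_lfunK.
have gV i u : M0 i u -> g ((g^-1)%VF u) = u /\ (g^-1)%VF u \in q i.
  by move=> /gM0[x xi <-]; rewrite gK.
have [e'E e'1] := gV _ _ e1; have [f'E f'k] := gV _ _ fk; have [z'E z'0] := gV _ _ z00.
set e' := (g^-1)%VF e in e'E e'1; set f' := (g^-1)%VF f in f'E f'k.
set z' := (g^-1)%VF z0 in z'E z'0.
pose v' := (g^-1 \o v)%VF; have v'E w : g (v' w) = v w by rewrite lfunE; case: (gV _ _ (v1 w)).
have v'1 w : v' w \in q (-1) by rewrite lfunE; case: (gV _ _ (v1 w)).
have gadn n x : g (adn e' n x) = adn e n (g x).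
  by elim: n => [//|n IH]; rewrite !adnS gbr IH e'E.
have f'0 : f' != 0 by apply: contra_neq f0 => h; rewrite -f'E h linear0.
have Kk : K = k.
  apply/eqP; rewrite eqn_leq; apply/andP; split; last first.
    rewrite leqNgt; apply/negP => Kk; case/eqP: f'0; apply/eqP; move: f'k.
    by rewrite (kgrading_supp kg) ?memv0 //; lia.
  rewrite leqNgt; apply/negP => kK; have := kgrading_depth kg.
  rewrite -subv0; apply/negP; rewrite negbK; apply/subvP => x xK; rewrite memv0.
  apply/eqP/gi; rewrite linear0; apply: degNlow (gM1 _ _ xK); lia.
subst K.
have D1' x : x \in q (-1) -> exists c w, x = c *: e' + v' w.
  move=> /gM1/degN1[c [w xE]]; exists c, w; apply: gi.
  by rewrite xE linearD linearZ /= e'E v'E.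
have DN j x : (j.+3 <= k)%N -> x \in q (- j.+2%:Z) -> exists w, x = adn e' j.+1 (v' w).
  by move=> jk /gM1/(degN jk)[w xE]; exists w; apply: gi; rewrite xE gadn v'E.
have Dk x : x \in q (- k%:Z) -> exists c, x = c *: f'.
  by move=> /gM1/degNk[c xE]; exists c; apply: gi; rewrite xE linearZ /= f'E.
have B0 j w u : (j.+2 < k)%N -> [lie v' w, adn e' j (v' u)] = 0.
  by move=> jk; apply: gi; rewrite gbr gadn !v'E (nr_br0 nr) // linear0.
have B1 w u : [lie v' w, adn e' k.-2 (v' u)] = b w u *: f'.
  by apply: gi; rewrite gbr gadn !v'E (nr_br1 nr) linearZ /= f'E.
have Tp w : adn e' k.-1 (v' w) = 0.
  by apply: gi; rewrite gadn v'E (nr_top nr) linear0.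
have ind c w : c *: e' + v' w = 0 -> c = 0.
  by move=> /(congr1 g); rewrite linearD linearZ /= e'E v'E linear0 => /indep.
have q0e z : z \in q 0 -> exists c, [lie z, e'] = c *: e'.
  move=> /gM1/deg0[[c zc] _]; exists c; apply: gi.
  by rewrite gbr e'E zc linearZ /= e'E.
have q0v z w : z \in q 0 -> exists u, [lie z, v' w] = v' u.
  move=> /gM1/deg0[_ /(_ w)[u zu]]; exists u; apply: gi.
  by rewrite gbr !v'E zu.
have z'e : [lie z', e'] = la *: e' by apply: gi; rewrite gbr z'E e'E z0e linearZ /= e'E.
have z'v w : [lie z', v' w] = mu *: v' w by apply: gi; rewrite gbr z'E v'E z0v linearZ /= v'E.
exists <[e']>%VS; split; last (exists (limg v'); split).
- exact: (fwd_condition1 kg k3 e'1 v'1 D1' DN f'k Dk B0 B1 Tp b_left b_right ind f'0 z'0 lamu parity).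
- exact: (fwd_complement k3 e'1 v'1 D1' f'k B1 b_right ind f'0 q0v z'0 z'e z'v lamu parity).
- exact: (fwd_condition2 kg k3 e'1 v'1 DN f'k B0 B1 b_right f'0 z'0 lamu parity).
Qed.
End ForwardTransfer.

Section SoTransfer.
Variables (R : realFieldType) (p q : nat).
Local Notation N := (p.+2 + q.+2)%N.
Local Notation r := (so_rank p q).

(** The explicit form of an element of degree i, as opposed to the eigenvalue condition [so_MI]: the
    former is what elements of the grading satisfy, the latter what suffices to belong to it. *)
Definition so_deg (t : 'rV[R]_r) (i : int) (u : gl R N) := exists c : so_index p q -> R,
  u = \sum_a c a *: so_vec R a /\ forall a, c a != 0 -> so_wt a t = i%:~R.

Lemma so_type_transfer (L : lieAlgType R) k gr labels (t : 'rV[R]_r) :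
  @kgrading R L k gr -> so_type p q labels gr ->
  (forall i : 'I_r, so_root i t = (i.+1 \in labels)%:R) ->
  exists g : 'Hom(L, gl R N), [/\ lker g = 0%VS, forall x y, g [lie x, y] = [lie g x, g y],
    forall i x, x \in gr i -> so_deg t i (g x)
  & forall i u, so_MI t i u -> exists2 x, x \in gr i & g x = u].
Proof.
move=> kg [f [A [alpha [[fker fP fbr] AH al _ cor]]]] tl.
have rt i : so_root i t = (i \in [set i : 'I_r | i.+1 \in labels])%:R by rewrite inE tl.
have [h1 h2] := @root_grading R (gl R N) _ _ _ _ _ _ _ (so_root_model R p q) L f fker fP fbr
  k gr _ t kg rt A alpha AH al cor.
exists f; split=> // i u [su hu]; have [x fx] := (fP u).1 su.
by exists x => //; apply/h1; rewrite fx.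
Qed.
End SoTransfer.

(** * The two conditions at depth three *)

Section SoThreeForward.
Variables (R : realFieldType) (p q : nat).
Hypothesis m0 : (0 < p + q)%N.
Local Notation N := (p.+2 + q.+2)%N.
Local Notation m := (p + q)%N.
Local Notation E := (@E3 R p q).
Local Notation F := (@F3 R p q).
Local Notation V := (@V3 R p q).
Local Notation iota3 := (@iota3 R p q).
Local Notation a2 := (@a2 R p q).
Local Notation b2 := (@b2 R p q).
Local Notation a1 := (@a1 R p q).
Local Notation b1 := (@b1 R p q).
Local Notation t3 := (@t3 R p q).
Implicit Types (w : 'rV[R]_m).

Lemma so3_deg_ind i (Q : gl R N -> Prop) : linear_closed_pred Q ->
  (forall d d' x y, gv3 d x -> gv3 d' y -> d + d' = i -> Q (wd x y)) ->
  forall u, so_deg t3 i u -> Q u.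
Proof. by move=> QL QG u [c [-> cw]]; exact: so3_graded_ind QL QG cw. Qed.

Lemma V3_scale c w : c *: wd b1 (iota3 w) = V (c *: w).
Proof. by rewrite linearZ /= V3E. Qed.

Lemma so3_degN1 u : so_deg t3 (-1) u -> exists c w, u = c *: E + V w.
Proof.
move: u; apply: so3_deg_ind => [|d d' x y].
  split=> [|a x y [c [w ->]] [c' [w' ->]]].
    by exists 0, 0; rewrite linear0 scale0r addr0.
  by exists (a * c + c'), (a *: w + w'); rewrite [V (_ + _)]linearP; linear_ring.
have QE c : exists c' w, c *: E = c' *: E + V w by exists c, 0; rewrite linear0 addr0.
have QV w : exists c' w', V w = c' *: E + V w' by exists 0, w; rewrite scale0r add0r.
case=> {d x} [c|c|w|c|c]; case=> {d' y} [c'|c'|w'|c'|c'] /eqP // _.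
- by rewrite wd_sym wdZl wdZr scalerA -scaleNr; exact: QE.
- by rewrite wd_sym wdZl -scaleNr V3_scale; exact: QV.
- by rewrite wdZl V3_scale; exact: QV.
- by rewrite wdZl wdZr scalerA; exact: QE.
Qed.

Lemma so3_degN2 u : so_deg t3 (-2) u -> exists w, u = adn E 1 (V w).
Proof.
move: u; apply: so3_deg_ind => [|d d' x y].
  split=> [|a x y [w ->] [w' ->]].
    by exists 0; rewrite linear0 adn0.
  by exists (a *: w + w'); rewrite [V (_ + _)]linearP adn_linear.
have QV c w : exists w', c *: wd b2 (iota3 w) = adn E 1 (V w').
  by exists (c *: w); rewrite adn1 linearZ lieZr E3_V3.
case=> {d x} [c|c|w|c|c]; case=> {d' y} [c'|c'|w'|c'|c'] /eqP // _.
- by rewrite wd_sym wdZl -scaleNr; exact: QV.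
- by exists 0; rewrite wdZl wdZr wdxx !scaler0 linear0 adn0.
- by rewrite wdZl; exact: QV.
Qed.

Lemma so3_degN3 u : so_deg t3 (-3) u -> exists c, u = c *: F.
Proof.
move: u; apply: so3_deg_ind => [|d d' x y].
  split=> [|a x y [c ->] [c' ->]]; first by exists 0; rewrite scale0r.
  by exists (a * c + c'); linear_ring.
case=> {d x} [c|c|w|c|c]; case=> {d' y} [c'|c'|w'|c'|c'] /eqP // _.
- by exists (- (c' * c)); rewrite wd_sym wdZl wdZr scalerA -scaleNr.
- by exists (c * c'); rewrite wdZl wdZr scalerA.
Qed.

Lemma so3_deg_low i u : i < - 3%:Z -> so_deg t3 i u -> u = 0.
Proof.
move=> i3; move: u; apply: so3_deg_ind => [|d d' x y].
  by split=> [//|a x y -> ->]; rewrite scaler0 addr0.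
case=> {d x} [c|c|w|c|c]; case=> {d' y} [c'|c'|w'|c'|c'] ii; try by exfalso; lia.
by rewrite wdZl wdZr wdxx !scaler0.
Qed.

Lemma so3_deg0 u : so_deg t3 0 u -> (exists c, [lie u, E] = c *: E) /\
  forall w, exists w', [lie u, V w] = V w'.
Proof.
move: u; pose Q u := (exists c, [lie u, E] = c *: E) /\
  forall w, exists w', [lie u, V w] = V w'.
have QL : linear_closed_pred Q.
  split=> [|a x y [[c xc] xw] [[c' yc] yw]].
    split=> [|w]; first by exists 0; rewrite lie0l scale0r.
    by exists 0; rewrite lie0l linear0.
  split=> [|w]; first by exists (a * c + c'); rewrite lieDl lieZl xc yc; linear_ring.
  have [w1 w1E] := xw w; have [w2 w2E] := yw w; exists (a *: w1 + w2).
  by rewrite lieDl lieZl w1E w2E [in RHS]linearP.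
have [Q0 _ _ QZ] := linear_closed_conv QL.
have Q2 c c' : Q (wd (c *: a2) (c' *: b2)).
  rewrite wdZl wdZr; do 2!apply: (QZ); split=> [|w].
    by exists (-1); rewrite br_wd !gram3 !zsimp scaleN1r.
  by exists 0; rewrite V3E br_wd !gram3 !zsimp linear0.
have Q1 c c' : Q (wd (c *: a1) (c' *: b1)).
  rewrite wdZl wdZr; do 2!apply: (QZ); split=> [|w].
    by exists 1; rewrite br_wd !gram3 !zsimp.
  by exists (- w); rewrite linearN V3E br_wd !gram3 !zsimp -V3E.
have Qi w w' : Q (wd (iota3 w) (iota3 w')).
  split=> [|w0].
    by exists 0; rewrite br_wd !gram3 !zsimp.
  exists (sform w' w0 *: w - sform w w0 *: w').
  by rewrite [RHS]linearB /= ![V (_ *: _)]linearZ /= !V3E br_wd !gram3 !zsimp.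
have QS x y : Q (wd x y) -> Q (wd y x) by move=> h; rewrite wd_sym -scaleN1r; exact: QZ.
apply: so3_deg_ind => // d d' x y.
case=> {d x} [c|c|w|c|c]; case=> {d' y} [c'|c'|w'|c'|c'] /eqP // _.
- exact: Q2.
- exact: Q1.
- exact: Qi.
- by apply: (QS); exact: Q1.
- by apply: (QS); exact: Q2.
Qed.

(** It acts by -1 on [E3] and by 0 on V, and so singles out the invariant complement. *)
Definition Z3 : gl R N := so_boost (\row_k (k == 0%N :> nat)%:R).

Lemma Z3_wd x y : [lie Z3, wd x y] = wd ((Z3 : 'M_N) *m x) y + wd x ((Z3 : 'M_N) *m y).
Proof. by rewrite br_so_wd //; exact: so_boostP. Qed.

Lemma tt_Z3 i : boost_coef (\row_(k < so_rank p q) (k == 0%N :> nat)%:R) i = (i == 0%N)%:R :> R.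
Proof.
rewrite /boost_coef; case: ltnP => ir; first by rewrite mxE inordK.
by case: i ir.
Qed.

Lemma Z3_act : [/\ (Z3 : 'M_N) *m b2 = - b2, (Z3 : 'M_N) *m a1 = 0, (Z3 : 'M_N) *m b1 = 0
  & forall w, (Z3 : 'M_N) *m iota3 w = 0].
Proof.
split; rewrite ?b2E ?a1E ?b1E -?scalemxAr ?boost_wv ?tt_Z3.
- by rewrite mulr1 scaleN1r scalerN.
- by rewrite mulr0 scale0r.
- by rewrite mulr0 scale0r scaler0.
move=> w; apply: (boost_kill (d := 2)) => i; last exact: iota3_low.
by rewrite tt_Z3; case: i.
Qed.

Lemma F3_neq0 : F != 0.
Proof.
apply/eqP => /(congr1 (fun u : gl R N => ip a1 ((u : 'M_N) *m a2))).
by rewrite mul0mx ip0r wdE !gram3 !zsimp ipNr !gram3 => /eqP; rewrite oppr_eq0 oner_eq0.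
Qed.

Lemma t3_MI : [/\ so_MI t3 (-1) E, forall w, so_MI t3 (-1) (V w), so_MI t3 (-3) F & so_MI t3 0 Z3].
Proof.
have hb2 := H3_b2 R p q; have ha1 := H3_a1 R p q; have hb1 := H3_b1 R p q.
split.
- by apply: (so3_MI (d := -2) (d' := 1)) => //; rewrite (hb2, ha1) ?rmorphN.
- by move=> w; rewrite V3E; apply: (so3_MI (d := -1) (d' := 0)) => //; exact: H3_i.
- by apply: (so3_MI (d := -2) (d' := -1)).
split; first exact: so_boostP.
rewrite scale0r; exact: (rm_comm (so_root_model R p q)).
Qed.

Lemma so3_forward (L : lieAlgType R) k gr labels : @kgrading R L k gr -> so_type p q labels gr ->
  (forall i : 'I_(so_rank p q), so_root i t3 = (i.+1 \in labels)%:R) ->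
  exists Ee : {vspace L}, condition1 k gr Ee /\
     exists Ve : {vspace L}, unique (invariant_complement gr Ee) Ve /\ condition2 k gr Ee Ve.
Proof.
move=> kg st tl; have [g [gker gbr g1 g0]] := so_type_transfer kg st tl.
have [zb2 za1 zb1 zi] := Z3_act; have [ME MV MF MZ] := t3_MI.
have ZE : [lie Z3, E] = (-1) *: E by rewrite Z3_wd zb2 za1 wd0r addr0 wdNl scaleN1r.
have ZV w : [lie Z3, V w] = 0 *: V w by rewrite V3E Z3_wd zb1 zi wd0l wd0r addr0 scale0r.
have sl w : (forall u, sform w u = 0) -> w = 0 by exact: sform_nondeg.
apply: (forward_transfer (k := 3) (e := E) (f := F) (v := V) (b := @sform R p q) (M0 := so_MI t3)
  (M1 := so_deg t3) (z0 := Z3) (la := -1) (mu := 0)) kg gker gbr g1 g0 => //.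
- exact: so3_negative.
- exact: so3_degN1.
- by move=> [|j] u // _; exact: so3_degN2.
- exact: so3_degN3.
- exact: so3_deg_low.
- exact: so3_deg0.
- by move=> u uw; apply: sl => w; rewrite sform_sym.
- move=> c w /(congr1 (fun u : gl R N => ip a2 ((u : 'M_N) *m b1))).
  by rewrite mulmxDl -scalemxAl V3E mul0mx ip0r !wdE !gram3 !zsimp (ipZr c) !gram3 mulr1.
- exact: F3_neq0.
- by rewrite oppr_eq0 oner_eq0.
- by rewrite oddM andbF.
Qed.
End SoThreeForward.

Lemma vline_of_dim1 (F : fieldType) (W : vectType F) (U : {vspace W}) :
  \dim U = 1%N -> exists e, U = <[e]>%VS.
Proof.
move=> dU; exists (vpick U); apply/esym/eqP; rewrite eqEdim -memvE memv_pick dU dim_vline vpick0.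
by rewrite -dimv_eq0 dU.
Qed.

(** * Embedding into a model *)

Section ConverseTransfer.
Variables (R : realFieldType) (L T : lieAlgType R) (k m : nat) (q : int -> {vspace L}).
Variables (E V : {vspace L}) (e f : L) (v : 'Hom('rV[R]_m, L)).
Variables (e' f' : T) (v' : 'Hom('rV[R]_m, T)) (b : 'rV[R]_m -> 'rV[R]_m -> R) (MI : int -> T -> Prop).
Hypotheses (simp : simple_lie L) (kg : kgrading k q) (k3 : (3 <= k)%N).
Hypotheses (c1 : condition1 k q E) (ic : invariant_complement q E V) (c2 : condition2 k q E V).
Hypotheses (Ee : E = <[e]>%VS) (fq : q (- k%:Z) = <[f]>%VS).
Hypotheses (vV : limg v = V) (vb : forall w u, bform k e f (v w) (v u) = b w u).
Hypothesis b_left : forall w, (forall u, b w u = 0) -> w = 0.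
Hypothesis b_right : forall u, (forall w, b w u = 0) -> u = 0.
Hypotheses (nr' : negative_relations k e' f' v' b) (e'0 : e' != 0).
Hypothesis MI_lin : forall i, linear_closed_pred (MI i).
Hypothesis MI_br : forall i j u w, MI i u -> MI j w -> MI (i + j) [lie u, w].
Hypotheses (e'1 : MI (-1) e') (v'1 : forall w, MI (-1) (v' w)) (f'k : MI (- k%:Z) f').
Hypothesis MI_trans : forall i u, 0 <= i -> MI i u -> [lie u, e'] = 0 ->
  (forall w, [lie u, v' w] = 0) -> u = 0.
Variable z : L.
Hypotheses (zs : z \in bracket_span (q 1) (q (-1))) (ze : [lie z, e] = e).
Hypothesis zv : forall w, [lie z, v w] = - ((k.-1)%:R / 2) *: v w.
Hypothesis tot0 : forall z, z \in q 0 -> exists u, match0 q e v e' v' MI z u.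
Hypothesis tot1 : forall x, x \in q 1 -> exists u, match1 q e v e' v' MI x u.

Lemma converse_V w : v w \in V. Proof. by rewrite -vV memv_img ?memvf. Qed.

Lemma converse_onto w : w \in V -> exists u, w = v u.
Proof. by rewrite -vV => /memv_imgP[u _ ->]; exists u. Qed.

Lemma converse_inj w : v w = 0 -> w = 0.
Proof.
by move=> w0; apply: b_left => u; rewrite -vb w0 /bform lie0l linear0.
Qed.

(** The kernel of the homomorphism is an ideal that does not contain [e], hence 0 by simplicity. *)
Lemma converse_transfer : exists h : 'Hom(L, T),
  [/\ lker h = 0%VS, forall x y, h [lie x, y] = [lie h x, h y], h e = e' /\ forall w, h (v w) = v' w,
      forall i x, x \in q i -> MI i (h x) & forall x u, match1 q e v e' v' MI x u -> h x = u].
Proof.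
have vq w : v w \in q (-1) by apply: (V_deg ic); exact: converse_V.
have fk := bottom_deg fq.
have ek : e \in q (-1) := E_gen_deg c1 Ee.
have nr : negative_relations k e f v b.
  split=> [j w u jk|w u|w||w].
  - by apply: (V_adn0 kg k3 c1 ic c2 Ee); rewrite ?converse_V.
  - by rewrite (formE kg k3 c1 ic Ee fq) ?vb ?converse_V.
  - by apply: (adn_top kg k3 c1 ic Ee); exact: converse_V.
  - by have := gr_br kg ek fk; rewrite (kgrading_supp kg) ?memv0; [move/eqP|lia].
  - by apply: (V_bottom kg k3 ic fq); exact: converse_V.
have degN1 x : x \in q (-1) -> exists c w, x = c *: e + v w.
  by move=> /(degN1_decomp ic Ee)[c [_ [/converse_onto[w ->] ->]]]; exists c, w.
have degN j x : (j.+3 <= k)%N -> x \in q (- j.+2%:Z) -> exists w, x = adn e j.+1 (v w).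
  move=> jk xj; have [_ /converse_onto[w ->] ->] := adn_onto k3 c1 c2 Ee jk xj.
  by exists w.
have degNk x : x \in q (- k%:Z) -> exists c, x = c *: f by rewrite fq => /vlineP.
have indep c w : c *: e + v w = 0 -> c = 0 /\ w = 0.
  by move=> /(EV_indep c1 ic Ee (converse_V w))[-> /converse_inj->].
have f0 : f != 0 := bottom_gen_neq0 c1 fq.
have zV w : w \in V -> [lie z, w] = - ((k.-1)%:R / 2) *: w.
  by move=> /converse_onto[u ->]; exact: zv.
have pos := analysis_positive_generation simp kg k3 c1 ic c2 Ee fq zs ze zV.
have [h [hbr he hv hM h1]] := recognition kg k3 nr nr' ek vq fk degN1 degN degNk b_left b_right
  indep f0 MI_lin MI_br e'1 v'1 f'k MI_trans pos tot0 tot1.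
exists h; split=> //.
have [_ _ /(_ (lker h) (subvf _))] := simp; case=> // [x y _|kf].
  by rewrite !memv_ker hbr => /eqP->; rewrite lie0r.
by case/eqP: e'0; rewrite -he; apply/eqP; rewrite -memv_ker kf memvf.
Qed.
End ConverseTransfer.

(** * Recognition at depth three *)

Section SoThreeGenerate.
Variables (R : realFieldType) (p q : nat).
Hypothesis m0 : (0 < p + q)%N.
Local Notation N := (p.+2 + q.+2)%N.
Local Notation m := (p + q)%N.
Local Notation so u := (@in_so R p.+2 q.+2 u).
Local Notation E := (@E3 R p q).
Local Notation V := (@V3 R p q).
Local Notation iota3 := (@iota3 R p q).
Local Notation a2 := (@a2 R p q).
Local Notation b2 := (@b2 R p q).
Local Notation a1 := (@a1 R p q).
Local Notation b1 := (@b1 R p q).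
Local Notation t3 := (@t3 R p q).
Implicit Types (w : 'rV[R]_m) (u : gl R N).

(** Brackets of the two kinds of elements of degree 1 with each other and with the negative part
    reach the wedges of all pairs among a2, a1, b1, b2 and the middle vectors. *)
Lemma so3_generate (Q : gl R N -> Prop) : linear_closed_pred Q ->
  (forall u u', Q u -> Q u' -> Q [lie u, u']) -> Q E -> (forall w, Q (V w)) ->
  Q (wd a2 b1) -> (forall w, Q (wd a1 (iota3 w))) -> forall u, so u -> Q u.
Proof.
move=> QL Qbr QE QV Qab Qai; have [Q0 QD QB QZ] := linear_closed_conv QL.
have QN u : Q u -> Q (- u) by move=> Qu; rewrite -scaleN1r; exact: QZ.
have QS x y : Q (wd x y) -> Q (wd y x) by move=> h; rewrite wd_sym; exact: QN.
(* [d] has square s with s^2 = 1, so the factor [sform d d] that some brackets carry can be divided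
   out. *)
pose d : 'rV[R]_m := delta_mx 0 (Ordinal m0); pose s := sform d d.
have ss : s * s = 1 by exact: sform_anisotropic.
have Qs u : Q (s *: u) -> Q u by move=> /(QZ s); rewrite scalerA ss scale1r.
have b2i w : Q (wd b2 (iota3 w)) by rewrite -E3_V3; exact: Qbr.
have b1i w : Q (wd b1 (iota3 w)) by rewrite -V3E.
have a2i w : Q (wd a2 (iota3 w)).
  by have := Qbr _ _ Qab (Qai w); rewrite br_wd !gram3 !zsimp.
have a1a2 : Q (wd a1 a2).
  by apply: (Qs); have := Qbr _ _ (a2i d) (Qai d); rewrite br_wd !gram3 !zsimp.
have b2b1 : Q (wd b2 b1).
  by apply: (Qs); have := Qbr _ _ (b1i d) (b2i d); rewrite br_wd !gram3 !zsimp.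
have b2a2 : Q (wd b2 a2).
  by apply: (Qs); have := Qbr _ _ (a2i d) (b2i d); rewrite br_wd !gram3 !zsimp wdxx oppr0 add0r.
have b1a1 : Q (wd b1 a1).
  by apply: (Qs); have := Qbr _ _ (Qai d) (b1i d); rewrite br_wd !gram3 !zsimp wdxx oppr0 add0r.
have iiw w w' : Q (wd (iota3 w) (iota3 w')).
  have := Qbr _ _ (Qai w) (b1i w'); rewrite br_wd !gram3 !zsimp => h.
  have := QB _ _ (QZ (sform w w') _ b1a1) h.
  by rewrite opprD opprK addrCA subrr addr0.
have lin x : linear_closed_pred (fun y => Q (wd x y)).
  by split=> [|a y z Qy Qz]; [rewrite wd0r|rewrite wdDr wdZr; apply: (proj2 QL)].
have QW x y : Q (wd x y).
  have Qxx z : Q (wd z z) by rewrite wdxx.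
  move: y; apply: (span3 (lin x)) => [||||w]; apply: (QS); move: x; apply: (span3 (lin _)).
  - exact: Qxx.
  - exact: QS a1a2.
  - exact: Qab.
  - exact: QS b2a2.
  - exact: a2i.
  - exact: a1a2.
  - exact: Qxx.
  - exact: QS b1a1.
  - exact: QS QE.
  - exact: Qai.
  - exact: QS Qab.
  - exact: b1a1.
  - exact: Qxx.
  - exact: QS b2b1.
  - exact: b1i.
  - exact: b2a2.
  - exact: QE.
  - exact: b2b1.
  - exact: Qxx.
  - exact: b2i.
  - exact: QS (a2i w).
  - exact: QS (Qai w).
  - exact: QS (b1i w).
  - exact: QS (b2i w).
  - exact: iiw.
apply: (so_ind (F := fun _ => True) QL) => // Q' _ h x; exact: h.
Qed.

(* A skew endomorphism is half the sum of the wedges of the images of the vectors of a basis with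
   the vectors of the dual basis. *)
Lemma so3_skew (G : 'M[R]_m) : (forall w w', sform (w *m G) w' + sform w (w' *m G) = 0) ->
  exists X : gl R N, [/\ so_MI t3 0 X, [lie X, E] = 0 & forall w, [lie X, V w] = V (w *m G)].
Proof.
move=> skew; pose S := sig_form R p q; pose dv i : 'rV[R]_m := delta_mx 0 i.
have dS i w : sform (dv i *m S) w = w 0 i.
  by rewrite /sform -!mulmxA [S *m _]mulmxA sig_form_sqr mul1mx -rowE !mxE.
have Sd w : \sum_i sform (dv i) w *: (dv i *m S) = w.
  have -> : \sum_i sform (dv i) w *: (dv i *m S) = (\sum_i (w *m S) 0 i *: dv i) *m S.
    rewrite mulmx_suml; apply: eq_bigr => i _; rewrite -scalemxAl; congr (_ *: _).
    by rewrite sform_sym /sform trmx_delta -colE mxE.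
  by rewrite -row_sum_delta -mulmxA sig_form_sqr mulmx1.
exists (2^-1 *: \sum_i wd (iota3 (dv i *m G)) (iota3 (dv i *m S))).
have MIL := so_MI_linear t3 0; have [_ _ _ MIZ] := linear_closed_conv MIL.
have lin (x : gl R N) (F : 'I_m -> gl R N) : [lie 2^-1 *: \sum_i F i, x] = 2^-1 *: \sum_i [lie F i, x].
  rewrite lieZl; congr (_ *: _); elim/big_rec2: _ => [|i y z _ <-]; first by rewrite lie0l.
  by rewrite lieDl.
split.
- apply: MIZ; apply: linear_closed_sum => // i _.
  by apply: (so3_MI (d := 0) (d' := 0)) => //; exact: H3_i.
- by rewrite lin big1 ?scaler0 // => i _; rewrite br_wd !gram3 !zsimp.
move=> w; rewrite lin.
have -> : \sum_i [lie wd (iota3 (dv i *m G)) (iota3 (dv i *m S)), V w] =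
   V (\sum_i (sform (dv i *m S) w *: (dv i *m G)) + \sum_i (sform (dv i) (w *m G) *: (dv i *m S))).
  rewrite -big_split linear_sum; apply: eq_bigr => i _ /=.
  rewrite V3E br_wd !gram3 !zsimp [RHS]linearD /= !linearZ /= !V3E.
  have -> : sform (dv i) (w *m G) = - sform (dv i *m G) w.
    by apply/eqP; rewrite -addr_eq0 addrC skew.
  by rewrite scaleNr scalerN.
rewrite Sd; under eq_bigr do rewrite dS.
have -> : \sum_i w 0 i *: (dv i *m G) = w *m G.
  by under eq_bigr do rewrite scalemxAl; rewrite -mulmx_suml -row_sum_delta.
by rewrite -linearZ -mulr2n -scaler_nat scalerA mulVf ?pnatr_eq0 // scale1r.
Qed.
End SoThreeGenerate.

Section SoThreeMatch.
Variables (R : realFieldType) (p q : nat).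
Local Notation N := (p.+2 + q.+2)%N.
Local Notation m := (p + q)%N.
Local Notation E := (@E3 R p q).
Local Notation V := (@V3 R p q).
Local Notation iota3 := (@iota3 R p q).
Local Notation a2 := (@a2 R p q).
Local Notation b2 := (@b2 R p q).
Local Notation a1 := (@a1 R p q).
Local Notation b1 := (@b1 R p q).
Local Notation t3 := (@t3 R p q).
Implicit Types (w : 'rV[R]_m) (u : gl R N).

Lemma so3_MI_gen : [/\ so_MI t3 0 (wd a2 b2), so_MI t3 0 (wd a1 b1),
  forall w w', so_MI t3 0 (wd (iota3 w) (iota3 w')), so_MI t3 1 (wd a2 b1)
  & forall w, so_MI t3 1 (wd a1 (iota3 w))].
Proof.
have hb2 := H3_b2 R p q; have ha1 := H3_a1 R p q; have hb1 := H3_b1 R p q; have ha2 := H3_a2 R p q.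
split=> [||w w'||w].
- by apply: (so3_MI (d := 2) (d' := -2)).
- by apply: (so3_MI (d := 1) (d' := -1)).
- by apply: (so3_MI (d := 0) (d' := 0)) => //; exact: H3_i.
- by apply: (so3_MI (d := 2) (d' := -1)).
- by apply: (so3_MI (d := 1) (d' := 0)) => //; exact: H3_i.
Qed.

Lemma a1b1_E : [lie wd a1 b1, E] = E.
Proof. by rewrite br_wd !gram3 !zsimp. Qed.
Lemma a2b2_E : [lie wd a2 b2, E] = - E.
Proof. by rewrite br_wd !gram3 !zsimp. Qed.
Lemma a1b1_V w : [lie wd a1 b1, V w] = - V w.
Proof. by rewrite V3E br_wd !gram3 !zsimp. Qed.
Lemma a2b2_V w : [lie wd a2 b2, V w] = 0.
Proof. by rewrite V3E br_wd !gram3 !zsimp. Qed.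
Lemma ii_E w w' : [lie wd (iota3 w) (iota3 w'), E] = 0.
Proof. by rewrite br_wd !gram3 !zsimp. Qed.
Lemma ii_V w w' w0 : [lie wd (iota3 w) (iota3 w'), V w0] = V (sform w' w0 *: w - sform w w0 *: w').
Proof. by rewrite [RHS]linearB /= ![V (_ *: _)]linearZ /= !V3E br_wd !gram3 !zsimp. Qed.

(** The partner of an x in [q 1] with a = [lam e [lie x, e]] and [x, f] = [e, v y]. The factor a / 2
    makes its bracket with [E3] act by a on [E3] and by - a / 2 on V, as [x, e] acts on e and V. *)
Definition so3_raise (a : R) (y : 'rV[R]_m) : gl R N := (a / 2) *: wd a2 b1 - wd a1 (iota3 y).

Lemma so3_raise_MI a y : so_MI t3 1 (so3_raise a y).
Proof.
have [_ _ _ M1 M2] := so3_MI_gen; have [_ _ MB MZ] := linear_closed_conv (so_MI_linear t3 1).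
by apply: (MB) => //; exact: MZ.
Qed.

Lemma so3_raise_E a y : [lie so3_raise a y, E] = (a / 2) *: (wd a1 b1 - wd a2 b2).
Proof.
rewrite lieBl lieZl !br_wd !gram3 !zsimp; congr (_ *: _).
by rewrite (wd_sym b1) (wd_sym b2) opprK.
Qed.

Lemma so3_raise_V a y w : [lie so3_raise a y, V w] =
  wd (iota3 y) (iota3 w) + sform y w *: wd a1 b1.
Proof.
rewrite V3E lieBl lieZl !br_wd !gram3 !zsimp.
by rewrite (wd_sym b1) scalerN opprD !opprK.
Qed.
(** The element on the left acts by -2 on the wedge of a2 and b1 and by 1 on those of a1 with the
    middle vectors, so the difference with the original isolates the first part. *)
Lemma so3_raise_br a y : [lie wd a1 b1 - wd a2 b2, so3_raise a y] = so3_raise (- 2 * a) y.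
Proof.
have h1 : [lie wd a1 b1, wd a2 b1] = - wd a2 b1 by rewrite br_wd !gram3 !zsimp wd_sym opprK.
have h2 : [lie wd a2 b2, wd a2 b1] = wd a2 b1 by rewrite br_wd !gram3 !zsimp.
have h3 : [lie wd a1 b1, wd a1 (iota3 y)] = wd a1 (iota3 y) by rewrite br_wd !gram3 !zsimp.
have h4 : [lie wd a2 b2, wd a1 (iota3 y)] = 0 by rewrite br_wd !gram3 !zsimp.
rewrite lieBl !lieBr !lieZr h1 h2 h3 h4 /so3_raise.
by move: (wd a2 b1) (wd a1 (iota3 y)) => X Y; linear_field.
Qed.

Lemma so3_raise_diff a y : so3_raise a y - so3_raise (- 2 * a) y = (3 * (a / 2)) *: wd a2 b1.
Proof. by rewrite /so3_raise; move: (wd a2 b1) (wd a1 (iota3 y)) => X Y; linear_field. Qed.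
End SoThreeMatch.

Section SoThreeConverse.
Variables (R : realType) (L : lieAlgType R) (q : int -> {vspace L}) (E V : {vspace L}).
Hypotheses (simp : simple_lie L) (kg : kgrading 3 q).
Hypotheses (c1 : condition1 3 q E) (ic : invariant_complement q E V) (c2 : condition2 3 q E V).

Lemma so3_converse : exists p p', (0 < p + p')%N /\ forall labels,
  (forall i : 'I_(so_rank p p'), so_root i (t3 R p p') = (i.+1 \in labels)%:R) ->
  so_type p p' labels q.
Proof.
have k3 : (3 <= 3)%N by []; have k3e : 3%N = 3%N by [].
have [e Ee] : exists e, E = <[e]>%VS by have [_ _ _ dE _] := c1; exact: vline_of_dim1.
have [f fq] : exists f, q (- 3%:Z) = <[f]>%VS by have [df _ _ _ _] := c1; exact: vline_of_dim1.
have [p [p' [v [vV vb]]]] := @sylvester_basis R L (bform 3 e f) (form_linl 3 e f)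
  (fun a x y z => form_linr 3 e f a z x y) V
  (fun x y => form_sym kg k3 c1 ic c2 Ee fq k3e (w := x) (u := y))
  (fun x => form_eq0 kg k3 c1 ic c2 Ee fq (w := x)).
have vin w : v w \in V := converse_V vV w.
have onto := converse_onto vV.
have nd w : (forall u, sform w u = 0) -> w = 0 := @sform_nondeg R p p' w.
have inj w : v w = 0 -> w = 0 := converse_inj vb nd (w := w).
have m0 : (0 < p + p')%N.
  rewrite lt0n; apply/eqP => m0; have [w /onto[u ->]] := V_neq0 kg k3 c1 ic Ee fq.
  by rewrite (_ : u = 0) ?linear0 ?eqxx //; apply/rowP => -[i il]; exfalso; move: il; rewrite m0.
exists p, p'; split=> // labels tl.
pose d : 'rV[R]_(p + p') := delta_mx 0 (Ordinal m0); pose s := sform d d.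
have ss : s * s = 1 by exact: sform_anisotropic.
have [x0 x01 x0f] := q1_bottom_onto simp kg k3 c1 ic Ee fq (vin d).
(* [x0, v d] acts by s on [e] and by -s on V; after multiplication by s the scalars are 1 and -(k -
   1) / 2 for k = 3. *)
pose z := s *: [lie x0, v d].
have act x y w u : x \in q 1 -> [lie x, f] = [lie e, v y] ->
    [lie [lie x, v w], v u] = v (sform w u *: y - sform y w *: u - sform y u *: w).
  move=> x1 xf; rewrite (depth3_action kg k3 c1 ic c2 Ee fq k3e x1 (vin y) xf) ?vin // !vb.
  by rewrite !linearB !linearZ.
have lam1 x y w : x \in q 1 -> [lie x, f] = [lie e, v y] -> [lie [lie x, v w], e] = sform y w *: e.
  move=> x1 xf; rewrite (q0_E kg k3 c1 Ee (q1_V kg ic x1 (vin w))).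
  by rewrite (depth3_lam kg k3 c1 ic c2 Ee fq k3e x1 (vin y) xf) ?vin // vb.
have zs : z \in bracket_span (q 1) (q (-1)).
  by rewrite memvZ // mem_bracket_span // (V_deg ic).
have ze : [lie z, e] = e by rewrite lieZl (lam1 _ d) // scalerA ss scale1r.
have zv w : [lie z, v w] = - (2%:R / 2) *: v w.
  have -> : [lie z, v w] = v (s *: (- s *: w)).
    by rewrite lieZl (act _ d) // [RHS]linearZ /= scaleNr [_ - s *: w]addrC addrK.
  by rewrite scalerA mulrN ss linearZ /= mulfV ?pnatr_eq0.
have xbot x : x \in q 1 -> exists y, [lie x, f] = [lie e, v y].
  move=> x1; have [_ /onto[y ->] xf] := depth3_q1_bottom kg k3 c1 c2 Ee fq k3e x1.
  by exists y.
have [Ma2b2 Ma1b1 Mii _ _] := so3_MI_gen R p p'.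
have MIL i := @so_MI_linear R p p' (t3 R p p') i.
have [_ MD0 MB0 MZ0] := linear_closed_conv (MIL 0).
pose m0q := match0 q e v (@E3 R p p') (@V3 R p p') (@so_MI R p p' (t3 R p p')).
pose m1q := match1 q e v (@E3 R p p') (@V3 R p p') (@so_MI R p p' (t3 R p p')).
have tot0 z' : z' \in q 0 -> exists u, m0q z' u.
  move=> z'0; have gex (i : 'I_(p + p')) : exists g, [lie z', v (delta_mx 0 i)] = v g.
    by have [g] := onto _ (q0_V ic z'0 (vin (delta_mx 0 i))); exists g.
  pose G : 'M[R]_(p + p') := \matrix_i projT1 (cid (gex i)).
  have zG w : [lie z', v w] = v (w *m G).
    have lin u : [lie z', v (\sum_i u i *: delta_mx 0 i)] = v (\sum_i u i *: row i G).
      elim/big_rec2: _ => [|i x y _ IH]; first by rewrite !linear0 lie0r.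
      rewrite !linearD !linearZ /= lieDr lieZr IH; congr (_ *: _ + _).
      by rewrite rowK; case: (cid (gex i)).
    have := lin (fun i => w 0 i); rewrite -row_sum_delta => ->; congr (v _).
    by rewrite [in RHS](row_sum_delta w) mulmx_suml; apply: eq_bigr => i _; rewrite -scalemxAl -rowE.
  have ze' := q0_E kg k3 c1 Ee z'0; set la := lam e z' in ze'.
  have [nu zf] : exists nu, [lie z', f] = nu *: f.
    by apply/vlineP; rewrite -fq; apply: (gr_br_eq kg z'0 (bottom_deg fq)); rewrite add0r.
  (* [z'] scales the form on V by nu - la; subtracting half of this factor leaves a skew
     endomorphism. *)
  have skew w w' : sform (w *m (G - ((nu - la) / 2)%:M)) w' + sform w (w' *m (G - ((nu - la) / 2)%:M)) = 0.
    have := form_q0 kg k3 c1 ic Ee fq z'0 zf (vin w) (vin w').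
    rewrite !zG !vb -/la mul1r => h.
    rewrite !mulmxBr !mul_mx_scalar -!scaleNr sformDl sformDr sformZl sformZr addrACA h; lra.
  have [X [XM XE XV]] := so3_skew skew.
  (* The coefficients are solved from the scalars of the two wedges: 1 on [E3] and -1 on V for a1
     with b1, -1 and 0 for a2 with b2. *)
  exists (X - ((nu - la) / 2) *: wd (a1 R p p') (b1 R p p') - ((nu - la) / 2 + la) *: wd (a2 R p p') (b2 R p p')).
  split=> //; first by apply: (MB0); [apply: (MB0) => //|]; exact: MZ0.
  exists la, (fun w => w *m G); split=> // [|w].
    by rewrite !lieBl !lieZl XE a1b1_E a2b2_E; linear_ring.
  rewrite !lieBl !lieZl XV a1b1_V a2b2_V scaler0 subr0 scalerN opprK -linearZ -linearD.
  by rewrite mulmxBr mul_mx_scalar subrK.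
have m0E x : x \in q 1 -> m0q [lie x, e] ((lam e [lie x, e] / 2) *: (wd (a1 R p p') (b1 R p p') - wd (a2 R p p') (b2 R p p'))).
  move=> x1; have xe0 := q1_e kg c1 Ee x1; split=> //; first by apply: MZ0; exact: MB0.
  exists (lam e [lie x, e]), (fun w => - (lam e [lie x, e] / 2) *: w); split.
  - exact: (q0_E kg k3 c1 Ee).
  - by rewrite lieZl lieBl a1b1_E a2b2_E; linear_field.
  - by move=> w; rewrite (q1_e_V kg k3 c1 ic c2 Ee x1 (vin w)) linearZ /=; congr (_ *: _); field.
  - by move=> w; rewrite lieZl lieBl a1b1_V a2b2_V subr0 linearZ /= scalerN scaleNr.
have m1x x y : x \in q 1 -> [lie x, f] = [lie e, v y] -> m1q x (so3_raise (lam e [lie x, e]) y).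
  move=> x1 xf; split=> //; first exact: so3_raise_MI.
    by rewrite so3_raise_E; exact: m0E.
  move=> w; rewrite so3_raise_V; split; first exact: (q1_V kg ic x1 (vin w)).
    by apply: (MD0) => //; exact: MZ0.
  exists (sform y w), (fun w' => sform w w' *: y - sform y w *: w' - sform y w' *: w); split.
  - exact: lam1.
  - by rewrite lieDl lieZl ii_E a1b1_E add0r.
  - by move=> w'; exact: act.
  - by move=> w'; rewrite lieDl lieZl ii_V a1b1_V scalerN -linearZ -linearB addrAC.
have tot1 x : x \in q 1 -> exists u, m1q x u.
  by move=> x1; have [y xf] := xbot x x1; exists (so3_raise (lam e [lie x, e]) y); exact: m1x.
have [ME MV MF _] := t3_MI R p p'.
have E0 : E3 R p p' != 0.
  apply/eqP => /(congr1 (fun u : gl R (p.+2 + p'.+2) => ip (b1 R p p') ((u : 'M_(p.+2 + p'.+2)) *m a2 R p p'))).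
  rewrite mul0mx ip0r wdE !gram3 !zsimp ipNr !gram3 => /eqP.
  by rewrite oppr_eq0 oner_eq0.
have nd' u : (forall w, @sform R p p' w u = 0) -> u = 0 by move=> h; apply: nd => w; rewrite sform_sym.
have [h [hker hbr [he hv] hM h1]] := converse_transfer simp kg k3 c1 ic c2 Ee fq vV vb nd nd'
  (so3_negative R p p') E0 MIL (@so_MI_br R p p' _) ME MV MF (fun i u => @so3_transitive R p p' i u m0)
  zs ze zv tot0 tot1.
(* An x with [x, e] acting nontrivially on [e] is bracketed with [x, e], which separates the two
   parts of its image. *)
have imab : exists x, h x = wd (a2 R p p') (b1 R p p').
  have [x x1 a0] := lam_e_nonzero simp kg k3 c1 ic c2 Ee fq.
  have [y xf] := xbot x x1; have hx := h1 _ _ (m1x _ _ x1 xf).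
  set a := lam e [lie x, e] in a0 hx.
  exists ((3 * (a / 2))^-1 *: (x - (2 / a) *: [lie [lie x, e], x])).
  rewrite linearZ /= linearB linearZ /= !hbr he hx so3_raise_E lieZl scalerA.
  rewrite (_ : 2 / a * (a / 2) = 1); last by field.
  rewrite scale1r so3_raise_br so3_raise_diff scalerK //.
  by apply: mulf_neq0; rewrite ?pnatr_eq0 // mulf_neq0 // invr_eq0 pnatr_eq0.
have hP u : in_so (u : 'M_(p.+2 + p'.+2)) <-> exists x, h x = u.
  split=> [su|[x <-]]; last first.
    move: x; apply: (graded_ind kg) => [|i x /hM[] //].
    split=> [|a x y hx hy]; first by rewrite linear0; case: (MIL 0) => -[].
    by rewrite linearP; apply: (proj2 (@so_linear R p p')).
  apply: (so3_generate m0 (Q := fun u => exists x, h x = u)) su.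
  - split=> [|a _ _ [x <-] [y <-]]; first by exists 0; rewrite linear0.
    by exists (a *: x + y); rewrite linearP.
  - by move=> _ _ [x <-] [y <-]; exists [lie x, y]; rewrite hbr.
  - by exists e.
  - by move=> w; exists (v w).
  - exact: imab.
  - move=> w; have [x x1 xf] := q1_bottom_onto simp kg k3 c1 ic Ee fq (vin w).
    have hx := h1 _ _ (m1x _ _ x1 xf); have [y hy] := imab.
    exists ((lam e [lie x, e] / 2) *: y - x).
    rewrite linearB linearZ /= hy hx /so3_raise.
    by rewrite opprB addrCA subrr addr0.
have rt i : so_root i (t3 R p p') = (i \in [set i : 'I_(so_rank p p') | i.+1 \in labels])%:R.
  by rewrite inE tl.
apply: (@has_type_intro R (gl R (p.+2 + p'.+2)) _ _ _ _ _ _ _ (so_root_model R p p') L h hker hP hbr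
  3 q _ (t3 R p p') kg rt) => //.
by move=> i x /hM[].
Qed.
End SoThreeConverse.

(** * Depth four: so(3, 4) *)

Section SoFour.
Variable R : realFieldType.
Local Notation p := 1%N.
Local Notation q := 2%N.
Local Notation N := (p.+2 + q.+2)%N.
Local Notation so u := (@in_so R p.+2 q.+2 u).
Local Notation r := (so_rank p q).
Local Notation ep := (@pos_vec R p q).
Local Notation em := (@neg_vec R p q).
Local Notation wv := (@null_vec R p q).
Local Notation tt := (@boost_coef R p q).
Implicit Types (x y z : 'cV[R]_N) (w : 'rV[R]_2) (u : gl R N).

(* Isotropic planes of degrees 2 and -2 in duality, a dual pair of isotropic vectors of degrees 1
   and -1, and a vector of square -1 orthogonal to all of them. *)
Fact pi4_subproof : {F : 'rV[R]_2 -> 'cV[R]_N |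
  forall w, F w = w 0 0 *: wv true 0 + w 0 1 *: wv true 1}.
Proof. by exists (fun w => w 0 0 *: wv true 0 + w 0 1 *: wv true 1). Qed.
Fact rho4_subproof : {F : 'rV[R]_2 -> 'cV[R]_N |
  forall w, F w = w 0 0 *: (2^-1 *: wv false 0) + w 0 1 *: (2^-1 *: wv false 1)}.
Proof. by exists (fun w => w 0 0 *: (2^-1 *: wv false 0) + w 0 1 *: (2^-1 *: wv false 1)). Qed.
Fact ep4_subproof : {x | x = wv true 2}. Proof. by exists (wv true 2). Qed.
Fact et4_subproof : {x | x = 2^-1 *: wv false 2}. Proof. by exists (2^-1 *: wv false 2). Qed.
Fact un4_subproof : {x | x = em 3}. Proof. by exists (em 3). Qed.
Definition pi4 := sval pi4_subproof.
Definition rho4 := sval rho4_subproof.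
Definition ep4 := sval ep4_subproof.
Definition et4 := sval et4_subproof.
Definition un4 := sval un4_subproof.
Lemma pi4E w : pi4 w = w 0 0 *: wv true 0 + w 0 1 *: wv true 1.
Proof. exact: svalP pi4_subproof w. Qed.
Lemma rho4E w : rho4 w = w 0 0 *: (2^-1 *: wv false 0) + w 0 1 *: (2^-1 *: wv false 1).
Proof. exact: svalP rho4_subproof w. Qed.
Lemma ep4E : ep4 = wv true 2. Proof. exact: svalP ep4_subproof. Qed.
Lemma et4E : et4 = 2^-1 *: wv false 2. Proof. exact: svalP et4_subproof. Qed.
Lemma un4E : un4 = em 3. Proof. exact: svalP un4_subproof. Qed.

Lemma pi4_linear : linear pi4.
Proof. by move=> a w w'; rewrite !pi4E !mxE; linear_ring. Qed.
Lemma rho4_linear : linear rho4.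
Proof. by move=> a w w'; rewrite !rho4E !mxE; linear_ring. Qed.
HB.instance Definition _ := GRing.isLinear.Build R 'rV[R]_2 'cV[R]_N _ pi4 pi4_linear.
HB.instance Definition _ := GRing.isLinear.Build R 'rV[R]_2 'cV[R]_N _ rho4 rho4_linear.

Definition dot2 w w' : R := w 0 0 * w' 0 0 + w 0 1 * w' 0 1.

Ltac gram_calc :=
  rewrite ?pi4E ?rho4E ?ep4E ?et4E ?un4E ?(ipDl, ipDr, ipZl, ipZr)
    /null_vec ?(ipDl, ipDr, ipZl, ipZr) ?(ip_pp, ip_mm, ip_pm, ip_mp) /sgn /dot2 /=; try by [field|ring].

Lemma gram4_sym : (forall w w', ip (pi4 w) (pi4 w') = 0) * (forall w w', ip (pi4 w) (rho4 w') = dot2 w w') *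
  (forall w, ip (pi4 w) ep4 = 0) * (forall w, ip (pi4 w) un4 = 0) * (forall w, ip (pi4 w) et4 = 0) *
  (forall w w', ip (rho4 w) (rho4 w') = 0) *
  (forall w, ip (rho4 w) ep4 = 0) * (forall w, ip (rho4 w) un4 = 0) * (forall w, ip (rho4 w) et4 = 0) *
  (ip ep4 ep4 = 0) * (ip ep4 un4 = 0) * (ip ep4 et4 = 1) * (ip un4 un4 = -1) *
  (ip et4 un4 = 0) * (ip et4 et4 = 0).
Proof. do ![split] => *; gram_calc. Qed.

Lemma dot2C w w' : dot2 w w' = dot2 w' w. Proof. by rewrite /dot2; ring. Qed.

Lemma gram4_swap : (forall w w', ip (rho4 w') (pi4 w) = dot2 w w') *
  (forall w, ip ep4 (pi4 w) = 0) * (forall w, ip un4 (pi4 w) = 0) * (forall w, ip et4 (pi4 w) = 0) *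
  (forall w, ip ep4 (rho4 w) = 0) * (forall w, ip un4 (rho4 w) = 0) * (forall w, ip et4 (rho4 w) = 0) *
  (ip un4 ep4 = 0) * (ip et4 ep4 = 1) * (ip un4 et4 = 0).
Proof. by do ![split] => *; rewrite ip_sym !gram4_sym. Qed.

Definition gram4 := (gram4_sym, gram4_swap).

Lemma row2 (w : 'rV[R]_2) : w = w 0 0 *: delta_mx 0 0 + w 0 1 *: delta_mx 0 1.
Proof.
apply/rowP => i; rewrite !mxE eqxx /=.
by case: i => [[|[|//]] ?]; rewrite ?mulr1 ?mulr0 ?addr0 ?add0r; congr (w _ _); apply: val_inj.
Qed.

Lemma pi4_d0 : pi4 (delta_mx 0 0) = wv true 0.
Proof. by rewrite pi4E !mxE /= scale1r scale0r addr0. Qed.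
Lemma pi4_d1 : pi4 (delta_mx 0 1) = wv true 1.
Proof. by rewrite pi4E !mxE /= scale1r scale0r add0r. Qed.
Lemma rho4_d0 : rho4 (2 *: delta_mx 0 0) = wv false 0.
Proof. by rewrite rho4E !mxE /= mulr0 scale0r addr0 mulr1 scalerA mulfV ?pnatr_eq0 // scale1r. Qed.
Lemma rho4_d1 : rho4 (2 *: delta_mx 0 1) = wv false 1.
Proof. by rewrite rho4E !mxE /= mulr0 scale0r add0r mulr1 scalerA mulfV ?pnatr_eq0 // scale1r. Qed.
Lemma et4_double : 2 *: et4 = wv false 2.
Proof. by rewrite et4E scalerA mulfV ?pnatr_eq0 // scale1r. Qed.
Lemma un4_scale s : sgn R s *: un4 = wv s 3.
Proof.
rewrite un4E /null_vec; have -> : ep 3 = 0; last by rewrite add0r.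
rewrite (std_span (ep 3)) !big1 ?subr0 // => i _; first by rewrite ip_mp scale0r.
rewrite ip_pp (_ : (i == 3%N :> nat) = false) ?scale0r //; apply/eqP; have := ltn_ord i; lia.
Qed.

(** The grading element for the second and third simple roots: eps_1 = eps_2 = 2 and eps_3 = 1. *)
Definition t4 : 'rV[R]_r := \row_k (if k == 2%N :> nat then 1 else 2).
Definition H4 : gl R N := so_boost t4.

Lemma tt_t4 i : tt t4 i = if (i < 2)%N then 2 else if i == 2%N then 1 else 0.
Proof.
rewrite /boost_coef; case: ltnP => ir; first by rewrite mxE inordK //; case: i ir => [|[|[|]]].
by case: i ir => [|[|[|]]].
Qed.

Lemma H4_pi w : (H4 : 'M_N) *m pi4 w = 2 *: pi4 w.
Proof. by rewrite pi4E mulmxDr -!scalemxAr !boost_wv !tt_t4 /= /sgn; linear_ring. Qed.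
Lemma H4_rho w : (H4 : 'M_N) *m rho4 w = (-2) *: rho4 w.
Proof. by rewrite rho4E mulmxDr -!scalemxAr !boost_wv !tt_t4 /= /sgn; linear_ring. Qed.
Lemma H4_ep : (H4 : 'M_N) *m ep4 = 1 *: ep4.
Proof. by rewrite ep4E boost_wv tt_t4 /= /sgn mul1r. Qed.
Lemma H4_et : (H4 : 'M_N) *m et4 = (-1) *: et4.
Proof. by rewrite et4E -scalemxAr boost_wv tt_t4 /= /sgn; linear_ring. Qed.
Lemma H4_un : (H4 : 'M_N) *m un4 = 0 *: un4.
Proof. by rewrite un4E boost_em tt_t4 /= !scale0r. Qed.

Inductive gv4 : int -> 'cV[R]_N -> Prop :=
| Gv4_2 w : gv4 2 (pi4 w)
| Gv4_1 c : gv4 1 (c *: ep4)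
| Gv4_0 c : gv4 0 (c *: un4)
| Gv4_N1 c : gv4 (-1) (c *: et4)
| Gv4_N2 w : gv4 (-2) (rho4 w).

Lemma gv4_wv s i : (i < 4)%N -> exists2 d, gv4 d (wv s i) & sgn R s * tt t4 i = d%:~R.
Proof.
rewrite tt_t4; case: i => [|[|[|[|//]]]] _ /=.
- case: s; first by exists 2; rewrite /sgn ?mul1r // -pi4_d0; constructor.
  by exists (-2); rewrite /sgn ?mulN1r // -rho4_d0; constructor.
- case: s; first by exists 2; rewrite /sgn ?mul1r // -pi4_d1; constructor.
  by exists (-2); rewrite /sgn ?mulN1r // -rho4_d1; constructor.
- case: s; first by exists 1; rewrite /sgn ?mul1r // -ep4E -[ep4]scale1r; constructor.
  by exists (-1); rewrite /sgn ?mulN1r // -et4_double; constructor.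
by exists 0; rewrite ?mulr0 // -un4_scale; constructor.
Qed.

Lemma span4 (Q : 'cV[R]_N -> Prop) : linear_closed_pred Q -> (forall w, Q (pi4 w)) -> Q ep4 -> Q un4 ->
  Q et4 -> (forall w, Q (rho4 w)) -> forall x, Q x.
Proof.
move=> QL Qp Qe Qu Qt Qr; have [_ _ _ QZ] := linear_closed_conv QL.
apply: wv_ind => // s [|[|[|[|//]]]] _.
- by case: s; rewrite -?pi4_d0 -?rho4_d0.
- by case: s; rewrite -?pi4_d1 -?rho4_d1.
- by case: s; [rewrite -ep4E|rewrite -et4_double; exact: QZ].
by rewrite -un4_scale; exact: QZ.
Qed.

Lemma so4_deg_ind i (Q : gl R N -> Prop) : linear_closed_pred Q ->
  (forall d d' x y, gv4 d x -> gv4 d' y -> d + d' = i -> Q (wd x y)) ->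
  forall u, so_deg t4 i u -> Q u.
Proof.
move=> QL QG u [c [-> cw]]; have [Q0 _ _ QZ] := linear_closed_conv QL.
apply: linear_closed_sum => // a _.
have [->|/cw] := eqVneq (c a) 0; first by rewrite scale0r.
case: a => [[s j] [s' j']]; rewrite /so_wt /so_vec /=; case: eqP => [[-> ->] _|_].
  by rewrite wdxx scaler0.
have [d dx ->] := gv4_wv s (ltn_ord j); have [d' dy ->] := gv4_wv s' (ltn_ord j').
rewrite -rmorphD /= => /intr_inj dd; apply: QZ; exact: QG dx dy dd.
Qed.

(** [E4], [F4] and [V4f w] have the degrees -1 + 0, -2 - 2 and -2 + 1. *)
Definition E4 : gl R N := wd et4 un4.
Definition F4 : gl R N := wd (rho4 (delta_mx 0 0)) (rho4 (delta_mx 0 1)).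
Definition V4f w : gl R N := wd (rho4 w) ep4.
Lemma V4_linear : linear V4f.
Proof. by move=> a w w'; rewrite /V4f rho4_linear wdDl wdZl. Qed.
HB.instance Definition _ := GRing.isLinear.Build R 'rV[R]_2 (gl R N) _ V4f V4_linear.
Definition V4 : 'Hom('rV[R]_2, gl R N) := linfun V4f.
Lemma V4E w : V4 w = wd (rho4 w) ep4. Proof. exact: lfunE. Qed.

(** The area form of the plane, with the sign for which [V w, D^2 (V w')] is [b4 w w'] times
    [F4]. *)
Definition b4 w w' : R := w' 0 0 * w 0 1 - w' 0 1 * w 0 0.

Lemma rho4_wd w w' : wd (rho4 w) (rho4 w') = b4 w' w *: F4.
Proof.
rewrite /b4 /F4 {1}(row2 w) {1}(row2 w') !linearD !linearZ /= wdDl !wdDr !wdZl !wdZr !wdxx.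
by rewrite (wd_sym (rho4 (delta_mx 0 1))); linear_ring.
Qed.

Lemma E4_V4 w : [lie E4, V4 w] = - wd (rho4 w) un4.
Proof. by rewrite V4E br_wd !gram4 !zsimp. Qed.
Lemma E4_V4_2 w : [lie E4, [lie E4, V4 w]] = wd (rho4 w) et4.
Proof. by rewrite E4_V4 lieNr br_wd !gram4 !zsimp scaleN1r opprK. Qed.

Lemma so4_negative : negative_relations 4 E4 F4 V4 b4.
Proof.
split=> [[|[|j]] w u _|w u|w||w] //.
- by rewrite /= !V4E br_wd !gram4 !zsimp.
- by rewrite /= E4_V4 V4E lieNr br_wd !gram4 !zsimp.
- by rewrite /= E4_V4_2 V4E br_wd !gram4 !zsimp rho4_wd.
- by rewrite /= E4_V4_2 br_wd !gram4 !zsimp.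
- by rewrite br_wd !gram4 !zsimp.
- by rewrite V4E br_wd !gram4 !zsimp.
Qed.
End SoFour.

(** * The two conditions at depth four *)

Section SoFourForward.
Variable R : realFieldType.
Local Notation p := 1%N.
Local Notation q := 2%N.
Local Notation N := (p.+2 + q.+2)%N.
Local Notation so u := (@in_so R p.+2 q.+2 u).
Local Notation r := (so_rank p q).
Local Notation pi4 := (@pi4 R).
Local Notation rho4 := (@rho4 R).
Local Notation ep4 := (@ep4 R).
Local Notation et4 := (@et4 R).
Local Notation un4 := (@un4 R).
Local Notation E := (E4 R).
Local Notation F := (F4 R).
Local Notation V := (V4 R).
Local Notation t4 := (t4 R).
Implicit Types (x y z : 'cV[R]_N) (w : 'rV[R]_2) (u : gl R N).

Lemma dot2_d0 w : dot2 w (delta_mx 0 0) = w 0 0.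
Proof. by rewrite /dot2 !mxE /= mulr1 mulr0 addr0. Qed.
Lemma dot2_d1 w : dot2 w (delta_mx 0 1) = w 0 1.
Proof. by rewrite /dot2 !mxE /= mulr1 mulr0 add0r. Qed.

(** [u] preserves the plane of top degree 2. The elements of V send this plane to multiples of
    [ep4], and commuting with them makes [u] a scalar c on [ep4] and then on the plane; E and V
    carry c to the remaining vectors. A scalar in so is 0. *)
Lemma so4_transitive (i : int) u : 0 <= i -> so_MI t4 i u -> [lie u, E] = 0 ->
  (forall w, [lie u, V w] = 0) -> u = 0.
Proof.
move=> i0 [su hu] uE uV.
have comm (y : gl R N) : [lie u, y] = 0 -> forall x, (u : 'M_N) *m ((y : 'M_N) *m x) = (y : 'M_N) *m ((u : 'M_N) *m x).
  by rewrite gl_lieE => /eqP; rewrite subr_eq0 => /eqP h x; rewrite !mulmxA h.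
have sH := so_boostP t4; have i0R : 0 <= i%:~R :> R by rewrite ler0z.
have upi w : exists w', (u : 'M_N) *m pi4 w = pi4 w'.
  set g := (u : 'M_N) *m pi4 w.
  have hg : (H4 R : 'M_N) *m g = (i%:~R + 2) *: g.
    have /(congr1 (fun M : gl R N => (M : 'M_N) *m pi4 w)) := hu.
    rewrite gl_lieE mulmxBl -!mulmxA H4_pi -scalemxAr -scalemxAl => /eqP.
    by rewrite subr_eq -scalerDl => /eqP.
  have pair y (c : R) : (H4 R : 'M_N) *m y = c *: y -> i%:~R + 2 + c != 0 -> ip y g = 0.
    move=> hy n0; have := so_ip y g sH; rewrite -/(H4 R) hy hg ipZl ipZr => h.
    by apply: (mulfI n0); rewrite mulr0 mulrDl h addrN.
  exists (ip (rho4 (delta_mx 0 0)) g *: delta_mx 0 0 + ip (rho4 (delta_mx 0 1)) g *: delta_mx 0 1).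
  rewrite linearD !linearZ /=; apply/eqP; rewrite -subr_eq0; apply/eqP; apply: ip_nondeg.
  have pos (c : R) : -1 <= c -> i%:~R + 2 + c != 0 by move=> hc; apply/eqP; lra.
  apply: span4.
  - by split=> [|a y z hy hz]; rewrite ?ip0l // ipDl ipZl hy hz mulr0 addr0.
  - move=> w'; rewrite ipDr ipNr ipDr !ipZr !gram4 (pair _ _ (H4_pi w')) ?pos ?mulr0 ?addr0 ?subr0 //; lra.
  - by rewrite ipDr ipNr ipDr !ipZr !gram4 (pair _ _ (H4_ep R)) ?pos ?mulr0 ?addr0 ?subr0 //; lra.
  - by rewrite ipDr ipNr ipDr !ipZr !gram4 (pair _ _ (H4_un R)) ?pos ?mulr0 ?addr0 ?subr0 //; lra.
  - by rewrite ipDr ipNr ipDr !ipZr !gram4 (pair _ _ (H4_et R)) ?pos ?mulr0 ?addr0 ?subr0 //; lra.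
  move=> w'; rewrite ipDr ipNr ipDr !ipZr !gram4 (dot2C _ w') (dot2C _ w') dot2_d0 dot2_d1.
  by rewrite {1}(row2 w') linearD !linearZ /= ipDl !ipZl; ring.
have Vp w w' : (V w : 'M_N) *m pi4 w' = - dot2 w' w *: ep4.
  by rewrite V4E wdE !gram4 !zsimp scaleNr.
have uep w w' g : (u : 'M_N) *m pi4 w = pi4 g -> dot2 w w' *: ((u : 'M_N) *m ep4) = dot2 g w' *: ep4.
  move=> ug; have := comm _ (uV w') (pi4 w); rewrite ug !Vp -scalemxAr !scaleNr.
  exact: oppr_inj.
pose d0 : 'rV[R]_2 := delta_mx 0 0; pose d1 : 'rV[R]_2 := delta_mx 0 1.
have [g0 ug0] := upi d0; set c := dot2 g0 d0.
have uE4 : (u : 'M_N) *m ep4 = c *: ep4.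
  by have := uep _ d0 _ ug0; rewrite dot2_d0 mxE /= scale1r.
have up w : (u : 'M_N) *m pi4 w = c *: pi4 w.
  have [g ug] := upi w; rewrite ug -linearZ; congr (pi4 _).
  have e4n : ep4 != 0.
    apply/eqP => h; have : ip ep4 et4 = 1 by rewrite !gram4.
    by rewrite h ip0l => /esym/eqP; rewrite oner_eq0.
  have h w' : dot2 g w' = c * dot2 w w'.
    by apply: (scale_vector_inj e4n); rewrite -(uep w w' g ug) uE4 scalerA mulrC.
  by rewrite [LHS]row2 [RHS]row2 !mxE -(dot2_d0 g) -(dot2_d1 g) !h dot2_d0 dot2_d1.
have cE x x' (y : gl R N) (a : R) : a != 0 -> (u : 'M_N) *m x = c *: x -> [lie u, y] = 0 ->
    (y : 'M_N) *m x = a *: x' -> (u : 'M_N) *m x' = c *: x'.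
  move=> an0 ux uy yx; have := comm y uy x; rewrite yx ux -!scalemxAr yx.
  by rewrite scalerA mulrC -scalerA => /(scalerI an0).
have n1 : -1 != 0 :> R by rewrite oppr_eq0 oner_eq0.
have uu : (u : 'M_N) *m un4 = c *: un4.
  by apply: (cE ep4 _ E (-1)) => //; rewrite /E4 wdE !gram4 !zsimp scaleN1r.
have ut : (u : 'M_N) *m et4 = c *: et4.
  by apply: (cE un4 _ E (-1)) => //; rewrite /E4 wdE !gram4 !zsimp.
have ur w : (u : 'M_N) *m rho4 w = c *: rho4 w.
  by apply: (cE et4 _ (V w) 1) => //; [rewrite oner_eq0|rewrite V4E wdE !gram4 !zsimp].
have c0 : c = 0.
  have := so_ip ep4 et4 su; rewrite uE4 ut (ipZl c) (ipZr c) !gram4; lra.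
apply: mulmx_ext; apply: span4.
- by split=> [|a y z hy hz]; rewrite ?mulmx0 // !mulmxDr -!scalemxAr hy hz.
- by move=> w; rewrite up c0 scale0r mul0mx.
- by rewrite uE4 c0 scale0r mul0mx.
- by rewrite uu c0 scale0r mul0mx.
- by rewrite ut c0 scale0r mul0mx.
- by move=> w; rewrite ur c0 scale0r mul0mx.
Qed.

Lemma V4_scale c w : c *: wd (rho4 w) ep4 = V (c *: w).
Proof. by rewrite linearZ /= V4E. Qed.

Lemma so4_degN1 u : so_deg t4 (-1) u -> exists c w, u = c *: E + V w.
Proof.
move: u; apply: so4_deg_ind => [|d d' x y].
  split=> [|a x y [c [w ->]] [c' [w' ->]]].
    by exists 0, 0; rewrite linear0 scale0r addr0.
  by exists (a * c + c'), (a *: w + w'); rewrite [V (_ + _)]linearP; linear_ring.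
have QE c : exists c' w, c *: E = c' *: E + V w by exists c, 0; rewrite linear0 addr0.
have QV c w : exists c' w', c *: wd (rho4 w) ep4 = c' *: E + V w'.
  by exists 0, (c *: w); rewrite V4_scale scale0r add0r.
case=> {d x} [w|c|c|c|w]; case=> {d' y} [w'|c'|c'|c'|w'] /eqP // _.
- by rewrite wd_sym wdZr -scaleNr; exact: QV.
- by rewrite wd_sym wdZl wdZr scalerA -scaleNr; exact: QE.
- by rewrite wdZl wdZr scalerA; exact: QE.
- by rewrite wdZr; exact: QV.
Qed.

Lemma so4_degN2 u : so_deg t4 (-2) u -> exists w, u = adn E 1 (V w).
Proof.
move: u; apply: so4_deg_ind => [|d d' x y].
  split=> [|a x y [w ->] [w' ->]]; first by exists 0; rewrite linear0 adn0.
  by exists (a *: w + w'); rewrite [V (_ + _)]linearP adn_linear.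
have QV c w : exists w', c *: wd (rho4 w) un4 = adn E 1 (V w').
  by exists (- c *: w); rewrite adn1 linearZ /= lieZr E4_V4 scaleNr scalerN opprK.
case=> {d x} [w|c|c|c|w]; case=> {d' y} [w'|c'|c'|c'|w'] /eqP // _.
- by rewrite wd_sym wdZr -scaleNr; exact: QV.
- by exists 0; rewrite wdZl wdZr wdxx !scaler0 linear0 adn0.
- by rewrite wdZr; exact: QV.
Qed.

Lemma so4_degN3 u : so_deg t4 (-3) u -> exists w, u = adn E 2 (V w).
Proof.
move: u; apply: so4_deg_ind => [|d d' x y].
  split=> [|a x y [w ->] [w' ->]]; first by exists 0; rewrite linear0 adn0.
  by exists (a *: w + w'); rewrite [V (_ + _)]linearP adn_linear.
have QV c w : exists w', c *: wd (rho4 w) et4 = adn E 2 (V w').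
  by exists (c *: w); rewrite /adn /= linearZ /= !lieZr E4_V4_2.
case=> {d x} [w|c|c|c|w]; case=> {d' y} [w'|c'|c'|c'|w'] /eqP // _.
- by rewrite wd_sym wdZr -scaleNr; exact: QV.
- by rewrite wdZr; exact: QV.
Qed.

Lemma so4_degN4 u : so_deg t4 (-4) u -> exists c, u = c *: F.
Proof.
move: u; apply: so4_deg_ind => [|d d' x y].
  split=> [|a x y [c ->] [c' ->]]; first by exists 0; rewrite scale0r.
  by exists (a * c + c'); linear_ring.
case=> {d x} [w|c|c|c|w]; case=> {d' y} [w'|c'|c'|c'|w'] /eqP // _.
by rewrite rho4_wd; eexists.
Qed.

Lemma so4_deg_low i u : i < - 4%:Z -> so_deg t4 i u -> u = 0.
Proof.
move=> i4; move: u; apply: so4_deg_ind => [|d d' x y].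
  by split=> [//|a x y -> ->]; rewrite scaler0 addr0.
by case=> {d x} [w|c|c|c|w]; case=> {d' y} [w'|c'|c'|c'|w'] ii; exfalso; lia.
Qed.

Lemma epet_E : [lie wd ep4 et4, E] = - E.
Proof. by rewrite br_wd !gram4 !zsimp. Qed.
Lemma epet_V w : [lie wd ep4 et4, V w] = V w.
Proof. by rewrite V4E br_wd !gram4 !zsimp. Qed.
Lemma pirho_E w w' : [lie wd (pi4 w) (rho4 w'), E] = 0.
Proof. by rewrite br_wd !gram4 !zsimp. Qed.
Lemma pirho_V w w' w0 : [lie wd (pi4 w) (rho4 w'), V w0] = V (- dot2 w w0 *: w').
Proof. by rewrite [RHS]linearZ /= !V4E br_wd !gram4 !zsimp scaleNr. Qed.

Lemma so4_deg0 u : so_deg t4 0 u -> (exists c, [lie u, E] = c *: E) /\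
  forall w, exists w', [lie u, V w] = V w'.
Proof.
move: u; pose Q u := (exists c, [lie u, E] = c *: E) /\
  forall w, exists w', [lie u, V w] = V w'.
have QL : linear_closed_pred Q.
  split=> [|a x y [[c xc] xw] [[c' yc] yw]].
    split=> [|w]; first by exists 0; rewrite lie0l scale0r.
    by exists 0; rewrite lie0l linear0.
  split=> [|w]; first by exists (a * c + c'); rewrite lieDl lieZl xc yc; linear_ring.
  have [w1 w1E] := xw w; have [w2 w2E] := yw w; exists (a *: w1 + w2).
  by rewrite lieDl lieZl w1E w2E [in RHS]linearP.
have [Q0 _ _ QZ] := linear_closed_conv QL.
have Q2 w w' : Q (wd (pi4 w) (rho4 w')).
  split=> [|w0]; first by exists 0; rewrite pirho_E scale0r.
  by rewrite pirho_V; eexists.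
have Q1 c c' : Q (wd (c *: ep4) (c' *: et4)).
  rewrite wdZl wdZr; do 2!apply: (QZ); split=> [|w].
    by exists (-1); rewrite epet_E scaleN1r.
  by rewrite epet_V; exists w.
have QS x y : Q (wd x y) -> Q (wd y x) by move=> h; rewrite wd_sym -scaleN1r; exact: QZ.
apply: so4_deg_ind => // d d' x y.
case=> {d x} [w|c|c|c|w]; case=> {d' y} [w'|c'|c'|c'|w'] /eqP // _.
- exact: Q2.
- exact: Q1.
- by rewrite wdZl wdZr wdxx !scaler0.
- by apply: (QS); exact: Q1.
- by apply: (QS); exact: Q2.
Qed.

Lemma F4_neq0 : F != 0.
Proof.
apply/eqP => /(congr1 (fun u : gl R N => ip (pi4 (delta_mx 0 0)) ((u : 'M_N) *m pi4 (delta_mx 0 1)))).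
rewrite mul0mx ip0r wdE !gram4 dot2_d0 dot2_d1 !mxE /= !zsimp !gram4 dot2_d0 mxE /= => /eqP.
by rewrite oner_eq0.
Qed.

Lemma so4_MI d d' x y (i : int) : so_boost t4 *m x = d%:~R *: x -> so_boost t4 *m y = d'%:~R *: y ->
  d + d' = i -> so_MI t4 i (wd x y).
Proof. by move=> hx hy <-; exact: so_MI_wd. Qed.

Lemma t4_MI : [/\ so_MI t4 (-1) E, forall w, so_MI t4 (-1) (V w), so_MI t4 (-4) F &
  so_MI t4 0 (wd ep4 et4)].
Proof.
have hr := @H4_rho R; have he := H4_ep R; have ht := H4_et R; have hu := H4_un R.
split.
- by apply: (so4_MI (d := -1) (d' := 0)).
- by move=> w; rewrite V4E; apply: (so4_MI (d := -2) (d' := 1)) => //; exact: hr.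
- by apply: (so4_MI (d := -2) (d' := -2)) => //; exact: hr.
- by apply: (so4_MI (d := 1) (d' := -1)).
Qed.

Lemma b4_left w : (forall w', b4 w w' = 0) -> w = 0.
Proof.
move=> h; have h0 := h (delta_mx 0 0); have h1 := h (delta_mx 0 1).
rewrite /b4 !mxE /= mul1r mul0r subr0 in h0; rewrite /b4 !mxE /= mul1r mul0r sub0r in h1.
by rewrite (row2 w) h0 -[w 0 0]opprK h1 oppr0 !scale0r addr0.
Qed.

Lemma b4_skew w w' : b4 w w' = - b4 w' w.
Proof. by rewrite /b4; ring. Qed.

Lemma t4_roots (i : 'I_r) : so_root i t4 = (i.+1 \in [:: 2; 3]%N)%:R.
Proof.
rewrite so_rootE !tt_t4; case: i => [[|[|[|//]]] ?] //=; last by lra.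
by rewrite subrr.
Qed.

Lemma so4_forward (L : lieAlgType R) k gr : @kgrading R L k gr -> so_type p q [:: 2; 3]%N gr ->
  exists Ee : {vspace L}, condition1 k gr Ee /\
     exists Ve : {vspace L}, unique (invariant_complement gr Ee) Ve /\ condition2 k gr Ee Ve.
Proof.
move=> kg st; have [g [gker gbr g1 g0]] := so_type_transfer kg st t4_roots.
have [ME MV MF MZ] := t4_MI.
apply: (forward_transfer (k := 4) (e := E) (f := F) (v := V) (b := @b4 R) (M0 := so_MI t4)
  (M1 := so_deg t4) (z0 := wd ep4 et4) (la := -1) (mu := 1)) kg gker gbr g1 g0 => //.
- exact: so4_negative.
- exact: so4_degN1.
- by move=> [|[|j]] u // _; [exact: so4_degN2|exact: so4_degN3].
- exact: so4_degN4.
- exact: so4_deg_low.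
- exact: so4_deg0.
- exact: b4_left.
- by move=> u uw; apply: b4_left => w; rewrite b4_skew uw oppr0.
- move=> c w /(congr1 (fun u : gl R N => ip un4 ((u : 'M_N) *m ep4))).
  by rewrite mulmxDl -scalemxAl V4E mul0mx ip0r !wdE !gram4 !zsimp (ipZr c) ipNr !gram4 opprK mulr1.
- exact: F4_neq0.
- by rewrite epet_E scaleN1r.
- by move=> w; rewrite epet_V scale1r.
- by apply/eqP => h; lra.
Qed.
End SoFourForward.

(** * Recognition at depth four *)

Section SoFourMatch.
Variable R : realFieldType.
Local Notation p := 1%N.
Local Notation q := 2%N.
Local Notation N := (p.+2 + q.+2)%N.
Local Notation so u := (@in_so R p.+2 q.+2 u).
Local Notation r := (so_rank p q).
Local Notation pi4 := (@pi4 R).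
Local Notation rho4 := (@rho4 R).
Local Notation ep4 := (@ep4 R).
Local Notation et4 := (@et4 R).
Local Notation un4 := (@un4 R).
Local Notation E := (E4 R).
Local Notation F := (F4 R).
Local Notation V := (V4 R).
Local Notation t4 := (t4 R).
Implicit Types (x y z : 'cV[R]_N) (w : 'rV[R]_2) (u : gl R N).

Lemma so4_generate (Q : gl R N -> Prop) : linear_closed_pred Q ->
  (forall u u', Q u -> Q u' -> Q [lie u, u']) -> Q E -> (forall w, Q (V w)) ->
  Q (wd ep4 un4) -> (forall w, Q (wd (pi4 w) et4)) -> forall u, so u -> Q u.
Proof.
move=> QL Qbr QE QV Qeu Qpt; have [Q0 QD QB QZ] := linear_closed_conv QL.
have QN u : Q u -> Q (- u) by move=> Qu; rewrite -scaleN1r; exact: QZ.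
have NQ u : Q (- u) -> Q u by move=> /QN; rewrite opprK.
have QS x y : Q (wd x y) -> Q (wd y x) by move=> h; rewrite wd_sym; exact: QN.
have re w : Q (wd (rho4 w) ep4) by rewrite -V4E.
have ru w : Q (wd (rho4 w) un4) by apply: (NQ); rewrite -E4_V4; exact: Qbr.
have rt w : Q (wd (rho4 w) et4) by rewrite -E4_V4_2; apply: (Qbr) => //; exact: Qbr.
have pu w : Q (wd (pi4 w) un4).
  by apply: (NQ); have := Qbr _ _ Qeu (Qpt w); rewrite br_wd !gram4 !zsimp.
have pe w : Q (wd (pi4 w) ep4).
  by apply: (NQ); have := Qbr _ _ Qeu (pu w); rewrite br_wd !gram4 !zsimp scaleN1r.
have et : Q (wd et4 ep4).
  by apply: (NQ); have := Qbr _ _ Qeu QE; rewrite br_wd !gram4 !zsimp wdxx ?oppr0 ?add0r ?addr0 scaleN1r.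
have rr w w' : Q (wd (rho4 w) (rho4 w')).
  by have := Qbr _ _ (re w') (rt w); rewrite br_wd !gram4 !zsimp.
have pp w w' : Q (wd (pi4 w) (pi4 w')).
  by have := Qbr _ _ (pe w') (Qpt w); rewrite br_wd !gram4 !zsimp.
have pr w w' : Q (wd (rho4 w') (pi4 w)).
  have := Qbr _ _ (pu w) (ru w'); rewrite br_wd !gram4 !zsimp wdxx scaler0 oppr0 add0r scaleN1r.
  by move=> /NQ.
have lin x : linear_closed_pred (fun y => Q (wd x y)).
  by split=> [|a y z Qy Qz]; [rewrite wd0r|rewrite wdDr wdZr; apply: (proj2 QL)].
have QW x y : Q (wd x y).
  have Qxx z : Q (wd z z) by rewrite wdxx.
  move: y; apply: (span4 (lin x)) => [w||||w]; apply: (QS); move: x; apply: (span4 (lin _)).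
  - by move=> w'; exact: pp.
  - exact: pe.
  - exact: pu.
  - exact: Qpt.
  - by move=> w'; exact: QS (pr _ _).
  - by move=> w'; exact: QS (pe _).
  - exact: Qxx.
  - exact: Qeu.
  - exact: QS et.
  - by move=> w'; exact: QS (re _).
  - by move=> w'; exact: QS (pu _).
  - exact: QS Qeu.
  - exact: Qxx.
  - exact: QS QE.
  - by move=> w'; exact: QS (ru _).
  - by move=> w'; exact: QS (Qpt _).
  - exact: et.
  - exact: QE.
  - exact: Qxx.
  - by move=> w'; exact: QS (rt _).
  - by move=> w'; exact: pr.
  - exact: re.
  - exact: ru.
  - exact: rt.
  - by move=> w'; exact: rr.
apply: (so_ind (F := fun _ => True) QL) => // Q' _ h x; exact: h.
Qed.

Lemma so4_MI_gen : [/\ forall w w', so_MI t4 0 (wd (pi4 w) (rho4 w')), so_MI t4 1 (wd ep4 un4)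
  & forall w, so_MI t4 1 (wd (pi4 w) et4)].
Proof.
have hr := @H4_rho R; have he := H4_ep R; have ht := H4_et R; have hu := H4_un R; have hp := @H4_pi R.
split=> [w w'||w].
- exact: (so4_MI (d := 2) (d' := -2) (hp w) (hr w') erefl).
- by apply: (so4_MI (d := 1) (d' := 0)).
- exact: (so4_MI (d := 2) (d' := -1) (hp w) ht erefl).
Qed.

(** The wedges between the two dual planes form a copy of gl(2), which acts on V by all
    endomorphisms and trivially on [E4]. *)
Lemma so4_level (A : 'M[R]_2) : exists X : gl R N,
  [/\ so_MI t4 0 X, [lie X, E] = 0 & forall w, [lie X, V w] = V (w *m A)].
Proof.
have [Mpr _ _] := so4_MI_gen; have [_ MD _ MZ] := linear_closed_conv (so_MI_linear t4 0).
exists (wd (pi4 (delta_mx 0 0)) (rho4 (- row 0 A)) + wd (pi4 (delta_mx 0 1)) (rho4 (- row 1 A))).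
split; first exact: MD.
- by rewrite lieDl !pirho_E addr0.
move=> w; rewrite lieDl !pirho_V -linearD; congr (V _).
rewrite [in RHS](row2 w) mulmxDl -!scalemxAl -!rowE !(dot2C _ w) dot2_d0 dot2_d1.
by rewrite !scaleNr !scalerN !opprK.
Qed.

(* The element of degree 1 whose bracket with [V w] acts on [E] by [dot2 l w]. *)
Definition so4_raise (a : R) (l : 'rV[R]_2) : gl R N := (- a) *: wd ep4 un4 - wd (pi4 l) et4.

Lemma so4_raise_MI a l : so_MI t4 1 (so4_raise a l).
Proof.
have [_ M1 M2] := so4_MI_gen; have [_ _ MB MZ] := linear_closed_conv (so_MI_linear t4 1).
by apply: (MB) => //; exact: MZ.
Qed.

Lemma so4_raise_E a l : [lie so4_raise a l, E] = (- a) *: wd ep4 et4.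
Proof.
rewrite lieBl lieZl !br_wd !gram4 !zsimp wdxx oppr0 add0r scaleN1r.
by rewrite (wd_sym et4) opprK.
Qed.

Lemma so4_raise_V a l w : [lie so4_raise a l, V w] = - dot2 l w *: wd ep4 et4 + wd (pi4 l) (rho4 w).
Proof.
rewrite V4E lieBl lieZl !br_wd !gram4 !zsimp (wd_sym et4) (wd_sym (rho4 w)).
by rewrite scalerN opprK opprB addrC scaleNr.
Qed.

(** The wedge of [ep4] and [et4] fixes the first summand of [so4_raise] and negates the second, so
    adding the bracket isolates the first. *)
Lemma so4_raise_br a l : [lie wd ep4 et4, so4_raise a l] = so4_raise a (- l).
Proof.
rewrite /so4_raise linearN wdNl lieBr lieZr.
have -> : [lie wd ep4 et4, wd ep4 un4] = wd ep4 un4 by rewrite br_wd !gram4 !zsimp.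
by have -> : [lie wd ep4 et4, wd (pi4 l) et4] = - wd (pi4 l) et4 by rewrite br_wd !gram4 !zsimp.
Qed.

Lemma so4_raise_sum a l : so4_raise a l + so4_raise a (- l) = (- 2 * a) *: wd ep4 un4.
Proof.
rewrite /so4_raise linearN wdNl; move: (wd ep4 un4) (wd (pi4 l) et4) => X Y; linear_ring.
Qed.
End SoFourMatch.

Section SoFourConverse.
Variables (R : realFieldType) (L : lieAlgType R) (q : int -> {vspace L}) (E V : {vspace L}).
Hypotheses (simp : simple_lie L) (kg : kgrading 4 q).
Hypotheses (c1 : condition1 4 q E) (ic : invariant_complement q E V) (c2 : condition2 4 q E V).

Lemma so4_converse : so_type 1 2 [:: 2; 3]%N q.
Proof.
have k3 : (3 <= 4)%N by []; have k4 : (4 <= 4)%N by []; have k4e : 4%N = 4%N by [].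
have [e Ee] : exists e, E = <[e]>%VS by have [_ _ _ dE _] := c1; exact: vline_of_dim1.
have [f0 fq0] : exists f, q (- 4%:Z) = <[f]>%VS by have [df _ _ _ _] := c1; exact: vline_of_dim1.
have [w0 [w1 [w0V w1V w01 Vspan]]] := depth4_plane simp kg k3 c1 ic c2 Ee fq0 k4e.
(* The sign matches [b4], whose value on the two basis vectors is -1. *)
pose f := - [lie w0, adn e 2 w1].
have fq : q (- 4%:Z) = <[f]>%VS.
  have [c fE] := form_mem kg k3 c1 ic Ee fq0 w0V w1V.
  apply/esym/eqP; rewrite eqEdim -memvE fq0 !dim_vline /f fE oppr_eq0 /=.
  rewrite memvN memvZ ?memv_line //=; have := w01; rewrite [adn _ _ _]/= in fE *; rewrite fE.
  by move=> ->; case: (f0 == 0).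
have fn0 := bottom_gen_neq0 c1 fq.
have b01 : bform 4 e f w0 w1 = -1.
  by apply: (scale_vector_inj fn0); rewrite -(formE kg k3 c1 ic Ee fq w0V w1V) scaleN1r opprK.
pose v0 (w : 'rV[R]_2) := w 0 0 *: w0 + w 0 1 *: w1.
have v0L : linear v0 by move=> a w w'; rewrite /v0 !mxE; linear_ring.
pose v := linfun (HB.pack_for {linear 'rV[R]_2 -> L} v0 (GRing.isLinear.Build R 'rV[R]_2 L _ v0 v0L)).
have vE w : v w = w 0 0 *: w0 + w 0 1 *: w1 by rewrite lfunE.
have vd0 : v (delta_mx 0 0) = w0 by rewrite vE !mxE /= scale1r scale0r addr0.
have vd1 : v (delta_mx 0 1) = w1 by rewrite vE !mxE /= scale1r scale0r add0r.
have vV : limg v = V.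
  apply/vspaceP => y; apply/memv_imgP/idP => [[u _ ->]|/Vspan[a [b ->]]].
    by rewrite vE memvD ?memvZ.
  by exists (\row_i (if i == 0 then a else b)); rewrite ?memvf // vE !mxE.
have vin w : v w \in V := converse_V vV w.
have onto := converse_onto vV.
(* As [x] commutes with [D y], the bracket of [x] with [D (D y)] is minus that of [D x] with [D y]. *)
have bskew w u : w \in V -> u \in V -> bform 4 e f w u = - bform 4 e f u w.
  move=> wV uV; apply: (scale_vector_inj fn0); rewrite scaleNr -!(formE kg k3 c1 ic Ee fq) //.
  have h x y : x \in V -> y \in V -> [lie x, adn e 2 y] = - [lie [lie e, x], [lie e, y]].
    move=> xV yV; have Vx : [lie x, adn e 1 y] = 0 by apply: (V_adn0 kg k3 c1 ic c2 Ee).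
    by rewrite [adn e 2 y]adnS (lieJ x) Vx lie0r addr0 (lieC x) lieNl.
  by rewrite (h w u) // (h u w) // lieC.
have vb w u : bform 4 e f (v w) (v u) = b4 w u.
  have bxx x : x \in V -> bform 4 e f x x = 0 by move=> xV; have := bskew x x xV xV; lra.
  rewrite !vE form_linl -[_ *: w1]addr0 !form_linr.
  rewrite -[w 0 1 *: _]addr0 !form_linl.
  have z0 x : bform 4 e f 0 x = 0 by rewrite /bform lie0l linear0.
  have z1 x : bform 4 e f x 0 = 0 by rewrite /bform adn0 lie0r linear0.
  rewrite !z0 !z1 !bxx // b01 (bskew w1 w0) // b01 /b4; ring.
have inj w : v w = 0 -> w = 0 := converse_inj vb (@b4_left R) (w := w).
have b4r (w : 'rV[R]_2) : (forall w', b4 w' w = 0) -> w = 0.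
  by move=> h; apply: b4_left => w'; rewrite b4_skew h oppr0.
have lamD x (l : 'rV[R]_2) : x \in q 1 -> lam e [lie x, w0] = l 0 0 -> lam e [lie x, w1] = l 0 1 ->
    forall w, lam e [lie x, v w] = dot2 l w.
  move=> x1 l0 l1 w; rewrite vE lieDr !lieZr lam_linear l0.
  by rewrite -[_ *: [lie x, w1]]addr0 lam_linear l1 /lam lie0l linear0 /dot2; ring.
have lam1 x (l : 'rV[R]_2) w : x \in q 1 -> (forall w, lam e [lie x, v w] = dot2 l w) ->
    [lie [lie x, v w], e] = dot2 l w *: e.
  by move=> x1 xl; rewrite (q0_E kg k3 c1 Ee (q1_V kg ic x1 (vin w))) xl.
have act x (l : 'rV[R]_2) w u : x \in q 1 -> (forall w, lam e [lie x, v w] = dot2 l w) ->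
    [lie [lie x, v w], v u] = v (- (dot2 l w *: u + dot2 l u *: w)).
  move=> x1 xl; rewrite (q1_V_ge4 kg k3 c1 ic c2 Ee x1 k4 (vin w) (vin u)) !xl.
  by rewrite -!linearZ -linearD -linearN.
have xl l : exists2 x, x \in q 1 & forall w, lam e [lie x, v w] = dot2 l w.
  (* Let s and t be the scalars of [x, w0] and [x, w1] on [e], and [x, f] = D^2 y. Applying [x] to
     [w0, D^2 w1] = - f gives s w1 - t w0 = - y; the vector chosen as y makes (s, t) equal to l. *)
  have [x x1 xf] := q1_bottom_onto simp kg k3 c1 ic Ee fq (vin (l 0 1 *: delta_mx 0 0 - l 0 0 *: delta_mx 0 1)).
  exists x => //.
  have := q1_V_D kg k3 c1 ic c2 Ee x1 (isT : (2 <= 2)%N) (isT : (3 < 4)%N) w0V w1V.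
  rewrite (q1_V_ge4 kg k3 c1 ic c2 Ee x1 k4 w0V w1V) -[[lie w0, adn e 2 w1]]opprK -/f lieNr xf.
  rewrite [(4%N).-2]/= => /eqP; rewrite eq_sym -subr_eq0 opprK -adnD => /eqP h.
  set s := lam e [lie x, w0] in h *; set t := lam e [lie x, w1] in h *.
  have yE : (2%:R * s) *: w1 - (s *: w1 + t *: w0) + v (l 0 1 *: delta_mx 0 0 - l 0 0 *: delta_mx 0 1) =
      v (\row_i (if i == 0 then l 0 1 - t else s - l 0 0)).
    by rewrite !vE !mxE /= !(mulr1, mulr0, oppr0, addr0, sub0r); linear_ring.
  rewrite yE in h; have /inj/rowP h' : v (\row_i (if i == 0 then l 0 1 - t else s - l 0 0)) = 0.
    by apply: (adn_inj kg k3 c1 ic c2 Ee (n := 2)).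
  apply: lamD => //; [have := h' 1|have := h' 0]; rewrite !mxE /=.
    by move=> /eqP; rewrite subr_eq0 => /eqP.
  by move=> /eqP; rewrite subr_eq0 eq_sym => /eqP.
pose d0 : 'rV[R]_2 := delta_mx 0 0; pose d1 : 'rV[R]_2 := delta_mx 0 1.
have [y0 y01 l0] := xl d0; have [y1 y11 l1] := xl d1.
have vq w : v w \in q (-1) by exact: (V_deg ic).
(* Over a basis and its dual basis the scalars add up to 2 on [e] and to - (2 + 1) on V, the last
   unit coming from the rank one parts; half of this is 1 and -(k - 1) / 2 for k = 4. *)
pose z := 2^-1 *: ([lie y0, v d0] + [lie y1, v d1]).
have zs : z \in bracket_span (q 1) (q (-1)).
  by rewrite memvZ // memvD // mem_bracket_span.
have d00 : dot2 d0 d0 = 1 by rewrite dot2_d0 mxE.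
have d11 : dot2 d1 d1 = 1 by rewrite dot2_d1 mxE.
have ze : [lie z, e] = e.
  rewrite lieZl lieDl (lam1 _ _ _ y01 l0) (lam1 _ _ _ y11 l1) d00 d11 scale1r.
  by linear_field.
have zv w : [lie z, v w] = - (3%:R / 2) *: v w.
  rewrite lieZl lieDl (act _ _ _ _ y01 l0) (act _ _ _ _ y11 l1) d00 d11 -linearD -!linearZ; congr (v _).
  have wE : dot2 d1 w *: d1 = w - dot2 d0 w *: d0.
    rewrite !(dot2C _ w) dot2_d0 dot2_d1; apply/eqP; rewrite eq_sym subr_eq addrC; apply/eqP.
    exact: row2.
  by rewrite wE; move: (dot2 d0 w *: d0) => X; linear_field.
have [Mpr Meu Mpt] := so4_MI_gen R; have [ME MV MF MZ] := t4_MI R.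
have MIL i := @so_MI_linear R 1 2 (t4 R) i.
have [_ MD0 MB0 MZ0] := linear_closed_conv (MIL 0).
pose m0q := match0 q e v (E4 R) (V4 R) (@so_MI R 1 2 (t4 R)).
pose m1q := match1 q e v (E4 R) (V4 R) (@so_MI R 1 2 (t4 R)).
have tot0 z' : z' \in q 0 -> exists u, m0q z' u.
  move=> z'0; have [g0 g0E] := onto _ (q0_V ic z'0 w0V); have [g1 g1E] := onto _ (q0_V ic z'0 w1V).
  pose G : 'M[R]_2 := \matrix_i (if i == 0 then g0 else g1).
  have zG w : [lie z', v w] = v (w *m G).
    rewrite vE lieDr !lieZr g0E g1E -!linearZ -linearD; congr (v _).
    by rewrite [w in RHS]row2 mulmxDl -!scalemxAl -!rowE !rowK.
  have ze' := q0_E kg k3 c1 Ee z'0; set la := lam e z' in ze'.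
  (* The wedge of [ep4] and [et4] acts by -1 on [E4] and by 1 on V; subtracting la times it gives la
     on [E4], and the shift of G compensates its effect on V. *)
  have [X [XM XE XV]] := so4_level (G + la%:M).
  exists (X - la *: wd (ep4 R) (et4 R)).
  split=> //; first by apply: (MB0) => //; exact: MZ0.
  exists la, (fun w => w *m G); split=> // [|w].
    by rewrite lieBl lieZl XE epet_E scalerN opprK add0r.
  by rewrite lieBl lieZl XV epet_V mulmxDr mul_mx_scalar linearD linearZ /= addrK.
have m0E x : x \in q 1 -> m0q [lie x, e] ((- lam e [lie x, e]) *: wd (ep4 R) (et4 R)).
  move=> x1; have xe0 := q1_e kg c1 Ee x1; split=> //; first exact: MZ0.
  exists (lam e [lie x, e]), (fun w => - lam e [lie x, e] *: w); split.
  - exact: (q0_E kg k3 c1 Ee).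
  - by rewrite lieZl epet_E scaleNr scalerN opprK.
  - move=> w; rewrite (q1_e_V kg k3 c1 ic c2 Ee x1 (vin w)) linearZ /=; congr (_ *: _).
    by rewrite mulfV ?pnatr_eq0 // mulN1r.
  - by move=> w; rewrite lieZl epet_V linearZ.
have m1x x l : x \in q 1 -> (forall w, lam e [lie x, v w] = dot2 l w) ->
    m1q x (so4_raise (lam e [lie x, e]) l).
  move=> x1 hl; split=> //; first exact: so4_raise_MI.
    by rewrite so4_raise_E; exact: m0E.
  move=> w; rewrite so4_raise_V; split; first exact: (q1_V kg ic x1 (vin w)).
    by apply: (MD0) => //; exact: MZ0.
  exists (dot2 l w), (fun w' => - (dot2 l w *: w' + dot2 l w' *: w)); split.
  - exact: lam1.
  - by rewrite lieDl lieZl epet_E pirho_E addr0 scaleNr scalerN opprK.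
  - by move=> w'; exact: act.
  - by move=> w'; rewrite lieDl lieZl epet_V pirho_V -linearZ -linearD; congr (V4 R _); linear_ring.
have lamx x : x \in q 1 -> forall w, lam e [lie x, v w] =
    dot2 (\row_i (if i == 0 then lam e [lie x, w0] else lam e [lie x, w1])) w.
  by move=> x1; apply: lamD; rewrite // mxE.
have tot1 x : x \in q 1 -> exists u, m1q x u by move=> x1; eexists; exact: m1x (lamx x x1).
have E0 : E4 R != 0.
  apply/eqP => /(congr1 (fun u : gl R (3 + 4) => ip (ep4 R) ((u : 'M_(3 + 4)) *m un4 R))).
  rewrite mul0mx ip0r wdE !gram4 !zsimp ipZr !gram4 mulr1 => /eqP.
  by rewrite oppr_eq0 oner_eq0.
have [h [hker hbr [he hv] hM h1]] := converse_transfer simp kg k3 c1 ic c2 Ee fq vV vb (@b4_left R) b4r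
  (so4_negative R) E0 MIL (@so_MI_br R 1 2 _) ME MV MF (@so4_transitive R)
  zs ze zv tot0 tot1.
have imeu : exists x, h x = wd (ep4 R) (un4 R).
  have [x x1 a0] := lam_e_nonzero simp kg k3 c1 ic c2 Ee fq.
  have hx := h1 _ _ (m1x _ _ x1 (lamx x x1)); move: hx.
  set a := lam e [lie x, e] in a0 *; set l := \row_i _ => hx.
  exists ((- 2 * a)^-1 *: (x + (- a)^-1 *: [lie [lie x, e], x])).
  rewrite linearZ /= linearD linearZ /= !hbr he hx so4_raise_E lieZl scalerA mulVf ?oppr_eq0 // scale1r.
  by rewrite so4_raise_br so4_raise_sum scalerK // mulf_neq0 // oppr_eq0 pnatr_eq0.
have hP u : in_so (u : 'M_(3 + 4)) <-> exists x, h x = u.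
  split=> [su|[x <-]]; last first.
    move: x; apply: (graded_ind kg) => [|i x /hM[] //].
    split=> [|a x y hx hy]; first by rewrite linear0; case: (MIL 0) => -[].
    by rewrite linearP; apply: (proj2 (@so_linear R 1 2)).
  apply: (so4_generate (Q := fun u => exists x, h x = u)) su.
  - split=> [|a _ _ [x <-] [y <-]]; first by exists 0; rewrite linear0.
    by exists (a *: x + y); rewrite linearP.
  - by move=> _ _ [x <-] [y <-]; exists [lie x, y]; rewrite hbr.
  - by exists e.
  - by move=> w; exists (v w).
  - exact: imeu.
  - move=> w; have [x x1 hl] := xl w.
    have hx := h1 _ _ (m1x _ _ x1 hl); have [y hy] := imeu.
    exists (- lam e [lie x, e] *: y - x).
    by rewrite linearB linearZ /= hy hx /so4_raise opprB addrCA subrr addr0.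
have rt i : so_root i (t4 R) = (i \in [set i : 'I_(so_rank 1 2) | i.+1 \in [:: 2; 3]%N])%:R.
  by rewrite inE t4_roots.
apply: (@has_type_intro R (gl R (3 + 4)) _ _ _ _ _ _ _ (so_root_model R 1 2) L h hker hP hbr
  4 q _ (t4 R) kg rt) => //.
by move=> i x /hM[].
Qed.
End SoFourConverse.

(** * Depth five: derivations of the split octonions *)

Definition endo (R : fieldType) (V : vectType R) : Type := 'End(V).

Section EndoLie.
Variables (R : fieldType) (V : vectType R).
HB.instance Definition _ := Vector.copy (endo V) 'End(V).

Definition endo_br (u w : endo V) : endo V :=
  locked (((u : 'End(V)) \o w)%VF - ((w : 'End(V)) \o u)%VF).

Lemma endo_brE (u w : endo V) x : (endo_br u w : 'End(V)) x = (u : 'End(V)) ((w : 'End(V)) x) - (w : 'End(V)) ((u : 'End(V)) x).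
Proof. by rewrite /endo_br -lock add_lfunE opp_lfunE !comp_lfunE. Qed.

Lemma endo_br_linear_l w : linear (endo_br^~ w).
Proof.
move=> a u v; apply/lfunP => x; rewrite endo_brE.
rewrite [in RHS]add_lfunE [in RHS]scale_lfunE !endo_brE !add_lfunE !scale_lfunE linearP /=.
by linear_ring.
Qed.
Lemma endo_br_linear_r u : linear (endo_br u).
Proof.
move=> a w v; apply/lfunP => x; rewrite endo_brE.
rewrite [in RHS]add_lfunE [in RHS]scale_lfunE !endo_brE !add_lfunE !scale_lfunE linearP /=.
by linear_ring.
Qed.
Lemma endo_brxx u : endo_br u u = 0. Proof. by rewrite /endo_br -lock subrr. Qed.
Lemma endo_br_jacobi u v w :
  endo_br u (endo_br v w) + endo_br v (endo_br w u) + endo_br w (endo_br u v) = 0.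
Proof.
apply/lfunP => x; rewrite !add_lfunE zero_lfunE !endo_brE !linearB /=.
by linear_ring.
Qed.

HB.instance Definition _ := Vector_isLie.Build R (endo V)
  endo_br_linear_l endo_br_linear_r endo_brxx endo_br_jacobi.

Lemma endo_lieE (u w : endo V) x :
  ([lie u, w] : 'End(V)) x = (u : 'End(V)) ((w : 'End(V)) x) - (w : 'End(V)) ((u : 'End(V)) x).
Proof. exact: endo_brE. Qed.
End EndoLie.

(** * Derivations of Zorn matrices in coordinates *)

Section ZornCoordinates.
Variable R : realFieldType.
Definition r3 (a b c : R) : 'rV[R]_3 := \row_i [:: a; b; c]`_i.

Lemma ord3_case (Q : 'I_3 -> Prop) : Q 0 -> Q 1 -> Q 2%:R -> forall i, Q i.
Proof.
move=> Q0 Q1 Q2 [[|[|[|//]]] ilt].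
- by rewrite (_ : Ordinal ilt = 0) //; apply: val_inj.
- by rewrite (_ : Ordinal ilt = 1) //; apply: val_inj.
- by rewrite (_ : Ordinal ilt = 2%:R) //; apply: val_inj.
Qed.

Lemma r3E (u : 'rV[R]_3) : u = r3 (u 0 0) (u 0 1) (u 0 2%:R).
Proof. by apply/rowP; apply: ord3_case; rewrite mxE. Qed.

Lemma dot3_r3 a b c a' b' c' : dot3 (r3 a b c) (r3 a' b' c') = a * a' + b * b' + c * c'.
Proof. by rewrite /dot3 !big_ord_recl big_ord0 !mxE /= addr0 addrA. Qed.

Lemma cross3_r3 a b c a' b' c' : cross3 (r3 a b c) (r3 a' b' c') =
  r3 (b * c' - c * b') (c * a' - a * c') (a * b' - b * a').
Proof. by apply/rowP; apply: ord3_case; rewrite !mxE. Qed.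

Lemma add_r3 a b c a' b' c' : r3 a b c + r3 a' b' c' = r3 (a + a') (b + b') (c + c').
Proof. by apply/rowP; apply: ord3_case; rewrite !mxE. Qed.
Lemma scale_r3 x a b c : x *: r3 a b c = r3 (x * a) (x * b) (x * c).
Proof. by apply/rowP; apply: ord3_case; rewrite !mxE. Qed.
Lemma opp_r3 a b c : - r3 a b c = r3 (- a) (- b) (- c).
Proof. by apply/rowP; apply: ord3_case; rewrite !mxE. Qed.

Definition zr (a u0 u1 u2 v0 v1 v2 b : R) : zorn R := ((a, r3 u0 u1 u2), (r3 v0 v1 v2, b)).

#[local] Arguments zorn_mul : simpl never.

Lemma zr_ind (Q : zorn R -> Prop) : (forall a u0 u1 u2 v0 v1 v2 b, Q (zr a u0 u1 u2 v0 v1 v2 b)) ->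
  forall x, Q x.
Proof. by move=> h [[a u] [v b]]; rewrite (r3E u) (r3E v); exact: h. Qed.

Lemma zr_add a u0 u1 u2 v0 v1 v2 b a' u0' u1' u2' v0' v1' v2' b' :
  zr a u0 u1 u2 v0 v1 v2 b + zr a' u0' u1' u2' v0' v1' v2' b' =
  zr (a + a') (u0 + u0') (u1 + u1') (u2 + u2') (v0 + v0') (v1 + v1') (v2 + v2') (b + b').
Proof. by rewrite /zr -!add_r3. Qed.
Lemma zr_scale x a u0 u1 u2 v0 v1 v2 b :
  x *: zr a u0 u1 u2 v0 v1 v2 b =
  zr (x * a) (x * u0) (x * u1) (x * u2) (x * v0) (x * v1) (x * v2) (x * b).
Proof. by rewrite /zr -!scale_r3. Qed.
Lemma zr_opp a u0 u1 u2 v0 v1 v2 b :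
  - zr a u0 u1 u2 v0 v1 v2 b = zr (- a) (- u0) (- u1) (- u2) (- v0) (- v1) (- v2) (- b).
Proof. by rewrite /zr -!opp_r3. Qed.

Lemma zr_mul a u0 u1 u2 v0 v1 v2 b a' u0' u1' u2' v0' v1' v2' b' :
  zorn_mul (zr a u0 u1 u2 v0 v1 v2 b) (zr a' u0' u1' u2' v0' v1' v2' b') =
  zr (a * a' + (u0 * v0' + u1 * v1' + u2 * v2'))
     (a * u0' + b' * u0 - (v1 * v2' - v2 * v1')) (a * u1' + b' * u1 - (v2 * v0' - v0 * v2'))
     (a * u2' + b' * u2 - (v0 * v1' - v1 * v0'))
     (a' * v0 + b * v0' + (u1 * u2' - u2 * u1')) (a' * v1 + b * v1' + (u2 * u0' - u0 * u2'))
     (a' * v2 + b * v2' + (u0 * u1' - u1 * u0'))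
     (v0 * u0' + v1 * u1' + v2 * u2' + b * b').
Proof. by rewrite /zorn_mul /zr !dot3_r3 !cross3_r3 !scale_r3 opp_r3 !add_r3. Qed.

Lemma zr_eq a u0 u1 u2 v0 v1 v2 b a' u0' u1' u2' v0' v1' v2' b' :
  a = a' -> u0 = u0' -> u1 = u1' -> u2 = u2' -> v0 = v0' -> v1 = v1' -> v2 = v2' -> b = b' ->
  zr a u0 u1 u2 v0 v1 v2 b = zr a' u0' u1' u2' v0' v1' v2' b'.
Proof. by move=> -> -> -> -> -> -> -> ->. Qed.

Lemma zr_inj a u0 u1 u2 v0 v1 v2 b a' u0' u1' u2' v0' v1' v2' b' :
  zr a u0 u1 u2 v0 v1 v2 b = zr a' u0' u1' u2' v0' v1' v2' b' ->
  [/\ a = a', [/\ u0 = u0', u1 = u1' & u2 = u2'], [/\ v0 = v0', v1 = v1' & v2 = v2'] & b = b'].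
Proof.
move=> [-> /rowP u /rowP v ->]; split=> //.
  by have := u 0; have := u 1; have := u 2%:R; rewrite !mxE.
by have := v 0; have := v 1; have := v 2%:R; rewrite !mxE.
Qed.

Implicit Types c : 'rV[R]_14.

(* The derivation [D] with coordinates [c] sends the idempotent ((1, 0), (0, 0)) to ((0, p), (q, 0))
   with p = (c0, c1, c2) and q = (c3, c4, c5), and acts on the first vector component of trace-free
   Zorn matrices by a trace-free matrix (a_ij), acting on rows, with off-diagonal entries
   c6, ..., c11 and first diagonal entries c12, c13. *)
Definition g2c c k : R := c 0 (inord k).
Local Notation "c $ k" := (g2c c k) (at level 9, k at level 8, format "c $ k").
Definition mk14 (s : seq R) : 'rV[R]_14 := \row_i s`_i.

Lemma mk14E s k : (k < 14)%N -> (mk14 s)$k = s`_k.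
Proof. by move=> k14; rewrite /g2c mxE inordK. Qed.

Lemma c14_eq c c' : (forall k, (k < 14)%N -> c$k = c'$k) -> c = c'.
Proof. by move=> h; apply/rowP => i; have := h i (ltn_ord i); rewrite /g2c inord_val. Qed.

(** The matrix acts on the second vector component by its negative transpose; the cross products
    with p and q are forced by the Leibniz rule. *)
Definition g2f c (x : zorn R) : zorn R :=
  let: ((a, u), (v, b)) := x in
  let u0 := u 0 0 in let u1 := u 0 1 in let u2 := u 0 2%:R in
  let v0 := v 0 0 in let v1 := v 0 1 in let v2 := v 0 2%:R in
  let qu := c$3 * u0 + c$4 * u1 + c$5 * u2 in
  let pv := c$0 * v0 + c$1 * v1 + c$2 * v2 in
  zr (- qu - pv)
   ((a - b) * c$0 + (u0 * c$12 + u1 * c$8 + u2 * c$10) + (c$4 * v2 - c$5 * v1))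
   ((a - b) * c$1 + (u0 * c$6 + u1 * c$13 + u2 * c$11) + (c$5 * v0 - c$3 * v2))
   ((a - b) * c$2 + (u0 * c$7 + u1 * c$9 + u2 * (- c$12 - c$13)) + (c$3 * v1 - c$4 * v0))
   ((a - b) * c$3 + (c$1 * u2 - c$2 * u1) - (v0 * c$12 + v1 * c$6 + v2 * c$7))
   ((a - b) * c$4 + (c$2 * u0 - c$0 * u2) - (v0 * c$8 + v1 * c$13 + v2 * c$9))
   ((a - b) * c$5 + (c$0 * u1 - c$1 * u0) - (v0 * c$10 + v1 * c$11 + v2 * (- c$12 - c$13)))
   (qu + pv).

Lemma g2f_zr c a u0 u1 u2 v0 v1 v2 b : g2f c (zr a u0 u1 u2 v0 v1 v2 b) =
  let qu := c$3 * u0 + c$4 * u1 + c$5 * u2 in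
  let pv := c$0 * v0 + c$1 * v1 + c$2 * v2 in
  zr (- qu - pv)
   ((a - b) * c$0 + (u0 * c$12 + u1 * c$8 + u2 * c$10) + (c$4 * v2 - c$5 * v1))
   ((a - b) * c$1 + (u0 * c$6 + u1 * c$13 + u2 * c$11) + (c$5 * v0 - c$3 * v2))
   ((a - b) * c$2 + (u0 * c$7 + u1 * c$9 + u2 * (- c$12 - c$13)) + (c$3 * v1 - c$4 * v0))
   ((a - b) * c$3 + (c$1 * u2 - c$2 * u1) - (v0 * c$12 + v1 * c$6 + v2 * c$7))
   ((a - b) * c$4 + (c$2 * u0 - c$0 * u2) - (v0 * c$8 + v1 * c$13 + v2 * c$9))
   ((a - b) * c$5 + (c$0 * u1 - c$1 * u0) - (v0 * c$10 + v1 * c$11 + v2 * (- c$12 - c$13)))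
   (qu + pv).
Proof. by rewrite /g2f /zr !mxE. Qed.

Lemma g2f_linear c : linear (g2f c).
Proof.
move=> s; apply: zr_ind => a u0 u1 u2 v0 v1 v2 b; apply: zr_ind => a' u0' u1' u2' v0' v1' v2' b'.
rewrite zr_scale zr_add !g2f_zr /= zr_scale zr_add; apply: zr_eq; ring.
Qed.
HB.instance Definition _ c := GRing.isLinear.Build R (zorn R) (zorn R) _ (g2f c) (g2f_linear c).
Definition g2d c : endo (zorn R) := linfun (g2f c).

Lemma g2dE c x : (g2d c : 'End(zorn R)) x = g2f c x.
Proof. exact: lfunE. Qed.

Lemma g2d_linear : linear g2d.
Proof.
move=> s c c'; apply/lfunP; apply: zr_ind => a u0 u1 u2 v0 v1 v2 b.
rewrite add_lfunE scale_lfunE !g2dE !g2f_zr /= zr_scale zr_add.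
by apply: zr_eq; rewrite /g2c !mxE; ring.
Qed.
HB.instance Definition _ := GRing.isLinear.Build R 'rV[R]_14 (endo (zorn R)) _ g2d g2d_linear.

Lemma g2d_derivation c : zorn_derivation (g2d c).
Proof.
apply: zr_ind => a u0 u1 u2 v0 v1 v2 b; apply: zr_ind => a' u0' u1' u2' v0' v1' v2' b'.
rewrite !g2dE zr_mul !g2f_zr /= !zr_mul zr_add; apply: zr_eq; ring.
Qed.

(** The bracket of G_2 in its decomposition into sl_3, a three-dimensional representation
    (coordinates 0 to 2) and its dual (coordinates 3 to 5). *)
Definition g2_br c c' := mk14 [::
   c'$0 * c$12 + c'$1 * c$8 + c'$2 * c$10 - (c$0 * c'$12 + c$1 * c'$8 + c$2 * c'$10) + 2 * (c$4 * c'$5 - c$5 * c'$4);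
   c'$0 * c$6 + c'$1 * c$13 + c'$2 * c$11 - (c$0 * c'$6 + c$1 * c'$13 + c$2 * c'$11) + 2 * (c$5 * c'$3 - c$3 * c'$5);
   c'$0 * c$7 + c'$1 * c$9 + c'$2 * (- c$12 - c$13) - (c$0 * c'$7 + c$1 * c'$9 + c$2 * (- c'$12 - c'$13)) + 2 * (c$3 * c'$4 - c$4 * c'$3);
   2 * (c$1 * c'$2 - c$2 * c'$1) - (c'$3 * c$12 + c'$4 * c$6 + c'$5 * c$7) + (c$3 * c'$12 + c$4 * c'$6 + c$5 * c'$7);
   2 * (c$2 * c'$0 - c$0 * c'$2) - (c'$3 * c$8 + c'$4 * c$13 + c'$5 * c$9) + (c$3 * c'$8 + c$4 * c'$13 + c$5 * c'$9);
   2 * (c$0 * c'$1 - c$1 * c'$0) - (c'$3 * c$10 + c'$4 * c$11 + c'$5 * (- c$12 - c$13)) + (c$3 * c'$10 + c$4 * c'$11 + c$5 * (- c'$12 - c'$13));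
   c'$12 * c$6 + c'$6 * c$13 + c'$7 * c$11 - (c$12 * c'$6 + c$6 * c'$13 + c$7 * c'$11) + 3 * (c$3 * c'$1 - c'$3 * c$1);
   c'$12 * c$7 + c'$6 * c$9 + c'$7 * (- c$12 - c$13) - (c$12 * c'$7 + c$6 * c'$9 + c$7 * (- c'$12 - c'$13)) + 3 * (c$3 * c'$2 - c'$3 * c$2);
   c'$8 * c$12 + c'$13 * c$8 + c'$9 * c$10 - (c$8 * c'$12 + c$13 * c'$8 + c$9 * c'$10) + 3 * (c$4 * c'$0 - c'$4 * c$0);
   c'$8 * c$7 + c'$13 * c$9 + c'$9 * (- c$12 - c$13) - (c$8 * c'$7 + c$13 * c'$9 + c$9 * (- c'$12 - c'$13)) + 3 * (c$4 * c'$2 - c'$4 * c$2);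
   c'$10 * c$12 + c'$11 * c$8 + (- c'$12 - c'$13) * c$10 - (c$10 * c'$12 + c$11 * c'$8 + (- c$12 - c$13) * c'$10) + 3 * (c$5 * c'$0 - c'$5 * c$0);
   c'$10 * c$6 + c'$11 * c$13 + (- c'$12 - c'$13) * c$11 - (c$10 * c'$6 + c$11 * c'$13 + (- c$12 - c$13) * c'$11) + 3 * (c$5 * c'$1 - c'$5 * c$1);
   c'$12 * c$12 + c'$6 * c$8 + c'$7 * c$10 - (c$12 * c'$12 + c$6 * c'$8 + c$7 * c'$10) + 3 * (c$3 * c'$0 - c'$3 * c$0) - ((c$3 * c'$0 - c'$3 * c$0) + (c$4 * c'$1 - c'$4 * c$1) + (c$5 * c'$2 - c'$5 * c$2));
   c'$8 * c$6 + c'$13 * c$13 + c'$9 * c$11 - (c$8 * c'$6 + c$13 * c'$13 + c$9 * c'$11) + 3 * (c$4 * c'$1 - c'$4 * c$1) - ((c$3 * c'$0 - c'$3 * c$0) + (c$4 * c'$1 - c'$4 * c$1) + (c$5 * c'$2 - c'$5 * c$2))].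

Lemma g2d_br c c' : [lie g2d c, g2d c'] = g2d (g2_br c c').
Proof.
apply/lfunP; apply: zr_ind => a u0 u1 u2 v0 v1 v2 b.
rewrite endo_lieE !g2dE !g2f_zr /= zr_opp zr_add !mk14E //=.
apply: zr_eq; ring.
Qed.
End ZornCoordinates.

Section G2Derivations.
Variable R : realFieldType.
Implicit Types (c : 'rV[R]_14) (D : endo (zorn R)).
Local Notation "c $ k" := (g2c c k) (at level 9, k at level 8, format "c $ k").
#[local] Arguments zorn_mul : simpl never.

Lemma zr_ex (x : zorn R) : exists a u0 u1 u2 v0 v1 v2 b, x = zr a u0 u1 u2 v0 v1 v2 b.
Proof. by move: x; apply: zr_ind => a u0 u1 u2 v0 v1 v2 b; do 8!eexists. Qed.

(** The Leibniz rule on the two idempotents and on their products with the vector components fixes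
    all values up to a matrix on each vector part. Products of a vector of each kind make these
    matrices negative transposes of each other, and the product of two basis vectors of the first
    kind makes the trace vanish. *)
Lemma derivation_g2d D : zorn_derivation D -> exists c, D = g2d c.
Proof.
move=> dD.
have mulP x y z : zorn_mul x y = z -> D z = zorn_mul (D x) y + zorn_mul x (D y) by move=> <-.
have z0 : zr 0 0 0 0 0 0 0 0 = 0 :> zorn R.
  by rewrite -[RHS](scale0r (zr 0 0 0 0 0 0 0 0)) zr_scale; apply: zr_eq; ring.
have mul0 x y : zorn_mul x y = zr 0 0 0 0 0 0 0 0 -> zr 0 0 0 0 0 0 0 0 = zorn_mul (D x) y + zorn_mul x (D y).
  by move=> /mulP <-; rewrite z0 linear0.
pose e1 : zorn R := zr 1 0 0 0 0 0 0 0; pose e2 : zorn R := zr 0 0 0 0 0 0 0 1.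
pose U u0 u1 u2 : zorn R := zr 0 u0 u1 u2 0 0 0 0; pose V v0 v1 v2 : zorn R := zr 0 0 0 0 v0 v1 v2 0.
have [p0 [p1 [p2 [q0 [q1 [q2 dE1]]]]]] : exists p0 p1 p2 q0 q1 q2, D e1 = zr 0 p0 p1 p2 q0 q1 q2 0.
  have [a [u0 [u1 [u2 [v0 [v1 [v2 [b de]]]]]]]] := zr_ex (D e1).
  have := mulP e1 e1 e1; rewrite de /e1 !zr_mul zr_add => h.
  have [] := zr_inj (h _); first by apply: zr_eq; ring.
  move=> ha _ _ hb; exists u0, u1, u2, v0, v1, v2.
  by apply: zr_eq => //; lra.
have dE2 : D e2 = zr 0 (- p0) (- p1) (- p2) (- q0) (- q1) (- q2) 0.
  have [a [u0 [u1 [u2 [v0 [v1 [v2 [b de]]]]]]]] := zr_ex (D e2).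
  have := mul0 e1 e2; rewrite de dE1 /e1 /e2 !zr_mul zr_add => h1.
  have := mul0 e2 e1; rewrite de dE1 /e1 /e2 !zr_mul zr_add => h2.
  have := mulP e2 e2 e2; rewrite de /e2 !zr_mul zr_add => h3.
  have [] := zr_inj (h1 _); first by apply: zr_eq; ring.
  have [] := zr_inj (h2 _); first by apply: zr_eq; ring.
  have [] := zr_inj (h3 _); first by apply: zr_eq; ring.
  move=> _ _ _ hb _ _ [? ? ?] _ ha [? ? ?] _ _; apply: zr_eq; lra.
have dU u0 u1 u2 : exists x0 x1 x2, D (U u0 u1 u2) = zr (- (q0 * u0 + q1 * u1 + q2 * u2)) x0 x1 x2
    (p1 * u2 - p2 * u1) (p2 * u0 - p0 * u2) (p0 * u1 - p1 * u0) (q0 * u0 + q1 * u1 + q2 * u2).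
  have [a [x0 [x1 [x2 [y0 [y1 [y2 [b de]]]]]]]] := zr_ex (D (U u0 u1 u2)).
  have := mulP e1 (U u0 u1 u2) (U u0 u1 u2); rewrite de dE1 /e1 /U !zr_mul zr_add => h1.
  have := mul0 (U u0 u1 u2) e1; rewrite de dE1 /e1 /U !zr_mul zr_add => h2.
  have [] := zr_inj (h1 _); first by apply: zr_eq; ring.
  have [] := zr_inj (h2 _); first by apply: zr_eq; ring.
  move=> ha _ _ _ _ _ [? ? ?] hb; exists x0, x1, x2; apply: zr_eq => //; lra.
have dV v0 v1 v2 : exists y0 y1 y2, D (V v0 v1 v2) = zr (- (p0 * v0 + p1 * v1 + p2 * v2))
    (q1 * v2 - q2 * v1) (q2 * v0 - q0 * v2) (q0 * v1 - q1 * v0) y0 y1 y2 (p0 * v0 + p1 * v1 + p2 * v2).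
  have [a [x0 [x1 [x2 [y0 [y1 [y2 [b de]]]]]]]] := zr_ex (D (V v0 v1 v2)).
  have := mulP (V v0 v1 v2) e1 (V v0 v1 v2); rewrite de dE1 /e1 /V !zr_mul zr_add => h1.
  have := mul0 e1 (V v0 v1 v2); rewrite de dE1 /e1 /V !zr_mul zr_add => h2.
  have [] := zr_inj (h1 _); first by apply: zr_eq; ring.
  have [] := zr_inj (h2 _); first by apply: zr_eq; ring.
  move=> ha _ _ _ _ [? ? ?] _ hb; exists y0, y1, y2; apply: zr_eq => //; lra.
have [a00 [a01 [a02 dU0]]] := dU 1 0 0; have [a10 [a11 [a12 dU1]]] := dU 0 1 0.
have [a20 [a21 [a22 dU2]]] := dU 0 0 1.
have [b00 [b01 [b02 dV0]]] := dV 1 0 0; have [b10 [b11 [b12 dV1]]] := dV 0 1 0.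
have [b20 [b21 [b22 dV2]]] := dV 0 0 1.
have UV u0 u1 u2 v0 v1 v2 : D ((u0 * v0 + u1 * v1 + u2 * v2) *: e1) =
    zorn_mul (D (U u0 u1 u2)) (V v0 v1 v2) + zorn_mul (U u0 u1 u2) (D (V v0 v1 v2)).
  by apply: mulP; rewrite /U /V /e1 zr_mul zr_scale; apply: zr_eq; ring.
have tr : a22 = - a00 - a11.
  have := mulP (U 1 0 0) (U 0 1 0) (V 0 0 1); rewrite dU0 dU1 dV2 /U /V !zr_mul zr_add => h.
  have [] := zr_inj (h _); first by apply: zr_eq; ring.
  move=> _ _ [_ _ h1] _; have := UV 0 0 1 0 0 1; rewrite linearZ /= dE1 dU2 dV2 /U /V !zr_mul zr_add zr_scale.
  by move=> /zr_inj[h2 _ _ _]; lra.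
have bE : [/\ b00 = - a00, b01 = - a10 & b02 = - a20] /\ [/\ b10 = - a01, b11 = - a11 & b12 = - a21] /\
    [/\ b20 = - a02, b21 = - a12 & b22 = a00 + a11].
  do ![split];
  [have := UV 1 0 0 1 0 0|have := UV 0 1 0 1 0 0|have := UV 0 0 1 1 0 0
  |have := UV 1 0 0 0 1 0|have := UV 0 1 0 0 1 0|have := UV 0 0 1 0 1 0
  |have := UV 1 0 0 0 0 1|have := UV 0 1 0 0 0 1|have := UV 0 0 1 0 0 1];
  rewrite linearZ /= dE1 ?dU0 ?dU1 ?dU2 ?dV0 ?dV1 ?dV2 /U /V !zr_mul zr_add zr_scale => /zr_inj[h _ _ _];
  lra.
exists (mk14 [:: p0; p1; p2; q0; q1; q2; a01; a02; a10; a12; a20; a21; a00; a11]).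
apply/lfunP; apply: zr_ind => a u0 u1 u2 v0 v1 v2 b; rewrite g2dE g2f_zr /= !mk14E //=.
have -> : zr a u0 u1 u2 v0 v1 v2 b = a *: e1 + b *: e2 + (u0 *: U 1 0 0 + u1 *: U 0 1 0 + u2 *: U 0 0 1)
    + (v0 *: V 1 0 0 + v1 *: V 0 1 0 + v2 *: V 0 0 1).
  by rewrite /e1 /e2 /U /V !zr_scale !zr_add; apply: zr_eq; ring.
rewrite !linearD !linearZ /= dE1 dE2 dU0 dU1 dU2 dV0 dV1 dV2 !zr_scale !zr_add.
move: bE => [[-> -> ->] [[-> -> ->] [-> -> ->]]]; rewrite tr.
by apply: zr_eq; ring.
Qed.

Lemma g2d_inj c : g2d c = 0 -> c = 0.
Proof.
move=> c0; have h x : g2f c x = 0 by rewrite -g2dE c0 zero_lfunE.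
have z0 : 0 = zr 0 0 0 0 0 0 0 0 :> zorn R.
  by rewrite -[LHS](scale0r (zr 0 0 0 0 0 0 0 0)) zr_scale; apply: zr_eq; ring.
have := h (zr 1 0 0 0 0 0 0 0); rewrite g2f_zr z0 /= => /zr_inj[_ [h0 h1 h2] [h3 h4 h5] _].
have := h (zr 0 1 0 0 0 0 0 0); rewrite g2f_zr z0 /= => /zr_inj[_ [h12 h6 h7] _ _].
have := h (zr 0 0 1 0 0 0 0 0); rewrite g2f_zr z0 /= => /zr_inj[_ [h8 h13 h9] _ _].
have := h (zr 0 0 0 1 0 0 0 0); rewrite g2f_zr z0 /= => /zr_inj[_ [h10 h11 _] _ _].
apply: c14_eq; do 14!(case=> [_|]; first by rewrite [RHS]/g2c mxE; lra); by [].
Qed.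

(** Listed in the order of the 14 coordinates, the last two being those of the torus. *)
Definition g2_wts (t : 'rV[R]_2) : seq R :=
  let w0 := t 0 0 in let w1 := t 0 1 in let w2 := - t 0 0 - t 0 1 in
  [:: w0; w1; w2; - w0; - w1; - w2; w1 - w0; w2 - w0; w0 - w1; w2 - w1; w0 - w2; w1 - w2; 0; 0].

Definition g2_weight_row (t : 'rV[R]_2) : 'rV[R]_14 := mk14 [:: 0; 0; 0; 0; 0; 0; 0; 0; 0; 0; 0; 0; t 0 0; t 0 1].

Lemma g2_torusE t : g2_torus t = g2d (g2_weight_row t) :> endo (zorn R).
Proof.
pose F (x : zorn R) : zorn R := let: ((_, u), (v, _)) := x in
    ((0, \row_i (g2_weights t 0 i * u 0 i)), (- \row_i (g2_weights t 0 i * v 0 i), 0)).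
have FL : linear F.
  move=> s [[a u] [v b]] [[a' u'] [v' b']]; rewrite /F /=.
  congr ((_, _), (_, _)) => /=; rewrite ?scaler0 ?addr0 //; apply/rowP => i; rewrite !mxE; ring.
pose FF := HB.pack_for {linear zorn R -> zorn R} F (GRing.isLinear.Build R (zorn R) (zorn R) _ F FL).
apply/lfunP; apply: zr_ind => a u0 u1 u2 v0 v1 v2 b; rewrite g2dE g2f_zr /= !mk14E //=.
have -> : g2_torus t (zr a u0 u1 u2 v0 v1 v2 b) = F (zr a u0 u1 u2 v0 v1 v2 b) by exact: (lfunE FF).
rewrite /F /zr; congr ((_, _), (_, _)); try ring; apply/rowP; apply: ord3_case; rewrite !mxE /=; ring.
Qed.

Lemma g2_torus_br t c : [lie g2_torus t : endo (zorn R), g2d c] = g2d (\row_(k < 14) ((g2_wts t)`_k * c 0 k)).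
Proof.
rewrite g2_torusE g2d_br; congr (g2d _); apply: c14_eq.
do 14!(case=> [_|]; first by rewrite mk14E //= !mk14E //= /g2c !mxE inordK //=; ring); by [].
Qed.
End G2Derivations.

Section G2Model.
Variable R : realFieldType.
Local Notation T := (endo (zorn R)).
Local Notation P := (fun D : T => zorn_derivation D).
Local Notation H := (@g2_torus R : 'rV[R]_2 -> T).
Implicit Types (c : 'rV[R]_14) (D : T) (t : 'rV[R]_2).
Local Notation "c $ k" := (g2c c k) (at level 9, k at level 8, format "c $ k").

Definition g2_vec (k : 'I_14) : T := g2d (delta_mx 0 k).
Definition g2_wt (k : 'I_14) t : R := (g2_wts t)`_k.

Lemma g2_wt_root (k : 'I_14) : (forall t, g2_wt k t = 0) \/
  exists n : 'I_2 -> nat, (forall t, g2_wt k t = \sum_i (n i)%:R * g2_root i t) \/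
                          (forall t, g2_wt k t = - \sum_i (n i)%:R * g2_root i t).
Proof.
have pos (a b : nat) (l : 'rV[R]_2 -> R) : (forall t, l t = a%:R * t 0 1 + b%:R * (t 0 0 - t 0 1)) ->
    exists n : 'I_2 -> nat, (forall t, l t = \sum_i (n i)%:R * g2_root i t) \/
                            (forall t, l t = - \sum_i (n i)%:R * g2_root i t).
  move=> h; exists (fun i => if i == 0 then a else b); left=> t.
  by rewrite h !big_ord_recl big_ord0 /g2_root /= addr0.
have neg (a b : nat) (l : 'rV[R]_2 -> R) : (forall t, l t = - (a%:R * t 0 1 + b%:R * (t 0 0 - t 0 1))) ->
    exists n : 'I_2 -> nat, (forall t, l t = \sum_i (n i)%:R * g2_root i t) \/
                            (forall t, l t = - \sum_i (n i)%:R * g2_root i t).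
  move=> h; exists (fun i => if i == 0 then a else b); right=> t.
  by rewrite h !big_ord_recl big_ord0 /g2_root /= addr0.
rewrite /g2_wt; case: k => [[|[|[|[|[|[|[|[|[|[|[|[|[|[|//]]]]]]]]]]]]]] klt] /=; [right|right|right|right|right|right|right|right|right|right|right|right|by left|by left].
- by apply: (pos 1 1)%N => t; ring.
- by apply: (pos 1 0)%N => t; ring.
- by apply: (neg 2 1)%N => t; ring.
- by apply: (neg 1 1)%N => t; ring.
- by apply: (neg 1 0)%N => t; ring.
- by apply: (pos 2 1)%N => t; ring.
- by apply: (neg 0 1)%N => t; ring.
- by apply: (neg 3 2)%N => t; ring.
- by apply: (pos 0 1)%N => t; ring.
- by apply: (neg 3 1)%N => t; ring.
- by apply: (pos 3 2)%N => t; ring.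
- by apply: (pos 3 1)%N => t; ring.
Qed.

(** The element with w_0 = 2, w_1 = 1 and w_2 = -3 is regular: no root vanishes on it. *)
Lemma g2_wt_neq0 k t : (k < 12)%N -> t = \row_i (if i == 0 then 2 else 1) -> (g2_wts t)`_k != 0.
Proof.
move=> k12 ->; rewrite /g2_wts !mxE /=.
by move: k k12; do 12!(case=> [_ /=|]; first by apply/eqP => h; lra).
Qed.

Lemma g2_root_model : root_model P H (@g2_root R) g2_vec g2_wt.
Proof.
split.
- move=> a t s; rewrite !g2_torusE -linearZ -linearD; congr (g2d _).
  by apply: c14_eq; do 14!(case=> [_|]; first by rewrite /g2c !mxE inordK //= ?mxE; ring).
- move=> t; rewrite g2_torusE => /g2d_inj/rowP h; apply/rowP => i.
  have := h (inord 12); have := h (inord 13); rewrite !mxE !inordK //= => h1 h0.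
  by case: i => [[|[|//]] ilt]; [rewrite -[RHS]h0|rewrite -[RHS]h1]; congr (t _ _); apply: val_inj.
- move=> t s; rewrite [H s]g2_torusE g2_torus_br; rewrite -[RHS](linear0 (@g2d R)); congr (g2d _).
  by apply: c14_eq; do 14!(case=> [_|]; first by rewrite /g2c !mxE inordK //= ?mulr0 ?mul0r).
- move=> t; rewrite g2_torusE; exact: g2d_derivation.
- move=> k; exact: g2d_derivation.
- move=> t k; rewrite /g2_vec g2_torus_br -linearZ; congr (g2d _); apply/rowP => i; rewrite !mxE.
  by rewrite /g2_wt; case: (eqVneq i k) => [->|_] /=; rewrite ?mulr0.
- move=> u /derivation_g2d[c ->]; exists (fun k => c 0 k).
  by rewrite {1}(row_sum_delta c) linear_sum; apply: eq_bigr => k _; rewrite linearZ.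
- by move=> i a t s; rewrite /g2_root; case: ifP => _; rewrite !mxE; ring.
- exact: g2_wt_root.
- move=> i; have vec0 k : g2_vec k != 0.
    apply/eqP => /g2d_inj/rowP/(_ k); rewrite !mxE !eqxx => /eqP.
    by rewrite oner_eq0.
  (* Coordinates 1 and 8 have the weights w_1 and w_0 - w_1. *)
  exists (if i == 0 then inord 1 else inord 8); split=> // t.
  by rewrite /g2_wt /g2_root; case: ifP => _; rewrite inordK.
- move=> i; exists (\row_j (if i == 0 then 1 else (j == 0)%:R)) => j; rewrite /g2_root !mxE /=.
  by case: i => [[|[|//]] ?]; case: j => [[|[|//]] ?]; rewrite /= ?subrr ?subr0.
(* The centralizer of a regular element of the torus is the torus itself. *)
move=> u /derivation_g2d[c ->] hc; exists (\row_i c$(12 + i)) => _.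
rewrite g2_torusE; congr (g2d _).
pose t := \row_(i < 2) (if i == 0 then 2 else 1 : R).
have := hc t; rewrite g2_torus_br => /g2d_inj/rowP h.
apply: c14_eq => k k14; rewrite mk14E //.
have [k12|k12] := ltnP k 12.
  have := h (inord k); rewrite !mxE inordK // => /eqP; rewrite mulf_eq0 (negPf (g2_wt_neq0 k12 erefl)) /=.
  move=> /eqP; rewrite /g2c => ->.
  by move: k k12 {k14}; do 12!(case=> [//|]).
have [->|kE] := eqVneq k 12; first by rewrite /= mxE.
by have -> : k = 13%N by [lia]; rewrite /= mxE.
Qed.

(** Both simple roots take the value 1 here: w_1 = 1 and w_0 - w_1 = 1. *)
Definition t5 : 'rV[R]_2 := \row_i (if i == 0 then 2 else 1).
Definition g2_MI (i : int) (u : T) := P u /\ [lie H t5, u] = i%:~R *: u.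

Lemma derivation_linear : linear_closed_pred P.
Proof.
split=> [|a u w /derivation_g2d[c ->] /derivation_g2d[c' ->]].
  by rewrite -(linear0 (@g2d R)); exact: g2d_derivation.
by rewrite -linearP; exact: g2d_derivation.
Qed.

Lemma g2_MI_linear i : linear_closed_pred (g2_MI i).
Proof.
have [s0 sD] := derivation_linear.
split=> [|a u v [su hu] [sv hv]]; first by split=> //; rewrite lie0r scaler0.
split; first exact: sD.
by rewrite lieDr lieZr hu hv scalerDr !scalerA mulrC.
Qed.

Lemma g2_MI_br i j (u v : T) : g2_MI i u -> g2_MI j v -> g2_MI (i + j) [lie u, v].
Proof.
move=> [su hu] [sv hv]; split.
  have [c ->] := derivation_g2d su; have [c' ->] := derivation_g2d sv.
  by rewrite g2d_br; exact: g2d_derivation.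
by rewrite lieJ hu hv lieZl lieZr -scalerDl rmorphD.
Qed.

Definition g2_deg : seq int := [:: 2; 1; -3; -2; -1; 3; -1; -5; 1; -4; 5; 4; 0; 0].

Lemma g2_degE k : (k < 14)%N -> (g2_wts t5)`_k = (g2_deg`_k)%:~R.
Proof.
rewrite /g2_wts /t5 !mxE /=; move: k.
by do 14!(case=> [_ /=|]; first by rewrite ?rmorphN /=; lra).
Qed.

Lemma g2_MI_coord i u : g2_MI i u -> exists2 c, u = g2d c & forall k, (k < 14)%N -> g2_deg`_k != i -> c$k = 0.
Proof.
move=> [/derivation_g2d[c ->] hc]; exists c => // k k14 ki.
move: hc; rewrite g2_torus_br -linearZ => /eqP; rewrite -subr_eq0 -linearB => /eqP/g2d_inj/rowP/(_ (inord k)).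
rewrite !mxE inordK // g2_degE // -mulrBl -rmorphB => /eqP; rewrite mulf_eq0 intr_eq0 subr_eq0 (negPf ki) /=.
by move/eqP.
Qed.

Lemma g2_MI_of_coord (i : int) c : (forall k, (k < 14)%N -> g2_deg`_k != i -> c$k = 0) -> g2_MI i (g2d c).
Proof.
move=> hc; split; first exact: g2d_derivation.
rewrite g2_torus_br -linearZ; congr (g2d _); apply/rowP => k; rewrite !mxE g2_degE //.
have := hc k (ltn_ord k); rewrite /g2c inord_val; case: eqP => [-> //|_ -> //].
by rewrite !mulr0.
Qed.

Fact g2v_subproof : {F : nat -> T | forall k, F k = g2d (mk14 (rcons (nseq k 0) 1))}.
Proof. by exists (fun k => g2d (mk14 (rcons (nseq k 0) 1))). Qed.
Definition g2v := sval g2v_subproof.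
Lemma g2vE k : g2v k = g2d (mk14 (rcons (nseq k 0) 1)).
Proof. exact: svalP g2v_subproof k. Qed.

Fact g2h_subproof : {F : R -> R -> T |
  forall a b, F a b = g2d (mk14 [:: 0; 0; 0; 0; 0; 0; 0; 0; 0; 0; 0; 0; a; b])}.
Proof. by exists (fun a b => g2d (mk14 [:: 0; 0; 0; 0; 0; 0; 0; 0; 0; 0; 0; 0; a; b])). Qed.
Definition g2h := sval g2h_subproof.
Lemma g2hE a b : g2h a b = g2d (mk14 [:: 0; 0; 0; 0; 0; 0; 0; 0; 0; 0; 0; 0; a; b]).
Proof. exact: svalP g2h_subproof a b. Qed.

Lemma g2v_c k j : (j < 14)%N -> (mk14 (rcons (nseq k 0) (1 : R)))$j = (j == k)%:R.
Proof.
move=> j14; rewrite mk14E // nth_rcons size_nseq nth_nseq.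
by case: ltngtP.
Qed.

Lemma g2v_MI k : (k < 14)%N -> g2_MI g2_deg`_k (g2v k).
Proof.
move=> k14; rewrite g2vE; apply: g2_MI_of_coord => j j14 jk; rewrite g2v_c //.
by have [jE|//] := eqVneq j k; rewrite jE eqxx in jk.
Qed.
End G2Model.

(** * Negative part of the split form of G_2, and the two conditions at depth five *)

Section G2Negative.
Variable R : realFieldType.
Local Notation T := (endo (zorn R)).
Implicit Types (c : 'rV[R]_14) (D : T) (w : 'rV[R]_1).
Local Notation "c $ k" := (g2c c k) (at level 9, k at level 8, format "c $ k").
Local Notation g2v := (g2v R).
Local Notation g2h := (@g2h R).

Lemma g2cD c c' k : (c + c')$k = c$k + c'$k. Proof. by rewrite /g2c mxE. Qed.
Lemma g2cN c k : (- c)$k = - c$k. Proof. by rewrite /g2c mxE. Qed.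
Lemma g2cZ a c k : (a *: c)$k = a * c$k. Proof. by rewrite /g2c mxE. Qed.
Lemma g2c0 k : (0 : 'rV[R]_14)$k = 0. Proof. by rewrite /g2c mxE. Qed.

Ltac g2_coord := apply: c14_eq;
  do 14!(case=> [_|]; first by rewrite [LHS]mk14E //= ?(g2cD, g2cN, g2cZ, g2c0) ?mk14E //=; ring); by [].
Ltac g2_vector := rewrite ?g2vE ?g2hE -?linearZ -?linearN -?linearD ?mulr0 -?[RHS](linear0 (@g2d R));
  congr (g2d _); g2_coord.

Definition E5 : T := g2v 4.
Definition X5 : T := g2v 6.
Definition F5 : T := 6 *: g2v 7.
Definition V5f w : T := w 0 0 *: X5.
Lemma V5_linear : linear V5f.
Proof. by move=> a w w'; rewrite /V5f !mxE scalerDl scalerA. Qed.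
HB.instance Definition _ := GRing.isLinear.Build R 'rV[R]_1 T _ V5f V5_linear.
Definition V5 : 'Hom('rV[R]_1, T) := linfun V5f.
Lemma V5E w : V5 w = w 0 0 *: X5. Proof. exact: lfunE. Qed.

Lemma g2_br_E c : [lie g2d c, E5] = g2d (mk14 [:: -2 * c$5; 0; 2 * c$3; - c$6; - c$13; - c$11;
  0; 0; -3 * c$0; -3 * c$2; 0; 0; c$1; -2 * c$1]).
Proof. rewrite /E5 g2vE g2d_br; congr (g2d _); g2_coord. Qed.

Lemma g2_br_X c : [lie g2d c, X5] = g2d (mk14 [:: 0; - c$0; 0; c$4; 0; 0;
  c$13 - c$12; c$9; 0; 0; 0; - c$10; c$8; - c$8]).
Proof. rewrite /X5 g2vE g2d_br; congr (g2d _); g2_coord. Qed.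

Lemma g2_table_E : (([lie g2v 3, E5] = 2 *: g2v 2) * ([lie g2v 2, E5] = -3 *: g2v 9) *
  ([lie g2v 9, E5] = 0) * ([lie g2v 7, E5] = 0)) * (([lie g2v 1, E5] = g2h 1 (-2)) *
  ([lie g2v 8, E5] = 0)).
Proof. by do ![split]; rewrite {1}g2vE g2_br_E; g2_vector. Qed.

Lemma g2_table_X : (([lie g2v 4, X5] = g2v 3) * ([lie g2v 3, X5] = 0) * ([lie g2v 2, X5] = 0) *
  ([lie g2v 9, X5] = g2v 7)) * (([lie g2v 7, X5] = 0) * ([lie g2v 1, X5] = 0) *
  ([lie g2v 8, X5] = g2h 1 (-1))).
Proof. by do ![split]; rewrite {1}g2vE g2_br_X; g2_vector. Qed.

Lemma g2h_E a b : [lie g2h a b, E5] = - b *: E5.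
Proof. rewrite g2hE g2_br_E /E5; g2_vector. Qed.
Lemma g2h_X a b : [lie g2h a b, X5] = (b - a) *: X5.
Proof. rewrite g2hE g2_br_X /X5; g2_vector. Qed.

Lemma E5_adn1 : adn E5 1 X5 = g2v 3. Proof. exact: (g2_table_X.1.1.1.1). Qed.
Lemma E5_adn2 : adn E5 2 X5 = -2 *: g2v 2.
Proof. by rewrite adnS E5_adn1 lieC !g2_table_E scaleNr. Qed.
Lemma E5_adn3 : adn E5 3 X5 = -6 *: g2v 9.
Proof. by rewrite adnS E5_adn2 lieZr lieC !g2_table_E -scaleNr opprK scalerA; congr (_ *: _); ring. Qed.
Lemma E5_adn4 : adn E5 4 X5 = 0.
Proof. by rewrite adnS E5_adn3 lieZr lieC !g2_table_E oppr0 scaler0. Qed.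

Definition b5 (w u : 'rV[R]_1) : R := w 0 0 * u 0 0.

Lemma g2_negative : negative_relations 5 E5 F5 V5 b5.
Proof.
have XX n : [lie X5, adn E5 n X5] = - [lie adn E5 n X5, X5] by rewrite lieC.
split=> [[|[|[|j]]] w u _|w u|w||w] //.
- by rewrite /= !V5E lieZl lieZr lbrxx !scaler0.
- by rewrite !V5E adnZ lieZl lieZr XX E5_adn1 !g2_table_X oppr0 !scaler0.
- by rewrite !V5E adnZ lieZl lieZr XX E5_adn2 lieZl !g2_table_X scaler0 oppr0 !scaler0.
- rewrite !V5E adnZ lieZl lieZr XX E5_adn3 lieZl !g2_table_X scaleNr opprK /F5 /b5 !scalerA.
  by [].
- by rewrite V5E adnZ E5_adn4 scaler0.
- by rewrite /F5 lieZr lieC !g2_table_E oppr0 scaler0.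
- by rewrite V5E lieZl /F5 lieZr lieC !g2_table_X oppr0 !scaler0.
Qed.

(** The brackets with [E5] and [X5] show all coordinates but the one of index 7, which has degree -5
    and vanishes because i >= 0. *)
Lemma g2_transitive (i : int) u : 0 <= i -> g2_MI i u -> [lie u, E5] = 0 ->
  (forall w, [lie u, V5 w] = 0) -> u = 0.
Proof.
move=> i0 /g2_MI_coord[c -> ci] uE uV.
have uX : [lie g2d c, X5] = 0 by have := uV 1; rewrite V5E mxE scale1r.
move: uE; rewrite g2_br_E => /g2d_inj/(congr1 (fun c => [seq c$k | k <- iota 0 14])) /=.
rewrite !mk14E //= !g2c0 => -[h5 h3 h6 h13 h11 h0 h2 h1 _].
move: uX; rewrite g2_br_X => /g2d_inj/(congr1 (fun c => [seq c$k | k <- iota 0 14])) /=.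
rewrite !mk14E //= !g2c0 => -[_ h4 h12 h9 h10 h8 _].
have h7 : c$7 = 0 by apply: ci => //; apply/eqP => /= h; lia.
rewrite -(linear0 (@g2d R)); congr (g2d _); apply: c14_eq.
by do 14!(case=> [_|]; first by rewrite g2c0; lra).
Qed.

Lemma g2_degN1 u : g2_MI (-1) u -> exists a w, u = a *: E5 + V5 w.
Proof.
move=> /g2_MI_coord[c -> ci]; exists (c$4), (const_mx (c$6)).
rewrite V5E mxE; have -> : c$4 *: E5 + c$6 *: X5 =
    g2d (c$4 *: mk14 (rcons (nseq 4 0) 1) + c$6 *: mk14 (rcons (nseq 6 0) 1)).
  by rewrite linearD !linearZ /E5 /X5 !g2vE.
congr (g2d _); apply: c14_eq; do 14!(case=> [_|]; first by
  rewrite g2cD !g2cZ !mk14E //= ?(mulr0, mulr1, addr0, add0r); first [done | rewrite ci]).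
by [].
Qed.

Lemma g2_single (i : int) (k : nat) u : (forall j, (j < 14)%N -> j != k -> g2_deg`_j != i) ->
  g2_MI i u -> exists a, u = a *: g2v k.
Proof.
move=> dk /g2_MI_coord[c -> ci]; exists (c$k).
rewrite g2vE -linearZ; congr (g2d _); apply: c14_eq => j j14.
rewrite g2cZ g2v_c //; have [->|jk] := eqVneq j k; first by rewrite mulr1.
by rewrite mulr0 ci // dk.
Qed.

Lemma g2_deg0 u : g2_MI 0 u -> exists a b, u = g2h a b.
Proof.
move=> /g2_MI_coord[c -> ci]; exists (c$12), (c$13); rewrite g2hE; congr (g2d _); apply: c14_eq.
by do 14!(case=> [_|]; first by rewrite mk14E //= ?ci).
Qed.

Lemma g2h_MI a b : g2_MI 0 (g2h a b).
Proof. by rewrite g2hE; apply: g2_MI_of_coord; do 14!(case=> [_|]; first by rewrite mk14E). Qed.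

Lemma g2v_neq0 k : (k < 14)%N -> g2v k != 0.
Proof.
move=> k14; rewrite g2vE; apply/eqP => /g2d_inj/(congr1 (fun c => c$k)); rewrite g2v_c // g2c0 eqxx => /eqP.
by rewrite oner_eq0.
Qed.

Lemma g2_MI_gen : [/\ g2_MI (-1) E5, forall w, g2_MI (-1) (V5 w) & g2_MI (-5) F5].
Proof.
have MZ i := linear_closed_conv (@g2_MI_linear R i).
split=> [|w|]; first exact: (g2v_MI R (k := 4)).
  by rewrite V5E; case: (MZ (-1)) => _ _ _; apply; exact: (g2v_MI R (k := 6)).
by case: (MZ (-5)) => _ _ _; apply; exact: (g2v_MI R (k := 7)).
Qed.

Lemma b5_left w : (forall u, b5 w u = 0) -> w = 0.
Proof.
move=> h; apply/rowP => i; rewrite (ord1 i); have := h (const_mx 1).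
by rewrite /b5 !mxE mulr1.
Qed.
Lemma b5C (w u : 'rV[R]_1) : b5 w u = b5 u w. Proof. exact: mulrC. Qed.

Lemma t5_roots (i : 'I_2) : g2_root i (t5 R) = (i \in [set: 'I_2])%:R.
Proof. by rewrite inE /g2_root /t5 !mxE /=; case: ifP => _ //; lra. Qed.

Lemma g2_forward (L : lieAlgType R) k gr : @kgrading R L k gr -> g2_type gr ->
  exists Ee : {vspace L}, condition1 k gr Ee /\
     exists Ve : {vspace L}, unique (invariant_complement gr Ee) Ve /\ condition2 k gr Ee Ve.
Proof.
move=> kg [g [A [alpha [[gker gP gbr] AH al _ cor]]]].
have gbr' x y : g [lie x, y] = [lie (g x : T), (g y : T)].
  by rewrite gbr; apply/lfunP => z; rewrite endo_lieE add_lfunE opp_lfunE !comp_lfunE.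
have [h1 _] := @root_grading R T _ _ _ _ _ _ _ (g2_root_model R) L g gker gP gbr'
  k gr _ (t5 R) kg t5_roots A alpha AH al cor.
have g1 i x : x \in gr i -> g2_MI i (g x).
  by move=> /h1 hx; split=> //; apply/gP; exists x.
have g0 i (u : T) : g2_MI i u -> exists2 x, x \in gr i & g x = u.
  by move=> [/gP[x <-] hx]; exists x => //; apply/h1.
have [ME MV MF] := g2_MI_gen.
apply: (forward_transfer (T := T) (k := 5) (e := E5) (f := F5) (v := V5) (b := b5) (M0 := @g2_MI R)
  (M1 := @g2_MI R) (z0 := g2h 1 0) (la := 0) (mu := -1)) kg gker gbr' g1 g0 => //.
- exact: g2_negative.
- exact: g2_degN1.
- have nz (a b : R) : a != 0 -> exists w : 'rV[R]_1, b = a * w 0 0.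
    by move=> a0; exists (const_mx (b / a)); rewrite mxE mulrC divfK.
  move=> [|[|[|j]]] u // _ /g2_single hu.
  + have [[|[|[|[|[|[|[|[|[|[|[|[|[|[|//]]]]]]]]]]]]]]//|a ->] := hu 3%N.
    by exists (const_mx a); rewrite V5E mxE adnZ E5_adn1.
  + have [[|[|[|[|[|[|[|[|[|[|[|[|[|[|//]]]]]]]]]]]]]]//|a ->] := hu 2%N.
    have [w ->] := nz (-2) a ltac:(by rewrite oppr_eq0 pnatr_eq0).
    by exists w; rewrite V5E adnZ E5_adn2 scalerA mulrC.
  + have [[|[|[|[|[|[|[|[|[|[|[|[|[|[|//]]]]]]]]]]]]]]//|a ->] := hu 9%N.
    have [w ->] := nz (-6) a ltac:(by rewrite oppr_eq0 pnatr_eq0).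
    by exists w; rewrite V5E adnZ E5_adn3 scalerA mulrC.
- move=> u /g2_single hu; have [[|[|[|[|[|[|[|[|[|[|[|[|[|[|//]]]]]]]]]]]]]]//|a ->] := hu 7%N.
  by exists (a / 6); rewrite /F5 scalerA divfK ?pnatr_eq0.
- move=> i u i5 /g2_MI_coord[c -> ci]; rewrite -(linear0 (@g2d R)); congr (g2d _); apply: c14_eq.
  by do 14!(case=> [_|]; first by rewrite g2c0 ci //=; apply/eqP => h; lia).
- move=> u /g2_deg0[a [b ->]]; split=> [|w]; first by exists (- b); rewrite g2h_E.
  by exists ((b - a) *: w); rewrite V5E lieZr g2h_X V5E mxE scalerA mulrC -scalerA scalerA.
- exact: b5_left.
- by move=> u uw; apply: b5_left => w; rewrite b5C.
- move=> a w; rewrite V5E; have -> : a *: E5 + w 0 0 *: X5 =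
      g2d (a *: mk14 (rcons (nseq 4 0) 1) + w 0 0 *: mk14 (rcons (nseq 6 0) 1)).
    by rewrite linearD !linearZ /E5 /X5 !g2vE.
  move=> /g2d_inj/(congr1 (fun c => c$4)).
  by rewrite g2c0 g2cD !g2cZ !mk14E //= mulr1 mulr0 addr0.
- by rewrite scaler_eq0 negb_or pnatr_eq0 g2v_neq0.
- exact: g2h_MI.
- by rewrite g2h_E oppr0.
- by move=> w; rewrite V5E lieZr g2h_X sub0r !scalerA mulrC.
- by rewrite eq_sym oppr_eq0 oner_eq0.
Qed.
End G2Negative.

(** * Recognition at depth five *)

Section G2Generate.
Variable R : realFieldType.
Local Notation T := (endo (zorn R)).
Implicit Types (c : 'rV[R]_14) (D : T) (w : 'rV[R]_1).
Local Notation "c $ k" := (g2c c k) (at level 9, k at level 8, format "c $ k").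
Local Notation g2v := (g2v R).
Local Notation E5 := (E5 R).
Local Notation X5 := (X5 R).
Local Notation g2h := (@g2h R).

Ltac g2_coord := apply: c14_eq;
  do 14!(case=> [_|]; first by rewrite [LHS]mk14E //= ?(g2cD, g2cN, g2cZ) ?mk14E //=; ring); by [].

Lemma g2_table_top : ([lie g2v 1, g2v 8] = - g2v 0) * ([lie g2v 0, g2v 1] = 2 *: g2v 5) *
  ([lie g2v 5, g2v 1] = 3 *: g2v 11) * ([lie g2v 5, g2v 0] = 3 *: g2v 10).
Proof.
by do ![split]; rewrite !g2vE g2d_br -?linearZ -?linearN; congr (g2d _); g2_coord.
Qed.

Lemma g2h_1 a b : [lie g2h a b, g2v 1] = b *: g2v 1.
Proof. rewrite g2hE !g2vE g2d_br -linearZ; congr (g2d _); g2_coord. Qed.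
Lemma g2h_8 a b : [lie g2h a b, g2v 8] = (a - b) *: g2v 8.
Proof. rewrite g2hE !g2vE g2d_br -linearZ; congr (g2d _); g2_coord. Qed.

Lemma g2d_delta (k : 'I_14) : g2d (delta_mx 0 k) = g2v k.
Proof. by rewrite g2vE; congr (g2d _); apply: c14_eq => j j14; rewrite g2v_c // /g2c mxE eqxx -val_eqE /= inordK. Qed.

(** The four given elements are root vectors of the simple roots and of their negatives; the bracket
    tables reach the other roots one after the other. *)
Lemma g2_generate (Q : T -> Prop) : linear_closed_pred Q ->
  (forall u u', Q u -> Q u' -> Q [lie u, u']) -> Q E5 -> Q X5 -> Q (g2v 1) -> Q (g2v 8) ->
  forall c, Q (g2d c).
Proof.
move=> QL Qbr QE QX Q1 Q8; have [Q0 QD QB QZ] := linear_closed_conv QL.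
have ZQ a u : a != 0 -> Q (a *: u) -> Q u by move=> a0 /(QZ a^-1); rewrite scalerA mulVf // scale1r.
have n2 : 2 != 0 :> R by rewrite pnatr_eq0.
have n3 : 3 != 0 :> R by rewrite pnatr_eq0.
have Q3 : Q (g2v 3) by have := Qbr _ _ QE QX; rewrite g2_table_X.
have Q2 : Q (g2v 2) by apply: (ZQ 2) => //; have := Qbr _ _ Q3 QE; rewrite g2_table_E.
have Q9 : Q (g2v 9).
  by apply: (ZQ (-3)); rewrite ?oppr_eq0 //; have := Qbr _ _ Q2 QE; rewrite g2_table_E.
have Q7 : Q (g2v 7) by have := Qbr _ _ Q9 QX; rewrite g2_table_X.
have Qh2 : Q (g2h 1 (-2)) by have := Qbr _ _ Q1 QE; rewrite g2_table_E.
have Qh1 : Q (g2h 1 (-1)) by have := Qbr _ _ Q8 QX; rewrite g2_table_X.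
have Qv0 : Q (g2v 0).
  by apply: (ZQ (-1)); rewrite ?oppr_eq0 ?oner_eq0 // scaleN1r; have := Qbr _ _ Q1 Q8; rewrite g2_table_top.
have Q5 : Q (g2v 5) by apply: (ZQ 2) => //; have := Qbr _ _ Qv0 Q1; rewrite g2_table_top.
have Q11 : Q (g2v 11) by apply: (ZQ 3) => //; have := Qbr _ _ Q5 Q1; rewrite g2_table_top.
have Q10 : Q (g2v 10) by apply: (ZQ 3) => //; have := Qbr _ _ Q5 Qv0; rewrite g2_table_top.
have Q12 : Q (g2v 12).
  have -> : g2v 12 = 2 *: g2h 1 (-1) - g2h 1 (-2); last by apply: QB => //; exact: QZ.
  by rewrite g2vE !g2hE -linearZ -linearB; congr (g2d _); g2_coord.
have Q13 : Q (g2v 13).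
  have -> : g2v 13 = g2h 1 (-1) - g2h 1 (-2); last exact: QB.
  by rewrite g2vE !g2hE -linearB; congr (g2d _); g2_coord.
move=> c; rewrite (row_sum_delta c) linear_sum; apply: linear_closed_sum => // k _.
rewrite linearZ /=; apply: (QZ); rewrite g2d_delta.
by case: k => [[|[|[|[|[|[|[|[|[|[|[|[|[|[|//]]]]]]]]]]]]]] ?].
Qed.

(** Its brackets with [E5] and [X5] act on the negative part as [x, e] and [x, w0] do when these
    scale [e] by a and l. *)
Definition g2_raise (a l : R) : T := (a / 2) *: g2v 1 + l *: g2v 8.

Lemma g2_raise_MI a l : g2_MI 1 (g2_raise a l).
Proof.
have [_ MD _ MZ] := linear_closed_conv (@g2_MI_linear R 1).
by apply: (MD); apply: MZ; [exact: (g2v_MI R (k := 1))|exact: (g2v_MI R (k := 8))].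
Qed.

Lemma g2_raise_E a l : [lie g2_raise a l, E5] = (a / 2) *: g2h 1 (-2).
Proof. by rewrite lieDl !lieZl !g2_table_E scaler0 addr0. Qed.
Lemma g2_raise_X a l : [lie g2_raise a l, X5] = l *: g2h 1 (-1).
Proof. by rewrite lieDl !lieZl !g2_table_X scaler0 add0r. Qed.

(* The identities are proved in an abstract space, where [linear_field] is fast. *)
Lemma g2_raise_br a l : [lie g2h 1 (-2), g2_raise a l] = (3 * l) *: g2v 8 - a *: g2v 1.
Proof.
have lin (W : vectType R) (X Y : W) :
    (a / 2) *: (-2 *: X) + l *: ((1 - -2) *: Y) = (3 * l) *: Y - a *: X by linear_field.
by rewrite /g2_raise lieDr (lieZr (a / 2)) (lieZr l) g2h_1 g2h_8; exact: lin.
Qed.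

(** [g2h 1 (-2)] acts by -2 on [g2v 1] and by 3 on [g2v 8], so only the latter survives. *)
Lemma g2_raise_sum a l : 2 *: g2_raise a l + [lie g2h 1 (-2), g2_raise a l] = (5 * l) *: g2v 8.
Proof.
have lin (W : vectType R) (X Y : W) :
    2 *: ((a / 2) *: X + l *: Y) + ((3 * l) *: Y - a *: X) = (5 * l) *: Y by linear_field.
by rewrite g2_raise_br; exact: lin.
Qed.
End G2Generate.

Section G2Converse.
Variables (R : realFieldType) (L : lieAlgType R) (q : int -> {vspace L}) (E V : {vspace L}).
Hypotheses (simp : simple_lie L) (kg : kgrading 5 q).
Hypotheses (c1 : condition1 5 q E) (ic : invariant_complement q E V) (c2 : condition2 5 q E V).

Lemma g2_converse : g2_type q.
Proof.
have k3 : (3 <= 5)%N by []; have k5e : 5%N = 5%N by [].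
have [e Ee] : exists e, E = <[e]>%VS by have [_ _ _ dE _] := c1; exact: vline_of_dim1.
have [f0 fq0] : exists f, q (- 5%:Z) = <[f]>%VS by have [df _ _ _ _] := c1; exact: vline_of_dim1.
have [x0 [w0 [x01 w0V l01 Vw]]] := depth5_line simp kg k3 c1 ic c2 Ee fq0 k5e.
(* This choice of [f] turns the form into the product of coordinates [b5]. *)
pose f := [lie w0, adn e 3 w0].
have f_n0 : f != 0.
  apply/eqP => f_0; have w00 : w0 = 0.
    apply: (form_nondegenerate kg k3 c1 ic c2 Ee w0V) => u; rewrite Vw => /vlineP[a ->].
    by rewrite adnZ lieZr -/f f_0 scaler0.
  by move: l01; rewrite w00 /lam lie0r lie0l linear0 => /esym/eqP; rewrite oner_eq0.
have fq : q (- 5%:Z) = <[f]>%VS.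
  have [c fE] := form_mem kg k3 c1 ic Ee fq0 w0V w0V.
  apply/esym/eqP; rewrite eqEdim -memvE fq0 !dim_vline f_n0 [f]fE memvZ ?memv_line //=.
  by case: (f0 == 0).
pose v0 (w : 'rV[R]_1) := w 0 0 *: w0.
have v0L : linear v0 by move=> a w w'; rewrite /v0 !mxE scalerDl scalerA.
pose v := linfun (HB.pack_for {linear 'rV[R]_1 -> L} v0 (GRing.isLinear.Build R 'rV[R]_1 L _ v0 v0L)).
have vE w : v w = w 0 0 *: w0 by rewrite lfunE.
have vV : limg v = V.
  rewrite Vw; apply/vspaceP => y; apply/memv_imgP/vlineP => [[u _ ->]|[a ->]].
    by exists (u 0 0); rewrite vE.
  by exists (const_mx a); rewrite ?memvf // vE mxE.
have vin w : v w \in V := converse_V vV w.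
have vb w u : bform 5 e f (v w) (v u) = b5 w u.
  apply: (scale_vector_inj f_n0); rewrite -(formE kg k3 c1 ic Ee fq) // !vE.
  by rewrite adnZ lieZl lieZr scalerA.
have b5r (w : 'rV[R]_1) : (forall w', b5 w' w = 0) -> w = 0.
  by move=> h; apply: b5_left => w'; rewrite b5C.
have lamv x w : lam e [lie x, v w] = w 0 0 * lam e [lie x, w0].
  by rewrite vE lieZr -[_ *: _]addr0 lam_linear [lam e 0]/lam lie0l linear0 addr0.
have act x w u : x \in q 1 -> [lie [lie x, v w], v u] = - (2 * lam e [lie x, v w]) *: v u.
  by move=> x1; rewrite (q1_V_ge kg k3 c1 ic c2 Ee (n := 2)).
have lam1 x w : x \in q 1 -> [lie [lie x, v w], e] = lam e [lie x, v w] *: e.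
  by move=> x1; exact: (q0_E kg k3 c1 Ee (q1_V kg ic x1 (vin w))).
have w0v : w0 = v (const_mx 1) by rewrite vE mxE scale1r.
(* With scalar 1 on [e] it acts by -2 on V, which is -(k - 1) / 2. *)
pose z := [lie x0, w0].
have zs : z \in bracket_span (q 1) (q (-1)) by apply: mem_bracket_span => //; exact: (V_deg ic).
have ze : [lie z, e] = e by rewrite /z w0v lam1 // -w0v l01 scale1r.
have zv w : [lie z, v w] = - (4%:R / 2) *: v w.
  by rewrite /z w0v act // -w0v l01; congr (_ *: _); field.
have [ME MV MF] := g2_MI_gen R.
have MIL i := @g2_MI_linear R i.
have [_ MD0 MB0 MZ0] := linear_closed_conv (MIL 0).
pose m0q := match0 q e v (E5 R) (V5 R) (@g2_MI R).
pose m1q := match1 q e v (E5 R) (V5 R) (@g2_MI R).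
have h_match z' a b la mu : z' \in q 0 -> [lie z', e] = la *: e -> (forall w, [lie z', v w] = mu *: v w) ->
    la = - b -> mu = b - a -> m0q z' (g2h a b).
  move=> z'0 z'e z'v lab mab; split; [exact: z'0|exact: g2h_MI|].
  exists la, (fun w => mu *: w); split=> [||w|w]; first exact: z'e.
  - by rewrite g2h_E lab.
  - by rewrite z'v linearZ.
  - by rewrite linearZ /= V5E lieZr g2h_X mab !scalerA mulrC.
have tot0 z' : z' \in q 0 -> exists u, m0q z' u.
  move=> z'0; have ze' := q0_E kg k3 c1 Ee z'0; set la := lam e z' in ze'.
  have : [lie z', w0] \in V by exact: (q0_V ic z'0 w0V).
  rewrite Vw => /vlineP[mu zw]; exists (g2h (- la - mu) (- la)).
  apply: (h_match _ _ _ la mu) => // [w||]; [|by rewrite opprK|by ring].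
  by rewrite vE lieZr zw !scalerA mulrC.
have m1x x : x \in q 1 -> m1q x (g2_raise (lam e [lie x, e]) (lam e [lie x, w0])).
  move=> x1; split; [exact: x1|exact: g2_raise_MI| |].
    rewrite g2_raise_E (_ : _ *: g2h _ _ = g2h (lam e [lie x, e] / 2) (- lam e [lie x, e])).
      apply: (h_match _ _ _ (lam e [lie x, e]) (- (3 / 2) * lam e [lie x, e])); last by field.
      - exact: (q1_e kg c1 Ee x1).
      - exact: (q0_E kg k3 c1 Ee (q1_e kg c1 Ee x1)).
      - by move=> w; exact: (q1_e_V kg k3 c1 ic c2 Ee x1 (vin w)).
      - by rewrite opprK.
    rewrite !g2hE -linearZ; congr (g2d _); apply: c14_eq.
    by do 14!(case=> [_|]; first by rewrite g2cZ !mk14E //=; field).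
  move=> w; rewrite V5E lieZr g2_raise_X scalerA -lamv.
  rewrite (_ : _ *: g2h _ _ = g2h (lam e [lie x, v w]) (- lam e [lie x, v w])).
    apply: (h_match _ _ _ (lam e [lie x, v w]) (- (2 * lam e [lie x, v w]))); last by ring.
    - exact: (q1_V kg ic x1 (vin w)).
    - exact: lam1.
    - by move=> u; exact: act.
    - by rewrite opprK.
  rewrite !g2hE -linearZ; congr (g2d _); apply: c14_eq.
  by do 14!(case=> [_|]; first by rewrite g2cZ !mk14E //=; ring).
have tot1 x : x \in q 1 -> exists u, m1q x u by move=> x1; eexists; exact: m1x.
have E0 : E5 R != 0 := g2v_neq0 R (isT : (4 < 14)%N).
have [h [hker hbr [he hv] hM h1]] := converse_transfer simp kg k3 c1 ic c2 Ee fq vV vb (@b5_left R) b5r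
  (g2_negative R) E0 MIL (@g2_MI_br R) ME MV MF (@g2_transitive R) zs ze zv tot0 tot1.
have imL : linear_closed_pred (fun u => exists x, h x = u).
  split=> [|a _ _ [x <-] [y <-]]; first by exists 0; rewrite linear0.
  by exists (a *: x + y); rewrite linearP.
have imbr u u' : (exists x, h x = u) -> (exists x, h x = u') -> exists x, h x = [lie u, u'].
  by move=> [x <-] [y <-]; exists [lie x, y]; rewrite hbr.
have [_ imD imB imZ] := linear_closed_conv imL.
have [x2 x21 a2] := lam_e_nonzero simp kg k3 c1 ic c2 Ee fq.
have hx0 := h1 _ _ (m1x _ x01); have hx2 := h1 _ _ (m1x _ x21).
rewrite l01 in hx0; set a0 := lam e [lie x0, e] in hx0.
set a := lam e [lie x2, e] in a2 hx2; set l := lam e [lie x2, w0] in hx2.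
have scaled c u : c != 0 -> (exists x, h x = c *: u) -> exists x, h x = u.
  by move=> c0 /(imZ c^-1); rewrite scalerA mulVf // scale1r.
have imE : exists x, h x = E5 R by exists e.
have imh : exists x, h x = g2h 1 (-2).
  apply: (scaled (a / 2)); first by rewrite mulf_neq0 // invr_eq0 pnatr_eq0.
  by rewrite -(g2_raise_E a l); apply: imbr => //; exists x2.
have im8 : exists x, h x = g2v R 8.
  apply: (scaled (5 * 1)); first by rewrite mulr1 pnatr_eq0.
  by rewrite -(g2_raise_sum a0 1); apply: imD; [apply: imZ|apply: imbr => //]; exists x0.
have im1 : exists x, h x = g2v R 1.
  apply: (scaled (a / 2)); first by rewrite mulf_neq0 // invr_eq0 pnatr_eq0.
  rewrite (_ : _ *: _ = g2_raise a l - l *: g2v R 8); last by rewrite addrK.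
  by apply: imB; [exists x2|exact: imZ].
have imX : exists x, h x = X5 R by exists w0; rewrite w0v hv V5E mxE scale1r.
have hP u : zorn_derivation (u : 'End(zorn R)) <-> exists x, h x = u.
  split=> [/derivation_g2d[c ->]|[x <-]]; first exact: (g2_generate (Q := fun u => exists x, h x = u)).
  move: x; apply: (graded_ind kg) => [|i x /hM[] //].
  split=> [|s x y hx hy]; first by rewrite linear0; case: (MIL 0) => -[].
  by rewrite linearP; apply: (proj2 (@derivation_linear R)).
apply: (@has_type_intro R (endo (zorn R)) _ _ _ _ _ _ _ (g2_root_model R) L h hker hP hbr
  5 q _ (t5 R) kg (@t5_roots R)) => [u w|i x /hM[] //].
by apply/lfunP => y; rewrite endo_lieE add_lfunE opp_lfunE !comp_lfunE.
Qed.
End G2Converse.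

(** * Simple roots at the grading element of depth three, and the classification *)

(** Beyond the first two, a simple root takes the value 1 at [t3] only for p = q = 1, where the
    third one is eps_2 + eps_3. *)
Lemma t3_roots (R : realFieldType) (p q : nat) (labels : seq nat) : (0 < p + q)%N ->
  (forall i, (i < so_rank p q)%N -> (i.+1 \in labels) = (i < 2)%N || (p == 1)%N && (q == 1)%N) ->
  forall i : 'I_(so_rank p q), so_root i (t3 R p q) = (i.+1 \in labels)%:R.
Proof.
move=> pq0 lab i; rewrite lab // so_rootE !tt_t3; case: i => [[|[|[|i]]] ir] //=.
- by rewrite ?ifT //; lra.
- case: ifP => [_|ir']; first by rewrite subr0.
  by case: eqP => // pq; move: ir' ir; rewrite /so_rank; lia.
- case: ifP => [ir'|ir'].
    rewrite subrr (_ : _ && _ = false) //; move: ir'; rewrite /so_rank; lia.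
  case: eqP => [pq|pq]; last by rewrite (_ : _ && _ = false) //; lia.
  rewrite addr0 (_ : _ && _ = true) //; move: ir ir'; rewrite /so_rank; lia.
rewrite subrr addr0 !if_same (_ : _ && _ = false) //.
by move: ir; rewrite /so_rank; lia.
Qed.

Lemma t3_roots_12 (R : realFieldType) (p q : nat) : (0 < p + q)%N -> (p + q)%N != 2%N ->
  forall i : 'I_(so_rank p q), so_root i (t3 R p q) = (i.+1 \in [:: 1; 2]%N)%:R.
Proof.
move=> pq0 pq2; apply: t3_roots => // i _; rewrite !inE.
by case: i => [|[|i]] //=; lia.
Qed.

Lemma t3_roots_123 (R : realFieldType) (p q : nat) : (p + q)%N = 2%N ->
  forall i : 'I_(so_rank p q), so_root i (t3 R p q) = (i.+1 \in [:: 1; 2; 3]%N)%:R.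
Proof.
move=> pq2; apply: t3_roots => [|i]; first by rewrite pq2.
rewrite !inE /so_rank; case: i => [|[|[|i]]] //=; lia.
Qed.

Theorem proposition2p12 (R : realType) :
  (forall (L : lieAlgType R) (k : nat) (q : int -> {vspace L}),
     simple_lie L -> kgrading k q -> listed_type q ->
     exists E : {vspace L}, condition1 k q E /\
     exists V : {vspace L}, unique (invariant_complement q E) V /\
       condition2 k q E V)
  /\
  (forall (L : lieAlgType R) (k : nat) (q : int -> {vspace L})
     (E V : {vspace L}),
     simple_lie L -> kgrading k q -> (3 <= k)%N ->
     condition1 k q E -> invariant_complement q E V -> condition2 k q E V ->
     ~ low_dim_type q ->
     listed_type q).
Proof.
split=> [L k gr simp kg|L k gr E V simp kg k3 c1 ic c2 low].
  case=> [g2|so34|[p [q [pq st]]]|[p [q [pq st]]]].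
  - exact: g2_forward kg g2.
  - exact: so4_forward kg so34.
  - have pq0 : (0 < p + q)%N by lia.
    by apply: (so3_forward pq0 kg st); apply: t3_roots_12 => //; lia.
  - have pq0 : (0 < p + q)%N by lia.
    by apply: (so3_forward pq0 kg st); apply: t3_roots_123; lia.
have [e Ee] : exists e, E = <[e]>%VS by have [_ _ _ dE _] := c1; exact: vline_of_dim1.
have [f fq] : exists f, gr (- k%:Z) = <[f]>%VS by have [df _ _ _ _] := c1; exact: vline_of_dim1.
have k5 := depth_le5 simp kg k3 c1 ic c2 Ee fq.
have [k3e|kn3] := eqVneq k 3%N.
  subst k; have [p [q [pq0 st]]] := so3_converse simp kg c1 ic c2.
  (* p + q is the dimension of V: the value 2 is the case n = 4, the value 1 the excluded so(2,
     3). *)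
  have [pq2|pqn2] := eqVneq (p + q)%N 2%N.
    by apply: Or44; exists p, q; split; [rewrite pq2|apply: st; exact: t3_roots_123].
  have {}st := st _ (t3_roots_12 R pq0 pqn2).
  have [pq1|pqn1] := eqVneq (p + q)%N 1%N.
    by case: low; exists p, q; rewrite pq1.
  by apply: Or43; exists p, q; split=> //; lia.
have [k4e|kn4] := eqVneq k 4%N.
  by subst k; apply: Or42; exact: so4_converse simp kg c1 ic c2.
have k5e : k = 5%N by lia.
by subst k; apply: Or41; exact: g2_converse simp kg c1 ic c2.
Qed.
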